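(* Let the co-ordinate process $B=(B_t)_{t\in[0,1]}\colon\Omega\to L^2([0,1])$ satisfy $\int_0^1\mathbb{E}[B_t^2]\,\mathrm{d}t<\infty$. Then $B$ is the Brownian bridge if and only if $$ \mathbb{E}\left[\int_0^1B_t\,\mathrm{D}_tf(B)\,\mathrm{d}t\right]=\mathbb{E}\left[\int_0^1\!\!\int_0^1\!\!\int_0^1\left[\mathbf{1}_t(s)-t\right]\mathrm{D}^2_{t,u}f(B)\,\left[\delta_s(\mathrm{d}u)-\mathrm{d}u\right]\mathrm{d}s\,\mathrm{d}t\right] $$ for all smooth functionals $f\in\mathcal{S}$.
   Context: Setting: $\Omega=L^2=L^2([0,1])$ with its Borel $\sigma$-field, $\mathbb{P}$ is a probability measure on $\Omega$, $\mathbb{E}$ its expectation, and $B_t(\omega)=\omega(t)$ is the co-ordinate process. The Brownian bridge is the centered Gaussian process with the law of $W_t-tW_1$, $W$ a Brownian motion, i.e. with covariance $\min(t,s)-ts$. $\delta_s$ denotes the unit mass at $s$; the innermost integral on the right-hand side is over $u$, against the signed measure $\delta_s(\mathrm{d}u)-\mathrm{d}u$. Step functions: $\mathbf{1}_t=\mathbf{1}_{[0,t)}$. $\mathcal{E}\subset L^2$ is the set of right-continuous step functions, i.e. finite linear combinations $e=\sum_j a_j\mathbf{1}_{u_j}$ with $u_j\in(0,1]$. For a path $x$ put $\int_0^1 e(t)\,\mathrm{d}x(t)=\sum_j a_j x(u_j)$, so that $\int_0^1\mathbf{1}_u(t)\,\mathrm{d}x(t)=x(u)$. Smooth functionals: $\mathcal{S}$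 is the set of functionals $f\colon L^2\to\mathbb{C}$ of the form $f(x)=g(z_1,\dots,z_n)$, $z_k=\int_0^1e_k(t)\,\mathrm{d}x(t)$, where $n\in\mathbb{N}$, $e_k\in\mathcal{E}$, and $g\in\mathcal{C}^\infty_p(\mathbb{R}^n)$, i.e. $g$ is smooth and it and all its partial derivatives of all orders are polynomially bounded. Pathwise Malliavin derivatives: for such $f$, $\mathrm{D}_tf(x)=\sum_{k=1}^n\frac{\partial g}{\partial z_k}(z_1,\dots,z_n)\,e_k(t)$ and $\mathrm{D}^2_{t,s}f(x)=\sum_{k,l=1}^n\frac{\partial^2g}{\partial z_k\partial z_l}(z_1,\dots,z_n)\,e_k(t)e_l(s)$. *)

(* Defs.v *)
From HB Require Import structures.
From mathcomp Require Import all_boot all_order all_algebra.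
From mathcomp Require Import complex.
From mathcomp Require Import all_classical all_reals all_analysis measurable_realfun.

Set Implicit Arguments.
Unset Strict Implicit.
Unset Printing Implicit Defensive.

Import Order.TTheory GRing.Theory Num.Theory.
Import numFieldNormedType.Exports.

Local Open Scope classical_set_scope.
Local Open Scope ring_scope.
Local Open Scope complex_scope.

Section L2.
Variable R : realType.

Definition leb01 : {measure set (measurableTypeR R) -> \bar R} :=
  mrestr (@lebesgue_measure R)
    (@measurable_itv R `[0, 1] : measurable (`[0, 1] : set (measurableTypeR R))).

Definition L2 : Type := LspaceType2 leb01.

HB.instance Definition _ := gen_eqMixin L2.
HB.instance Definition _ := gen_choiceMixin L2.

(* The underlying function is only determined up to a.e. equality on [0,1]. *)
Definition L2_repr (x : L2) : R -> R := x : LspaceType2 leb01.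

Definition zero_class : {mfun_ leb01, measurableTypeR R >-> measurableTypeR R} :=
  (\pi_({mfun_ leb01, measurableTypeR R >-> measurableTypeR R}) (cst 0%R))%qT.

Lemma zero_class_finite : finite_norm leb01 2%:E zero_class.
Proof.
have h : (zero_class : R -> R) = cst 0 %[ae leb01].
  have /eqP : (repr zero_class = cst 0%R %[mod {mfun_ leb01, measurableTypeR R >-> measurableTypeR R}])%qT.
    by rewrite reprK.
  by rewrite eqmodE => /asboolP.
rewrite /finite_norm unlock.
rewrite (@ae_eq_integral _ _ _ leb01 setT (cst 0%E)) //.
- by rewrite integral_cst// mul0e poweR0r// ?ltry// invr_eq0.
- apply: (measurableT_comp (measurable_poweR _)) => //.
  apply: measurableT_comp => //; apply/measurable_EFinP.
  exact: (@measurable_funPT _ _ _ _ (repr zero_class)%qT).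
- apply: (@filterS _ _ (ae_filter_ringOfSetsType leb01) _ _ _ h) => y /= hy _; rewrite /= hy//= normr0 powR0//.
Qed.

HB.instance Definition _ :=
  @isFinLebesgue.Build _ _ R leb01 2%:E (lee1n 2) zero_class zero_class_finite.

HB.instance Definition _ := isPointed.Build L2 (zero_class : LspaceType2 leb01).

Definition L2_dist (x y : L2) : \bar R :=
  'N[leb01]_2%:E[EFin \o (L2_repr x \- L2_repr y)].

Definition L2_open : set (set L2) :=
  [set U | forall x, U x -> exists2 e : R, 0 < e &
     forall y, (L2_dist x y < e%:E)%E -> U y].

(* L^2([0,1]) with its Borel sigma-field. *)
Definition Omega := g_sigma_algebraType L2_open.

(* The value of a class x at t is that of its precise representative, the limit
   of the means of x over the [0,1]-neighbourhoods of t (and 0 where these means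
   diverge). It is an a.e. representative of x by Lebesgue differentiation, and
   is the continuous representative of x when there is one. *)
Definition local_mean (x : Omega) (t r : R) : R :=
  (\int[lebesgue_measure]_(s in `[0%R, 1%R] `&` ball t r) L2_repr x s) /
  fine (lebesgue_measure (`[0%R, 1%R]%classic `&` ball t r)).

Definition coordinate (t : R) (x : Omega) : R :=
  xget 0 [set l | local_mean x t r @[r --> 0^'+] --> l].

End L2.

Section brownian_bridge.
Context d (T : measurableType d) (R : realType) (P : probability T R).

(* Point masses count as Gaussian; [normal_prob] requires [s != 0]. *)
Definition gaussian (X : T -> R) : Prop :=
  measurable_fun setT X /\
  ((exists m : R, forall A, measurable A -> pushforward P X A = \d_m A) \/
   (exists m s : R, s != 0 /\
      forall A, measurable A -> pushforward P X A = normal_prob m s A)).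

Definition gaussian_process (X : R -> T -> R) : Prop :=
  forall (n : nat) (t a : 'I_n -> R),
    (forall i, 0 <= t i <= 1) ->
    gaussian (fun w => \sum_(i < n) a i * X (t i) w).

Definition brownian_bridge (X : R -> T -> R) : Prop :=
  [/\ gaussian_process X,
      forall t, 0 <= t <= 1 -> ('E_P[X t] = 0)%E &
      forall s t, 0 <= s <= 1 -> 0 <= t <= 1 ->
        covariance P (X s) (X t) = (Num.min s t - s * t)%:E].

End brownian_bridge.

Section step_functions.
Variable R : realType.

Definition ind (u t : R) : R := \1_`[0, u[ t.

(* The pairs (a_j, u_j) of e = \sum_j a_j 1_{u_j}. *)
Record step_fun := StepFun {
  step_seq :> seq (R * R) ;
  step_seqP : forall p, p \in step_seq -> 0 < p.2 <= 1 }.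

Definition step_val (e : step_fun) (t : R) : R := \sum_(p <- e) p.1 * ind p.2 t.

Definition step_int (e : step_fun) (x : R -> R) : R := \sum_(p <- e) p.1 * x p.2.

End step_functions.

Section smooth.
Variables (R : realType) (n : nat).

Definition partial (k : 'I_n) (h : 'rV[R]_n -> R) : 'rV[R]_n -> R :=
  fun z => 'D_(delta_mx 0 k) h z.

Definition partials (s : seq 'I_n) (h : 'rV[R]_n -> R) : 'rV[R]_n -> R :=
  foldr partial h s.

Definition poly_bounded (h : 'rV[R]_n -> R) : Prop :=
  exists (C : R) (N : nat), forall z, `|h z| <= C * (1 + `|z|) ^+ N.

Definition Cinf_p (h : 'rV[R]_n -> R) : Prop := forall s : seq 'I_n,
  [/\ continuous (partials s h),
      forall (k : 'I_n) z, derivable (partials s h) z (delta_mx 0 k) &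
      poly_bounded (partials s h)].

Definition cCinf_p (g : 'rV[R]_n -> R[i]) : Prop :=
  Cinf_p (@complex.Re R \o g) /\ Cinf_p (@complex.Im R \o g).

Definition cpartial (k : 'I_n) (g : 'rV[R]_n -> R[i]) : 'rV[R]_n -> R[i] :=
  fun z => partial k (@complex.Re R \o g) z +i* partial k (@complex.Im R \o g) z.

End smooth.

Section complex_integral.
Context d (T : measurableType d) (R : realType) (mu : {measure set T -> \bar R}).

Definition cintegral (D : set T) (F : T -> R[i]) : R[i] :=
  (\int[mu]_(x in D) complex.Re (F x)) +i* (\int[mu]_(x in D) complex.Im (F x)).

Definition cintegrable (D : set T) (F : T -> R[i]) : Prop :=
  mu.-integrable D (fun x => (complex.Re (F x))%:E) /\
  mu.-integrable D (fun x => (complex.Im (F x))%:E).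

End complex_integral.

Section malliavin.
Variable R : realType.

(* A smooth functional is given together with a representation
   f(x) = g(z_1, ..., z_n), through which its derivatives are defined. *)
Record smooth_functional := SmoothFunctional {
  sf_dim : nat ;
  sf_fun : 'rV[R]_sf_dim -> R[i] ;
  sf_step : 'I_sf_dim -> step_fun R ;
  sf_smooth : cCinf_p sf_fun }.

Arguments sf_fun : clear implicits.
Arguments sf_step : clear implicits.

Implicit Types (f : smooth_functional) (x : Omega R) (s t u : R).

Definition sf_arg f x : 'rV[R]_(sf_dim f) :=
  \row_k step_int (sf_step f k) (fun t => coordinate t x).

Definition sf_eval f x : R[i] := sf_fun f (sf_arg f x).

Definition D1 f t x : R[i] :=
  \sum_(k < sf_dim f)
    cpartial k (sf_fun f) (sf_arg f x) * (step_val (sf_step f k) t)%:C.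

Definition D2 f t s x : R[i] :=
  \sum_(k < sf_dim f) \sum_(l < sf_dim f)
    cpartial k (cpartial l (sf_fun f)) (sf_arg f x) *
    (step_val (sf_step f k) t)%:C * (step_val (sf_step f l) s)%:C.

Definition int01 (F : R -> R[i]) : R[i] :=
  cintegral (@lebesgue_measure R) `[0, 1] F.

(* Integral over [0,1] against the signed measure delta_s(du) - du. *)
Definition int_dirac_sub_leb s (F : R -> R[i]) : R[i] :=
  cintegral (@dirac _ (measurableTypeR R) s R) `[0, 1] F
  - int01 F.

Definition stein_lhs f x : R[i] :=
  int01 (fun t => (coordinate t x)%:C * D1 f t x).

Definition stein_rhs f x : R[i] :=
  int01 (fun t => int01 (fun s => int_dirac_sub_leb s (fun u =>
    (ind t s - t)%:C * D2 f t u x))).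

End malliavin.

Arguments coordinate {R} t x.

(* Main.v *)
(** Write kern(s,t) = min(s,t) - st, X_rho = \int rho(t) B_t dt and
(V rho)(t) = \int_t^1 rho.

If B is the bridge, then integrating F(Z + h s c) over s in [0,1] gives the
Gaussian integration by parts E[B_t F(Z)] = \sum_l kern_sum(e_l)(t) E[d_l F(Z)]
as h -> 0: both sides of the integrated identity are integrals of F against
finite signed measures, so that it suffices to check trigonometric F. Fubini in t and
the symmetry of second derivatives turn it into the stated identity.

Conversely, testing the identity with cosines of step functionals whose atoms
form randomly shifted Riemann sums yields, for every bounded rho,
E[sin(X_rho + a) X_(V rho)] = <V rho, kern rho> E[cos(X_rho + a)].
The profiles rho_s(t) = sin(2 s sqrt(u - t)) / s satisfy
d/ds rho_s = -2 s V rho_s, so that E[cos(X + a)] exp(Q/2), with Q the bridge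
variance of X, is constant along s. Since rho_s -> 0 as s -> oo, its value is
cos a. Letting s -> 0, averaging and taking difference quotients reaches the
indicators, hence all local means. Their oscillation on the scale 4^-n is
O(2^-n) in mean, so they converge almost surely at every fixed time, to a
centred Gaussian family of covariance kern. *)

Require Import Defs.
From HB Require Import structures.
From mathcomp Require Import all_boot all_order all_algebra.
From mathcomp Require Import complex.
From mathcomp Require Import all_classical all_reals all_analysis measurable_realfun.
From mathcomp Require Import ring lra.

Set Implicit Arguments.
Unset Strict Implicit.
Unset Printing Implicit Defensive.

Import Order.TTheory GRing.Theory Num.Theory.
Import numFieldNormedType.Exports.
Local Open Scope classical_set_scope.
Local Open Scope ring_scope.
Local Open Scope complex_scope.

(** * Integration of real functions *)

(** Tested on a function of [X_rho], the identity only controls products with [X_(V rho)], because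
    the derivative of an atom is a step. The usual differential equation in [l] for
    [E[cos (l X + a)]] would need [X_rho] itself and does not close: [V rho] is the only direction
    in which a characteristic function can be followed. This forces the semigroup [exp (- s^2 V)].
    Applied to the profile [2 sqrt y], its exponential series sums to [sin (2 s sqrt y) / s], an
    elementary function whose decay in [s], uniform in [y], supplies the boundary value at infinity.
    Averaging the root over the delays [x^2] is an Abel half-integral and yields the ramp. A second
    obstacle: the functionals see values at single times, whereas a path is an L^2 class and the
    moment assumption says nothing about any single time. Random shifts make the passage from atoms
    to densities blind to null sets of times; the way back needs the oscillation estimate, since the
    co-ordinate is 0 wherever the local means diverge. *)

Lemma cvg_sumr (R : realType) (T : Type) (F : set_system T) (FF : Filter F)
    (J : Type) (s : seq J) (f : J -> T -> R) (l : J -> R) :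
  (forall j, f j x @[x --> F] --> l j) ->
  \sum_(j <- s) f j x @[x --> F] --> \sum_(j <- s) l j.
Proof.
move=> h; elim: s => [|j s IH].
  by rewrite big_nil; under eq_fun do rewrite big_nil; exact: cvg_cst.
by rewrite big_cons; under eq_fun do rewrite big_cons; exact: cvgD.
Qed.

Lemma rV_norm_le (R : realType) n (z : 'rV[R]_n) (e : R) : 0 <= e ->
  (forall k, `|z 0 k| <= e) -> `|z| <= e.
Proof.
move=> e0 h; rewrite [leLHS]/Num.norm /= mx_normrE; apply/bigmax_leP; split => //.
by move=> [i j] _ /=; rewrite ord1.
Qed.

Lemma rV_coord_le (R : realType) n (z : 'rV[R]_n) k : `|z 0 k| <= `|z|.
Proof.
by rewrite [leRHS]/Num.norm /= mx_normrE; apply/bigmax_geP; right => /=; exists (0, k).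
Qed.

Notation integ mu f := (mu.-integrable setT (EFin \o f)).

Section integ.
Context d (T : measurableType d) (R : realType) (mu : {measure set T -> \bar R}).
Implicit Types f g : T -> R.

Lemma integ_meas f : integ mu f -> measurable_fun setT f.
Proof. by move=> /integrableP[/measurable_EFinP]. Qed.

Lemma integ_le f g : measurable_fun setT f -> integ mu g ->
  (forall x, `|f x| <= g x) -> integ mu f.
Proof.
move=> mf ig fg; apply: (le_integrable _ _ _ ig) => //.
  exact/measurable_EFinP.
by move=> x _ /=; rewrite lee_fin (le_trans (fg x))// ler_norm.
Qed.

Lemma integ_norm f : integ mu f -> integ mu (fun x => `|f x|).
Proof. by move=> /integrable_norm. Qed.

Lemma integD f g : integ mu f -> integ mu g -> integ mu (fun x => f x + g x).
Proof. by move=> hf hg; have := integrableD measurableT hf hg. Qed.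

Lemma integB f g : integ mu f -> integ mu g -> integ mu (fun x => f x - g x).
Proof. by move=> hf hg; have := integrableB measurableT hf hg. Qed.

Lemma integZ c f : integ mu f -> integ mu (fun x => c * f x).
Proof. by move=> hf; have := integrableZl measurableT c hf. Qed.

Lemma integ_sum (I : Type) (s : seq I) (f : I -> T -> R) :
  (forall i, integ mu (f i)) -> integ mu (fun x => \sum_(i <- s) f i x).
Proof.
move=> hf; elim: s => [|i s IH].
  have -> : (fun x => \sum_(i <- [::]) f i x) = cst 0.
    by apply/funext => x; rewrite big_nil.
  exact: (@integrable0 _ _ _ mu setT).
have -> : (fun x => \sum_(j <- i :: s) f j x) = (fun x => f i x + \sum_(j <- s) f j x).
  by apply/funext => x; rewrite big_cons.
exact: integD.
Qed.

Lemma Rint_sum (I : Type) (s : seq I) (f : I -> T -> R) :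
  (forall i, integ mu (f i)) ->
  \int[mu]_x (\sum_(i <- s) f i x) = \sum_(i <- s) \int[mu]_x f i x.
Proof.
move=> hf; elim: s => [|i s IH].
  rewrite big_nil -[RHS](@Rintegral_set0 _ _ _ mu (cst 0)).
  by under eq_Rintegral do rewrite big_nil; rewrite /Rintegral !integral0.
rewrite big_cons -IH -RintegralD//; last exact: integ_sum.
by apply: eq_Rintegral => x _; rewrite big_cons.
Qed.

Lemma RintD f g : integ mu f -> integ mu g ->
  \int[mu]_x (f x + g x) = \int[mu]_x f x + \int[mu]_x g x.
Proof. by move=> hf hg; exact: RintegralD. Qed.

Lemma RintB f g : integ mu f -> integ mu g ->
  \int[mu]_x (f x - g x) = \int[mu]_x f x - \int[mu]_x g x.
Proof. by move=> hf hg; exact: RintegralB. Qed.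

Lemma RintZ c f : integ mu f ->
  \int[mu]_x (c * f x) = c * \int[mu]_x f x.
Proof. by move=> hf; exact: RintegralZl. Qed.

Lemma RintN f : integ mu f -> \int[mu]_x (- f x) = - \int[mu]_x f x.
Proof.
by move=> hf; rewrite -mulN1r -RintZ//; apply: eq_Rintegral => x _; rewrite mulN1r.
Qed.

Lemma Rintegral_zero : \int[mu]_x (0 : R) = 0.
Proof. by rewrite /Rintegral integral0. Qed.

Lemma le_Rint f g : integ mu f -> integ mu g -> (forall x, f x <= g x) ->
  \int[mu]_x f x <= \int[mu]_x g x.
Proof. by move=> hf hg fg; apply: le_Rintegral => // x _. Qed.

Lemma norm_Rint f : integ mu f -> `|\int[mu]_x f x| <= \int[mu]_x `|f x|.
Proof. by move=> hf; exact: le_normr_Rintegral. Qed.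

Lemma norm_Rint_le f g : integ mu f -> integ mu g -> (forall x, `|f x| <= g x) ->
  `|\int[mu]_x f x| <= \int[mu]_x g x.
Proof.
move=> hf hg fg; apply: le_trans (norm_Rint hf) _.
by apply: le_Rint => //; exact: integ_norm.
Qed.

Lemma Rint_EFin f : integ mu f -> (\int[mu]_x f x)%:E = (\int[mu]_x (f x)%:E)%E.
Proof. by move=> hf; rewrite fineK// integrable_fin_num. Qed.

Lemma Rint_dct (f_ : nat -> T -> R) f g :
  (forall n, measurable_fun setT (f_ n)) -> integ mu g ->
  (forall x, f_ n x @[n --> \oo] --> f x) -> (forall n x, `|f_ n x| <= g x) ->
  integ mu f /\ (\int[mu]_x f_ n x @[n --> \oo] --> \int[mu]_x f x).
Proof.
move=> mf ig ff fg.
have mf' : measurable_fun setT f.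
  by apply: (measurable_fun_cvg mf) => x _; exact: ff.
have [| | | | |h1 _ h2] :=
    @dominated_convergence _ _ _ mu setT measurableT (fun n x => (f_ n x)%:E)
      (EFin \o f) (EFin \o g).
- by move=> n; apply/measurable_EFinP.
- exact/measurable_EFinP.
- by apply: nearW => x _ /=; apply: cvg_EFin; [exact: nearW|exact: ff].
- by [].
- by apply: nearW => x n _; rewrite lee_fin.
split => //; apply: fine_cvg; rewrite fineK; first exact: h2.
by rewrite integrable_fin_num.
Qed.

(** For limits without a dominating function known in advance: integrability of the limit is part of
    the conclusion. *)
Lemma Rint_fatou (f_ : nat -> T -> R) f (q : R) :
  (forall n, integ mu (f_ n)) -> (forall n x, 0 <= f_ n x) ->
  (forall x, f_ n x @[n --> \oo] --> f x) -> (forall n, \int[mu]_x f_ n x <= q) ->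
  integ mu f /\ \int[mu]_x f x <= q.
Proof.
move=> If f0 ff fq.
have mf : measurable_fun setT f.
  by apply: (measurable_fun_cvg (fun n => integ_meas (If n))) => x _; exact: ff.
have f0' x : 0 <= f x.
  rewrite -(cvg_lim _ (ff x))//; apply: limr_ge; last exact: nearW.
  by apply/cvg_ex; exists (f x); exact: ff.
have H : (\int[mu]_x (f x)%:E <= q%:E)%E.
  have := @fatou _ _ _ mu setT measurableT (fun n x => (f_ n x)%:E) _ _.
  have -> : (\int[mu]_x limn_einf ((fun n x => (f_ n x)%:E) ^~ x) = \int[mu]_x (f x)%:E)%E.
    apply: eq_integral => x _ /=.
    have c : (f_ n x)%:E @[n --> \oo] --> (f x)%:E by apply: cvg_EFin; [exact: nearW|exact: ff].
    by rewrite is_cvg_limn_einfE; [exact/cvg_lim|apply/cvg_ex; exists (f x)%:E].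
  move=> H; apply: le_trans (H _ _) _.
  - by move=> m; apply/measurable_EFinP; exact: integ_meas (If m).
  - by move=> m x _; rewrite lee_fin.
  rewrite limn_einf_lim; apply: lime_le; first exact: is_cvg_einfs.
  apply: nearW => n; rewrite /einfs /=; apply: le_trans (_ : _ <= (\int[mu]_x f_ n x)%:E)%E _.
    by apply: ereal_inf_lbound; exists n => //=; rewrite Rint_EFin.
  by rewrite lee_fin.
have If' : integ mu f.
  apply/integrableP; split; first exact/measurable_EFinP.
  under eq_integral do rewrite /= ger0_norm//.
  by apply: le_lt_trans H _; rewrite ltry.
by split => //; rewrite -lee_fin Rint_EFin.
Qed.

Lemma ae_eq_Rint f g : measurable_fun setT f -> measurable_fun setT g ->
  {ae mu, forall x, f x = g x} -> \int[mu]_x f x = \int[mu]_x g x.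
Proof.
move=> mf mg fg; congr fine; apply: ae_eq_integral => //.
- exact/measurable_EFinP.
- exact/measurable_EFinP.
- by apply: filterS fg => x /= ->.
Qed.

Lemma ae_eq_integ f g : measurable_fun setT f ->
  {ae mu, forall x, f x = g x} -> integ mu g -> integ mu f.
Proof.
move=> mf fg /integrableP[mg hg]; apply/integrableP; split.
  exact/measurable_EFinP.
rewrite (ae_eq_integral (abse \o (EFin \o g))) //.
- by apply: measurableT_comp => //; exact/measurable_EFinP.
- by apply: measurableT_comp.
- by apply: filterS fg => x /= ->.
Qed.

End integ.

Section integ_finite.
Context d (T : measurableType d) (R : realType) (mu : {finite_measure set T -> \bar R}).
Implicit Types f g : T -> R.

Lemma integ_bounded f (C : R) : measurable_fun setT f -> (forall x, `|f x| <= C) ->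
  integ mu f.
Proof.
move=> mf fC; apply: measurable_bounded_integrable => //.
  by rewrite ltey_eq fin_num_measure.
exists C; split; first exact: num_real.
by move=> M CM x _; apply: le_trans (fC x) _; exact: ltW.
Qed.

Lemma integ_cst (c : R) : integ mu (fun=> c).
Proof. by apply: (@integ_bounded _ `|c|). Qed.

Lemma integ_sqr f : measurable_fun setT f -> integ mu (fun x => f x ^+ 2) -> integ mu f.
Proof.
move=> mf hf; apply: (@integ_le _ _ _ mu f (fun x => 1 + f x ^+ 2)) => //.
  by apply: integD => //; exact: integ_cst.
by move=> x; have := sqr_ge0 (`|f x| - 1); rewrite -[f x ^+ 2]real_normK ?num_real//; nra.
Qed.

Lemma integ_mulb f g (C : R) : integ mu f -> measurable_fun setT g ->
  (forall x, `|g x| <= C) -> integ mu (fun x => g x * f x).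
Proof.
move=> hf mg gC; apply: (@integ_le _ _ _ mu _ (fun x => C * `|f x|)).
- by apply: measurable_funM => //; exact: integ_meas hf.
- by apply: integZ; exact: integ_norm.
- by move=> x; rewrite normrM ler_wpM2r.
Qed.

Lemma integ_mul2 f g : measurable_fun setT f -> measurable_fun setT g ->
  integ mu (fun x => f x ^+ 2) -> integ mu (fun x => g x ^+ 2) ->
  integ mu (fun x => f x * g x).
Proof.
move=> mf mg hf hg; apply: (@integ_le _ _ _ mu _ (fun x => f x ^+ 2 + g x ^+ 2)).
- exact: measurable_funM.
- exact: integD.
- move=> x; rewrite normrM -[f x ^+ 2]real_normK ?num_real// -[g x ^+ 2]real_normK ?num_real//.
  by have := sqr_ge0 (`|f x| - `|g x|); have := sqr_ge0 (`|f x|); have := sqr_ge0 (`|g x|); nra.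
Qed.

End integ_finite.

Lemma Rint_probability_cst d (T : measurableType d) (R : realType)
  (P : probability T R) (c : R) : \int[P]_x c = c.
Proof. by rewrite Rintegral_cst//= probability_setT mulr1. Qed.

(** * Fubini's theorem for real-valued integrals *)

Section product.
Context d1 d2 (T1 : measurableType d1) (T2 : measurableType d2) (R : realType).
Variables (m1 : {sigma_finite_measure set T1 -> \bar R})
          (m2 : {sigma_finite_measure set T2 -> \bar R}).
Implicit Types f : T1 * T2 -> R.

Lemma integ_prod12 f (g : T1 -> R) : measurable_fun setT f -> integ m1 g ->
  (forall x, integ m2 (fun y => f (x, y))) ->
  (forall x, \int[m2]_y `|f (x, y)| <= g x) -> integ (m1 \x m2)%E f.
Proof.
move=> mf ig fi fg; apply/integrable12ltyP; first exact/measurable_EFinP.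
have /integrableP[_ +] := ig; apply: le_lt_trans; apply: ge0_le_integral => //.
- by move=> x _; exact: integral_ge0.
- apply: (@measurable_fun_fubini_tonelli_F _ _ _ _ _ m2 (abse \o (EFin \o f))).
  + by apply: measurableT_comp => //; exact/measurable_EFinP.
  + by move=> x; rewrite /= lee_fin.
- by have := integ_meas ig => mg; do 2 apply: measurableT_comp => //.
- move=> x _ /=; rewrite -Rint_EFin; last exact/integ_norm/fi.
  by rewrite lee_fin (le_trans (fg x))// ler_norm.
Qed.

Lemma integ_prodM f (g : T1 -> R) (h : T2 -> R) : measurable_fun setT f ->
  integ m1 g -> integ m2 h -> (forall x y, `|f (x, y)| <= g x * h y) ->
  integ (m1 \x m2)%E f.
Proof.
move=> mf ig ih fgh.
have fi x : integ m2 (fun y => f (x, y)).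
  apply: (@integ_le _ _ _ m2 _ (fun y => g x * h y)) => //.
  - by apply: measurableT_comp => //; exact: measurable_pair1.
  - exact: integZ.
apply: (@integ_prod12 f (fun x => g x * \int[m2]_y h y)) => //.
  under [X in integrable _ _ (_ \o X)]eq_fun do rewrite mulrC.
  exact: integZ.
move=> x; rewrite -RintZ//; apply: le_Rint => //.
- exact: integ_norm.
- exact: integZ.
Qed.

Lemma integ_section1 f : integ (m1 \x m2)%E f ->
  integ m1 (fun x => \int[m2]_y f (x, y)).
Proof.
move=> hf; have := integrable_fubini_F hf => h.
have ae1 := ae_integrable1 hf.
apply/integrableP; split.
  apply/measurable_EFinP.
  apply: (measurableT_comp (@fine_measurable R setT _)) => //.
  exact: (measurable_fubini_F hf).
have /integrableP[mh +] := h; apply: le_lt_trans.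
apply: ge0_le_integral => //.
- apply: measurableT_comp => //; apply/measurable_EFinP.
  apply: (measurableT_comp (@fine_measurable R setT _)) => //.
- by apply: measurableT_comp.
(* An infinite section integral becomes 0 under [fine], which can only lower the absolute value. *)
- move=> x _ /=; rewrite /fubini_F /=.
  by rewrite /Rintegral; case: (integral _ _ _) => //=; rewrite normr0 leey.
Qed.

Lemma Rint_section1 f : integ (m1 \x m2)%E f ->
  \int[m1]_x \int[m2]_y f (x, y) = \int[(m1 \x m2)%E]_z f z.
Proof.
move=> hf; rewrite /Rintegral -(integral12_prod_meas1 hf); congr fine.
have h := integrable_fubini_F hf.
apply: ae_eq_integral => //.
- by have /integ_meas/measurable_EFinP := integ_section1 hf.
- exact: (measurable_fubini_F hf).
have := ae_integrable1 hf; apply: filterS => x hx _ /=.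
by rewrite fineK// integrable_fin_num.
Qed.
End product.

Section product_sym.
Context d1 d2 (T1 : measurableType d1) (T2 : measurableType d2) (R : realType).
Variables (m1 : {sigma_finite_measure set T1 -> \bar R})
          (m2 : {sigma_finite_measure set T2 -> \bar R}).
Implicit Types f : T1 * T2 -> R.

Lemma integ_swap f : integ (m1 \x m2)%E f -> integ (m2 \x m1)%E (fun z => f (z.2, z.1)).
Proof.
move=> hf; have mf := integ_meas hf; have mf' : measurable_fun setT (fun z : T2 * T1 => f (z.2, z.1)).
  apply: measurableT_comp => //.
  by apply: measurable_fun_pair; [exact: measurable_snd|exact: measurable_fst].
apply/integrable12ltyP; first exact/measurable_EFinP.
have /integrable21ltyP : measurable_fun setT (EFin \o f) by exact/measurable_EFinP.
by move=> /(_ m1 m2) H; apply/H.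
Qed.

Lemma Rint_fubini f : integ (m1 \x m2)%E f ->
  \int[m1]_x \int[m2]_y f (x, y) = \int[m2]_y \int[m1]_x f (x, y).
Proof.
move=> hf; have hf' := integ_swap hf.
rewrite (Rint_section1 hf) (Rint_section1 hf') /Rintegral.
by rewrite -(integral21_prod_meas1 hf) -(integral12_prod_meas1 hf').
Qed.

Lemma integ_section2 f : integ (m1 \x m2)%E f ->
  integ m2 (fun y => \int[m1]_x f (x, y)).
Proof. by move=> /integ_swap/integ_section1. Qed.

End product_sym.

Lemma integ_prod_bounded d1 d2 (T1 : measurableType d1) (T2 : measurableType d2) (R : realType)
    (m1 : {finite_measure set T1 -> \bar R}) (m2 : {finite_measure set T2 -> \bar R})
    (f : T1 * T2 -> R) (C : R) : measurable_fun setT f ->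
  (forall x y, `|f (x, y)| <= C) -> integ (m1 \x m2)%E f.
Proof.
move=> mf fC; apply: (@integ_prodM _ _ _ _ _ m1 m2 f (fun=> C) (fun=> 1)) => //.
- exact: integ_cst.
- exact: integ_cst.
- by move=> x y; rewrite mulr1.
Qed.

(** * Lebesgue measure on the unit interval *)

Definition pfm d1 d2 (T1 : measurableType d1) (T2 : measurableType d2)
  (R : realType) (m : {measure set T1 -> \bar R}) (f : T1 -> T2)
  (mf : measurable_fun setT f) : {measure set T2 -> \bar R} :=
  measure_function_pushforward__canonical__measure_function_Measure m mf.

Section lam.
Variable R : realType.

(** The body is that of [leb01]; as a bare set function it can be declared a probability, on which
    Fubini and the bounds for finite measures rely. *)
Definition lam : set (measurableTypeR R) -> \bar R :=
  mrestr (@lebesgue_measure R)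
    (@measurable_itv R `[0, 1] : measurable (`[0, 1] : set (measurableTypeR R))).

HB.instance Definition _ := Measure.on lam.

Let lamT : lam setT = 1%E.
Proof. by rewrite /lam /mrestr setTI lebesgue_measure_itv/= lte01 sube0. Qed.

HB.instance Definition _ := @Measure_isProbability.Build _ _ R lam lamT.

Lemma lamE (A : set R) : lam A = lebesgue_measure (A `&` `[0, 1]).
Proof. by []. Qed.

Lemma lam_integral (f : R -> \bar R) : measurable_fun setT f ->
  (\int[lebesgue_measure]_(t in `[0%R, 1%R]) f t = \int[lam]_t f t)%E.
Proof.
move=> mf.
have mI : measurable (`[0%R, 1%R] : set R) by exact: measurable_itv.
transitivity (\int[lam]_(t in `[0%R, 1%R]) f t)%E.
  by apply: eq_measure_integral => A mA sA; rewrite [RHS]lamE setIidl.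
rewrite [LHS]integral_mkcond; apply: ae_eq_integral => //.
  by apply/(measurable_restrictT _ _).1 => //; exact: measurable_funTS.
exists (~` `[0%R, 1%R]); split; first exact: measurableC.
  by rewrite [LHS]lamE setICl measure0.
move=> t /=; apply: contra_not => h _; rewrite patchE mem_set//.
Qed.

Lemma lam_Rintegral (f : R -> R) : measurable_fun setT f ->
  \int[lebesgue_measure]_(t in `[0%R, 1%R]) f t = \int[lam]_t f t.
Proof. by move=> mf; congr fine; apply: lam_integral; exact/measurable_EFinP. Qed.

Lemma lam_ae (Q : R -> Prop) : {ae lebesgue_measure, forall t, 0 <= t <= 1 -> Q t} ->
  {ae lam, forall t, Q t}.
Proof.
move=> [N [mN N0 hN]]; exists (N `|` ~` `[0%R, 1%R]); split.
- by apply: measurableU => //; apply: measurableC; exact: measurable_itv.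
- rewrite [LHS]lamE setIUl setICl setU0; apply/eqP; rewrite -measure_le0 -N0.
  by rewrite le_measure ?inE//; apply: measurableI => //; exact: measurable_itv.
- move=> t /= h; have [It|It] := pselect (`[0%R, 1%R]%classic t); last by right.
  left; apply: hN => /= hh; apply: h; apply: hh.
  by move: It; rewrite /= in_itv.
Qed.

Lemma eq_lam_Rint (f g : R -> R) : measurable_fun setT f -> measurable_fun setT g ->
  (forall t, 0 <= t <= 1 -> f t = g t) -> \int[lam]_t f t = \int[lam]_t g t.
Proof.
move=> mf mg fg; rewrite -!lam_Rintegral//; apply: eq_Rintegral => t.
by rewrite inE/= in_itv/= => /fg.
Qed.

Lemma lam_integrable (f : R -> R) : integ lam f ->
  (@lebesgue_measure R).-integrable (`[0%R, 1%R] : set R) (EFin \o f).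
Proof.
move=> hf; have mf := integ_meas hf; apply/integrableP; split.
  exact/measurable_EFinP/measurable_funTS.
rewrite lam_integral; last by apply: measurableT_comp => //; exact/measurable_EFinP.
by have /integrableP[] := hf.
Qed.

Lemma le_lam_Rint (f g : R -> R) : integ lam f -> integ lam g ->
  (forall t, 0 <= t <= 1 -> f t <= g t) -> \int[lam]_t f t <= \int[lam]_t g t.
Proof.
move=> hf hg fg; rewrite -!lam_Rintegral; [|exact: integ_meas hg|exact: integ_meas hf].
apply: le_Rintegral; [exact: measurable_itv|exact: lam_integrable..|].
by move=> t; rewrite /= in_itv/= => /fg.
Qed.

Lemma norm_lam_Rint_le (f g : R -> R) : integ lam f -> integ lam g ->
  (forall t, 0 <= t <= 1 -> `|f t| <= g t) -> `|\int[lam]_t f t| <= \int[lam]_t g t.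
Proof.
move=> hf hg fg; apply: le_trans (norm_Rint hf) _.
by apply: le_lam_Rint => //; exact: integ_norm.
Qed.

(* Real functions on [0,1] are handled as functions on the line read through
   [clip]; [lam] only sees [0,1]. *)
Definition clip (t : R) : R := Num.max 0 (Num.min t 1).

Lemma clip_in t : 0 <= clip t <= 1.
Proof. by rewrite /clip le_max lexx ge_max ler01/= ge_min lexx orbT. Qed.

Lemma clip_id t : 0 <= t <= 1 -> clip t = t.
Proof. by move=> /andP[t0 t1]; rewrite /clip (min_idPl t1) (max_idPr t0). Qed.

Lemma measurable_clip : measurable_fun setT clip.
Proof. by apply: measurable_maxr => //; exact: measurable_minr. Qed.

Lemma lam_clip (f : R -> R) : measurable_fun setT f ->
  \int[lam]_t f (clip t) = \int[lam]_t f t.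
Proof.
move=> mf; apply: eq_lam_Rint => //.
  by apply: measurableT_comp => //; exact: measurable_clip.
by move=> t t01; rewrite clip_id.
Qed.

(** The image of Lebesgue measure under the affine map, multiplied by [c], gives every []a, b]] its
    length, hence is Lebesgue measure. *)
Lemma lebesgue_affine (c d : R) (A : set R) : 0 < c -> measurable A ->
  (lebesgue_measure ((fun t => (c * t + d)%R) @^-1` A) = (c^-1)%:E * lebesgue_measure A)%E.
Proof.
move=> c0 mA.
have ma : measurable_fun (setT : set (measurableTypeR R))
   ((fun t => c * t + d) : measurableTypeR R -> measurableTypeR R).
  by apply: measurable_funD => //; exact: measurable_funM.
pose nu : {measure set (measurableTypeR R) -> \bar R} :=
  mscale (NngNum (ltW c0)) (pfm lebesgue_measure ma).
have : lebesgue_measure A = nu A.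
  apply: (@lebesgue_measure_unique R nu) => // X [[a b] _ <-] /=.
  rewrite /nu /mscale /= /pushforward /=.
  have -> : (fun t => c * t + d) @^-1` `]a, b] = `](a - d) / c, (b - d) / c]%classic.
    apply/seteqP; split => t /=; rewrite !in_itv/= ltr_pdivrMr// ler_pdivlMr//;
      by move=> /andP[h1 h2]; apply/andP; split; lra.
  rewrite !lebesgue_measure_itv/= !lte_fin ltr_pM2r ?invr_gt0// ltrD2r.
  case: ifP => _; last by rewrite mule0.
  by rewrite -!EFinB -EFinM; congr EFin; field; rewrite gt_eqF.
rewrite /nu /mscale /= /pushforward /= => ->.
by rewrite muleA -EFinM mulVf ?mul1e// gt_eqF.
Qed.

Lemma ge0_integral_affine (c d : R) (f : R -> \bar R) : 0 < c ->
  measurable_fun setT f -> (forall t, 0 <= f t)%E ->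
  (\int[lebesgue_measure]_t f (c * t + d)%R =
   (c^-1)%:E * \int[lebesgue_measure]_t f t)%E.
Proof.
move=> c0 mf f0.
have ma : measurable_fun (setT : set (measurableTypeR R))
   ((fun t => c * t + d) : measurableTypeR R -> measurableTypeR R).
  by apply: measurable_funD => //; exact: measurable_funM.
transitivity (\int[pfm (@lebesgue_measure R) ma]_t f t)%E.
  by rewrite ge0_integral_pushforward.
have c0' : 0 <= c^-1 by rewrite invr_ge0 ltW.
rewrite -(@ge0_integral_mscale _ _ R lebesgue_measure setT measurableT (NngNum c0') f)//.
by apply: eq_measure_integral => A mA _; rewrite /= /mscale /= /pushforward/= lebesgue_affine.
Qed.

End lam.

(** * Randomly shifted Riemann sums *)

Lemma dist_split (R : realFieldType) (a b c d p e : R) :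
  `|a - b| <= p -> `|b - c| <= e / 4 -> `|c - d| <= e / 4 -> `|a - d| <= p + e / 2.
Proof. by have := ler_distD b a d; have := ler_distD c b d; lra. Qed.

Section random_shift.
Variable R : realType.
Local Notation lam := (@lam R).
Local Notation mu := (@lebesgue_measure R).

(** For [th] uniform on [0,1] the [j]-th point is uniform in the [j]-th cell, so that the Riemann
    sum of any integrable [f] has mean exactly [\int f], although its value at a single [th] may say
    nothing about [f]. *)
Definition rs (N : nat) (f : R -> R) (th : R) : R :=
  N%:R^-1 * \sum_(j < N) f ((j%:R + th) / N%:R).

Lemma measurable_cell (N j : nat) d (T : measurableType d) (f : R -> T) :
  measurable_fun setT f -> measurable_fun setT (fun th : R => f ((j%:R + th) / N%:R)).
Proof.
move=> mf; apply: measurableT_comp => //.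
by apply: measurable_funM => //; exact: measurable_funD.
Qed.

Lemma ge0_integral_cell (N j : nat) (f : R -> \bar R) : (0 < N)%N ->
  measurable_fun setT f -> (forall t, 0 <= f t)%E ->
  (\int[lam]_th f ((j%:R + th) / N%:R)%R =
   N%:R%:E * \int[mu]_(t in `[(j%:R / N%:R)%R, (j.+1%:R / N%:R)%R[) f t)%E.
Proof.
move=> N0 mf f0.
have N0' : 0 < N%:R :> R by rewrite ltr0n.
have mfc := @measurable_cell N j _ _ f mf.
rewrite -lam_integral//.
rewrite -integral_itv_bndo_bndc; last exact: measurable_funTS.
rewrite integral_mkcond [in RHS]integral_mkcond.
have mI a b : measurable (`[a, b[ : set R) by exact: measurable_itv.
have := @ge0_integral_affine R (N%:R^-1) (j%:R / N%:R)
  (f \_ `[(j%:R / N%:R)%R, (j.+1%:R / N%:R)%R[).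
rewrite invr_gt0 N0' invrK => <- //.
- apply: eq_integral => t _; rewrite !patchE !mem_setE !in_itv/=.
  have -> : N%:R^-1 * t + j%:R / N%:R = (j%:R + t) / N%:R by field; rewrite gt_eqF.
  rewrite ler_pM2r ?invr_gt0// ltr_pM2r ?invr_gt0// -natr1.
  by rewrite lerDl ltrD2l.
- by apply/(measurable_restrictT _ _).1 => //; exact: measurable_funTS.
- by move=> t; rewrite patchE; case: ifP.
Qed.

Lemma ge0_sum_cell (N n : nat) (f : R -> \bar R) : (0 < N)%N ->
  measurable_fun setT f -> (forall t, 0 <= f t)%E ->
  (\sum_(j < n) \int[mu]_(t in `[(j%:R / N%:R)%R, (j.+1%:R / N%:R)%R[) f t =
   \int[mu]_(t in `[0%R, (n%:R / N%:R)%R[) f t)%E.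
Proof.
move=> N0 mf f0; elim: n => [|n IH].
  by rewrite big_ord0 mul0r set_itvco0 integral_set0.
have N0' : 0 < N%:R :> R by rewrite ltr0n.
have mI a b : measurable (`[a, b[ : set R) by exact: measurable_itv.
rewrite big_ord_recr/= IH -ge0_integral_setU//=.
- congr (integral _ _ _); apply/seteqP; split => t /=; rewrite !in_itv/=.
  + move=> [|] /andP[h1 h2]; apply/andP; split => //.
      by rewrite (lt_le_trans h2)// ler_pM2r ?invr_gt0// ler_nat.
    by rewrite (le_trans _ h1)// divr_ge0.
  + move=> /andP[h1 h2]; have [h|h] := ltP t (n%:R / N%:R); first by left; apply/andP.
    by right; apply/andP.
- exact: measurable_funTS.
- apply/disj_setPS => t /=; rewrite !in_itv/= => -[/andP[_ h1] /andP[h2 _]].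
  by have := lt_le_trans h1 h2; rewrite ltxx.
Qed.

Lemma ge0_integral_cells (N : nat) (f : R -> \bar R) : (0 < N)%N ->
  measurable_fun setT f -> (forall t, 0 <= f t)%E ->
  (\sum_(j < N) \int[lam]_th f ((j%:R + th) / N%:R)%R = N%:R%:E * \int[lam]_t f t)%E.
Proof.
move=> N0 mf f0; under eq_bigr do rewrite ge0_integral_cell//.
rewrite -ge0_sume_distrr; last by move=> j _; exact: integral_ge0.
rewrite ge0_sum_cell// divff ?pnatr_eq0 -?lt0n// -lam_integral//.
by rewrite -integral_itv_bndo_bndc//; exact: measurable_funTS.
Qed.

Lemma integ_cell (N j : nat) (f : R -> R) : (j < N)%N -> integ lam f ->
  integ lam (fun th => f ((j%:R + th) / N%:R)).
Proof.
move=> jN hf; have N0 : (0 < N)%N by exact: leq_trans jN.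
have mf := integ_meas hf.
apply/integrableP; split; first by apply/measurable_EFinP; exact: measurable_cell.
have H := @ge0_integral_cells N (fun t => `|f t|%:E)%E N0 _ _.
have {}H := H ltac:(by apply/measurable_EFinP; apply: measurableT_comp) ltac:(by []).
apply: (@le_lt_trans _ _ (N%:R%:E * \int[lam]_t `|f t|%:E)%E).
  rewrite -H (bigD1 (Ordinal jN))//= leeDl//.
  by apply: sume_ge0 => i _; exact: integral_ge0.
have /integrableP[_ hfi] := hf.
by rewrite lte_mul_pinfty// ?lee_fin.
Qed.

Lemma integ_rs (N : nat) (f : R -> R) : integ lam f -> integ lam (rs N f).
Proof.
move=> hf; apply: integZ.
have -> : (fun th => \sum_(j < N) f ((j%:R + th) / N%:R)) =
  (fun th => \sum_(j <- enum 'I_N) f ((j%:R + th) / N%:R)).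
  by apply/funext => th; rewrite big_enum.
by apply: integ_sum => j; exact: integ_cell.
Qed.

Lemma Rint_rs (N : nat) (f : R -> R) : (0 < N)%N -> integ lam f ->
  \int[lam]_th rs N f th = \int[lam]_t f t.
Proof.
move=> N0.
have N0' : N%:R != 0 :> R by rewrite pnatr_eq0 -lt0n.
have pos (g : R -> R) : integ lam g -> (forall t, 0 <= g t) ->
    \int[lam]_th rs N g th = \int[lam]_t g t.
  move=> hg g0; have mg := integ_meas hg.
  rewrite RintZ; last first.
    have -> : (fun th => \sum_(j < N) g ((j%:R + th) / N%:R)) =
      (fun th => \sum_(j <- enum 'I_N) g ((j%:R + th) / N%:R)).
      by apply/funext => th; rewrite big_enum.
    by apply: integ_sum => j; exact: integ_cell.
  rewrite -[RHS](mulKf N0'); congr (_ * _).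
  under eq_Rintegral do rewrite -big_enum/=.
  rewrite Rint_sum; last by move=> j; exact: integ_cell.
  rewrite big_enum /=; apply: EFin_inj; rewrite EFinM Rint_EFin//.
  rewrite -(ge0_integral_cells N0); last 2 first.
  - exact/measurable_EFinP.
  - by move=> t; rewrite lee_fin.
  rewrite -sumEFin; apply: eq_bigr => j _; rewrite Rint_EFin//.
  exact: integ_cell.
move=> hf; pose g t := `|f t|; pose h t := `|f t| - f t.
have hg : integ lam g by exact: integ_norm.
have hh : integ lam h by exact: integB.
have -> : f = (fun t => g t - h t).
  by apply/funext => t; rewrite /g /h; ring.
have h0 t : 0 <= h t by rewrite subr_ge0 ler_norm.
rewrite [RHS]RintB// -(pos g hg (fun t => normr_ge0 _)).
rewrite -[X in _ = _ - X](pos h hh h0).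
rewrite -RintB; [|exact: integ_rs..].
apply: eq_Rintegral => th _; rewrite /rs -mulrBr; congr (_ * _).
by rewrite -sumrB.
Qed.

(** Heine's theorem, from the near-covering form of compactness. Only [s] is confined to the
    segment. *)
Lemma uniform_on_segment (g : R -> R) (e : R) : continuous g -> 0 < e ->
  \forall dl \near (0:R)^'+, forall s t, 0 <= s <= 1 -> `|s - t| <= dl -> `|g s - g t| < e.
Proof.
move=> cg e0.
have /compact_near_coveringP cov : compact (`[0%R, 1%R] : set R) by exact: segment_compact.
have := cov _ (0^'+) (fun dl s => forall t, `|s - t| <= dl -> `|g s - g t| < e) _ _.
move=> H; have {}H : \forall dl \near (0:R)^'+, `[0%R, 1%R] `<=`
    (fun s => forall t, `|s - t| <= dl -> `|g s - g t| < e).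
  apply: H => s0 _.
  have e2 : 0 < e / 2 by rewrite divr_gt0.
  have /cvgrPdist_lt /(_ _ e2) := cg s0.
  move=> /nbhs_ballP[r /= r0 hr].
  exists (ball s0 (r / 2), [set dl : R | dl < r / 2]) => /=.
    split; first by apply: nbhsx_ballx; rewrite divr_gt0.
    by apply: nbhs_right_lt; rewrite divr_gt0.
  move=> [s dl] /= [hs hdl] t hst.
  have h1 := hr s; have h2 := hr t.
  rewrite /ball /= in hs h1 h2.
  have k1 : `|s0 - s| < r by lra.
  have k2 : `|s0 - t| < r.
    by have := ler_distD s s0 t; lra.
  have := ler_distD (g s0) (g s) (g t); rewrite [`|g s - g s0|]distrC.
  by have := h1 k1; have := h2 k2; lra.
apply: filterS H => dl H s t s01; apply: H => /=.
by rewrite in_itv.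
Qed.

Lemma cell_in (N j : nat) (th : R) : (j < N)%N -> 0 <= th <= 1 ->
  0 <= (j%:R + th) / N%:R <= 1.
Proof.
move=> jN /andP[t0 t1]; have N0 : 0 < N%:R :> R by rewrite ltr0n (leq_trans _ jN).
rewrite divr_ge0 ?addr_ge0//= ler_pdivrMr// mul1r.
by have : j.+1%:R <= N%:R :> R; [rewrite ler_nat|rewrite -natr1; lra].
Qed.

(** By [Rint_rs] the integral is itself the mean of the Riemann sums over the shift, and two shifts
    move each grid point by at most one mesh. *)
Lemma rs_cont (g : R -> R) (e : R) : integ lam g -> continuous g -> 0 < e ->
  \forall n \near \oo, forall th, 0 <= th <= 1 -> `|rs n.+1 g th - \int[lam]_t g t| <= e.
Proof.
move=> hg cg e0.
have U := uniform_on_segment cg e0.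
have [N0 _ HN] : \forall n \near \oo, forall s t : R, 0 <= s <= 1 ->
    `|s - t| <= n.+1%:R^-1 -> `|g s - g t| < e.
  move: U => /nbhs_ballP[dl /= dl0 hd].
  near=> n; apply: hd; last by rewrite invr_gt0.
  rewrite /ball /= sub0r normrN ger0_norm ?invr_ge0//.
  by near: n; exact: (near_infty_natSinv_lt (PosNum dl0)).
near=> n => th th01.
have nN : (N0 <= n)%N by near: n; exact: nbhs_infty_ge.
have n0 : 0 < n.+1%:R :> R by rewrite ltr0n.
rewrite -(@Rint_rs n.+1)//.
rewrite -[X in `|X - _|](Rint_probability_cst lam) -RintB; [|exact: integ_cst|exact: integ_rs].
rewrite -[leRHS](Rint_probability_cst lam).
apply: norm_lam_Rint_le => //.
- by apply: integB; [exact: integ_cst|exact: integ_rs].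
- exact: integ_cst.
move=> tau tau01.
rewrite /rs -mulrBr -sumrB normrM ger0_norm ?invr_ge0// ler_pdivrMl//.
apply: le_trans (ler_norm_sum _ _ _) _.
apply: (@le_trans _ _ (\sum_(j < n.+1) e)).
  apply: ler_sum => j _; apply/ltW/(HN n nN); first exact: cell_in.
  rewrite -mulrBl normrM [`|_^-1|]ger0_norm ?invr_ge0// ler_piMl ?invr_ge0//.
  by move: th01 tau01 => /andP[? ?] /andP[? ?]; rewrite ler_norml; apply/andP; split; lra.
by rewrite sumr_const card_ord -[leLHS]mulr_natl.
Unshelve. all: by end_near. Qed.

(* Averaging over the shift replaces the continuity of [f]: both sides are
   continuous in L^1 and the claim is clear for continuous functions. *)
Lemma rs_cvg (f : R -> R) : integ lam f ->
  (\int[lam]_th `|rs n.+1 f th - \int[lam]_t f t|) @[n --> \oo] --> (0 : R).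
Proof.
move=> hf; have mf := integ_meas hf.
apply/cvgrPdist_lt => e e0; have e4 : 0 < e / 4 by rewrite divr_gt0.
have mI : measurable (`[0%R, 1%R] : set R) by exact: measurable_itv.
have hfI := lam_integrable hf.
have [|g_ [cg_ ig_ gf]] := approximation_continuous_integrable mI _ hfI.
  have h : (lam setT < +oo)%E by rewrite probability_setT ltry.
  by rewrite lamE setTI in h; exact: h.
have [g [cg fg]] : exists g : R -> R, continuous g /\
    (\int[mu]_(z in `[0%R, 1%R]) `|(f z - g z)%:E| < (e / 4)%:E)%E.
  have : \forall n \near \oo, (\int[mu]_(z in `[0%R, 1%R]) `|(f z - g_ n z)%:E| < (e / 4)%:E)%E.
    move/fine_cvgP : gf => [fin /cvgrPdist_lt/(_ _ e4)].
    move=> gf; near=> n; rewrite -(@fineK _ (integral _ _ _)); last by near: n.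
    rewrite lte_fin; have : `|0 - fine (\int[mu]_(z in `[0%R, 1%R]) `|(f z - g_ n z)%:E|)%E| < e / 4.
      by near: n.
    by rewrite sub0r normrN; apply: le_lt_trans; exact: ler_norm.
  by move=> [n _ /(_ n (leqnn n))] h; exists (g_ n).
have mg : measurable_fun setT g by exact: continuous_measurable_fun.
have mfg : measurable_fun setT (fun t => f t - g t) by exact: measurable_funB.
have hfg : integ lam (fun t => f t - g t).
  apply/integrableP; split; first exact/measurable_EFinP.
  rewrite -lam_integral; last by apply: measurableT_comp => //; exact/measurable_EFinP.
  by apply: lt_trans fg _; rewrite ltry.
have hg : integ lam g.
  have -> : g = (fun t => f t - (f t - g t)) by apply/funext => t; ring.
  exact: integB.
have {}fg : \int[lam]_t `|f t - g t| < e / 4.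
  rewrite -lte_fin Rint_EFin; last exact: integ_norm.
  rewrite -lam_integral//; apply/measurable_EFinP; exact: measurableT_comp.
near=> n.
have Hg th : 0 <= th <= 1 -> `|rs n.+1 g th - \int[lam]_t g t| <= e / 4.
  by move: th; near: n; exact: rs_cont.
have hfgn : integ lam (fun t => `|f t - g t|) by exact: integ_norm.
rewrite sub0r normrN ger0_norm; last by apply: Rintegral_ge0 => th _; exact: normr_ge0.
(* The error that depends on the shift is the Riemann sum of [|f - g|], whose mean is below [e / 4]
   by [Rint_rs]; the two other errors are at most [e / 4] each, uniformly in the shift. *)
apply: (@le_lt_trans _ _ (\int[lam]_th (rs n.+1 (fun t => `|f t - g t|) th + e / 2))).
  apply: le_lam_Rint.
  - by apply: integ_norm; apply: integB; [exact: integ_rs|exact: integ_cst].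
  - by apply: integD; [exact: integ_rs|exact: integ_cst].
  move=> th th01.
  have h1 : `|rs n.+1 f th - rs n.+1 g th| <= rs n.+1 (fun t => `|f t - g t|) th.
    rewrite /rs -mulrBr -sumrB normrM ger0_norm ?invr_ge0// ler_wpM2l ?invr_ge0//.
    exact: ler_norm_sum.
  have h2 : `|\int[lam]_t g t - \int[lam]_t f t| <= e / 4.
    rewrite distrC -RintB//; apply: le_trans (norm_Rint hfg) _; exact: ltW.
  exact: dist_split h1 (Hg th th01) h2.
rewrite RintD; [|exact: integ_rs|exact: integ_cst].
rewrite Rint_rs// Rint_probability_cst -ltrBrDr; apply: lt_le_trans fg _.
by clear -e0; lra.
Unshelve. all: by end_near. Qed.

End random_shift.

(** * Trigonometric functions determine integrals *)

Section sign_approximation.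
Variable R : realType.
Implicit Types s : R.

(* The iterates of this map on [-1,1] converge to the sign. *)
Definition sgstep s : R := s * (3 - s ^+ 2) / 2.

Lemma sgstepN s : sgstep (- s) = - sgstep s.
Proof. by rewrite /sgstep; field. Qed.

Lemma iter_sgstepN n s : iter n sgstep (- s) = - iter n sgstep s.
Proof. by elim: n => //= n ->; rewrite sgstepN. Qed.

(** Since [1 - sgstep t = (1 - t) (1 - (t + t^2) / 2)] and the iterates stay above [s], each step
    multiplies the gap to 1 by at most [1 - s / 2]. *)
Lemma iter_sgstep_pos n s : 0 <= s <= 1 ->
  (s <= iter n sgstep s <= 1) && (1 - iter n sgstep s <= (1 - s / 2) ^+ n).
Proof.
move=> /andP[s0 s1]; elim: n => [|n /andP[/andP[h1 h2] h3]]/=.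
  by rewrite lexx s1/= expr0; lra.
set t := iter n sgstep s in h1 h2 h3 *.
have t0 : 0 <= t by exact: le_trans h1.
have e1 : 1 - sgstep t = (1 - t) * (1 - (t + t ^+ 2) / 2) by rewrite /sgstep; field.
have e2 : sgstep t - t = t * (1 - t) * (1 + t) / 2 by rewrite /sgstep; field.
have k1 : 0 <= t * (1 - t) * (1 + t) / 2.
  by rewrite !mulr_ge0 ?invr_ge0//; lra.
have k2 : 0 <= (1 - t) * (1 - (t + t ^+ 2) / 2) by rewrite mulr_ge0//; nra.
apply/andP; split; first by apply/andP; split; lra.
rewrite e1 [leRHS]exprSr; apply: ler_pM => //; [lra|nra|].
by have := sqr_ge0 t; lra.
Qed.

Lemma cvg_iter_sgstep s : -1 <= s <= 1 ->
  iter n sgstep s @[n --> \oo] --> Num.sg s.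
Proof.
have pos (t : R) : 0 < t <= 1 -> iter n sgstep t @[n --> \oo] --> (1 : R).
  move=> /andP[t0 t1].
  have H n : (1 - (1 - t / 2) ^+ n <= iter n sgstep t <= 1).
    have /andP[/andP[_ ->] h] := @iter_sgstep_pos n t ltac:(by rewrite (ltW t0) t1).
    by rewrite andbT; lra.
  have c1 : 1 - (1 - t / 2) ^+ n @[n --> \oo] --> (1 : R).
    rewrite -[X in _ --> X]subr0; apply: cvgB; first exact: cvg_cst.
    apply: (@cvg_expr R (1 - t / 2)); rewrite ger0_norm; lra.
  apply/cvgrPdist_le => e e0; near=> m; have /andP[h1 h2] := H m.
  have : `|1 - (1 - (1 - t / 2) ^+ m)| <= e.
    by near: m; move/cvgrPdist_le : c1; apply.
  by apply: le_trans; rewrite ger0_norm ?subr_ge0// ger0_norm ?subr_ge0 ?lerB// (le_trans h1).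
move=> /andP[s1 s2]; have [s0|s0|->] := ltrgt0P s.
- by rewrite gtr0_sg//; apply: pos; rewrite s0.
- rewrite ltr0_sg// -[s]opprK; under eq_fun do rewrite iter_sgstepN.
  by apply: cvgN; apply: pos; rewrite oppr_gt0 s0; lra.
- rewrite sgr0; have -> : (fun n => iter n sgstep (0 : R)) = cst 0; last exact: cvg_cst.
  by apply/funext; elim => //= n ->; rewrite /sgstep mul0r mul0r.
Unshelve. all: by end_near. Qed.

Lemma cos_mul (x y : R) : cos x * cos y = 2^-1 * cos (x + y) + 2^-1 * cos (x - y).
Proof. by rewrite cosD cosB; field. Qed.

Lemma sgr_sin (x : R) : `|x| < pi -> Num.sg (sin x) = Num.sg x.
Proof.
rewrite ltr_norml => /andP[h1 h2]; have [x0|x0|->] := ltrgt0P x.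
- by rewrite !gtr0_sg// sin_gt0_pi// x0.
- rewrite [RHS]ltr0_sg// -[x]opprK sinN ltr0_sg// oppr_lt0 sin_gt0_pi//.
  by rewrite oppr_gt0 x0; lra.
- by rewrite sin0.
Qed.

End sign_approximation.

Section trig_uniqueness.
Context (R : realType) (n : nat) d (T : measurableType d) (I : finType).
Variables (mu : I -> {measure set T -> \bar R}) (U : I -> T -> R)
  (Z : I -> T -> 'rV[R]_n).
Hypothesis iU : forall i, integ (mu i) (U i).
Hypothesis mZ : forall i k, measurable_fun setT (fun x => Z i x 0 k).
Implicit Types phi psi : 'rV[R]_n -> R.

(** Integration of [phi] against the sum of the images under [Z i] of the signed measures with
    density [U i] relative to [mu i]. An identity between several integrals of [F], moved to one
    side, becomes the vanishing of one pairing. *)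
Definition pairing phi : R := \sum_i \int[mu i]_x (U i x * phi (Z i x)).

Definition trig (l : 'I_n -> R) (a : R) (z : 'rV[R]_n) : R :=
  cos (\sum_k l k * z 0 k + a).

Hypothesis pairing_trig : forall l a, pairing (trig l a) = 0.

(** Measurability is asked along the maps [Z i] only, so that no sigma-field on row vectors
    enters. *)
Definition bmeas phi := (forall i, measurable_fun setT (fun x => phi (Z i x))) /\
  exists C : R, forall z, `|phi z| <= C.

(* Multipliers form an algebra closed under bounded pointwise limits; it contains
   the trigonometric functions, hence the signs of [sin], hence the boxes. *)
Definition annihilated phi := bmeas phi /\
  forall l a, pairing (fun z => phi z * trig l a z) = 0.

Definition multiplier psi := bmeas psi /\
  forall phi, annihilated phi -> annihilated (fun z => psi z * phi z).

Lemma integ_pairing phi i : bmeas phi -> integ (mu i) (fun x => U i x * phi (Z i x)).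
Proof.
move=> [mphi [C hC]]; apply: (@integ_le _ _ _ _ _ (fun x => C * `|U i x|)).
- by apply: measurable_funM => //; exact: integ_meas (iU i).
- by apply: integZ; exact: integ_norm.
- by move=> x; rewrite normrM mulrC ler_wpM2r.
Qed.

Lemma bmeas_trig l a : bmeas (trig l a).
Proof.
split; last by exists 1 => z; exact: cos_max.
move=> i; apply: (measurableT_comp (f := @cos R)).
  by apply: continuous_measurable_fun; exact: continuous_cos.
apply: measurable_funD => //; apply: measurable_sum => k.
exact: measurable_funM.
Qed.

Lemma bmeasM phi psi : bmeas phi -> bmeas psi -> bmeas (fun z => phi z * psi z).
Proof.
move=> [m1 [C1 h1]] [m2 [C2 h2]]; split; first by move=> i; exact: measurable_funM.
by exists (C1 * C2) => z; rewrite normrM; apply: ler_pM.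
Qed.

Lemma bmeasD phi psi : bmeas phi -> bmeas psi -> bmeas (fun z => phi z + psi z).
Proof.
move=> [m1 [C1 h1]] [m2 [C2 h2]]; split; first by move=> i; exact: measurable_funD.
by exists (C1 + C2) => z; apply: le_trans (ler_normD _ _) _; exact: lerD.
Qed.

Lemma bmeas_cst c : bmeas (fun=> c).
Proof. by split => //; exists `|c|. Qed.

Lemma pairingD phi psi : bmeas phi -> bmeas psi ->
  pairing (fun z => phi z + psi z) = pairing phi + pairing psi.
Proof.
move=> b1 b2; rewrite /pairing -big_split/=; apply: eq_bigr => i _.
rewrite -RintD; [|exact: integ_pairing..].
by apply: eq_Rintegral => x _; rewrite mulrDr.
Qed.

Lemma pairingZ c phi : bmeas phi -> pairing (fun z => c * phi z) = c * pairing phi.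
Proof.
move=> b; rewrite /pairing mulr_sumr; apply: eq_bigr => i _.
rewrite -RintZ; last exact: integ_pairing.
by apply: eq_Rintegral => x _; rewrite mulrCA.
Qed.

Lemma pairing_cvg (phi_ : nat -> 'rV[R]_n -> R) phi (C : R) :
  (forall m, bmeas (phi_ m)) -> (forall m z, `|phi_ m z| <= C) ->
  (forall z, phi_ m z @[m --> \oo] --> phi z) ->
  bmeas phi /\ (pairing (phi_ m) @[m --> \oo] --> pairing phi).
Proof.
move=> bp hC hphi; split.
  split; last first.
    exists C => z; have := hphi z => h.
    apply: (@closed_cvg _ _ \oo _ _ [set y : R | `|y| <= C] _ _ _ h) => //=.
      apply: (@closed_comp _ _ (fun y : R => `|y|) [set y | y <= C]).
        by move=> y _; exact: norm_continuous.
      exact: closed_le.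
    exact: nearW.
  move=> i; apply: (measurable_fun_cvg (h := fun m x => phi_ m (Z i x))).
    by move=> m; have [] := bp m.
  by move=> x _; exact: hphi.
rewrite /pairing.
apply: cvg_sumr => i.
have [] := @Rint_dct _ _ _ (mu i) (fun m x => U i x * phi_ m (Z i x))
  (fun x => U i x * phi (Z i x)) (fun x => C * `|U i x|) => //.
- move=> m; apply: measurable_funM; first exact: integ_meas (iU i).
  by have [] := bp m.
- by apply: integZ; exact: integ_norm.
- by move=> x; apply: cvgM; [exact: cvg_cst|exact: hphi].
- by move=> m x; rewrite normrM mulrC ler_wpM2r.
Qed.

Lemma multiplier_cvg (psi_ : nat -> 'rV[R]_n -> R) psi (C : R) :
  (forall m, multiplier (psi_ m)) -> (forall m z, `|psi_ m z| <= C) ->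
  (forall z, psi_ m z @[m --> \oo] --> psi z) -> multiplier psi.
Proof.
move=> mp hC hpsi.
have [bpsi _] := @pairing_cvg psi_ psi C (fun m => (mp m).1) hC hpsi.
split => // phi [bphi hphi]; split; first exact: bmeasM.
move=> l a; have [D hD] := bphi.2.
have C0 : 0 <= C by exact: le_trans (hC 0%N 0).
have [] := @pairing_cvg (fun m z => psi_ m z * phi z * trig l a z)
  (fun z => psi z * phi z * trig l a z) (C * D).
- move=> m; apply: bmeasM; last exact: bmeas_trig.
  by apply: bmeasM => //; exact: (mp m).1.
- move=> m z; rewrite normrM -[leRHS]mulr1 ler_pM ?cos_max// normrM.
  exact: ler_pM.
- move=> z; apply: cvgM; last exact: cvg_cst.
  by apply: cvgM; [exact: hpsi|exact: cvg_cst].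
- move=> _; have -> : (fun m => pairing (fun z => psi_ m z * phi z * trig l a z)) = cst 0.
    apply/funext => m; have [_ /(_ phi)] := mp m.
    by move=> /(_ (conj bphi hphi))[_ ->].
  by move=> /cvg_lim <- //; rewrite lim_cst.
Qed.

Lemma multiplierM psi1 psi2 : multiplier psi1 -> multiplier psi2 ->
  multiplier (fun z => psi1 z * psi2 z).
Proof.
move=> [b1 h1] [b2 h2]; split; first exact: bmeasM.
move=> phi /h2/h1; congr annihilated.
by apply/funext => z; rewrite mulrA.
Qed.

Lemma multiplierD psi1 psi2 : multiplier psi1 -> multiplier psi2 ->
  multiplier (fun z => psi1 z + psi2 z).
Proof.
move=> [b1 h1] [b2 h2]; split; first exact: bmeasD.
move=> phi hphi; have [c1 e1] := h1 _ hphi; have [c2 e2] := h2 _ hphi.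
have e : (fun z => (psi1 z + psi2 z) * phi z) = (fun z => psi1 z * phi z + psi2 z * phi z).
  by apply/funext => z; rewrite mulrDl.
split; first by rewrite e; exact: bmeasD.
move=> l a; have -> : (fun z => (psi1 z + psi2 z) * phi z * trig l a z) =
  (fun z => psi1 z * phi z * trig l a z + psi2 z * phi z * trig l a z).
  by apply/funext => z; rewrite -!mulrDl.
rewrite pairingD ?e1 ?e2 ?addr0//; apply: bmeasM => //; exact: bmeas_trig.
Qed.

Lemma multiplier_cst c : multiplier (fun=> c).
Proof.
split; first exact: bmeas_cst.
move=> phi [bphi hphi]; split; first by apply: bmeasM => //; exact: bmeas_cst.
move=> l a; have -> : (fun z => c * phi z * trig l a z) = (fun z => c * (phi z * trig l a z)).
  by apply/funext => z; rewrite mulrA.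
by rewrite pairingZ ?hphi ?mulr0//; apply: bmeasM => //; exact: bmeas_trig.
Qed.

Lemma multiplier_sum (J : Type) (s : seq J) (psi : J -> 'rV[R]_n -> R) :
  (forall j, multiplier (psi j)) -> multiplier (fun z => \sum_(j <- s) psi j z).
Proof.
move=> h; elim: s => [|j s IH].
  by under eq_fun do rewrite big_nil; exact: multiplier_cst.
by under eq_fun do rewrite big_cons; exact: multiplierD.
Qed.

Lemma multiplier_prod (J : Type) (s : seq J) (psi : J -> 'rV[R]_n -> R) :
  (forall j, multiplier (psi j)) -> multiplier (fun z => \prod_(j <- s) psi j z).
Proof.
move=> h; elim: s => [|j s IH].
  by under eq_fun do rewrite big_nil; exact: multiplier_cst.
by under eq_fun do rewrite big_cons; exact: multiplierM.
Qed.

Lemma multiplier_trig l0 a0 : multiplier (trig l0 a0).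
Proof.
split; first exact: bmeas_trig.
move=> phi [bphi hphi]; have bt := bmeas_trig.
split; first exact: bmeasM.
move=> l a.
have -> : (fun z => trig l0 a0 z * phi z * trig l a z) =
  (fun z => 2^-1 * (phi z * trig (fun k => l0 k + l k) (a0 + a) z) +
            2^-1 * (phi z * trig (fun k => l0 k - l k) (a0 - a) z)).
  apply/funext => z; rewrite /trig.
  have -> : \sum_k (l0 k + l k) * z 0 k + (a0 + a) =
      (\sum_k l0 k * z 0 k + a0) + (\sum_k l k * z 0 k + a).
    by under eq_bigr do rewrite mulrDl; rewrite big_split/=; ring.
  have -> : \sum_k (l0 k - l k) * z 0 k + (a0 - a) =
      (\sum_k l0 k * z 0 k + a0) - (\sum_k l k * z 0 k + a).
    by under eq_bigr do rewrite mulrBl; rewrite sumrB; ring.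
  by rewrite mulrAC cos_mul; ring.
rewrite pairingD; [|by apply: bmeasM; [exact: bmeas_cst|exact: bmeasM]..].
by rewrite !pairingZ ?hphi ?mulr0 ?addr0//; exact: bmeasM.
Qed.

(** For large [m] the number [(z 0 k - y) / m] lies in []-pi, pi[], where it has the sign of its
    sine. The sign of a sine is the limit of the iterates of [sgstep], which are polynomials in it,
    and a sine is a cosine with phase [- pi / 2]. *)
Lemma multiplier_sg (k : 'I_n) (y : R) : multiplier (fun z => Num.sg (z 0 k - y)).
Proof.
apply: (@multiplier_cvg (fun m z => Num.sg (sin (m.+1%:R^-1 * (z 0 k - y)))) _ 1).
- move=> m.
  apply: (@multiplier_cvg (fun p z => iter p (@sgstep R) (sin (m.+1%:R^-1 * (z 0 k - y)))) _ 1).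
  + elim => [|p IH] /=.
      have := multiplier_trig (fun j => (j == k)%:R * m.+1%:R^-1) (- (m.+1%:R^-1 * y) - pi / 2).
      congr multiplier; apply/funext => z; rewrite /trig (bigD1 k)//= eqxx mul1r big1.
        by rewrite addr0 addrA cosBpihalf mulrBr.
      by move=> j /negPf ->; rewrite !mul0r.
    rewrite /sgstep; apply: multiplierM; last exact: multiplier_cst.
    apply: multiplierM => //; apply: multiplierD; first exact: multiplier_cst.
    have := multiplierM (multiplier_cst (-1)) (multiplierM IH IH).
    by congr multiplier; apply/funext => z; rewrite expr2 mulN1r.
  + move=> p z; set s := sin _.
    have : `|s| <= 1 by exact: sin_max.
    rewrite ler_norml => /andP[s1 s2].
    have [s0|s0] := leP 0 s.
      have /andP[/andP[h1 h2] _] := @iter_sgstep_pos _ p s ltac:(by rewrite s0).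
      by rewrite ger0_norm// (le_trans s0).
    have s0' : 0 <= - s by lra.
    rewrite -[s]opprK iter_sgstepN normrN.
    have /andP[/andP[h1 h2] _] := @iter_sgstep_pos _ p (- s) ltac:(by rewrite s0'; lra).
    by rewrite ger0_norm// (le_trans s0').
  + by move=> z; apply: cvg_iter_sgstep; rewrite -ler_norml sin_max.
- by move=> m z; rewrite normr_sg; case: eqP.
- move=> z; apply: cvg_near_cst; near=> m.
  have m0 : 0 < m.+1%:R^-1 :> R by rewrite invr_gt0.
  rewrite sgr_sin; first by rewrite sgrM gtr0_sg// mul1r.
  rewrite normrM ger0_norm ?ltW// mulrC ltr_pdivrMr//.
  apply: (@lt_le_trans _ _ (m.+1%:R * 2)); last by rewrite mulrC ler_pM2r// pi_ge2.
  have : `|z 0 k - y| < m%:R by near: m; exact: nbhs_infty_gtr.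
  by rewrite -natr1; have := normr_ge0 (z 0 k - y); lra.
Unshelve. all: by end_near. Qed.

(** [(1 - sg) / 2] takes the value [1 / 2] at its jump; moving the jump to [b + 1 / m] gives the
    closed half-line in the limit. *)
Lemma multiplier_le (k : 'I_n) (b : R) : multiplier (fun z => (z 0 k <= b)%R%:R).
Proof.
apply: (@multiplier_cvg (fun m z => (1 - Num.sg (z 0 k - (b + m.+1%:R^-1))) * 2^-1) _ 1).
- move=> m; apply: multiplierM; last exact: multiplier_cst.
  have := multiplierD (multiplier_cst 1)
    (multiplierM (multiplier_cst (-1)) (multiplier_sg k (b + m.+1%:R^-1))).
  by congr multiplier; apply/funext => z; rewrite mulN1r.
- move=> m z; case: sgrP => _.
  + by rewrite subr0 mul1r ger0_norm; lra.
  + by rewrite subrr mul0r normr0.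
  + by rewrite opprK ger0_norm; lra.
- move=> z; apply: cvg_near_cst; have [h|h] := leP (z 0 k) b.
    apply: nearW => m; rewrite ltr0_sg; first by transitivity (1 : R); [field|done].
    by rewrite subr_lt0 (le_lt_trans h)// ltrDl invr_gt0.
  have zb : 0 < z 0 k - b by rewrite subr_gt0.
  near=> m; rewrite gtr0_sg; first by rewrite subrr mul0r.
  rewrite subr_gt0 addrC -ltrBrDr.
  by near: m; exact: (near_infty_natSinv_lt (PosNum zb)).
Unshelve. all: by end_near. Qed.

(** The grid of mesh [1 / N] on []-N, N]], with [2 N^2] cells: range and resolution grow
    together. *)
Definition gridpt (N j : nat) : R := (j%:R - (N ^ 2)%:R) / N%:R.

Definition gridbox (N j : nat) (t : R) : R :=
  (t <= gridpt N j.+1)%R%:R - (t <= gridpt N j)%R%:R.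

Lemma gridpt_le N j : gridpt N j <= gridpt N j.+1.
Proof. by rewrite ler_wpM2r ?invr_ge0// lerD2r ler_nat. Qed.

Lemma gridboxE N j t : gridbox N j t = (gridpt N j < t <= gridpt N j.+1)%R%:R.
Proof.
rewrite /gridbox ltNge; have h := gridpt_le N j.
have [h1|h1] := leP t (gridpt N j); last by rewrite subr0.
by rewrite (le_trans h1 h) subrr.
Qed.

Lemma sum_gridbox N t : `|t| < N%:R -> \sum_(j < (N ^ 2).*2) gridbox N j t = 1.
Proof.
move=> tN; have N0 : 0 < N%:R :> R by exact: le_lt_trans tN.
under eq_bigr do rewrite /gridbox.
rewrite -(big_mkord xpredT (fun j => (t <= gridpt N j.+1)%R%:R - (t <= gridpt N j)%R%:R)).
rewrite telescope_sumr//.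
have -> : gridpt N (N ^ 2).*2 = N%:R.
  by rewrite /gridpt -addnn natrD addrK natrX expr2 mulfK// gt_eqF.
have -> : gridpt N 0 = - N%:R.
  by rewrite /gridpt sub0r natrX expr2 mulNr mulfK// gt_eqF.
move: tN; rewrite ltr_norml => /andP[t1 t2].
by rewrite (ltW t2) leNgt t1/= subr0.
Qed.

Lemma sum_gridbox_le1 N t : \sum_(j < (N ^ 2).*2) gridbox N j t <= 1.
Proof.
under eq_bigr do rewrite /gridbox.
rewrite -(big_mkord xpredT (fun j => (t <= gridpt N j.+1)%R%:R - (t <= gridpt N j)%R%:R)).
by rewrite telescope_sumr//; do 2 case: (t <= gridpt _ _)%R => /=; lra.
Qed.

Definition gridw N (J : {ffun 'I_n -> 'I_(N ^ 2).*2}) (z : 'rV[R]_n) : R :=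
  \prod_k gridbox N (J k) (z 0 k).

Definition gridv N (J : {ffun 'I_n -> 'I_(N ^ 2).*2}) : 'rV[R]_n :=
  \row_k gridpt N (J k).+1.

(** A combination of products of half-line indicators, hence a multiplier for every [F]; it
    approximates a continuous [F] by its values at the upper corners of the boxes. *)
Definition gridfun (F : 'rV[R]_n -> R) N (z : 'rV[R]_n) : R :=
  \sum_J F (@gridv N J) * @gridw N J z.

Lemma gridw_ge0 N J z : 0 <= @gridw N J z.
Proof. by apply: prodr_ge0 => k _; rewrite gridboxE. Qed.

Lemma sum_gridw N z : \sum_J @gridw N J z = \prod_k \sum_(j < (N ^ 2).*2) gridbox N j (z 0 k).
Proof. by rewrite bigA_distr_bigA. Qed.

Lemma sum_gridw_le1 N z : \sum_J @gridw N J z <= 1.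
Proof.
rewrite sum_gridw; apply: prodr_ile1 => k _; rewrite sum_gridbox_le1 andbT.
by apply: sumr_ge0 => j _; rewrite gridboxE.
Qed.

Lemma sum_gridw1 N z : `|z| < N%:R -> \sum_J @gridw N J z = 1.
Proof.
move=> zN; rewrite sum_gridw big1// => k _; apply: sum_gridbox.
exact: le_lt_trans (rV_coord_le _ _) zN.
Qed.

Lemma gridw_close N J z : (0 < N)%N -> @gridw N J z != 0 -> `|gridv J - z| <= N%:R^-1.
Proof.
move=> N0 h; apply: rV_norm_le; first by rewrite invr_ge0.
move=> k; have : gridbox N (J k) (z 0 k) != 0.
  by apply: contra_neq h => h; rewrite /gridw (bigD1 k)//= h mul0r.
rewrite gridboxE; case: (boolP (_ && _)) => [/andP[h1 h2] _|_]; last by rewrite eqxx.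
rewrite !mxE; have : gridpt N (J k).+1 = gridpt N (J k) + N%:R^-1.
  by rewrite /gridpt -natr1; ring.
by rewrite ler_norml => h3; apply/andP; split; lra.
Qed.

Lemma gridfun_multiplier F N : multiplier (gridfun F N).
Proof.
apply: multiplier_sum => J; apply: multiplierM; first exact: multiplier_cst.
apply: multiplier_prod => k.
have := multiplierD (multiplier_le k (gridpt N (J k).+1))
   (multiplierM (multiplier_cst (-1)) (multiplier_le k (gridpt N (J k)))).
by congr multiplier; apply/funext => z; rewrite mulN1r.
Qed.

(** The corner at which [F] is evaluated is within [1 / N <= 1] of [z], whence [2 + |z|] in place of
    [1 + |z|], uniformly in [N]. *)
Lemma gridfun_bound F (C : R) p N z : (0 < N)%N -> 0 <= C ->
  (forall z, `|F z| <= C * (1 + `|z|) ^+ p) ->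
  `|gridfun F N z| <= C * (2 + `|z|) ^+ p.
Proof.
move=> N0 C0 hF.
have B0 : 0 <= C * (2 + `|z|) ^+ p by rewrite mulr_ge0// exprn_ge0// addr_ge0.
apply: le_trans (ler_norm_sum _ _ _) _.
apply: (@le_trans _ _ (\sum_J (C * (2 + `|z|) ^+ p) * @gridw N J z)).
  apply: ler_sum => J _; rewrite normrM (ger0_norm (gridw_ge0 _ _)).
  have [->|h] := eqVneq (gridw J z) 0; first by rewrite !mulr0.
  rewrite ler_wpM2r ?gridw_ge0//; apply: le_trans (hF _) _.
  rewrite ler_wpM2l// lerXn2r// ?nnegrE ?addr_ge0//.
  have h1 := gridw_close N0 h.
  have h2 : N%:R^-1 <= 1 :> R by rewrite invf_le1 ?ler1n// ltr0n.
  by have := ler_normD (gridv J - z) z; rewrite subrK; lra.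
by rewrite -mulr_sumr ler_piMr// sum_gridw_le1.
Qed.

Lemma gridfun_cvg F z : continuous F -> gridfun F m.+1 z @[m --> \oo] --> F z.
Proof.
move=> cF; apply/cvgrPdist_le => e e0.
have /cvgrPdist_le/(_ e e0)/nbhs_ballP[dl /= dl0 hd] := cF z.
near=> m.
have m0 : m.+1%:R^-1 < dl by near: m; exact: (near_infty_natSinv_lt (PosNum dl0)).
have zm : `|z| < m.+1%:R.
  rewrite -natr1; apply: (@lt_trans _ _ m%:R); last by rewrite ltrDl.
  by near: m; exact: nbhs_infty_gtr.
rewrite -[F z]mulr1 -(sum_gridw1 zm) mulr_sumr -sumrB.
apply: le_trans (ler_norm_sum _ _ _) _.
apply: (@le_trans _ _ (\sum_J e * @gridw m.+1 J z)).
  apply: ler_sum => J _; rewrite -mulrBl normrM (ger0_norm (gridw_ge0 _ _)).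
  have [->|h] := eqVneq (gridw J z) 0; first by rewrite !mulr0.
  rewrite ler_wpM2r ?gridw_ge0//; apply: hd.
  rewrite -ball_normE /ball_ /= distrC; apply: le_lt_trans m0.
  exact: gridw_close.
by rewrite -mulr_sumr ler_piMr ?sum_gridw_le1// ltW.
Unshelve. all: by end_near. Qed.

(** The hypothesis on trigonometric functions says that the constant 1 is annihilated. Every
    multiplier, in particular every [gridfun F], then has pairing 0, and dominated convergence
    carries this to [F] of polynomial growth. *)
Theorem trig_uniqueness F (C : R) p : continuous F -> 0 <= C ->
  (forall z, `|F z| <= C * (1 + `|z|) ^+ p) ->
  (forall i, integ (mu i) (fun x => (2 + `|Z i x|) ^+ p * `|U i x|)) ->
  pairing F = 0.
Proof.
move=> cF C0 hF hU.
have ann1 : annihilated (fun=> 1).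
  split; first exact: bmeas_cst.
  by move=> l a; under [X in pairing X]eq_fun do rewrite mul1r.
have h0 m : pairing (gridfun F m.+1) = 0.
  have [_ /(_ _ ann1)[_]] := gridfun_multiplier F m.+1.
  (* With zero frequency and phase the trigonometric factor is [cos 0 = 1]. *)
  move=> /(_ (fun=> 0) 0) <-; congr pairing; apply/funext => z.
  rewrite /trig big1 ?addr0 ?cos0 ?mulr1// => k _.
  by rewrite mul0r.
suff : pairing (gridfun F m.+1) @[m --> \oo] --> pairing F.
  by under eq_fun do rewrite h0; move=> /cvg_lim <- //; rewrite lim_cst.
apply: cvg_sumr => i.
have [] := @Rint_dct _ _ _ (mu i) (fun m x => U i x * gridfun F m.+1 (Z i x))
  (fun x => U i x * F (Z i x)) (fun x => C * ((2 + `|Z i x|) ^+ p * `|U i x|)) => //.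
- move=> m; apply: measurable_funM; first exact: integ_meas (iU i).
  by have [[]] := gridfun_multiplier F m.+1.
- exact: integZ.
- by move=> x; apply: cvgM; [exact: cvg_cst|exact: gridfun_cvg].
- move=> m x; rewrite normrM mulrC mulrA ler_wpM2r//.
  exact: gridfun_bound.
Qed.

End trig_uniqueness.

(** * Normal laws and characteristic functions *)

Section calculus.
Variable R : realType.
Implicit Types f df : R -> R.

Lemma is_derive_cont f (d x : R) : is_derive x 1 f d -> {for x, continuous f}.
Proof. by move=> [h _]; apply: differentiable_continuous; exact/derivable1_diffP. Qed.

Lemma MVT_dist f df : (forall x : R, is_derive x (1:R) f (df x)) ->
  forall x y, exists2 c, `|c - x| <= `|y - x| & f y - f x = df c * (y - x).
Proof.
move=> hf x y.
have cf : continuous f by move=> z; exact: is_derive_cont (hf z).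
have [xy|yx] := leP x y.
  have [c] := @MVT_segment R f df x y xy (fun z _ => hf z) (continuous_subspaceT cf).
  rewrite in_itv/= => /andP[c1 c2] e; exists c => //.
  by rewrite !ger0_norm ?subr_ge0// lerD2r.
have [c] := @MVT_segment R f df y x (ltW yx) (fun z _ => hf z) (continuous_subspaceT cf).
rewrite in_itv/= => /andP[c1 c2] e; exists c.
  rewrite -[c - x]opprB -[y - x]opprB !normrN.
  by rewrite !ger0_norm ?subr_ge0 ?(ltW yx)// lerD2l lerN2.
by rewrite -opprB e; ring.
Qed.

Lemma is_derive_lin (l a x : R) : is_derive x 1 (fun x => l * x + a) l.
Proof.
by apply: is_derive_eq; rewrite /GRing.scale/=; ring.
Qed.

Lemma is_derive_cosl (l a x : R) :
  is_derive x 1 (fun x => cos (l * x + a)) (- (l * sin (l * x + a))).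
Proof.
have := @is_derive1_comp R (@cos R) (fun x => l * x + a) _ _ _ (is_derive_cos (l * x + a)) (is_derive_lin l a x).
by move=> h; apply: is_derive_eq h _; rewrite mulNr mulrC.
Qed.

Lemma is_derive_sinl (l a x : R) :
  is_derive x 1 (fun x => sin (l * x + a)) (l * cos (l * x + a)).
Proof.
have := @is_derive1_comp R (@sin R) (fun x => l * x + a) _ _ _ (is_derive_sin (l * x + a)) (is_derive_lin l a x).
by move=> h; apply: is_derive_eq h _; rewrite mulrC.
Qed.

Lemma is_derive_expf (f : R -> R) (df x : R) : is_derive x 1 f df ->
  is_derive x 1 (fun x => expR (f x)) (df * expR (f x)).
Proof.
move=> hf; have := @is_derive1_comp R (@expR R) f _ _ _ (is_derive_expR (f x)) hf.
by move=> h; apply: is_derive_eq h _; rewrite mulrC.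
Qed.

Lemma is_deriveMr (f g : R -> R) (df dg x : R) : is_derive x 1 f df ->
  is_derive x 1 g dg -> is_derive x 1 (fun x => f x * g x) (df * g x + f x * dg).
Proof.
move=> hf hg; have := is_deriveM hf hg; move=> h; apply: is_derive_eq h _.
by rewrite addrC [f x *: _]/GRing.scale/= [g x *: _]/GRing.scale/= [g x * _]mulrC.
Qed.

Lemma sin_lip (x y : R) : `|sin x - sin y| <= `|x - y|.
Proof.
have [c _ ->] := @MVT_dist (@sin R) (@cos R) (fun z => is_derive_sin z) y x.
by rewrite normrM ler_piMl// cos_max.
Qed.

Lemma cos_lip (x y : R) : `|cos x - cos y| <= `|x - y|.
Proof.
have [c _ ->] := @MVT_dist (@cos R) (fun x => - sin x) (fun z => is_derive_cos z) y x.
by rewrite normrM ler_piMl// normrN sin_max.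
Qed.

Lemma sin_id_quad (x : R) : `|sin x - x| <= x ^+ 2.
Proof.
have h (z : R) : is_derive z (1:R) (fun x : R => sin x - x) (cos z - 1).
  by apply: (is_deriveB (is_derive_sin z)).
have [c hc e] := MVT_dist h 0 x.
rewrite sin0 !subr0 in e hc; rewrite e normrM -[x ^+ 2]real_normK ?num_real// expr2.
rewrite ler_wpM2r// (le_trans _ hc)// -cos0 (le_trans (cos_lip _ _))//.
by rewrite subr0.
Qed.

(** [m sin (x / m)] serves as a bounded substitute for [x], dominated by [|x|], whose first two
    moments can be read off a characteristic function. *)
Lemma scaled_sin_le m (x : R) : `|m.+1%:R * sin (x / m.+1%:R)| <= `|x|.
Proof.
have m0 : 0 < m.+1%:R :> R by rewrite ltr0n.
have -> : `|x| = m.+1%:R * `|x / m.+1%:R|.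
  by rewrite normrM normfV (ger0_norm (ltW m0)); field; rewrite gt_eqF.
rewrite normrM (ger0_norm (ltW m0)) ler_pM2l//.
by have := sin_lip (x / m.+1%:R) 0; rewrite sin0 !subr0.
Qed.

Lemma cvg_scaled_sin (x : R) : m.+1%:R * sin (x / m.+1%:R) @[m --> \oo] --> x.
Proof.
apply/cvgrPdist_lt => /= e e0; near=> m.
have m0 : 0 < m.+1%:R :> R by rewrite ltr0n.
have -> : x - m.+1%:R * sin (x / m.+1%:R) = - (m.+1%:R * (sin (x / m.+1%:R) - x / m.+1%:R)).
  by field; rewrite gt_eqF.
rewrite normrN normrM ger0_norm ?ltW//.
apply: (@le_lt_trans _ _ (m.+1%:R * (x / m.+1%:R) ^+ 2)).
  by rewrite ler_pM2l// sin_id_quad.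
have -> : m.+1%:R * (x / m.+1%:R) ^+ 2 = x ^+ 2 / m.+1%:R by field; rewrite gt_eqF.
rewrite ltr_pdivrMr// mulrC -ltr_pdivrMr// -natr1.
apply: (@lt_trans _ _ m%:R); last by rewrite ltrDl.
by near: m; exact: nbhs_infty_gtr.
Unshelve. all: by end_near. Qed.

End calculus.

Lemma is_derive_Rint d (Y : measurableType d) (R : realType)
    (mu : {measure set Y -> \bar R}) (f df : R -> Y -> R) (G : Y -> R) (k r : R) :
  0 < r -> (forall x, integ mu (f x)) ->
  (forall x y, `|x - k| < r -> is_derive x (1:R) (f ^~ y) (df x y)) -> (forall y, 0 <= G y) ->
  integ mu G -> (forall x y, `|x - k| < r -> `|df x y| <= G y) ->
  is_derive k (1:R) (fun x => \int[mu]_y f x y) (\int[mu]_y df k y).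
Proof.
move=> r0 If hdf G0 iG hG.
have Ik : `]k - r, k + r[%classic k by rewrite /= in_itv/=; apply/andP; split; lra.
have I1 x : `]k - r, k + r[%classic x -> `|x - k| < r.
  by rewrite /= in_itv/= ltr_norml => /andP[h1 h2]; apply/andP; split; lra.
have d1 x y : `|x - k| < r -> partial1of2 f x y = df x y.
  by move=> h; rewrite /partial1of2 derive1E; have [_] := hdf x y h.
have h1 x y : `]k - r, k + r[%classic x -> setT y -> derivable (f ^~ y) x 1.
  by move=> /I1 h _; have [] := hdf x y h.
have h2 x y : `]k - r, k + r[%classic x -> setT y -> `|partial1of2 f x y| <= G y.
  by move=> /I1 h _; rewrite d1//; exact: hG.
have D := @derivable_under_integral R _ _ mu f setT measurableT k (k - r) (k + r) Ik
  (fun x _ => If x) h1 G G0 iG h2.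
have E := @differentiation_under_integral R _ _ mu f setT measurableT k (k - r) (k + r) Ik
  (fun x _ => If x) h1 G G0 iG h2.
apply: DeriveDef; first exact: D.
rewrite -derive1E E; apply: eq_Rintegral => y _.
by rewrite d1// subrr normr0.
Qed.

(** * Moments of a variable with Gaussian characteristic function *)

Section gaussian_characteristic.
Context d (T : measurableType d) (R : realType) (P : probability T R).
Implicit Types X : T -> R.

(* [X] is centred Gaussian of variance [q], possibly degenerate; the phase [a]
   encodes the real and imaginary parts of the characteristic function. *)
Definition gauss_char X (q : R) : Prop :=
  forall l a, \int[P]_w cos (l * X w + a) = cos a * expR (- (l ^+ 2 * q / 2)).

Lemma measurable_cosl X l a : measurable_fun setT X ->
  measurable_fun setT (fun w => cos (l * X w + a)).
Proof.
move=> mX; apply: (measurableT_comp (f := @cos R)).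
  by apply: continuous_measurable_fun; exact: continuous_cos.
by apply: measurable_funD => //; exact: measurable_funM.
Qed.

Lemma measurable_sinl X l a : measurable_fun setT X ->
  measurable_fun setT (fun w => sin (l * X w + a)).
Proof.
move=> mX; apply: (measurableT_comp (f := @sin R)).
  by apply: continuous_measurable_fun; exact: continuous_sin.
by apply: measurable_funD => //; exact: measurable_funM.
Qed.

Lemma integ_cosl X l a : measurable_fun setT X -> integ P (fun w => cos (l * X w + a)).
Proof.
move=> mX; apply: (@integ_bounded _ _ _ P _ 1); first exact: measurable_cosl.
by move=> w; exact: cos_max.
Qed.

Lemma integ_sinl X l a : measurable_fun setT X -> integ P (fun w => sin (l * X w + a)).
Proof.
move=> mX; apply: (@integ_bounded _ _ _ P _ 1); first exact: measurable_sinl.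
by move=> w; exact: sin_max.
Qed.

Lemma gauss_char_ge0 X q : measurable_fun setT X -> gauss_char X q -> 0 <= q.
Proof.
move=> mX hX; have := hX 1 0; rewrite cos0 mul1r => h.
have : expR (- (1 ^+ 2 * q / 2)) <= 1.
  rewrite -h -[leRHS](Rint_probability_cst P); apply: le_Rint.
  - exact: integ_cosl.
  - exact: integ_cst.
  - by move=> w; exact: cos_le1.
by rewrite -[leRHS]expR0 ler_expR; lra.
Qed.

Lemma gauss_char_sin X q l : gauss_char X q -> \int[P]_w sin (l * X w) = 0.
Proof.
move=> hX; have := hX l (- (pi / 2)); rewrite cosN cos_pihalf mul0r => <-.
by apply: eq_Rintegral => w _; rewrite cosBpihalf.
Qed.

Lemma sin_sqr_half (x : R) : 2 * sin x ^+ 2 = 1 - cos (x *+ 2).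
Proof. by rewrite cos_mulr2n; have := cos2Dsin2 x; lra. Qed.

(** No moment is assumed. [Y m], the square of [m sin (X / m)] with [m.+1] for [m], is affine in the
    cosine of [2 X / m]; its mean is therefore known and at most [q]. Fatou's lemma makes [X ^+ 2]
    integrable, which then dominates [Y m] and identifies the limit as [q]. The mean of [X] is
    treated likewise with the sine itself. *)
Lemma gauss_char_moments X q : measurable_fun setT X -> gauss_char X q ->
  [/\ integ P (fun w => X w ^+ 2), \int[P]_w X w ^+ 2 = q & \int[P]_w X w = 0].
Proof.
move=> mX hX; have q0 := gauss_char_ge0 mX hX.
pose Y m w := (m.+1%:R * sin (X w / m.+1%:R)) ^+ 2.
have YE m w : Y m w = m.+1%:R ^+ 2 / 2 * (1 - cos (2 / m.+1%:R * X w + 0)).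
  rewrite /Y exprMn addr0.
  have -> : 2 / m.+1%:R * X w = (X w / m.+1%:R) *+ 2 by rewrite -mulr_natl; ring.
  by rewrite -sin_sqr_half; field.
have mY m : measurable_fun setT (Y m).
  rewrite (_ : Y m = fun w => m.+1%:R ^+ 2 / 2 * (1 - cos (2 / m.+1%:R * X w + 0))).
    apply: measurable_funM => //; apply: measurable_funB => //; exact: measurable_cosl.
  exact/funext/YE.
have EY m : \int[P]_w Y m w = m.+1%:R ^+ 2 / 2 * (1 - expR (- (2 * q / m.+1%:R ^+ 2))).
  under eq_Rintegral do rewrite YE.
  rewrite RintZ; last by apply: integB; [exact: integ_cst|exact: integ_cosl].
  rewrite RintB; [|exact: integ_cst|exact: integ_cosl].
  rewrite Rint_probability_cst hX cos0 mul1r.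
  by congr (_ * (1 - expR (- _))); field.
have iY m : integ P (Y m).
  rewrite (_ : Y m = fun w => m.+1%:R ^+ 2 / 2 * (1 - cos (2 / m.+1%:R * X w + 0))).
    by apply: integZ; apply: integB; [exact: integ_cst|exact: integ_cosl].
  exact/funext/YE.
have YX w : Y m w @[m --> \oo] --> X w ^+ 2.
  have h := @cvg_scaled_sin R (X w).
  by rewrite expr2; under eq_fun do rewrite /Y expr2; exact: cvgM.
have leY m w : `|Y m w| <= X w ^+ 2.
  rewrite ger0_norm ?sqr_ge0// -[Y m w]real_normK ?num_real//.
  rewrite -[leRHS]real_normK ?num_real//.
  by rewrite lerXn2r ?nnegrE// scaled_sin_le.
have EYq m : \int[P]_w Y m w <= q.
  rewrite EY; have m0 : 0 < m.+1%:R ^+ 2 :> R by rewrite exprn_gt0// ltr0n.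
  have := expR_ge1Dx (- (2 * q / m.+1%:R ^+ 2)) => h.
  apply: (@le_trans _ _ (m.+1%:R ^+ 2 / 2 * (2 * q / m.+1%:R ^+ 2))).
    by apply: ler_wpM2l; [rewrite ltW// divr_gt0|rewrite lerBlDr addrC -lerBlDr].
  by rewrite le_eqVlt; apply/orP; left; apply/eqP; field; rewrite gt_eqF// ltr0n.
have [iX2 _] := Rint_fatou iY (fun m w => sqr_ge0 _) YX EYq.
have [_ cY] := Rint_dct mY iX2 YX leY.
have EYl : \int[P]_w Y m w @[m --> \oo] --> q.
  apply/cvgrPdist_le => /= e e0; near=> m; rewrite EY.
  have m0 : 0 < m.+1%:R :> R by rewrite ltr0n.
  set x := 2 * q / m.+1%:R ^+ 2.
  have x0 : 0 <= x by rewrite /x !mulr_ge0// invr_ge0 exprn_ge0.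
  have -> : q = m.+1%:R ^+ 2 / 2 * x by rewrite /x; field; rewrite gt_eqF.
  rewrite -mulrBr normrM ger0_norm; last by rewrite divr_ge0// exprn_ge0.
  have h1 : 1 - expR (- x) <= x by have := expR_ge1Dx (- x); lra.
  have h2 : x - (1 - expR (- x)) <= x ^+ 2.
    have := expR_ge1Dx x; have := expR_gt0 (- x).
    have : expR (- x) * expR x = 1 by rewrite -expRD addNr expR0.
    by nra.
  rewrite ger0_norm; last by rewrite subr_ge0.
  apply: (@le_trans _ _ (m.+1%:R ^+ 2 / 2 * x ^+ 2)).
    by rewrite ler_wpM2l// divr_ge0// exprn_ge0.
  have -> : m.+1%:R ^+ 2 / 2 * x ^+ 2 = 2 * q ^+ 2 / m.+1%:R / m.+1%:R.
    by rewrite /x; field; rewrite gt_eqF.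
  apply: (@le_trans _ _ (2 * q ^+ 2 / m.+1%:R)).
    rewrite ler_pdivrMr// ler_peMr ?ler1n//.
    by rewrite !mulr_ge0 ?invr_ge0 ?sqr_ge0// ltW.
  rewrite ler_pdivrMr// -ler_pdivrMl// -[m.+1%:R]natr1.
  apply/ltW; apply: (@lt_trans _ _ m%:R); last by rewrite ltrDl.
  by near: m; exact: nbhs_infty_gtr.
split => //.
  by rewrite -(cvg_lim _ cY)//; exact: cvg_lim.
have iX := integ_sqr mX iX2.
have [||||_ cS] := @Rint_dct _ _ _ P (fun m w => m.+1%:R * sin (X w / m.+1%:R)) X (fun w => `|X w|).
- move=> m; apply: measurable_funM => //.
  have := measurable_sinl (m.+1%:R^-1) 0 mX.
  by under eq_fun do rewrite addr0 mulrC.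
- exact: integ_norm.
- by move=> w; exact: cvg_scaled_sin.
- by move=> m w; exact: scaled_sin_le.
rewrite -(cvg_lim _ cS)//; under eq_fun => m.
  rewrite RintZ; last first.
    have := integ_sinl (m.+1%:R^-1) 0 mX.
    by under [X in integrable _ _ (_ \o X)]eq_fun do rewrite addr0 mulrC.
  under eq_Rintegral do rewrite mulrC.
  rewrite (gauss_char_sin _ hX) mulr0; over.
by rewrite lim_cst.
Unshelve. all: by end_near. Qed.

End gaussian_characteristic.

(** * The normal density: moments and characteristic function *)

Section normal_density.
Variables (R : realType) (m s : R).
Hypothesis s0 : s != 0.
Local Notation mu := (@lebesgue_measure R).
Local Notation p := (normal_pdf m s).

Let s2 : 0 < s ^+ 2. Proof. by rewrite exprn_even_gt0. Qed.

Let pE x : p x = normal_peak s * expR (- (x - m) ^+ 2 / (s ^+ 2 *+ 2)).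
Proof. by rewrite normal_pdfE. Qed.

Lemma is_derive_normal_pdf (x : R) :
  is_derive x (1:R) p (- ((x - m) / s ^+ 2) * p x).
Proof.
have h1 : is_derive x (1:R) (fun x => - (x - m) ^+ 2 / (s ^+ 2 *+ 2)) (- ((x - m) / s ^+ 2)).
  have h : is_derive x (1:R) (fun x => (1 * x + - m) * (1 * x + - m))
     (1 * (1 * x - m) + (1 * x - m) * 1).
    exact: is_deriveMr (is_derive_lin 1 (- m) x) (is_derive_lin 1 (- m) x).
  have := is_deriveMr (is_derive_cst (- (s ^+ 2 *+ 2)^-1) x 1) h.
  have -> : (fun x0 => cst (- (s ^+ 2 *+ 2)^-1) x0 * ((1 * x0 + - m) * (1 * x0 + - m))) =
      (fun x => - (x - m) ^+ 2 / (s ^+ 2 *+ 2)).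
    by apply/funext => y /=; rewrite mul1r expr2; ring.
  by move=> h'; apply: is_derive_eq h' _ => /=; rewrite -mulr_natl; field; exact: s0.
have := is_deriveMr (is_derive_cst (normal_peak s) x 1) (is_derive_expf h1).
have -> : (fun x0 => cst (normal_peak s) x0 * expR (- (x0 - m) ^+ 2 / (s ^+ 2 *+ 2))) = p.
  by apply/funext => y; rewrite pE.
by move=> h'; apply: is_derive_eq h' _ => /=; rewrite pE; ring.
Qed.

Lemma integ_normal_pdf : integ mu p.
Proof. exact: integrable_normal_pdf. Qed.

Lemma integ_normal_pdfM (f : R -> R) (C : R) : measurable_fun setT f -> (forall x, `|f x| <= C) ->
  integ mu (fun x => f x * p x).
Proof.
move=> mf fC; apply: (@integ_le _ _ _ mu _ (fun x => C * p x)).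
- by apply: measurable_funM => //; exact: measurable_normal_pdf.
- exact: integZ integ_normal_pdf.
- by move=> x; rewrite normrM (ger0_norm (normal_pdf_ge0 _ _ _)) ler_wpM2r ?normal_pdf_ge0.
Qed.

Lemma pow_le_exp (y : R) k : 0 <= y -> y ^+ k <= k`!%:R * expR y.
Proof.
move=> y0; case: k => [|k].
  by rewrite expr0 fact0 mul1r -[leLHS]expR0 ler_expR.
have := expR_ge1Dxn k y0; have f0 : 0 < (k.+1`!)%:R :> R by rewrite ltr0n fact_gt0.
move=> h; rewrite -ler_pdivrMl// mulrC; apply: le_trans h.
by rewrite lerDr.
Qed.

End normal_density.

Section normal_moments.
Variables (R : realType) (m s : R).
Hypothesis s0 : s != 0.
Local Notation mu := (@lebesgue_measure R).
Local Notation p := (normal_pdf m s).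

Let s2 : 0 < s ^+ 2. Proof. by rewrite exprn_even_gt0. Qed.

(** With [y = (x - m)^2 / (4 s^2)] the Gaussian factor is [exp (- 2 y)]: one factor [exp (- y)]
    absorbs the power [y^k], the other is a normal density of variance [2 s^2]. *)
Lemma integ_normal_even k : integ mu (fun x => ((x - m) ^+ 2) ^+ k * p x).
Proof.
pose s' := Num.sqrt 2 * s.
have s'0 : s' != 0 by rewrite mulf_neq0// gt_eqF// sqrtr_gt0.
have s'2 : s' ^+ 2 = 2 * s ^+ 2 by rewrite exprMn sqr_sqrtr.
pose C := (4 * s ^+ 2) ^+ k * (k`!%:R * normal_peak s / normal_peak s').
apply: (@integ_le _ _ _ mu _ (fun x => C * normal_pdf m s' x)).
- apply: measurable_funM; last exact: measurable_normal_pdf.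
  by do 2 apply: measurable_funX => //; exact: measurable_funB.
- exact/integZ/integ_normal_pdf.
move=> x; rewrite ger0_norm; last first.
  by rewrite mulr_ge0 ?normal_pdf_ge0// exprn_ge0// sqr_ge0.
set y := (x - m) ^+ 2 / (4 * s ^+ 2).
have y0 : 0 <= y by rewrite divr_ge0 ?sqr_ge0// mulr_ge0// ltW.
have -> : (x - m) ^+ 2 = (4 * s ^+ 2) * y.
  by rewrite /y; field; exact: s0.
rewrite exprMn (normal_pdfE _ s0) (normal_pdfE _ s'0) /normal_fun.
have -> : - (x - m) ^+ 2 / (s ^+ 2 *+ 2) = - y + - y.
  by rewrite /y -mulr_natl; field; exact: s0.
have -> : - (x - m) ^+ 2 / (s' ^+ 2 *+ 2) = - y.
  by rewrite /y s'2 -mulr_natl; field; exact: s0.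
have c0 : 0 <= (4 * s ^+ 2) ^+ k by rewrite exprn_ge0// mulr_ge0// ltW.
rewrite expRD /C -[leLHS]mulrA -[leRHS]mulrA ler_wpM2l//.
have p'0 := normal_peak_gt0 s'0; have p0 := normal_peak_gt0 s0.
have -> : k`!%:R * normal_peak s / normal_peak s' * (normal_peak s' * expR (- y)) =
    normal_peak s * (k`!%:R * expR (- y)) by field; rewrite gt_eqF.
rewrite [leLHS]mulrCA ler_pM2l// mulrA ler_pM2r ?expR_gt0// expRN.
by rewrite ler_pdivrMr ?expR_gt0// pow_le_exp.
Qed.

Lemma integ_normal_abs k : integ mu (fun x => `|x - m| ^+ k * p x).
Proof.
apply: (@integ_le _ _ _ mu _ (fun x => p x + ((x - m) ^+ 2) ^+ k * p x)).
- apply: measurable_funM; last exact: measurable_normal_pdf.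
  apply: measurable_funX => //; apply: measurableT_comp => //; exact: measurable_funB.
- by apply: integD; [exact: integ_normal_pdf|exact: integ_normal_even].
move=> x; rewrite ger0_norm; last by rewrite mulr_ge0 ?normal_pdf_ge0// exprn_ge0.
rewrite -{2}[p x]mul1r -mulrDl ler_wpM2r ?normal_pdf_ge0//.
rewrite -exprM mulnC exprM -[(x - m) ^+ k ^+ 2]real_normK ?num_real// normrX.
by set t := `|x - m| ^+ k; have := sqr_ge0 (t - 1); have := sqr_ge0 t; lra.
Qed.

Lemma normal_fun_le (x : R) : p x <= normal_peak s / (1 + (x - m) ^+ 2 / (s ^+ 2 *+ 2)).
Proof.
rewrite (normal_pdfE _ s0) /normal_fun mulNr expRN.
rewrite ler_wpM2l ?normal_peak_ge0// lef_pV2 ?posrE ?expR_gt0 ?expR_ge1Dx//.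
by rewrite ltr_pwDl// divr_ge0 ?sqr_ge0// mulrn_wge0// ltW.
Qed.

Lemma normal_pdf_sym_cvg0 : p (m + n%:R) @[n --> \oo] --> 0 /\ p (m - n%:R) @[n --> \oo] --> 0.
Proof.
have sq (n : nat) : (m + n%:R - m) ^+ 2 = n%:R ^+ 2 /\ (m - n%:R - m) ^+ 2 = n%:R ^+ 2.
  by split; ring.
have H : forall e : R, 0 < e -> \forall n \near \oo,
    normal_peak s / (1 + n%:R ^+ 2 / (s ^+ 2 *+ 2)) <= e.
  move=> e e0; near=> n.
  have n1 : 1 <= n%:R :> R by near: n; exact: nbhs_infty_ger.
  have c0 : 0 < s ^+ 2 *+ 2 by rewrite mulrn_wgt0.
  rewrite ler_pdivrMr; last by rewrite ltr_pwDl// divr_ge0// ?ltW.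
  rewrite mulrDr; apply: (@le_trans _ _ (e * (n%:R ^+ 2 / (s ^+ 2 *+ 2)))); last first.
    by rewrite lerDr mulr1 ltW.
  rewrite -ler_pdivrMl// ler_pdivlMr//.
  apply: (@le_trans _ _ n%:R); first by near: n; exact: nbhs_infty_ger.
  by rewrite expr2 ler_peMr// (le_trans ler01).
split; apply/cvgrPdist_le => e e0; near=> n; rewrite sub0r normrN ger0_norm ?normal_pdf_ge0//;
  apply: le_trans (normal_fun_le _) _; rewrite ?(sq n).1 ?(sq n).2; near: n; exact: H.
Unshelve. all: by end_near. Qed.

(* The derivative of the density is [- (x - m) / s ^+ 2] times the density. *)
Lemma stein_normal (l a : R) :
  \int[mu]_x (cos (l * x + a) * p x) * l =
  \int[mu]_x ((x - m) / s ^+ 2 * sin (l * x + a) * p x).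
Proof.
(* The integral of [f = F'] over the line is the limit of boundary terms of [F]; these are bounded
   by the density and vanish. *)
pose F x := sin (l * x + a) * p x.
pose f x := l * (cos (l * x + a) * p x) - (x - m) / s ^+ 2 * sin (l * x + a) * p x.
have dF (x : R) : is_derive x (1:R) F (f x).
  have h := is_deriveMr (is_derive_sinl l a x) (is_derive_normal_pdf m s0 x).
  by apply: is_derive_eq h _; rewrite /f; ring.
have cF : continuous F by move=> x; exact: is_derive_cont (dF x).
have cp : continuous p by exact: continuous_normal_pdf.
have ccos : continuous (fun x => cos (l * x + a)).
  by move=> x; exact: is_derive_cont (is_derive_cosl l a x).
have csin : continuous (fun x => sin (l * x + a)).
  by move=> x; exact: is_derive_cont (is_derive_sinl l a x).
have clin : continuous (fun x : R => (x - m) / s ^+ 2).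
  by move=> x; apply: cvgMl; apply: cvgB; [exact: cvg_id|exact: cvg_cst].
have cf : continuous f.
  move=> x; apply: cvgB; first by apply: cvgM; [exact: cvg_cst|apply: cvgM; [exact: ccos|exact: cp]].
  by apply: cvgM; [apply: cvgM; [exact: clin|exact: csin]|exact: cp].
have i1 : integ mu (fun x => cos (l * x + a) * p x).
  apply: (@integ_normal_pdfM R m s _ 1); first exact: continuous_measurable_fun.
  by move=> x; exact: cos_max.
have i2 : integ mu (fun x => (x - m) / s ^+ 2 * sin (l * x + a) * p x).
  apply: (@integ_le _ _ _ mu _ (fun x => (s ^+ 2)^-1 * (`|x - m| ^+ 1 * p x))).
  - apply: continuous_measurable_fun => x.
    by apply: cvgM; [apply: cvgM; [exact: clin|exact: csin]|exact: cp].
  - exact/integZ/integ_normal_abs.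
  - move=> x; rewrite !normrM (ger0_norm (normal_pdf_ge0 _ _ _)) normfV (ger0_norm (ltW s2)).
    rewrite expr1 [in leRHS]mulrA [(_)^-1 * _]mulrC ler_wpM2r ?normal_pdf_ge0//.
    by rewrite ler_piMr ?sin_max// mulr_ge0// invr_ge0 ltW.
have i_f : integ mu f by apply: integB => //; exact: integZ.
pose I n : set R := `[m - n.+1%:R, m + n.+1%:R]%classic.
have FTC n : \int[mu]_x (f \_ (I n)) x = F (m + n.+1%:R) - F (m - n.+1%:R).
  rewrite -Rintegral_mkcond /Rintegral (@continuous_FTC2 R f F)//.
  - have n0 : 0 < n.+1%:R :> R by rewrite ltr0n.
    by clear -n0; lra.
  - exact: continuous_subspaceT.
  - split; first by move=> x _; have [] := dF x.
    + exact/cvg_at_right_filter/cF.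
    + exact/cvg_at_left_filter/cF.
  - by move=> x _; rewrite derive1E; have [_] := dF x.
have [||||_ c1] := @Rint_dct _ _ _ mu (fun n => f \_ (I n)) f (fun x => `|f x|).
- move=> n; apply/(measurable_restrictT _ _).1; first exact: measurable_itv.
  by apply: measurable_funTS; exact: integ_meas i_f.
- exact: integ_norm.
- move=> x; apply: cvg_near_cst; near=> n; rewrite patchE ifT// inE /I/= in_itv/=.
  have : `|x - m| < n%:R by near: n; exact: nbhs_infty_gtr.
  by rewrite ltr_norml -natr1 => /andP[h1 h2]; apply/andP; split; lra.
- by move=> n x; rewrite patchE; case: ifP => // _; rewrite normr0.
have c2 : F (m + n.+1%:R) - F (m - n.+1%:R) @[n --> \oo] --> 0.
  have [b1 b2] := normal_pdf_sym_cvg0.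
  have bd (u : nat -> R) : p (u n) @[n --> \oo] --> 0 -> F (u n) @[n --> \oo] --> 0.
    move=> /cvgrPdist_le h; apply/cvgrPdist_le => e e0; have := h e e0.
    apply: filterS => n; rewrite !sub0r !normrN; apply: le_trans.
    by rewrite /F normrM ler_piMl// sin_max.
  rewrite -[0 in X in _ --> X]subr0; apply: cvgB.
  + by apply: bd; rewrite -(cvg_shiftS (fun n => p (m + n%:R))) in b1.
  + by apply: bd; rewrite -(cvg_shiftS (fun n => p (m - n%:R))) in b2.
have : \int[mu]_x f x = 0.
  rewrite -(cvg_lim _ c1)//; under eq_fun do rewrite FTC.
  exact: cvg_lim c2.
rewrite /f RintB//; last exact: integZ.
by rewrite RintZ// => /eqP; rewrite subr_eq0 mulrC => /eqP.
Unshelve. all: by end_near. Qed.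

(** Differentiation under the integral and [stein_normal] give the equation [phi' = - s^2 l phi], so
    that [phi] times [exp (s^2 l^2 / 2)] is constant in [l]. *)
Lemma normal_char (l a : R) :
  \int[mu]_x (cos (l * (x - m) + a) * p x) = cos a * expR (- (l ^+ 2 * s ^+ 2 / 2)).
Proof.
pose f l x := cos (l * (x - m) + a) * p x.
pose phi l := \int[mu]_x f l x.
have cp : continuous p by exact: continuous_normal_pdf.
have ifl k : integ mu (f k).
  apply: (@integ_normal_pdfM R m s _ 1); last by move=> x; exact: cos_max.
  have -> : (fun x => cos (k * (x - m) + a)) = (fun x => cos (k * x + (a - k * m))).
    by apply/funext => x; congr cos; ring.
  by apply: continuous_measurable_fun => x; exact: is_derive_cont (is_derive_cosl _ _ _).
have df (x k : R) : is_derive k (1:R) (f ^~ x) (- ((x - m) * sin (k * (x - m) + a)) * p x).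
  have -> : f ^~ x = (fun k => cos ((x - m) * k + a) * cst (p x) k).
    by apply/funext => y; rewrite /f /= [(x - m) * y]mulrC.
  have h := is_deriveMr (is_derive_cosl (x - m) a k) (is_derive_cst (p x) k 1).
  by apply: is_derive_eq h _; rewrite /= [k * _]mulrC; ring.
have dphi (k : R) : is_derive k (1:R) phi (- (s ^+ 2 * k) * phi k).
  have iG : integ mu (fun x => `|x - m| ^+ 1 * p x) by exact: integ_normal_abs.
  have G0 x : 0 <= `|x - m| ^+ 1 * p x by rewrite mulr_ge0 ?normal_pdf_ge0.
  have Gub (y : R) x : `|- ((x - m) * sin (y * (x - m) + a)) * p x| <= `|x - m| ^+ 1 * p x.
    rewrite normrM normrN normrM (ger0_norm (normal_pdf_ge0 _ _ _)) expr1.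
    by rewrite ler_wpM2r ?normal_pdf_ge0// ler_piMr// sin_max.
  have D := @is_derive_Rint _ _ _ mu f (fun y x => - ((x - m) * sin (y * (x - m) + a)) * p x)
    _ k 1 ltr01 ifl (fun y x _ => df x y) G0 iG (fun y x _ => Gub y x).
  apply: is_derive_eq D _.
  have mdf : measurable_fun setT (fun x : R => (x - m) / s ^+ 2 * sin (k * x + (a - k * m)) * p x).
    apply: measurable_funM; last exact: measurable_normal_pdf.
    apply: measurable_funM; first by apply: measurable_funM => //; exact: measurable_funB.
    by apply: continuous_measurable_fun => x; exact: is_derive_cont (is_derive_sinl _ _ _).
  have eqd x : - ((x - m) * sin (k * (x - m) + a)) * p x =
      - s ^+ 2 * ((x - m) / s ^+ 2 * sin (k * x + (a - k * m)) * p x).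
    rewrite (_ : k * x + (a - k * m) = k * (x - m) + a); last by ring.
    by field; exact: s0.
  have idf : integ mu (fun x => (x - m) / s ^+ 2 * sin (k * x + (a - k * m)) * p x).
    apply: (@integ_le _ _ _ mu _ (fun x => (s ^+ 2)^-1 * (`|x - m| ^+ 1 * p x))) => //.
      exact: integZ.
    move=> x; have := Gub k x; rewrite eqd normrM normrN (ger0_norm (ltW s2)).
    by rewrite -ler_pdivlMl.
  under eq_Rintegral do rewrite eqd.
  rewrite RintZ// -stein_normal.
  transitivity (- s ^+ 2 * (phi k * k)); last by ring.
  congr (_ * (_ * k)).
  by apply: eq_Rintegral => x _; rewrite /f; congr (cos _ * _); ring.
have d0 (k : R) : is_derive k (1:R) (fun k => phi k * expR (s ^+ 2 / 2 * (k * k))) 0.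
  have h1 := is_deriveMr (is_derive_id k 1) (is_derive_id k 1).
  have h2 := is_deriveMr (is_derive_cst (s ^+ 2 / 2) k 1) h1.
  have h3 := is_deriveMr (dphi k) (is_derive_expf h2).
  by apply: is_derive_eq h3 _; rewrite /=; field.
have := is_derive_0_is_cst l 0 d0.
rewrite !mulr0 expR0 mulr1.
have -> : phi 0 = cos a.
  rewrite /phi /f; under eq_Rintegral do rewrite mul0r add0r.
  by rewrite RintZ ?integ_normal_pdf// /Rintegral integral_normal_pdf mulr1.
move=> e; rewrite -[LHS]/(phi l) -e -[RHS]mulrA -expRD (_ : _ + _ = 0) ?expR0 ?mulr1//.
by rewrite expr2; field.
Qed.

End normal_moments.

(** * Integrals against measures with a density, and laws of random variables *)

Section density.
Context d (T : measurableType d) (R : realType).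
Variables (mu nu : {measure set T -> \bar R}) (p : T -> R).
Hypotheses (p0 : forall x, 0 <= p x) (mp : measurable_fun setT p).
Hypothesis nuE : forall A, measurable A -> nu A = (\int[mu]_(x in A) (p x)%:E)%E.

Import HBNNSimple.

Let mpE : measurable_fun setT (EFin \o p). Proof. exact/measurable_EFinP. Qed.

(** [nuE] is the case of indicators; simple functions follow by linearity and the rest by monotone
    convergence. *)
Lemma ge0_integral_density (f : T -> \bar R) : measurable_fun setT f ->
  (forall x, 0 <= f x)%E -> (\int[nu]_x f x = \int[mu]_x (f x * (p x)%:E))%E.
Proof.
move=> mf f0; pose f_ := nnsfun_approx measurableT mf.
have cvgf x : (f_ n x)%:E @[n --> \oo] --> f x.
  exact: (cvg_nnsfun_approx measurableT mf (fun x _ => f0 x)).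
have step (h : {nnsfun T >-> R}) :
    (\int[nu]_x (h x)%:E = \int[mu]_x ((h x)%:E * (p x)%:E))%E.
  under [LHS]eq_integral do rewrite fimfunE -fsumEFin//.
  rewrite [LHS]ge0_integral_fsum//; last 2 first.
    by move=> r; exact/measurable_EFinP/measurableT_comp.
    by move=> n x _; rewrite EFinM nnfun_muleindic_ge0.
  under [RHS]eq_integral.
    move=> x _; rewrite fimfunE -fsumEFin// ge0_mule_fsuml; last first.
      by move=> r; rewrite EFinM nnfun_muleindic_ge0.
    over.
  rewrite [RHS]ge0_integral_fsum//; last 2 first.
    move=> r; apply: emeasurable_funM => //.
    by apply/measurable_EFinP/measurableT_comp => //.
    move=> r x _; rewrite mule_ge0// ?lee_fin//.
    by rewrite -lee_fin EFinM nnfun_muleindic_ge0.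
  apply: eq_fsbigr => r _.
  transitivity (r%:E * \int[nu]_x (\1_(h @^-1` [set r]) x)%:E)%E.
    by rewrite -integralZl_indic_nnsfun.
  rewrite integral_indic// setIT nuE//.
  have [r0|r0] := leP 0 r.
    rewrite -ge0_integralZl//; last 2 first.
      exact: measurable_funTS.
      by move=> x _; rewrite lee_fin.
    rewrite integral_mkcond; apply: eq_integral => x _; rewrite patchE indicE.
    have [xh|xh] := pselect ((h @^-1` [set r]) x).
      by rewrite !mem_set//= mulr1.
    by rewrite !memNset//= mulr0 mul0e.
  have -> : h @^-1` [set r] = set0.
    apply/seteqP; split => x //= hx; have : 0 <= r by rewrite -hx; exact: fun_ge0.
    by rewrite leNgt r0.
  rewrite integral_set0 mule0; apply/esym; apply: integral0_eq => x _.
  by rewrite indicE in_set0 mulr0 mul0e.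
transitivity (limn (fun n => \int[nu]_x (f_ n x)%:E)%E).
  rewrite -monotone_convergence//=.
  - by apply: eq_integral => x _; apply/esym/cvg_lim.
  - by move=> n; exact/measurable_EFinP.
  - by move=> n x _; rewrite lee_fin.
  - by move=> x _ a b ab; rewrite lee_fin; exact/lefP/nd_nnsfun_approx.
transitivity (limn (fun n => \int[mu]_x ((f_ n x)%:E * (p x)%:E))%E).
  by apply: congr_lim; apply/funext => n; exact: step.
rewrite -monotone_convergence//=.
- apply: eq_integral => x _; apply/cvg_lim => //.
  by apply: cvgeZr => //.
- by move=> n; apply: emeasurable_funM => //; exact/measurable_EFinP.
- by move=> n x _; rewrite mule_ge0// lee_fin.
- move=> x _ a b ab; rewrite lee_wpmul2r ?lee_fin//.
  exact/lefP/nd_nnsfun_approx.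
Qed.

Lemma Rint_density (f : T -> R) : measurable_fun setT f ->
  integ mu (fun x => f x * p x) ->
  integ nu f /\ \int[nu]_x f x = \int[mu]_x (f x * p x).
Proof.
move=> mf ifp.
have pos (g : T -> R) : measurable_fun setT g -> (forall x, 0 <= g x) ->
    integ mu (fun x => g x * p x) -> integ nu g /\ \int[nu]_x g x = \int[mu]_x (g x * p x).
  move=> mg g0 igp.
  have E : (\int[nu]_x (g x)%:E = \int[mu]_x (g x * p x)%:E)%E.
    rewrite (@ge0_integral_density (EFin \o g))//; exact/measurable_EFinP.
  split; last by rewrite /Rintegral E.
  apply/integrableP; split; first exact/measurable_EFinP.
  under eq_integral do rewrite /= ger0_norm//.
  rewrite E -Rint_EFin// ltry //.
have i1 : integ mu (fun x => `|f x| * p x).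
  have := integ_norm ifp; congr (_.-integrable _ (EFin \o _)).
  by apply/funext => x; rewrite normrM (ger0_norm (p0 x)).
have i2 : integ mu (fun x => (`|f x| - f x) * p x).
  by under [X in integrable _ _ (_ \o X)]eq_fun do rewrite mulrBl; exact: integB.
have ma : measurable_fun setT (fun x => `|f x|) by exact: measurableT_comp.
have [j1 e1] := pos _ ma (fun x => normr_ge0 _) i1.
have [||j2 e2] := pos (fun x => `|f x| - f x) _ _ i2.
- exact: measurable_funB.
- by move=> x; rewrite subr_ge0 ler_norm.
have fE : f = (fun x => `|f x| - (`|f x| - f x)) by apply/funext => x; ring.
split; first by rewrite fE; exact: integB.
rewrite {1}fE RintB// e1 e2 -RintB//.
by apply: eq_Rintegral => x _; ring.
Qed.

End density.

Section law.
Context d (T : measurableType d) (R : realType) (P : probability T R).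

Lemma Rint_pfm d2 (T2 : measurableType d2) (X : T -> T2) (mX : measurable_fun setT X)
    (f : T2 -> R) :
  measurable_fun setT f -> integ (pfm P mX) f ->
  integ P (fun w => f (X w)) /\ \int[P]_w f (X w) = \int[pfm P mX]_x f x.
Proof.
move=> mf jf.
have i : integ P (fun w => f (X w)).
  apply/integrableP; split; first by apply/measurable_EFinP; exact: measurableT_comp.
  have /integrableP[_] := jf; rewrite ge0_integral_pushforward//.
  by apply: measurableT_comp => //; exact/measurable_EFinP.
split => //; rewrite /Rintegral integral_pushforward//.
exact/measurable_EFinP.
Qed.

Lemma normal_law_Rint (X : T -> R) (m s : R) (f : R -> R) : s != 0 ->
  measurable_fun setT X ->
  (forall A, measurable A -> pushforward P X A = normal_prob m s A) ->
  measurable_fun setT f -> integ lebesgue_measure (fun x => f x * normal_pdf m s x) ->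
  integ P (fun w => f (X w)) /\
  \int[P]_w f (X w) = \int[lebesgue_measure]_x (f x * normal_pdf m s x).
Proof.
move=> s0 mX hX mf ifp.
have [j e] := @Rint_density _ _ R lebesgue_measure
  (pfm (T2 := measurableTypeR R) P mX) (normal_pdf m s)
  (normal_pdf_ge0 m s) (measurable_normal_pdf m s) hX f mf ifp.
by rewrite -e; exact: (@Rint_pfm _ (measurableTypeR R) X mX f mf j).
Qed.

Lemma normal_law (X : T -> R) (m s : R) : s != 0 -> measurable_fun setT X ->
  (forall A, measurable A -> pushforward P X A = normal_prob m s A) ->
  gauss_char P (fun w => X w - m) (s ^+ 2) /\
  forall k, integ P (fun w => `|X w - m| ^+ k).
Proof.
move=> s0 mX hX; split => [l a|k].
  have mf : measurable_fun setT (fun x : R => cos (l * (x - m) + a)).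
    apply: measurable_cosl; exact: measurable_funB.
  have [_ ->] := normal_law_Rint s0 mX hX mf (integ_normal_pdfM m s mf (fun x => cos_max _)).
  exact: normal_char.
apply: (proj1 (@normal_law_Rint X m s (fun x => `|x - m| ^+ k) s0 mX hX _ _)).
- apply: measurable_funX; apply: measurableT_comp => //; exact: measurable_funB.
- exact: integ_normal_abs.
Qed.

End law.

(** The pairing with weight 1 on [mu] and -1 on [nu] kills trigonometric functions, hence the
    multiplier [x <= b]. Equality on half-lines extends to all Borel sets by uniqueness of measures
    on a generating class stable under intersection. *)
Lemma probability_trig_unique (R : realType)
    (mu nu : probability (measurableTypeR R) R) :
  (forall l a, \int[mu]_x cos (l * x + a) = \int[nu]_x cos (l * x + a)) ->
  forall A, measurable A -> mu A = nu A.
Proof.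
move=> h.
pose m_ (b : bool) : {measure set (measurableTypeR R) -> \bar R} := if b then mu else nu.
pose U (b : bool) (x : measurableTypeR R) : R := if b then 1 else -1.
pose Z (b : bool) (x : measurableTypeR R) : 'rV[R]_1 := \row_(i < 1) x.
have iU b : integ (m_ b) (U b) by case: b; exact: integ_cst.
have mZ b k : measurable_fun setT (fun x => Z b x 0 k).
  by under eq_fun do rewrite mxE; exact: measurable_id.
have hp l a : pairing m_ U Z (trig l a) = 0.
  rewrite /pairing big_bool /= /m_ /U /Z /trig.
  have e (x : R) : cos (\sum_k l k * (\row_(_ < 1) x) 0 k + a) = cos (l 0 * x + a).
    by rewrite big_ord1 mxE.
  under eq_Rintegral do rewrite e mul1r.
  under [X in _ + X]eq_Rintegral do rewrite e mulN1r.
  by rewrite RintN ?h ?subrr//; exact: integ_cosl.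
have ray b : mu `]-oo, b]%classic = nu `]-oo, b]%classic.
  have ann1 : annihilated m_ U Z (fun=> 1).
    split; first exact: bmeas_cst.
    by move=> l a; under [X in pairing _ _ _ X]eq_fun do rewrite mul1r.
  have [_ /(_ _ ann1)[_ /(_ (fun=> 0) 0)]] := multiplier_le iU mZ 0 b.
  rewrite /pairing big_bool /= /m_ /U /Z /trig.
  have e (x : R) : (((\row_(_ < 1) x) 0 0 <= b)%R%:R * 1 *
     cos (\sum_k 0 * (\row_(_ < 1) x) 0 k + 0)) = (\1_(`]-oo, b]%classic) x : R).
    rewrite big1 ?addr0 ?cos0 ?mulr1; last by move=> k _; rewrite mul0r.
    by rewrite mxE indicE mem_setE in_itv.
  under eq_Rintegral do rewrite e mul1r.
  under [X in _ + X]eq_Rintegral do rewrite e mulN1r.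
  have mI : measurable (`]-oo, b]%classic : set (measurableTypeR R)) by exact: measurable_itv.
  have ii (P : probability (measurableTypeR R) R) :
      integ P (fun x => \1_(`]-oo, b]%classic) x : R).
    apply: (@integ_bounded _ _ _ P _ 1); first exact: measurable_indic.
    by move=> x; rewrite indicE; case: (_ \in _); rewrite ?normr1 ?normr0.
  rewrite RintN; last exact: ii.
  move=> /eqP; rewrite subr_eq0 => /eqP.
  move=> h'; have := congr1 (@EFin R) h'; rewrite !Rint_EFin; [|exact: ii..].
  by rewrite !integral_indic// !setIT.
move=> A mA.
pose g n : set (measurableTypeR R) := `](- n%:R), +oo[%classic.
refine (@measure_unique _ R (measurableTypeR R) (@RGenOInfty.G R) g _ _ _ _ mu nu _ _ A mA).
- exact: RGenOInfty.measurableE.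
- move=> _ _ [x ->] [y ->]; exists (Num.max x y).
  by apply/seteqP; split => z /=; rewrite !in_itv/= !andbT gt_max => /andP.
- by move=> n; exists (- n%:R).
- apply/seteqP; split => // x _; exists (Num.bound `|x : R|) => //=.
  have h1 : `|x : R| < (Num.bound `|x : R|)%:R by exact: archi_boundP.
  rewrite /g /= in_itv/= andbT ltrNl; apply: le_lt_trans h1.
  by rewrite -normrN; exact: ler_norm.
- move=> _ [x ->].
  have -> : `]x, +oo[%classic = ~` (`]-oo, x]%classic : set R) by rewrite setCitvl.
  have mI : measurable (`]-oo, x]%classic : set (measurableTypeR R)) by exact: measurable_itv.
  have := probability_setC mu mI; have := probability_setC nu mI.
  by move=> e1 e2; rewrite [LHS]e2 [RHS]e1 ray.
- move=> n; apply: le_lt_trans (probability_le1 _ _) (ltry _).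
  exact: measurable_itv.
Qed.

Lemma gauss_char_law d (T : measurableType d) (R : realType) (P : probability T R)
    (X : T -> R) (q : R) : measurable_fun setT X -> gauss_char P X q -> gaussian P X.
Proof.
move=> mX hX; split => //; have q0 := gauss_char_ge0 mX hX.
pose nu0 := pfm (T2 := measurableTypeR R) P mX.
have nuT : nu0 setT = 1%E by rewrite -[LHS]/(P (X @^-1` setT)) preimage_setT probability_setT.
pose nu : probability (measurableTypeR R) R :=
  HB.pack (nu0 : set (measurableTypeR R) -> \bar R) (Measure.on nu0)
    (@Measure_isProbability.Build _ _ R nu0 nuT).
have mcos l a : measurable_fun setT (fun x : R => cos (l * x + a)).
  by apply: continuous_measurable_fun => x; exact: is_derive_cont (is_derive_cosl _ _ _).
have Enu l a : \int[nu]_x cos (l * x + a) = cos a * expR (- (l ^+ 2 * q / 2)).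
  have [_ e] := @Rint_pfm _ _ _ P _ (measurableTypeR R) X mX (fun x : R => cos (l * x + a))
    (mcos l a) (@integ_bounded _ _ _ nu _ 1 (mcos l a) (fun x => cos_max _)).
  by rewrite -[LHS]e hX.
(* Zero variance gives a point mass, which [normal_prob] does not cover. *)
have [q00|qn0] := eqVneq q 0.
  left; exists 0 => A mA.
  have := @probability_trig_unique R nu (dirac (0 : measurableTypeR R)) _ A mA.
  apply => l a; rewrite Enu q00 mulr0 mul0r oppr0 expR0 mulr1.
  rewrite /Rintegral integral_dirac//.
    by rewrite diracT mul1e /= mulr0 add0r.
  by apply/measurable_EFinP; exact: mcos.
right; exists 0, (Num.sqrt q).
have sq0 : Num.sqrt q != 0 by rewrite gt_eqF// sqrtr_gt0 lt_neqAle eq_sym qn0.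
split => // A mA.
have := @probability_trig_unique R nu (normal_prob 0 (Num.sqrt q)) _ A mA.
apply => l a; rewrite Enu.
have [_ ->] := @Rint_density _ _ R lebesgue_measure (normal_prob 0 (Num.sqrt q))
  (normal_pdf 0 (Num.sqrt q)) (normal_pdf_ge0 _ _) (measurable_normal_pdf _ _)
  (fun _ _ => erefl) _ (mcos l a)
  (integ_normal_pdfM 0 (Num.sqrt q) (mcos l a) (fun x => cos_max _)).
have := normal_char 0 sq0 l a; rewrite sqr_sqrtr// => <-.
by apply: eq_Rintegral => x _; rewrite subr0.
Qed.

(** * The identity for smeared processes *)

Section bounded_functions.
Variable R : realType.
Local Notation lam := (@lam R).
Implicit Types f g rho : R -> R.

Definition bm f (C : R) := measurable_fun setT f /\ forall t, `|f t| <= C.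

Lemma bm_ge0 f C : bm f C -> 0 <= C.
Proof. by move=> [_ h]; exact: le_trans (h 0). Qed.

Lemma bm_integ f C : bm f C -> integ lam f.
Proof. by move=> [mf hf]; exact: (integ_bounded lam mf hf). Qed.

Lemma bmM f g C D : bm f C -> bm g D -> bm (fun t => f t * g t) (C * D).
Proof.
move=> [m1 h1] [m2 h2]; split; first exact: measurable_funM.
by move=> t; rewrite normrM ler_pM.
Qed.

(** The bridge covariance, extended by [clip] to a bounded measurable function on the whole
    plane. *)
Definition kern (s t : R) : R :=
  Num.min (clip s) (clip t) - clip s * clip t.

Lemma kernC s t : kern s t = kern t s.
Proof. by rewrite /kern minC mulrC. Qed.

Lemma kern_bound s t : `|kern s t| <= 1.
Proof.
rewrite /kern; have /andP[s0 s1] := clip_in s; have /andP[t0 t1] := clip_in t.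
by rewrite ler_norml; apply/andP; split; case: (leP (clip s) (clip t)) => h; nra.
Qed.

Lemma measurable_kern d (T : measurableType d) (f g : T -> R) :
  measurable_fun setT f -> measurable_fun setT g ->
  measurable_fun setT (fun x => kern (f x) (g x)).
Proof.
move=> mf mg.
have mc (h : T -> R) : measurable_fun setT h -> measurable_fun setT (fun x => clip (h x)).
  by move=> mh; apply: measurableT_comp => //; exact: measurable_clip.
by apply: measurable_funB; [apply: measurable_minr|apply: measurable_funM]; exact: mc.
Qed.

Lemma bm_kern s : bm (kern s) 1.
Proof. by split; [exact: measurable_kern|exact: kern_bound]. Qed.

(** Agrees with [ind u] at nonnegative times, all that [lam] sees, and is free of the lower cut at
    0. *)
Definition step (u t : R) : R := (t < u)%R%:R.

Lemma step_bound u t : `|step u t| <= 1.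
Proof. by rewrite /step; case: (_ < _); rewrite ?normr1 ?normr0. Qed.

Lemma measurable_step d (T : measurableType d) (f g : T -> R) :
  measurable_fun setT f -> measurable_fun setT g ->
  measurable_fun setT (fun x => step (f x) (g x)).
Proof.
move=> mf mg; have h : measurable_fun setT (fun x => g x < f x) by exact: measurable_fun_ltr.
have -> : (fun x => step (f x) (g x)) = (fun b : bool => b%:R : R) \o (fun x => g x < f x) by [].
by apply: measurableT_comp => //.
Qed.

Lemma bm_step v : bm (step v) 1.
Proof. by split; [exact: measurable_step|exact: step_bound]. Qed.

(** The order of arguments matters: [step s t] tests [t < s], so this is the integral of [rho] over
    []t, 1]]. *)
Definition volt rho (t : R) : R := \int[lam]_s (rho s * step s t).
Definition kernop rho (t : R) : R := \int[lam]_s (rho s * kern t s).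

Lemma integ_volt_section rho C t : bm rho C -> integ lam (fun s => rho s * step s t).
Proof.
move=> [mr hr]; apply: (@integ_bounded _ _ _ lam _ C).
  by apply: measurable_funM => //; exact: measurable_step.
by move=> s; rewrite normrM (le_trans (ler_pM _ _ (hr s) (step_bound _ _)))// mulr1.
Qed.

Lemma integ_kern_section rho C t : bm rho C -> integ lam (fun s => rho s * kern t s).
Proof. by move=> hr; exact: bm_integ (bmM hr (bm_kern t)). Qed.

Lemma bm_param (F : R -> R -> R) C : measurable_fun setT (fun z : R * R => F z.1 z.2) ->
  (forall t s, `|F t s| <= C) -> bm (fun t => \int[lam]_s F t s) C.
Proof.
move=> mF hF; split.
  have : integ (lam \x lam)%E (fun z : R * R => F z.1 z.2).
    by apply: (@integ_prod_bounded _ _ _ _ _ lam lam _ C) => // x y; exact: hF.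
  by move=> /integ_section1/integ_meas.
have mFt t : measurable_fun setT (F t).
  by have := measurableT_comp mF (measurable_pair1 t).
move=> t; rewrite -[leRHS](Rint_probability_cst lam).
apply: norm_Rint_le => //; last exact: integ_cst.
exact: (integ_bounded lam (mFt t) (hF t)).
Qed.

Lemma bm_volt rho C : bm rho C -> bm (volt rho) C.
Proof.
move=> [mr hr]; apply: bm_param.
  apply: measurable_funM; first by apply: measurableT_comp => //; exact: measurable_snd.
  by apply: measurable_step; [exact: measurable_snd|exact: measurable_fst].
move=> t s; rewrite normrM (le_trans (ler_pM _ _ (hr s) (step_bound _ _)))//.
by rewrite mulr1.
Qed.

Lemma bm_kernop rho C : bm rho C -> bm (kernop rho) C.
Proof.
move=> [mr hr]; apply: bm_param.
  apply: measurable_funM; first by apply: measurableT_comp => //; exact: measurable_snd.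
  by apply: measurable_kern; [exact: measurable_fst|exact: measurable_snd].
move=> t s; rewrite normrM (le_trans (ler_pM _ _ (hr s) (kern_bound _ _)))//.
by rewrite mulr1.
Qed.

Definition stein_coef rho : R := \int[lam]_t (volt rho t * kernop rho t).

Lemma measurable_rs (N : nat) d (T : measurableType d) (F : R -> T -> R) (g : T -> R) :
  measurable_fun setT (fun z : R * T => F z.1 z.2) -> measurable_fun setT g ->
  measurable_fun setT (fun z : T => rs N (fun u => F u z) (g z)).
Proof.
move=> mF mg; apply: measurable_funM => //; apply: measurable_sum => j.
have h : measurable_fun setT (fun z : T => ((j%:R + g z) / N%:R, z)).
  apply: measurable_fun_pair => //; apply: measurable_funM => //.
  exact: measurable_funD.
exact: (measurableT_comp mF h).
Qed.

Lemma rs_bound (N : nat) f C th : (0 < N)%N -> (forall t, `|f t| <= C) -> `|rs N f th| <= C.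
Proof.
move=> N0 hf; rewrite /rs normrM ger0_norm ?invr_ge0// ler_pdivrMl ?ltr0n//.
apply: le_trans (ler_norm_sum _ _ _) _.
apply: (@le_trans _ _ (\sum_(j < N) C)); first by apply: ler_sum.
by rewrite sumr_const card_ord -[leLHS]mulr_natl.
Qed.

Lemma cvg_to0 (u v : nat -> R) : (forall n, `|u n| <= v n) -> v n @[n --> \oo] --> 0 ->
  u n @[n --> \oo] --> 0.
Proof.
move=> uv /cvgrPdist_le h; apply/cvgrPdist_le => e e0; apply: filterS (h e e0) => n.
rewrite !sub0r !normrN; apply: le_trans; apply: le_trans (uv n) _; exact: ler_norm.
Qed.

(** The difference of the two products is at most [C] times the sum [D] of the two errors.
    Exchanging the integrals leaves, for each fixed [t], the mean over the shift of errors of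
    Riemann sums, where [rs_cvg] applies; boundedness takes care of [t]. *)
Lemma rs_coef_cvg rho C : bm rho C ->
  \int[lam]_th `|\int[lam]_t (rs n.+1 (fun u => rho u * step u t) th *
                              rs n.+1 (fun u => rho u * kern t u) th) - stein_coef rho|
  @[n --> \oo] --> 0.
Proof.
move=> br; have [mr hr] := br; have C0 := bm_ge0 br.
have mrho1 : measurable_fun setT (fun z : R * R => rho z.1).
  by apply: measurableT_comp => //; exact: measurable_fst.
pose e n t th := rs n.+1 (fun u => rho u * step u t) th.
pose k n t th := rs n.+1 (fun u => rho u * kern t u) th.
have he n t th : `|e n t th| <= C.
  apply: rs_bound => // u; rewrite normrM (le_trans (ler_pM _ _ (hr u) (step_bound _ _)))//.
  by rewrite mulr1.
have hk n t th : `|k n t th| <= C.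
  apply: rs_bound => // u; rewrite normrM (le_trans (ler_pM _ _ (hr u) (kern_bound _ _)))//.
  by rewrite mulr1.
have [mv hv] := bm_volt br; have [mk hko] := bm_kernop br.
have me n : measurable_fun setT (fun z : R * R => e n z.1 z.2).
  apply: (@measurable_rs n.+1 _ _ (fun u z => rho u * step u z.1) snd); last exact: measurable_snd.
  apply: measurable_funM; first by apply: measurableT_comp => //; exact: measurable_fst.
  apply: measurable_step; first exact: measurable_fst.
  by apply: measurableT_comp; [exact: measurable_fst|exact: measurable_snd].
have mkk n : measurable_fun setT (fun z : R * R => k n z.1 z.2).
  apply: (@measurable_rs n.+1 _ _ (fun u z => rho u * kern z.1 u) snd); last exact: measurable_snd.
  apply: measurable_funM; first by apply: measurableT_comp => //; exact: measurable_fst.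
  apply: measurable_kern; last exact: measurable_fst.
  by apply: measurableT_comp; [exact: measurable_fst|exact: measurable_snd].
pose D n t th := `|e n t th - volt rho t| + `|k n t th - kernop rho t|.
have mv1 : measurable_fun setT (fun z : R * R => volt rho z.1).
  by apply: measurableT_comp => //; exact: measurable_fst.
have mk1 : measurable_fun setT (fun z : R * R => kernop rho z.1).
  by apply: measurableT_comp => //; exact: measurable_fst.
have mD n : measurable_fun setT (fun z : R * R => D n z.1 z.2).
  by apply: measurable_funD; apply: measurableT_comp => //; exact: measurable_funB.
have hD n t th : `|D n t th| <= 4 * C.
  rewrite ger0_norm ?addr_ge0//.
  rewrite /D; have := ler_normB (e n t th) (volt rho t); have := ler_normB (k n t th) (kernop rho t).
  by have := he n t th; have := hk n t th; have := hv t; have := hko t; lra.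
have iD n : integ (lam \x lam)%E (fun z : R * R => D n z.1 z.2).
  by apply: (@integ_prod_bounded _ _ _ _ _ lam lam _ (4 * C)); [exact: mD|move=> x y; exact: hD].
have iDt n t : integ lam (D n t).
  by apply: (@integ_bounded _ _ _ lam _ (4 * C)) => //; exact: (measurableT_comp (mD n) (measurable_pair1 t)).
have iDth n th : integ lam (D n ^~ th).
  by apply: (@integ_bounded _ _ _ lam _ (4 * C)) => //; exact: (measurableT_comp (mD n) (measurable_pair2 th)).
have mek n : measurable_fun setT (fun z : R * R => e n z.1 z.2 * k n z.1 z.2).
  exact: measurable_funM.
have hek n t th : `|e n t th * k n t th| <= C * C by rewrite normrM ler_pM.
have iek n th : integ lam (fun t => e n t th * k n t th).
  by apply: (@integ_bounded _ _ _ lam _ (C * C)) => //; exact: (measurableT_comp (mek n) (measurable_pair2 th)).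
have ivk : integ lam (fun t => volt rho t * kernop rho t).
  exact: bm_integ (bmM (bm_volt br) (bm_kernop br)).
have mI n : measurable_fun setT (fun th => \int[lam]_t (e n t th * k n t th)).
  have : integ (lam \x lam)%E (fun z : R * R => e n z.1 z.2 * k n z.1 z.2).
    by apply: (@integ_prod_bounded _ _ _ _ _ lam lam _ (C * C)); [exact: mek|move=> x y; exact: hek].
  by move=> /integ_section2/integ_meas.
apply: (@cvg_to0 _ (fun n => C * \int[lam]_th \int[lam]_t D n t th)).
  move=> n; rewrite ger0_norm; last by apply: Rintegral_ge0.
  rewrite -RintZ; last exact: integ_section2 (iD n).
  apply: le_Rint.
  - apply: (@integ_bounded _ _ _ lam _ (2 * (C * C))).
      apply: measurableT_comp => //; apply: measurable_funB => //; exact: mI.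
    move=> th; rewrite normr_id; apply: le_trans (ler_normB _ _) _.
    rewrite [leRHS](_ : _ = C * C + C * C); last by ring.
    apply: lerD; rewrite -[leRHS](Rint_probability_cst lam); apply: norm_Rint_le => //;
      try exact: integ_cst.
    + exact: iek.
    + by move=> t; exact: hek.
    + by move=> t; rewrite normrM ler_pM.
  - by apply: integZ; exact: integ_section2 (iD n).
  move=> th; rewrite -RintB; [|exact: iek|exact: ivk].
  rewrite -(RintZ C (iDth n th)); apply: norm_Rint_le.
  + by apply: integB; [exact: iek|exact: ivk].
  + by apply: integZ; exact: iDth.
  move=> t; rewrite /D -/(e n t th) -/(k n t th).
  have -> : e n t th * k n t th - volt rho t * kernop rho t =
    (e n t th - volt rho t) * k n t th + volt rho t * (k n t th - kernop rho t) by ring.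
  apply: le_trans (ler_normD _ _) _; rewrite (normrM (_ - _)) (normrM (volt rho t)) mulrDr.
  apply: lerD; first by rewrite mulrC ler_wpM2r// hk.
  by rewrite ler_wpM2r// hv.
rewrite -[X in _ --> X](mulr0 C); apply: cvgM; first exact: cvg_cst.
have -> : (fun n => \int[lam]_th \int[lam]_t D n t th) = (fun n => \int[lam]_t \int[lam]_th D n t th).
  by apply/funext => n; exact: (esym (Rint_fubini (iD n))).
have [||||_] := @Rint_dct _ _ _ lam (fun n t => \int[lam]_th D n t th) (fun=> 0) (fun=> 4 * C).
- by move=> n; apply: integ_meas (integ_section1 (iD n)).
- exact: integ_cst.
- move=> t; rewrite -[X in _ --> X](addr0 0).
  have -> : (fun n => \int[lam]_th D n t th) =
     (fun n => \int[lam]_th `|e n t th - volt rho t| + \int[lam]_th `|k n t th - kernop rho t|).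
    apply/funext => n; rewrite RintD//; apply: (@integ_bounded _ _ _ lam _ (2 * C)).
    + apply: measurableT_comp => //; apply: measurable_funB => //.
      exact: (measurableT_comp (me n) (measurable_pair1 t)).
    + move=> th; rewrite normr_id; apply: le_trans (ler_normB _ _) _.
      by have := he n t th; have := hv t; lra.
    + apply: measurableT_comp => //; apply: measurable_funB => //.
      exact: (measurableT_comp (mkk n) (measurable_pair1 t)).
    + move=> th; rewrite normr_id; apply: le_trans (ler_normB _ _) _.
      by have := hk n t th; have := hko t; lra.
  apply: cvgD; apply: rs_cvg.
  + exact: integ_volt_section br.
  + exact: integ_kern_section br.
- move=> n t; rewrite -[leRHS](Rint_probability_cst lam).
  by apply: norm_Rint_le => //; exact: integ_cst.
by rewrite Rintegral_zero.
Qed.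

End bounded_functions.

(** No integrability is assumed: the integral is the difference of the integrals of the positive and
    negative parts, each measurable in [x] by Tonelli. *)
Lemma measurable_Rint_param d d' (S : measurableType d) (T : measurableType d')
    (R : realType) (m : {sigma_finite_measure set T -> \bar R}) (f : S * T -> R) :
  measurable_fun setT f -> measurable_fun setT (fun x => \int[m]_y f (x, y)).
Proof.
move=> mf; have mE : measurable_fun setT (EFin \o f) by exact/measurable_EFinP.
apply: (measurableT_comp (f := @fine R)); first by [].
have -> : (fun x => \int[m]_y (f (x, y))%:E)%E =
    (fun x => \int[m]_y (EFin \o f)^\+ (x, y) - \int[m]_y (EFin \o f)^\- (x, y))%E.
  by apply/funext => x; rewrite [LHS]integralE; congr (_ - _)%E; apply: eq_integral => y _;
    rewrite ?funeposE ?funenegE.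
apply: emeasurable_funB.
  apply: (@measurable_fun_fubini_tonelli_F _ _ _ _ _ m ((EFin \o f)^\+)%E) => //.
  exact: measurable_funepos.
apply: (@measurable_fun_fubini_tonelli_F _ _ _ _ _ m ((EFin \o f)^\-)%E) => //.
exact: measurable_funeneg.
Qed.

(** * From point values to bounded densities *)

Section process.
Context d (T : measurableType d) (R : realType) (P : probability T R).
Variable B : R -> T -> R.
Local Notation lam := (@lam R).
Hypothesis mB : measurable_fun setT (fun z : R * T => B z.1 z.2).
Hypothesis iB : forall x, integ lam (B ^~ x).
Hypothesis iB2 : integ (lam \x P)%E (fun z : R * T => B z.1 z.2 ^+ 2).
Implicit Types rho f : R -> R.

Definition pathnorm (x : T) : R := \int[lam]_t `|B t x|.
Definition smear rho (x : T) : R := \int[lam]_t (rho t * B t x).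

Lemma pathnorm_ge0 x : 0 <= pathnorm x.
Proof. by apply: Rintegral_ge0 => t _. Qed.

Lemma measurable_path x : measurable_fun setT (B ^~ x).
Proof. exact: integ_meas (iB x). Qed.

Lemma integ_process : integ (lam \x P)%E (fun z : R * T => B z.1 z.2).
Proof.
apply: (@integ_le _ _ _ (lam \x P)%E _ (fun z => 1 + B z.1 z.2 ^+ 2)) => //.
  by apply: integD => //; apply: (@integ_prod_bounded _ _ _ _ _ lam P _ 1) => // x y; rewrite normr1.
move=> z; have := sqr_ge0 (`|B z.1 z.2| - 1).
by rewrite -[B _ _ ^+ 2]real_normK ?num_real//; set b := `|_|; nra.
Qed.

Lemma integ_pathnorm : integ P pathnorm.
Proof.
have := integ_section2 (integ_norm integ_process).
by congr (_.-integrable _ (EFin \o _)); apply/funext => x.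
Qed.

Lemma measurable_smear rho C : bm rho C -> measurable_fun setT (smear rho).
Proof.
move=> [mr hr]; have : integ (lam \x P)%E (fun z : R * T => rho z.1 * B z.1 z.2).
  apply: (@integ_le _ _ _ (lam \x P)%E _ (fun z => C * `|B z.1 z.2|)).
  - apply: measurable_funM => //; apply: measurableT_comp => //; exact: measurable_fst.
  - exact: integZ (integ_norm integ_process).
  - by move=> z; rewrite normrM ler_wpM2r.
by move=> /integ_section2/integ_meas.
Qed.

Lemma integ_smear_path rho C x : bm rho C -> integ lam (fun t => rho t * B t x).
Proof. by move=> [mr hr]; exact: integ_mulb (iB x) mr hr. Qed.

Lemma smear_bound rho C x : bm rho C -> `|smear rho x| <= C * pathnorm x.
Proof.
move=> br; have [mr hr] := br; have i1 := integ_norm (iB x); rewrite -RintZ//.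
apply: norm_Rint_le; [exact: integ_smear_path br|exact: integZ|].
by move=> t; rewrite normrM ler_wpM2r.
Qed.

Lemma integ_smear rho C : bm rho C -> integ P (smear rho).
Proof.
move=> br; apply: (@integ_le _ _ _ P _ (fun x => C * pathnorm x)).
- exact: measurable_smear br.
- exact: integZ integ_pathnorm.
- by move=> x; exact: smear_bound.
Qed.

Definition point_sum (s : seq (R * R)) (x : T) : R := \sum_(p <- s) p.1 * B p.2 x.
Definition step_sum (s : seq (R * R)) (t : R) : R := \sum_(p <- s) p.1 * step p.2 t.
Definition kern_sum (s : seq (R * R)) (t : R) : R := \sum_(p <- s) p.1 * kern t p.2.

(** The assumed identity for cosines of step functionals, in real form. Atoms at 0 are excluded, as
    in [step_fun]. *)
Hypothesis stein_atoms : forall (s : seq (R * R)) (a : R),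
  (forall p, p \in s -> 0 < p.2 <= 1) ->
  \int[P]_x (sin (point_sum s x + a) * smear (step_sum s) x) =
  \int[P]_x ((\int[lam]_t (step_sum s t * kern_sum s t)) * cos (point_sum s x + a)).

(** The primitive of the path. It arises because the derivative of the point value at [u] is the
    step at [u]. *)
Let beta (u : R) (x : T) : R := \int[lam]_t (step u t * B t x).

Let measurable_beta : measurable_fun setT (fun z : R * T => beta z.1 z.2).
Proof.
have mi : measurable_fun setT (fun z : (R * T) * R => step z.1.1 z.2 * B z.2 z.1.2).
  apply: measurable_funM.
    apply: measurable_step; last exact: measurable_snd.
    by apply: (measurableT_comp measurable_fst); exact: measurable_fst.
  have h : measurable_fun setT (fun z : (R * T) * R => (z.2, z.1.2)).
    apply: measurable_fun_pair; first exact: measurable_snd.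
    by apply: (measurableT_comp measurable_snd); exact: measurable_fst.
  exact: (measurableT_comp mB h).
exact: (measurable_Rint_param lam mi).
Qed.

Let beta_bound u x : `|beta u x| <= pathnorm x.
Proof. by have := smear_bound x (bm_step u); rewrite mul1r. Qed.

Let rs_seq rho (n : nat) (th : R) : seq (R * R) :=
  [seq (n.+1%:R^-1 * rho ((j%:R + th) / n.+1%:R), (j%:R + th) / n.+1%:R) | j <- iota 0 n.+1].

Let sum_rs_seq rho n th (f : R -> R) :
  \sum_(p <- rs_seq rho n th) p.1 * f p.2 = rs n.+1 (fun u => rho u * f u) th.
Proof.
rewrite /rs_seq big_map /rs mulr_sumr -[n.+1 in RHS]subn0 -[iota _ _]/(index_iota 0 n.+1).
by rewrite big_mkord; apply: eq_bigr => j _; rewrite /= mulrA.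
Qed.

Lemma smear_volt rho C x : bm rho C ->
  smear (volt rho) x = \int[lam]_u (rho u * beta u x).
Proof.
move=> br; have [mr hr] := br; have C0 := bm_ge0 br.
have i : integ (lam \x lam)%E (fun z : R * R => rho z.2 * step z.2 z.1 * B z.1 x).
  apply: (@integ_prodM _ _ _ _ _ lam lam _ (fun t => `|B t x|) (fun=> C)).
  - apply: measurable_funM; last by apply: (measurableT_comp (measurable_path x)); exact: measurable_fst.
    apply: measurable_funM; first by apply: (measurableT_comp mr); exact: measurable_snd.
    by apply: measurable_step; [exact: measurable_snd|exact: measurable_fst].
  - exact: integ_norm.
  - exact: integ_cst.
  - move=> t u /=; rewrite normrM mulrC ler_wpM2l// normrM.
    by rewrite (le_trans (ler_pM _ _ (hr u) (step_bound _ _)))// mulr1.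
have := Rint_fubini i; rewrite /smear /=.
under [X in X = _ -> _]eq_Rintegral => t _.
  rewrite (_ : (fun y => rho y * step y t * B t x) = (fun y => B t x * (rho y * step y t))); last first.
    by apply/funext => y; rewrite mulrC.
  rewrite RintZ; last exact: integ_volt_section br.
  rewrite mulrC; over.
move=> ->; apply: eq_Rintegral => u _; rewrite -RintZ; last exact: integ_smear_path (bm_step u).
by apply: eq_Rintegral => t _; rewrite mulrA.
Qed.

Let stein_split (sz y cz c k D1 D2 D3 s Y cc : R) : `|sz| <= 1 -> `|cz| <= 1 ->
  `|sz - s| <= D2 -> `|cz - cc| <= D2 -> `|y - Y| <= D1 -> `|c - k| <= D3 ->
  `|sz * y - c * cz - (s * Y - k * cc)| <= D1 + (`|Y| + `|k|) * D2 + D3.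
Proof.
move=> h1 h2 h3 h4 h5 h6.
have -> : sz * y - c * cz - (s * Y - k * cc) =
  sz * (y - Y) + ((sz - s) * Y - k * (cz - cc)) - (c - k) * cz by ring.
apply: le_trans (ler_normB _ _) _; apply: lerD.
  apply: le_trans (ler_normD _ _) _; apply: lerD.
    by rewrite normrM -[leRHS]mul1r ler_pM.
  apply: le_trans (ler_normB _ _) _; rewrite [leRHS]mulrDl !normrM; apply: lerD.
    by rewrite mulrC ler_pM.
  by rewrite ler_pM.
by rewrite normrM -[leRHS]mulr1 ler_pM.
Qed.

(* The point masses of [stein_atoms] are placed at the randomly shifted grid points,
   with weights [rho]. *)
Lemma stein_density rho C (a : R) : bm rho C ->
  \int[P]_x (sin (smear rho x + a) * smear (volt rho) x) =
  stein_coef rho * \int[P]_x cos (smear rho x + a).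
Proof.
move=> br; have [mr hr] := br; have C0 := bm_ge0 br.
pose z n x th := rs n.+1 (fun u => rho u * B u x) th.
pose y n x th := rs n.+1 (fun u => rho u * beta u x) th.
pose c n th := \int[lam]_t (rs n.+1 (fun u => rho u * step u t) th *
                            rs n.+1 (fun u => rho u * kern t u) th).
pose J n x th := sin (z n x th + a) * y n x th - c n th * cos (z n x th + a).
have mz n : measurable_fun setT (fun w : T * R => z n w.1 w.2).
  apply: (@measurable_rs R n.+1 _ _ (fun u w => rho u * B u w.1) snd); last exact: measurable_snd.
  apply: measurable_funM; first by apply: (measurableT_comp mr); exact: measurable_fst.
  have h : measurable_fun setT (fun w : R * (T * R) => (w.1, w.2.1)).
    apply: measurable_fun_pair; first exact: measurable_fst.
    by apply: (measurableT_comp measurable_fst); exact: measurable_snd.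
  exact: (measurableT_comp mB h).
have my n : measurable_fun setT (fun w : T * R => y n w.1 w.2).
  apply: (@measurable_rs R n.+1 _ _ (fun u w => rho u * beta u w.1) snd); last exact: measurable_snd.
  apply: measurable_funM; first by apply: (measurableT_comp mr); exact: measurable_fst.
  have h : measurable_fun setT (fun w : R * (T * R) => (w.1, w.2.1)).
    apply: measurable_fun_pair; first exact: measurable_fst.
    by apply: (measurableT_comp measurable_fst); exact: measurable_snd.
  exact: (measurableT_comp measurable_beta h).
have bc n : bm (c n) (C * C).
  apply: bm_param.
    apply: measurable_funM.
      apply: (@measurable_rs R n.+1 _ _ (fun u w => rho u * step u w.2) fst); last exact: measurable_fst.
      apply: measurable_funM; first by apply: (measurableT_comp mr); exact: measurable_fst.
      apply: measurable_step; first exact: measurable_fst.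
      by apply: (measurableT_comp measurable_snd); exact: measurable_snd.
    apply: (@measurable_rs R n.+1 _ _ (fun u w => rho u * kern w.2 u) fst); last exact: measurable_fst.
    apply: measurable_funM; first by apply: (measurableT_comp mr); exact: measurable_fst.
    apply: measurable_kern; last exact: measurable_fst.
    by apply: (measurableT_comp measurable_snd); exact: measurable_snd.
  move=> th t; rewrite normrM; apply: ler_pM => //; apply: rs_bound => // u; rewrite normrM.
    by rewrite (le_trans (ler_pM _ _ (hr u) (step_bound _ _)))// mulr1.
  by rewrite (le_trans (ler_pM _ _ (hr u) (kern_bound _ _)))// mulr1.
have mc n := (bc n).1; have hc n := (bc n).2.
have hy n x th : `|y n x th| <= C * pathnorm x.
  by apply: rs_bound => // u; rewrite normrM ler_pM// beta_bound.
have msin n : measurable_fun setT (fun w : T * R => sin (z n w.1 w.2 + a)).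
  apply: (measurableT_comp (f := @sin R)); last exact: measurable_funD.
  by apply: continuous_measurable_fun; exact: continuous_sin.
have mcos n : measurable_fun setT (fun w : T * R => cos (z n w.1 w.2 + a)).
  apply: (measurableT_comp (f := @cos R)); last exact: measurable_funD.
  by apply: continuous_measurable_fun; exact: continuous_cos.
have mJ n : measurable_fun setT (fun w : T * R => J n w.1 w.2).
  apply: measurable_funB; first exact: measurable_funM.
  apply: measurable_funM => //; apply: (measurableT_comp (mc n)); exact: measurable_snd.
have hJ n x th : `|J n x th| <= C * pathnorm x + C * C.
  apply: le_trans (ler_normB _ _) _; rewrite [X in X + _]normrM [X in _ + X]normrM; apply: lerD.
    by rewrite -[leRHS]mul1r ler_pM ?sin_max.
  by rewrite -[leRHS]mulr1 ler_pM ?cos_max.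
have ig : integ P (fun x => C * pathnorm x + C * C).
  by apply: integD; [exact: integZ integ_pathnorm|exact: integ_cst].
have iJ n : integ (P \x lam)%E (fun w : T * R => J n w.1 w.2).
  apply: (@integ_prodM _ _ _ _ _ P lam _ (fun x => C * pathnorm x + C * C) (fun=> 1)).
  - exact: mJ.
  - exact: ig.
  - exact: integ_cst.
  - by move=> x th; rewrite mulr1.
have J0 n : \int[P]_x \int[lam]_th J n x th = 0.
  rewrite (Rint_fubini (iJ n)) -[RHS](Rintegral_zero lam).
  apply: ae_eq_Rint => //; first exact: integ_meas (integ_section2 (iJ n)).
  (* For [th > 0] all grid points lie in []0, 1]] and the identity for atoms applies; the shift 0
     would put an atom at 0 and is discarded as a null set. *)
  apply: lam_ae; exists [set 0]; split => //; first exact: lebesgue_measure_set1.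
  move=> th /= /not_implyP[th01 nz]; apply: contrapT => th0; apply: nz => /=.
  have thp : 0 < th by case/andP: th01 => + _; rewrite le_eqVlt => /orP[/eqP e|//]; case: th0.
  have hp p : p \in rs_seq rho n th -> 0 < p.2 <= 1.
    move=> /mapP[j]; rewrite mem_iota add0n => /andP[_ jn] -> /=.
    have /andP[_ ->] := @cell_in R n.+1 j th jn th01.
    by rewrite andbT divr_gt0// ltr_wpDl.
  have zE x : z n x th = point_sum (rs_seq rho n th) x by rewrite /point_sum (sum_rs_seq rho n th (B ^~ x)).
  have yE x : y n x th = smear (step_sum (rs_seq rho n th)) x.
    rewrite /y -(sum_rs_seq rho n th (beta ^~ x)) /smear.
    under [RHS]eq_Rintegral => t _ do rewrite /step_sum mulr_suml.
    under [RHS]eq_Rintegral => t _ do under eq_bigr => p _ do rewrite -mulrA.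
    rewrite Rint_sum; last by move=> p; apply: integZ; exact: integ_smear_path (bm_step p.2).
    by apply: eq_bigr => p _; rewrite RintZ//; exact: integ_smear_path (bm_step p.2).
  have cE : c n th = \int[lam]_t (step_sum (rs_seq rho n th) t * kern_sum (rs_seq rho n th) t).
    apply: eq_Rintegral => t _; rewrite /step_sum /kern_sum.
    by rewrite (sum_rs_seq rho n th (fun u : R => step u (t : R))) (sum_rs_seq rho n th (kern (t : R))).
  have sec (f : T * R -> R) : measurable_fun setT f -> measurable_fun setT (fun x => f (x, th)).
    by move=> mf; exact: (measurableT_comp mf (measurable_pair2 th)).
  rewrite RintB.
  - apply/eqP; rewrite subr_eq0; apply/eqP.
    under eq_Rintegral => x _ do rewrite zE yE.
    by rewrite (stein_atoms a hp) -cE; under [RHS]eq_Rintegral => x _ do rewrite zE.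
  - apply: (@integ_le _ _ _ P _ (fun x => C * pathnorm x)).
    + exact: sec (fun w => sin (z n w.1 w.2 + a) * y n w.1 w.2) (measurable_funM (msin n) (my n)).
    + exact: integZ integ_pathnorm.
    + by move=> x; rewrite normrM -[leRHS]mul1r ler_pM// sin_max.
  - apply: integZ; apply: (@integ_bounded _ _ _ P _ 1); last by move=> x; exact: cos_max.
    exact: sec (fun w => cos (z n w.1 w.2 + a)) (mcos n).
pose L x := sin (smear rho x + a) * smear (volt rho) x - stein_coef rho * cos (smear rho x + a).
(* For a fixed path the Riemann sums [z], [y] and the coefficient [c] converge in mean over the
   shift, and [stein_split] transfers this to [J]. *)
have JL x : \int[lam]_th J n x th @[n --> \oo] --> L x.
  have iz : integ lam (fun u => rho u * B u x) := integ_smear_path x br.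
  have iy : integ lam (fun u => rho u * beta u x).
    apply: (@integ_bounded _ _ _ lam _ (C * pathnorm x)); last first.
      by move=> u; rewrite normrM ler_pM// beta_bound.
    by apply: measurable_funM => //; exact: (measurableT_comp measurable_beta (measurable_pair2 x)).
  have iJx n : integ lam (J n x).
    apply: (@integ_bounded _ _ _ lam _ (C * pathnorm x + C * C)); last by move=> th; exact: hJ.
    exact: (measurableT_comp (mJ n) (measurable_pair1 x)).
  pose Y := smear (volt rho) x; pose D := `|Y| + `|stein_coef rho|.
  have i1 n : integ lam (fun th => `|y n x th - Y|).
    by apply: integ_norm; apply: integB; [exact: integ_rs|exact: integ_cst].
  have i2 n : integ lam (fun th => `|z n x th - smear rho x|).
    by apply: integ_norm; apply: integB; [exact: integ_rs|exact: integ_cst].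
  have i3 n : integ lam (fun th => `|c n th - stein_coef rho|).
    by apply: integ_norm; apply: integB; [exact: bm_integ (conj (mc n) (hc n))|exact: integ_cst].
  have bnd n : `|\int[lam]_th J n x th - L x| <=
      (\int[lam]_th `|y n x th - Y| + D * \int[lam]_th `|z n x th - smear rho x|) +
      \int[lam]_th `|c n th - stein_coef rho|.
    rewrite -[L x](Rint_probability_cst lam) -RintB//; last exact: integ_cst.
    rewrite -RintZ// -RintD//; last exact: integZ.
    rewrite -RintD//; last by apply: integD => //; exact: integZ.
    apply: norm_Rint_le; first by apply: integB => //; exact: integ_cst.
      by apply: integD => //; apply: integD => //; exact: integZ.
    move=> th; rewrite /J /L /D -/Y.
    apply: stein_split; [exact: sin_max|exact: cos_max| | |exact: lexx|exact: lexx].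
      by apply: le_trans (sin_lip _ _) _; rewrite opprD addrACA subrr addr0.
    by apply: le_trans (cos_lip _ _) _; rewrite opprD addrACA subrr addr0.
  have lim0 : (\int[lam]_th `|y n x th - Y| + D * \int[lam]_th `|z n x th - smear rho x|) +
      \int[lam]_th `|c n th - stein_coef rho| @[n --> \oo] --> 0.
    rewrite -[X in _ --> X]addr0; apply: cvgD; last exact: rs_coef_cvg br.
    rewrite -[X in _ --> X]addr0; apply: cvgD.
      by rewrite /Y (smear_volt x br); exact: rs_cvg.
    by rewrite -[X in _ --> X](mulr0 D); apply: cvgMr; exact: rs_cvg.
  by apply/subr_cvg0; exact: cvg_to0 bnd lim0.
have mZ : measurable_fun setT (smear rho) := measurable_smear br.
have isin : integ P (fun x => sin (smear rho x + a)).
  by apply: (@integ_le _ _ _ P _ (fun=> 1)); [|exact: integ_cst|move=> x; exact: sin_max];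
    have := measurable_sinl 1 a mZ; under eq_fun do rewrite mul1r.
have icos : integ P (fun x => cos (smear rho x + a)).
  by apply: (@integ_le _ _ _ P _ (fun=> 1)); [|exact: integ_cst|move=> x; exact: cos_max];
    have := measurable_cosl 1 a mZ; under eq_fun do rewrite mul1r.
have [||||_] := @Rint_dct _ _ _ P (fun n x => \int[lam]_th J n x th) L
  (fun x => C * pathnorm x + C * C).
- by move=> n; apply: integ_meas (integ_section1 (iJ n)).
- exact: ig.
- exact: JL.
- move=> n x; rewrite -[leRHS](Rint_probability_cst lam).
  apply: norm_Rint_le; last by move=> th; exact: hJ.
  + apply: (@integ_bounded _ _ _ lam _ (C * pathnorm x + C * C)); last by move=> th; exact: hJ.
    exact: (measurableT_comp (mJ n) (measurable_pair1 x)).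
  + exact: integ_cst.
under eq_fun do rewrite J0.
move=> /cvg_lim; rewrite lim_cst// => /(_ (@norm_hausdorff _ _)) e.
move: (esym e); rewrite /L RintB.
- by rewrite RintZ => [/eqP|]; [rewrite subr_eq0 => /eqP|exact: icos].
- by apply: (integ_mulb (C := 1) (integ_smear (bm_volt br)) (integ_meas isin)) => x; exact: sin_max.
- exact: integZ.
Qed.

End process.

(** * The characteristic flow *)

Section wave.
Variable R : realType.
Local Notation lam := (@lam R).
Implicit Types s x y u t : R.

(* [Num.sqrt] vanishes on negative numbers, so that both profiles are supported on
   [0 <= y]; [dwave s] is the primitive of [wave s] that vanishes at 0. *)
Definition wave s y : R := sin (2 * Num.sqrt y * s) / s.
Definition dwave s y : R :=
  (sin (2 * Num.sqrt y * s) - 2 * Num.sqrt y * s * cos (2 * Num.sqrt y * s)) / (2 * s ^+ 3).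

Lemma sin_le (x : R) : `|sin x| <= `|x|.
Proof. by have := sin_lip x 0; rewrite sin0 !subr0. Qed.

Lemma wave_bound s y : y <= 1 -> `|wave s y| <= 2.
Proof.
move=> y1; have [->|s0] := eqVneq s 0; first by rewrite /wave mulr0 sin0 mul0r normr0.
rewrite /wave normrM normfV ler_pdivrMr ?normr_gt0//.
apply: le_trans (sin_le _) _; rewrite !normrM ler_wpM2r// ger0_norm//.
by rewrite ger0_norm ?sqrtr_ge0// ler_piMr// -[leRHS]sqrtr1 ler_wsqrtr.
Qed.

Lemma wave_decay s y : 0 < s -> `|wave s y| <= s^-1.
Proof.
by move=> s0; rewrite /wave normrM normfV (gtr0_norm s0) ler_piMl ?invr_ge0 ?(ltW s0)// sin_max.
Qed.

Lemma dwave_bound s y : 0 < s -> y <= 1 -> `|dwave s y| <= 2 / s ^+ 2.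
Proof.
move=> s0 y1; have s3 : 0 < 2 * s ^+ 3 by rewrite mulr_gt0// exprn_gt0.
rewrite /dwave normrM normfV (gtr0_norm s3) ler_pdivrMr//.
have -> : 2 / s ^+ 2 * (2 * s ^+ 3) = 2 * s + 2 * s by field; rewrite gt_eqF.
have h : `|2 * Num.sqrt y * s| <= 2 * s.
  rewrite normrM (gtr0_norm s0) ler_wpM2r ?(ltW s0)// ger0_norm ?mulr_ge0 ?sqrtr_ge0//.
  by rewrite ler_piMr// -[leRHS]sqrtr1 ler_wsqrtr.
apply: le_trans (ler_normB _ _) _; apply: lerD; first exact: le_trans (sin_le _) h.
by rewrite normrM; apply: le_trans h; rewrite ler_piMr// cos_max.
Qed.

Lemma wave_neg s y : y <= 0 -> wave s y = 0.
Proof. by move=> y0; rewrite /wave ler0_sqrtr// mulr0 mul0r sin0 mul0r. Qed.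

Lemma dwave_neg s y : y <= 0 -> dwave s y = 0.
Proof. by move=> y0; rewrite /dwave ler0_sqrtr// mulr0 !mul0r sin0 subr0 mul0r. Qed.

Lemma continuous_wave s : continuous (wave s).
Proof.
move=> y; apply: cvgMl; apply: (@continuous_comp _ _ _ (fun y => 2 * Num.sqrt y * s) (@sin R));
  last exact: continuous_sin.
by apply: cvgMl; apply: cvgMr; exact: sqrt_continuous.
Qed.

Lemma continuous_dwave s : continuous (dwave s).
Proof.
move=> y; have c : {for y, continuous (fun y => 2 * Num.sqrt y * s)}.
  by apply: cvgMl; apply: cvgMr; exact: sqrt_continuous.
apply: cvgMl; apply: cvgB; first exact: (continuous_comp c (@continuous_sin R _)).
by apply: (cvgM c); exact: (continuous_comp c (@continuous_cos R _)).
Qed.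

(** Differentiating the quotient in [s] produces the numerator of [dwave], the primitive of the
    profile in [y]: this is the flow equation in closed form. *)
Lemma is_derive_wave s y : 0 < s -> is_derive s 1 (wave ^~ y) (- (2 * s * dwave s y)).
Proof.
move=> s0; set k := 2 * Num.sqrt y.
have sn : s != 0 by rewrite gt_eqF.
have h1 : is_derive s 1 (fun x => sin (k * x)) (k * cos (k * s)).
  by have := is_derive_sinl k 0 s; under eq_fun do rewrite addr0; rewrite addr0.
have h2 := @is_deriveV R id s 1 1 sn (is_derive_id s 1).
have := is_deriveMr h1 h2; move=> h; apply: is_derive_eq h _.
by rewrite /dwave -/k [_ *: _]/GRing.scale/=; field.
Qed.

(** Chain rule through [r = Num.sqrt y], available for [y > 0] only because the root is not
    differentiable at 0. *)
Lemma is_derive_dwave s y : 0 < s -> 0 < y -> is_derive y 1 (dwave s) (wave s y).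
Proof.
move=> s0 y0; have sy : 0 < Num.sqrt y by rewrite sqrtr_gt0.
have hs := is_derive1_sqrt y0.
pose g (r : R) := (sin (2 * s * r + 0) - (2 * s * r + 0) * cos (2 * s * r + 0)) / (2 * s ^+ 3).
have dg (r : R) : is_derive r 1 g (2 * s * r * sin (2 * s * r) / s ^+ 2).
  have h := is_deriveMr (is_derive_lin (2 * s) 0 r) (is_derive_cosl (2 * s) 0 r).
  have := is_deriveMr (is_deriveB (is_derive_sinl (2 * s) 0 r) h) (is_derive_cst (2 * s ^+ 3)^-1 r 1).
  move=> h'; apply: is_derive_eq h' _.
  by rewrite mulr0 addr0 /= !addr0; field; rewrite gt_eqF.
have := @is_derive1_comp R g Num.sqrt y _ _ (dg (Num.sqrt y)) hs.
have -> : g \o Num.sqrt = dwave s.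
  by apply/funext => x; rewrite /g /dwave/= !addr0 ![2 * s * _]mulrAC.
move=> h; apply: is_derive_eq h _; rewrite /wave [2 * s * _]mulrAC; field.
by rewrite !gt_eqF.
Qed.

(** As the profile vanishes at negative arguments, the integral over []t, 1]] of its translate is
    the integral of the profile from 0 to [u - t]. Here [u <= 1] ensures that the end of the
    interval cuts nothing off. *)
Lemma volt_wave s u t : 0 < s -> u <= 1 -> 0 <= t <= 1 ->
  \int[lam]_x (wave s (u - clip x) * step x t) = dwave s (u - t).
Proof.
move=> s0 u1 /andP[t0 t1].
have mw : measurable_fun setT (fun x => wave s (u - x)).
  apply: continuous_measurable_fun => x.
  apply: (@continuous_comp _ _ _ (fun x => u - x) (wave s)); last exact: continuous_wave.
  by apply: cvgB; [exact: cvg_cst|exact: cvg_id].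
have mst : measurable_fun setT (fun x => step x t) by exact: measurable_step.
transitivity (\int[lam]_x (wave s (u - x) * step x t)).
  apply: eq_lam_Rint; first by apply: measurable_funM => //; exact: (measurableT_comp mw (@measurable_clip R)).
    exact: measurable_funM.
  by move=> x x01; rewrite clip_id.
have [ut|tu] := leP u t.
  rewrite dwave_neg ?subr_le0// -[RHS](Rintegral_zero lam); apply: eq_Rintegral => x _.
  rewrite /step; case: ltP => [tx|_]; last by rewrite mulr0.
  by rewrite wave_neg ?mul0r// subr_le0 (le_trans ut)// ltW.
rewrite -lam_Rintegral; last exact: measurable_funM.
transitivity (\int[lebesgue_measure]_(x in `]t, u]) wave s (u - x)).
  rewrite Rintegral_mkcond [RHS]Rintegral_mkcond; apply: eq_Rintegral => x _.
  rewrite !patchE !mem_setE !in_itv/= /step.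
  case: (ltP t x) => tx; last by rewrite mulr0; case: ifP.
  rewrite (le_trans t0 (ltW tx))/= mulr1; case: (leP x u) => xu.
    by rewrite (le_trans xu).
  by rewrite wave_neg ?subr_le0 ?(ltW xu)//; case: ifP.
rewrite Rintegral_itv_obnd_cbnd; last first.
  apply: (@integrableS _ _ _ (@lebesgue_measure R) (`[t, u] : set R)) => //.
    by apply: subset_itvr; rewrite bnd_simp.
  apply: continuous_compact_integrable; first exact: segment_compact.
  apply: continuous_subspaceT => x.
  apply: (@continuous_comp _ _ _ (fun x => u - x) (wave s)); last exact: continuous_wave.
  by apply: cvgB; [exact: cvg_cst|exact: cvg_id].
have cd : continuous (fun x => - dwave s (u - x)).
  move=> x; apply: cvgN; apply: (@continuous_comp _ _ _ (fun x => u - x) (dwave s)).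
    by apply: cvgB; [exact: cvg_cst|exact: cvg_id].
  exact: continuous_dwave.
(* Differentiability is restricted to points below [u], where the argument of the profile is
   positive; at [u] the continuity of [dwave] is enough. *)
have dd x : x \in `]t, u[ -> is_derive x 1 (fun x => - dwave s (u - x)) (wave s (u - x)).
  rewrite in_itv/= => /andP[_ xu].
  have h1 : is_derive x 1 (fun x => u - x) (-1).
    by have := is_derive_lin (-1) u x; congr (is_derive _ _ _ _); apply/funext => z; ring.
  have ux : 0 < u - x by rewrite subr_gt0.
  have := is_deriveN (@is_derive1_comp R (dwave s) (fun x => u - x) x _ _ (is_derive_dwave s0 ux) h1).
  by move=> h; apply: is_derive_eq h _; rewrite mulrN1 opprK.
rewrite /Rintegral (@continuous_FTC2 _ _ (fun x => - dwave s (u - x)))//=.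
- by rewrite subrr [in X in X - _]dwave_neg// oppr0 sub0r opprK.
- apply: continuous_subspaceT => x.
  apply: (@continuous_comp _ _ _ (fun x => u - x) (wave s)); last exact: continuous_wave.
  by apply: cvgB; [exact: cvg_cst|exact: cvg_id].
- split; first by move=> x /dd[].
  + by apply: cvg_at_right_filter; exact: cd.
  + by apply: cvg_at_left_filter; exact: cd.
- by move=> x /dd h; rewrite derive1E; case: h.
Qed.

End wave.

(** * Translates of the profiles and the bridge variance along the flow *)

Section shapes.
Variable R : realType.
Local Notation lam := (@lam R).
Implicit Types (f h rho : R -> R) (s : seq (R * R)) (y u t v w : R).

(* The densities whose characteristic functions are followed: combinations of the
   translates [t |-> h (u - t)], [u <= 1]. *)
Definition lsum s h t : R := \sum_(p <- s) p.1 * h (p.2 - clip t).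
Definition below1 s := forall p, p \in s -> p.2 <= 1.
Definition weight s : R := \sum_(p <- s) `|p.1|.

Lemma lsum_bound s h C t : below1 s -> (forall y, y <= 1 -> `|h y| <= C) ->
  `|lsum s h t| <= weight s * C.
Proof.
move=> s1 hC; apply: le_trans (ler_norm_sum _ _ _) _; rewrite mulr_suml.
rewrite big_seq [leRHS]big_seq; apply: ler_sum => p ps; rewrite normrM ler_wpM2l// hC//.
have /andP[c0 _] := clip_in t; have := s1 _ ps; lra.
Qed.

Lemma measurable_lsum s h : measurable_fun setT h -> measurable_fun setT (lsum s h).
Proof.
move=> mh; apply: measurable_sum => p; apply: measurable_funM => //.
by apply: (measurableT_comp mh); apply: measurable_funB => //; exact: measurable_clip.
Qed.

Lemma bm_lsum s h C : below1 s -> measurable_fun setT h ->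
  (forall y, y <= 1 -> `|h y| <= C) -> bm (lsum s h) (weight s * C).
Proof. by move=> s1 mh hC; split; [exact: measurable_lsum|move=> t; exact: lsum_bound]. Qed.

Lemma measurable_wave v : measurable_fun setT (@wave R v).
Proof. by apply: continuous_measurable_fun; exact: continuous_wave. Qed.

Lemma measurable_dwave v : measurable_fun setT (@dwave R v).
Proof. by apply: continuous_measurable_fun; exact: continuous_dwave. Qed.

Lemma bm_wave s v : below1 s -> bm (lsum s (wave v)) (weight s * 2).
Proof. by move=> s1; apply: bm_lsum => //; [exact: measurable_wave|move=> y; exact: wave_bound]. Qed.

Lemma bm_dwave s v : 0 < v -> below1 s -> bm (lsum s (dwave v)) (weight s * (2 / v ^+ 2)).
Proof.
move=> v0 s1; apply: bm_lsum => //; first exact: measurable_dwave.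
by move=> y; exact: dwave_bound.
Qed.

Lemma volt_lsum s v t : 0 < v -> below1 s -> 0 <= t <= 1 ->
  volt (lsum s (wave v)) t = lsum s (dwave v) t.
Proof.
move=> v0 s1 t01; rewrite /volt /lsum.
elim: s s1 => [|p s ih] s1.
  rewrite big_nil -[RHS](Rintegral_zero lam); apply: eq_Rintegral => x _.
  by rewrite big_nil mul0r.
have p1 : p.2 <= 1 by apply: s1; rewrite mem_head.
have s1' : below1 s by move=> q qs; apply: s1; rewrite in_cons qs orbT.
under eq_Rintegral => x _ do rewrite big_cons mulrDl -mulrA.
have b1 : bm (fun x => wave v (p.2 - clip x) * step x t) (2 * 1).
  apply: (@bmM R (fun x => wave v (p.2 - clip x)) (fun x => step x t)).
    split; last by move=> x; apply: wave_bound; have /andP[c0 _] := clip_in x; lra.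
    apply: (measurableT_comp (measurable_wave v)).
    by apply: measurable_funB => //; exact: measurable_clip.
  by split; [exact: measurable_step|move=> x; exact: step_bound].
rewrite RintD.
- by rewrite RintZ ?(bm_integ b1)// volt_wave// ih// big_cons clip_id.
- exact: integZ (bm_integ b1).
- have b2 : bm (fun x => step x t) 1 by split; [exact: measurable_step|move=> x; exact: step_bound].
  exact: bm_integ (bmM (bm_wave v s1') b2).
Qed.

Lemma is_derive_lsum s v t : 0 < v ->
  is_derive v 1 (fun v => lsum s (wave v) t) (- (2 * v * lsum s (dwave v) t)).
Proof.
move=> v0; elim: s => [|p s ih]; rewrite /lsum.
  under eq_fun do rewrite big_nil.
  by rewrite big_nil mulr0 oppr0; exact: is_derive_cst.
under eq_fun do rewrite big_cons.
have h := is_deriveMr (is_derive_cst p.1 v 1) (is_derive_wave (p.2 - clip t) v0).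
have := is_deriveD h ih; move=> h'; apply: is_derive_eq h' _.
by rewrite big_cons mul0r add0r -/(lsum s _ t); ring.
Qed.

(** The variance that the smeared process has under the bridge. *)
Definition energy f : R := \int[(lam \x lam)%E]_z (f z.1 * f z.2 * kern z.1 z.2).

Lemma bm_kern2 (f h : R -> R) C D : bm f C -> bm h D ->
  measurable_fun setT (fun z : R * R => f z.1 * h z.2 * kern z.1 z.2) /\
  forall z : R * R, `|f z.1 * h z.2 * kern z.1 z.2| <= C * D.
Proof.
move=> [mf hf] [mh hh]; split.
  apply: measurable_funM; last by apply: measurable_kern; [exact: measurable_fst|exact: measurable_snd].
  apply: measurable_funM; first by apply: (measurableT_comp mf); exact: measurable_fst.
  by apply: (measurableT_comp mh); exact: measurable_snd.
move=> z; rewrite normrM -[leRHS]mulr1 ler_pM ?kern_bound//.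
by rewrite normrM ler_pM.
Qed.

Lemma integ_kern2 (f h : R -> R) C D : bm f C -> bm h D ->
  integ (lam \x lam)%E (fun z : R * R => f z.1 * h z.2 * kern z.1 z.2).
Proof.
move=> bf bh; have [m b] := bm_kern2 bf bh.
by apply: (@integ_prod_bounded _ _ _ _ _ lam lam _ (C * D)) => // x y; exact: (b (x, y)).
Qed.

Lemma coef_dwave s v : 0 < v -> below1 s ->
  \int[(lam \x lam)%E]_z (lsum s (dwave v) z.1 * lsum s (wave v) z.2 * kern z.1 z.2) =
  stein_coef (lsum s (wave v)).
Proof.
move=> v0 s1; have bw := bm_wave v s1; have bd := bm_dwave v0 s1.
rewrite -(Rint_section1 (integ_kern2 bd bw)) /stein_coef.
transitivity (\int[lam]_t (lsum s (dwave v) t * kernop (lsum s (wave v)) t)).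
  apply: eq_Rintegral => t _; rewrite /kernop -RintZ; last exact: integ_kern_section bw.
  by apply: eq_Rintegral => u _; rewrite /= mulrA.
apply: eq_lam_Rint; [exact: (bmM bd (bm_kernop bw)).1|exact: (bmM (bm_volt bw) (bm_kernop bw)).1|].
by move=> t t01; rewrite volt_lsum.
Qed.

Lemma kern2_swap (f h : R -> R) C D : bm f C -> bm h D ->
  \int[(lam \x lam)%E]_z (f z.1 * h z.2 * kern z.1 z.2) =
  \int[(lam \x lam)%E]_z (h z.1 * f z.2 * kern z.1 z.2).
Proof.
move=> bf bh; rewrite -(Rint_section1 (integ_kern2 bf bh)) (Rint_fubini (integ_kern2 bf bh)).
rewrite -(Rint_section1 (integ_kern2 bh bf)); apply: eq_Rintegral => t _.
by apply: eq_Rintegral => u _; rewrite /= kernC [f u * _]mulrC.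
Qed.

(** A symmetric quadratic form along a curve with velocity [- 2 v V rho]: the two halves of the
    product rule coincide by [kern2_swap], whence the factor 4. *)
Lemma is_derive_energy s v : 0 < v -> below1 s ->
  is_derive v 1 (fun v => energy (lsum s (wave v)))
    (- (4 * v * stein_coef (lsum s (wave v)))).
Proof.
move=> v0 s1.
pose df w (z : R * R) := - (2 * w) * (lsum s (dwave w) z.1 * lsum s (wave w) z.2 * kern z.1 z.2 +
  lsum s (wave w) z.1 * lsum s (dwave w) z.2 * kern z.1 z.2).
have v2 : 0 < v / 2 by rewrite divr_gt0.
have W0 : 0 <= weight s by apply: sumr_ge0.
have vpos w : `|w - v| < v / 2 -> v / 2 < w by rewrite ltr_norml => /andP[h1 h2]; lra.
(* Domination on [|w - v| < v / 2]: the bound [2 / w^2] on [dwave] requires [w] to stay above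
   [v / 2], and [w <= 2 v] bounds the factor [2 w]. *)
pose G := 2 * (weight s * 2) * (weight s * (2 / (v / 2) ^+ 2)) * (2 * (2 * v)).
have G0 : 0 <= G by rewrite !mulr_ge0// ?invr_ge0 ?exprn_ge0// ltW.
have D := @is_derive_Rint _ _ _ (lam \x lam)%E
  (fun w z => lsum s (wave w) z.1 * lsum s (wave w) z.2 * kern z.1 z.2) df (fun=> G) v (v / 2) v2.
rewrite (_ : - _ = \int[(lam \x lam)%E]_z df v z); last first.
  have i1 := integ_kern2 (bm_dwave v0 s1) (bm_wave v s1).
  have i2 := integ_kern2 (bm_wave v s1) (bm_dwave v0 s1).
  rewrite /df RintZ; last exact: integD.
  rewrite RintD// [X in _ + X](kern2_swap (bm_wave v s1) (bm_dwave v0 s1)).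
  by rewrite coef_dwave//; ring.
apply: D.
- by move=> w; exact: integ_kern2 (bm_wave w s1) (bm_wave w s1).
- move=> w z /vpos w0; have {}w0 : 0 < w := lt_trans v2 w0.
  have := is_deriveMr (is_deriveMr (is_derive_lsum s z.1 w0) (is_derive_lsum s z.2 w0))
    (is_derive_cst (kern z.1 z.2) w 1).
  move=> h; apply: is_derive_eq h _; rewrite /df /=; ring.
- by move=> _.
- by apply: (@integ_prod_bounded _ _ _ _ _ lam lam _ G) => // x y; rewrite ger0_norm.
- move=> w z hw; have w0 := vpos w hw; have wp : 0 < w := lt_trans v2 w0.
  have wv : w <= 2 * v by move: hw; rewrite ltr_norml => /andP[h1 h2]; lra.
  have bd t : `|lsum s (dwave w) t| <= weight s * (2 / (v / 2) ^+ 2).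
    apply: le_trans ((bm_dwave wp s1).2 t) _; rewrite ler_wpM2l// ler_wpM2l// lef_pV2 ?posrE ?exprn_gt0//.
    by rewrite lerXn2r ?nnegrE ?(ltW v2) ?(ltW wp)// ltW.
  have bw t := (bm_wave w s1).2 t.
  rewrite /df normrM mulrC ler_pM//; last first.
    by rewrite normrN ger0_norm ?mulr_ge0 ?(ltW wp)// ler_wpM2l.
  have b1 : bm (lsum s (dwave w)) (weight s * (2 / (v / 2) ^+ 2)).
    by split=> //; exact: (bm_dwave wp s1).1.
  apply: le_trans (ler_normD _ _) _.
  have -> : 2 * (weight s * 2) * (weight s * (2 / (v / 2) ^+ 2)) =
    weight s * (2 / (v / 2) ^+ 2) * (weight s * 2) + weight s * 2 * (weight s * (2 / (v / 2) ^+ 2)) by ring.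
  by apply: lerD; [exact: (bm_kern2 b1 (bm_wave w s1)).2|exact: (bm_kern2 (bm_wave w s1) b1).2].
Qed.

End shapes.

Lemma cvg_comp_continuous (R : realType) (g : R -> R) (u : nat -> R) (l : R) : continuous g ->
  u n @[n --> \oo] --> l -> g (u n) @[n --> \oo] --> g l.
Proof. by move=> cg h; exact: (cvg_comp _ _ h (cg l)). Qed.

(** * Characteristic functions along the flow *)

Section flow.
Context d (T : measurableType d) (R : realType) (P : probability T R).
Variable B : R -> T -> R.
Local Notation lam := (@lam R).
Local Notation smear := (smear B).
Local Notation pathnorm := (pathnorm B).
Hypothesis mB : measurable_fun setT (fun z : R * T => B z.1 z.2).
Hypothesis iB : forall x, integ lam (B ^~ x).
Hypothesis iB2 : integ (lam \x P)%E (fun z : R * T => B z.1 z.2 ^+ 2).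
Hypothesis stein_density : forall rho C a, bm rho C ->
  \int[P]_x (sin (smear rho x + a) * smear (volt rho) x) =
  stein_coef rho * \int[P]_x cos (smear rho x + a).
Implicit Types (f h rho : R -> R) (s : seq (R * R)) (y u t v w a l : R).

Definition phase f a : R := \int[P]_x cos (smear f x + a).

Lemma phase_limit (f_ : nat -> R -> R) f C a : (forall n, bm (f_ n) C) ->
  (forall t, f_ n t @[n --> \oo] --> f t) ->
  phase (f_ n) a @[n --> \oo] --> phase f a.
Proof.
move=> bf cf; have sm x : smear (f_ n) x @[n --> \oo] --> smear f x.
  have [||||_] // := @Rint_dct _ _ _ lam (fun n t => f_ n t * B t x) (fun t => f t * B t x)
    (fun t => C * `|B t x|).
  - by move=> n; apply: integ_meas (integ_smear_path iB x (bf n)).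
  - exact: integZ (integ_norm (iB x)).
  - by move=> t; exact: cvgMl.
  - by move=> n t; rewrite normrM ler_wpM2r//; exact: (bf n).2.
have [||||_] // := @Rint_dct _ _ _ P (fun n x => cos (smear (f_ n) x + a))
  (fun x => cos (smear f x + a)) (fun=> 1).
- move=> n; have := measurable_cosl 1 a (measurable_smear mB iB2 (bf n)).
  by under eq_fun do rewrite mul1r.
- exact: integ_cst.
- move=> x; apply: (cvg_comp_continuous (@continuous_cos R)).
  by apply: cvgD => //; exact: cvg_cst.
- by move=> n x; exact: cos_max.
Qed.

Lemma energy_limit (f_ : nat -> R -> R) f C : (forall n, bm (f_ n) C) ->
  (forall t, f_ n t @[n --> \oo] --> f t) ->
  energy (f_ n) @[n --> \oo] --> energy f.
Proof.
move=> bf cf.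
have [||||_] // := @Rint_dct _ _ _ (lam \x lam)%E (fun n z => f_ n z.1 * f_ n z.2 * kern z.1 z.2)
  (fun z => f z.1 * f z.2 * kern z.1 z.2) (fun=> C * C).
- by move=> n; exact: (bm_kern2 (bf n) (bf n)).1.
- by apply: (@integ_prod_bounded _ _ _ _ _ lam lam _ `|C * C|) => // x y.
- by move=> z; apply: cvgMl; exact: cvgM.
- by move=> n z; exact: (bm_kern2 (bf n) (bf n)).2.
Qed.

Definition characteristic f := forall a, phase f a = cos a * expR (- (energy f / 2)).

Lemma characteristic_limit (f_ : nat -> R -> R) f C : (forall n, bm (f_ n) C) ->
  (forall t, f_ n t @[n --> \oo] --> f t) -> (forall n, characteristic (f_ n)) ->
  characteristic f.
Proof.
move=> bf cf hf a.
have h1 := @phase_limit f_ f C a bf cf.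
have h2 : cos a * expR (- (energy (f_ n) / 2)) @[n --> \oo] --> cos a * expR (- (energy f / 2)).
  apply: cvgMr; apply: (cvg_comp_continuous (@continuous_expR R)).
  by apply: cvgN; apply: cvgMl; exact: energy_limit bf cf.
have e : (fun n => phase (f_ n) a) = (fun n => cos a * expR (- (energy (f_ n) / 2))).
  by apply/funext => n; exact: hf.
by rewrite e in h1; exact: (cvg_unique (@norm_hausdorff _ _) h1 h2).
Qed.

Lemma is_derive_smear s v x : 0 < v -> below1 s ->
  is_derive v 1 (fun v => smear (lsum s (wave v)) x) (- (2 * v * smear (lsum s (dwave v)) x)).
Proof.
move=> v0 s1; have v2 : 0 < v / 2 by rewrite divr_gt0.
have W0 : 0 <= weight s by apply: sumr_ge0.
have vpos w : `|w - v| < v / 2 -> v / 2 < w by rewrite ltr_norml => /andP[h1 h2]; lra.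
have -> : - (2 * v * smear (lsum s (dwave v)) x) =
    \int[lam]_t (- (2 * v) * (lsum s (dwave v) t * B t x)).
  by rewrite RintZ; [rewrite mulNr|exact: integ_smear_path (bm_dwave v0 s1)].
apply: (@is_derive_Rint _ _ _ lam (fun v t => lsum s (wave v) t * B t x)
  (fun v t => - (2 * v) * (lsum s (dwave v) t * B t x))
  (fun t => 2 * (2 * v) * (weight s * (2 / (v / 2) ^+ 2)) * `|B t x|) v (v / 2)) => //.
- by move=> w; exact: integ_smear_path (bm_wave w s1).
- move=> w t /vpos w0; have {}w0 : 0 < w := lt_trans v2 w0.
  have := is_deriveMr (is_derive_lsum s t w0) (is_derive_cst (B t x) w 1).
  by move=> h; apply: is_derive_eq h _ => /=; ring.
- by move=> t; rewrite !mulr_ge0// ?invr_ge0 ?exprn_ge0// ltW.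
- exact: integZ (integ_norm (iB x)).
- move=> w t hw; have w0 := vpos w hw; have wp : 0 < w := lt_trans v2 w0.
  have wv : w <= 2 * v by move: hw; rewrite ltr_norml => /andP[h1 h2]; lra.
  rewrite normrM -mulrA ler_pM//; first by rewrite normrN ger0_norm ?mulr_ge0 ?(ltW wp)// ler_wpM2l.
  rewrite normrM ler_wpM2r//; apply: le_trans ((bm_dwave wp s1).2 t) _.
  rewrite ler_wpM2l// ler_wpM2l// lef_pV2 ?posrE ?exprn_gt0//.
  by rewrite lerXn2r ?nnegrE ?(ltW v2) ?(ltW wp)// ltW.
Qed.

Lemma smear_volt_wave s v x : 0 < v -> below1 s ->
  smear (volt (lsum s (wave v))) x = smear (lsum s (dwave v)) x.
Proof.
move=> v0 s1; apply: eq_lam_Rint.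
- exact: integ_meas (integ_smear_path iB x (bm_volt (bm_wave v s1))).
- exact: integ_meas (integ_smear_path iB x (bm_dwave v0 s1)).
- by move=> t t01; rewrite volt_lsum.
Qed.

(** The chain rule yields the mean of [2 v] times [sin (X + a)] times the smeared process of
    [V rho], exactly the product that [stein_density] evaluates. *)
Lemma is_derive_phase s v a : 0 < v -> below1 s ->
  is_derive v 1 (fun v => phase (lsum s (wave v)) a)
    (2 * v * stein_coef (lsum s (wave v)) * phase (lsum s (wave v)) a).
Proof.
move=> v0 s1; have v2 : 0 < v / 2 by rewrite divr_gt0.
have W0 : 0 <= weight s by apply: sumr_ge0.
have vpos w : `|w - v| < v / 2 -> v / 2 < w by rewrite ltr_norml => /andP[h1 h2]; lra.
pose K := weight s * (2 / (v / 2) ^+ 2).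
have K0 : 0 <= K by rewrite !mulr_ge0// ?invr_ge0 ?exprn_ge0// ltW.
have msm w := measurable_smear mB iB2 (bm_wave w s1).
have mc w : measurable_fun setT (fun x => cos (smear (lsum s (wave w)) x + a)).
  by have := measurable_cosl 1 a (msm w); under eq_fun do rewrite mul1r.
have ms w : measurable_fun setT (fun x => sin (smear (lsum s (wave w)) x + a)).
  by have := measurable_sinl 1 a (msm w); under eq_fun do rewrite mul1r.
have -> : 2 * v * stein_coef (lsum s (wave v)) * phase (lsum s (wave v)) a =
    \int[P]_x ((2 * v) * (sin (smear (lsum s (wave v)) x + a) * smear (lsum s (dwave v)) x)).
  rewrite RintZ.
    rewrite -mulrA -(stein_density a (bm_wave v s1)); congr (_ * _).
    by apply: eq_Rintegral => x _; rewrite smear_volt_wave.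
  by apply: (integ_mulb (C := 1) (integ_smear mB iB iB2 (bm_dwave v0 s1)) (ms v)) => x; exact: sin_max.
apply: (@is_derive_Rint _ _ _ P (fun v x => cos (smear (lsum s (wave v)) x + a))
  (fun v x => (2 * v) * (sin (smear (lsum s (wave v)) x + a) * smear (lsum s (dwave v)) x))
  (fun x => 2 * (2 * v) * K * pathnorm x) v (v / 2)) => //.
- by move=> w; apply: (@integ_bounded _ _ _ P _ 1) => // x; exact: cos_max.
- move=> w x /vpos w0; have {}w0 : 0 < w := lt_trans v2 w0.
  have h := is_deriveD (is_derive_smear x w0 s1) (is_derive_cst a w 1).
  have := @is_derive1_comp R (@cos R) (fun w => smear (lsum s (wave w)) x + a) w _ _ (is_derive_cos _) h.
  by move=> h'; apply: is_derive_eq h' _ => /=; ring.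
- by move=> x; apply: mulr_ge0 (pathnorm_ge0 _ _); apply: mulr_ge0 K0; rewrite !mulr_ge0// ltW.
- exact: integZ (integ_pathnorm mB iB2).
- move=> w x hw; have w0 := vpos w hw; have wp : 0 < w := lt_trans v2 w0.
  have wv : w <= 2 * v by move: hw; rewrite ltr_norml => /andP[h1 h2]; lra.
  rewrite normrM -mulrA ler_pM//; first by rewrite ger0_norm ?mulr_ge0 ?(ltW wp)// ler_wpM2l.
  rewrite normrM -[leRHS]mul1r ler_pM ?sin_max//.
  apply: le_trans (smear_bound iB x (bm_dwave wp s1)) _; rewrite ler_wpM2r ?pathnorm_ge0//.
  rewrite ler_wpM2l// ler_wpM2l// lef_pV2 ?posrE ?exprn_gt0//.
  by rewrite lerXn2r ?nnegrE ?(ltW v2) ?(ltW wp)// ltW.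
Qed.

(** The phase is multiplied at the rate [2 v stein_coef], and half the energy decreases at the same
    rate. *)
Lemma flow_constant s v w a : 0 < v -> v <= w -> below1 s ->
  phase (lsum s (wave v)) a * expR (energy (lsum s (wave v)) / 2) =
  phase (lsum s (wave w)) a * expR (energy (lsum s (wave w)) / 2).
Proof.
move=> v0 vw s1.
pose H u := phase (lsum s (wave u)) a * expR (energy (lsum s (wave u)) / 2).
have dH u : 0 < u -> is_derive u 1 H 0.
  move=> u0; have h1 := is_deriveMr (is_derive_energy u0 s1) (is_derive_cst (2^-1 : R) u 1).
  have := is_deriveMr (is_derive_phase a u0 s1) (is_derive_expf h1).
  by move=> h; apply: is_derive_eq h _ => /=; rewrite mulr0 addr0; field.
have [||c _] := @MVT_segment R H (fun=> 0) v w vw.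
- by move=> u; rewrite in_itv/= => /andP[vu _]; apply: dH; exact: lt_trans vu.
- apply: continuous_in_subspaceT => u; rewrite mem_setE in_itv/= => /andP[vu _].
  exact: is_derive_cont (dH u (lt_le_trans v0 vu)).
- by rewrite mul0r => /subr0_eq e; exact: (esym e).
Qed.

Lemma characteristic_wave s v : 0 < v -> below1 s -> characteristic (lsum s (wave v)).
Proof.
move=> v0 s1 a.
pose f_ n := lsum s (wave (v + n%:R)).
have bf n : bm (f_ n) (weight s * 2) by exact: bm_wave.
have W0 : 0 <= weight s by apply: sumr_ge0.
have cf t : f_ n t @[n --> \oo] --> (0 : R).
  have h (n : nat) : `|f_ n t| <= weight s * (v + n%:R)^-1.
    by apply: lsum_bound => // y _; apply: wave_decay; rewrite ltr_wpDr.
  apply: cvg_to0 h _; rewrite -[X in _ --> X](mulr0 (weight s)); apply: cvgMr.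
  apply/gtr0_cvgV0; first by near=> n; rewrite ltr_wpDr.
  apply/cvgryPge => A; near=> n.
  have : A <= n%:R by near: n; exact: nbhs_infty_ger.
  by move=> h1; rewrite (le_trans h1)// lerDr ltW.
have hc := @phase_limit f_ (fun=> 0) _ a bf cf.
have he := @energy_limit f_ (fun=> 0) _ bf cf.
have phase0 : phase (fun=> 0) a = cos a.
  rewrite /phase -[RHS](Rint_probability_cst P); apply: eq_Rintegral => x _.
  rewrite (_ : smear _ x = 0) ?add0r// -[RHS](Rintegral_zero lam).
  by apply: eq_Rintegral => t _; rewrite mul0r.
have energy0 : energy (fun _ : R => 0 : R) = 0.
  rewrite /energy -[RHS](Rintegral_zero (lam \x lam)%E).
  by apply: eq_Rintegral => z _; rewrite !mul0r.
have hH : phase (f_ n) a * expR (energy (f_ n) / 2) @[n --> \oo] --> cos a.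
  have : phase (f_ n) a * expR (energy (f_ n) / 2) @[n --> \oo] -->
      phase (fun=> 0) a * expR (energy (fun _ : R => 0 : R) / 2).
    by apply: cvgM => //; apply: (cvg_comp_continuous (@continuous_expR R)); exact: cvgMl.
  by rewrite phase0 energy0 mul0r expR0 mulr1.
have cst n : phase (f_ n) a * expR (energy (f_ n) / 2) =
    phase (lsum s (wave v)) a * expR (energy (lsum s (wave v)) / 2).
  by apply: (esym (flow_constant a v0 _ s1)); rewrite lerDl.
move: hH; under eq_fun do rewrite cst.
move=> /cvg_lim; rewrite lim_cst// => /(_ (@norm_hausdorff _ _)) <-.
by rewrite -mulrA -expRD subrr expR0 mulr1.
Unshelve. all: by end_near. Qed.

End flow.

Lemma Rint_step (R : realType) (u : R) : \int[@lam R]_t step u t = clip u.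
Proof.
pose A := (`]-oo, u[%classic : set R).
rewrite /Rintegral (_ : (fun t => _) = (fun t => (\1_A t)%:E)); last first.
  by apply/funext => t; rewrite /step indicE mem_setE in_itv.
rewrite integral_indic//; last exact: measurable_itv.
rewrite -[X in fine X = _]/(@lam R (A `&` setT)) lamE setIT /clip /A.
case: (leP u 0) => u0.
  rewrite (_ : _ `&` _ = set0) ?measure0 ?min_l ?max_l//; first by rewrite (le_trans u0).
  by rewrite -subset0 => t /=; rewrite !in_itv/= => -[h /andP[h1 _]]; have := le_lt_trans h1 h; rewrite ltNge u0.
case: (leP u 1) => u1.
  rewrite (_ : _ `&` _ = `[0, u[%classic).
    by rewrite lebesgue_measure_itv/= lte_fin u0 -EFinD subr0 max_r// ltW.
  apply/seteqP; split => t /=; rewrite !in_itv/=; first by move=> [-> /andP[->]].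
  by move=> /andP[-> h]; split=> //; rewrite (le_trans (ltW h)).
rewrite (_ : _ `&` _ = `[0, 1]%classic).
  by rewrite lebesgue_measure_itv/= lte_fin ltr01 -EFinD subr0 max_r.
apply/seteqP; split => t /=; rewrite !in_itv/=; first by move=> [].
by move=> /andP[-> h]; rewrite h (le_lt_trans h).
Qed.

(** * From waves to roots, ramps and indicators *)

Section stages.
Context d (T : measurableType d) (R : realType) (P : probability T R).
Variable B : R -> T -> R.
Local Notation lam := (@lam R).
Local Notation smear := (smear B).
Hypothesis mB : measurable_fun setT (fun z : R * T => B z.1 z.2).
Hypothesis iB : forall x, integ lam (B ^~ x).
Hypothesis iB2 : integ (lam \x P)%E (fun z : R * T => B z.1 z.2 ^+ 2).
Hypothesis stein_density : forall rho C a, bm rho C ->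
  \int[P]_x (sin (smear rho x + a) * smear (volt rho) x) =
  stein_coef rho * \int[P]_x cos (smear rho x + a).
Implicit Types (f h rho : R -> R) (s : seq (R * R)) (y u t v w a l : R).

(* The set of solved profiles grows from [wave s] to its limit [2 * Num.sqrt y] as
   [s] tends to 0, then to ramps and to indicators. *)
Definition solved h := forall s, below1 s -> characteristic P B (lsum s h).

Lemma solved_limit (h_ : nat -> R -> R) h C : (forall n, measurable_fun setT (h_ n)) ->
  (forall n y, y <= 1 -> `|h_ n y| <= C) ->
  (forall y, y <= 1 -> h_ n y @[n --> \oo] --> h y) ->
  (forall n, solved (h_ n)) -> solved h.
Proof.
move=> mh hC ch sh s s1; apply: (characteristic_limit mB iB iB2 (f_ := fun n => lsum s (h_ n))
  (C := weight s * C)).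
- by move=> n; apply: (bm_lsum s1 (mh n)) => y; exact: hC.
- move=> t; rewrite /lsum; elim: s s1 => [|p s ih] s1.
    by under eq_fun do rewrite big_nil; rewrite big_nil; exact: cvg_cst.
  under eq_fun do rewrite big_cons; rewrite big_cons; apply: cvgD.
    apply: cvgMr; apply: ch; have /andP[c0 _] := clip_in t.
    by have := s1 p (mem_head _ _); lra.
  by apply: ih => q qs; apply: s1; rewrite in_cons qs orbT.
- by move=> n; exact: sh.
Qed.

(** Delays [q.2 >= 0] only lower the end points [u], so that combinations of delayed profiles stay
    within the admissible densities. *)
Lemma solved_shifts h (r : seq (R * R)) : (forall q, q \in r -> 0 <= q.2) -> solved h ->
  solved (fun y => \sum_(q <- r) q.1 * h (y - q.2)).
Proof.
move=> r0 sh s s1.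
have -> : lsum s (fun y => \sum_(q <- r) q.1 * h (y - q.2)) =
    lsum [seq (p.1 * q.1, p.2 - q.2) | p <- s, q <- r] h.
  apply/funext => t; rewrite /lsum big_allpairs_dep; apply: eq_bigr => p _.
  by rewrite mulr_sumr; apply: eq_bigr => q _ /=; rewrite mulrA addrAC.
apply: sh => _ /allpairsP[[p q] [/= ps qr ->]] /=.
by have := s1 _ ps; have := r0 _ qr; lra.
Qed.

Lemma solved_sqrt : solved (fun y => 2 * Num.sqrt y).
Proof.
apply: (@solved_limit (fun n => wave n.+1%:R^-1) _ 2).
- by move=> n; exact: measurable_wave.
- by move=> n y; exact: wave_bound.
- move=> y _; have := @cvg_scaled_sin R (2 * Num.sqrt y).
  rewrite (_ : (fun n => wave n.+1%:R^-1 y) = (fun m => m.+1%:R * sin (2 * Num.sqrt y / m.+1%:R)))//.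
  by apply/funext => n; rewrite /wave invrK mulrC.
- by move=> n s s1; apply: characteristic_wave => //; rewrite invr_gt0.
Qed.

(** Equal to [pi / 2], the Beta constant of the Abel half-integral. *)
Let kappa : R := \int[lam]_x (2 * Num.sqrt (1 - x ^+ 2)).

Let continuous_sqrt_sub y : continuous (fun x : R => 2 * Num.sqrt (y - x ^+ 2)).
Proof.
move=> x; apply: cvgMr; apply: (@continuous_comp _ _ _ (fun x : R => y - x ^+ 2) Num.sqrt); last exact: sqrt_continuous.
by apply: cvgB; [exact: cvg_cst|exact: exprn_continuous].
Qed.

Let sqrt_sub_bound y x : y <= 1 -> `|2 * Num.sqrt (y - x ^+ 2)| <= 2.
Proof.
move=> y1; rewrite ger0_norm ?mulr_ge0 ?sqrtr_ge0// ler_piMr// -[leRHS]sqrtr1 ler_wsqrtr//.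
by have := sqr_ge0 x; lra.
Qed.

Let bm_sqrt_sub y : y <= 1 -> bm (fun x => 2 * Num.sqrt (y - x ^+ 2)) 2.
Proof.
move=> y1; split; last by move=> x; exact: sqrt_sub_bound.
by apply: continuous_measurable_fun; exact: continuous_sqrt_sub.
Qed.

Lemma kappa_gt0 : 0 < kappa.
Proof.
have bs := bm_step (1 / 2 : R).
(* On [[0, 1 / 2[] the integrand is at least 1. *)
have : \int[lam]_t step (1 / 2) t <= kappa.
  apply: le_lam_Rint; [exact: bm_integ bs|exact: bm_integ (bm_sqrt_sub (lexx 1))|].
  move=> x /andP[x0 x1]; rewrite /step; case: ltP => hx; last by rewrite mulr_ge0 ?sqrtr_ge0.
  have h : 1 / 2 <= Num.sqrt (1 - x ^+ 2).
    rewrite -[leLHS]ger0_norm ?divr_ge0// -sqrtr_sqr ler_wsqrtr//; nra.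
  by rewrite /=; lra.
by rewrite Rint_step clip_id => [h|]; [lra|apply/andP; split; lra].
Qed.

(* The substitution [x = Num.sqrt y * v] makes the average linear in [y]. *)
Lemma sqrt_average y : y <= 1 ->
  \int[lam]_x (2 * Num.sqrt (y - x ^+ 2)) = kappa * Num.max y 0.
Proof.
move=> y1; have [y0|y0] := leP y 0.
  rewrite mulr0 -[RHS](Rintegral_zero lam); apply: eq_Rintegral => x _.
  by rewrite ler0_sqrtr ?mulr0//; have := sqr_ge0 x; lra.
pose c := (Num.sqrt y)^-1; have sy : 0 < Num.sqrt y by rewrite sqrtr_gt0.
have c0 : 0 < c by rewrite invr_gt0.
have c1 : 1 <= c by rewrite -invr1 lef_pV2 ?posrE// -[leRHS]sqrtr1 ler_wsqrtr.
have mg (z : R) : measurable_fun setT (fun x : R => (2 * Num.sqrt (z - x ^+ 2))%:E).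
  by apply/measurable_EFinP; apply: continuous_measurable_fun; exact: continuous_sqrt_sub.
pose F := (fun x : R => (2 * Num.sqrt (1 - x ^+ 2))%:E) \_ (`[0, 1]%classic : set R).
have hF : (\int[lebesgue_measure]_x F x = kappa%:E)%E.
  rewrite /F -integral_mkcond lam_integral// /kappa Rint_EFin//.
  exact: bm_integ (bm_sqrt_sub (lexx 1)).
have mF : measurable_fun setT F by apply/(measurable_restrictT _ _).1 => //; exact: measurable_funTS.
have F0 x : (0 <= F x)%E by rewrite /F patchE; case: ifP => _ //; rewrite lee_fin mulr_ge0 ?sqrtr_ge0.
have := ge0_integral_affine 0 c0 mF F0; rewrite hF invrK => h.
apply/EFin_inj; rewrite Rint_EFin; last exact: bm_integ (bm_sqrt_sub y1).
rewrite -lam_integral// integral_mkcond.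
transitivity (\int[lebesgue_measure]_x ((Num.sqrt y)%:E * F (c * x + 0)%R))%E.
  apply: eq_integral => x _; rewrite /F !patchE !mem_setE !in_itv/= addr0.
  rewrite pmulr_rge0//; case: (leP 0 x) => x0 /=; last by rewrite mule0.
  have cx : (c * x <= 1) = (x <= Num.sqrt y) by rewrite mulrC ler_pdivrMr// mul1r.
  rewrite cx; have [xy|xy] := leP x (Num.sqrt y).
    rewrite (_ : x <= 1) -?EFinM; last by apply: (le_trans xy); rewrite -[leRHS]sqrtr1 ler_wsqrtr.
    congr EFin; rewrite mulrCA -sqrtrM ?(ltW y0)// mulrBr mulr1 exprMn /c exprVn sqr_sqrtr ?(ltW y0)//.
    by rewrite mulrA mulfV ?mul1r// gt_eqF.
  rewrite mule0; case: ifP => // _; rewrite ler0_sqrtr ?mulr0//.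
  rewrite subr_le0 -[y in X in X <= _](sqr_sqrtr (ltW y0)).
  by rewrite lerXn2r ?nnegrE ?(ltW sy)// ltW.
rewrite ge0_integralZl//.
- rewrite h -!EFinM; congr EFin; rewrite mulrA -expr2 sqr_sqrtr ?(ltW y0)// mulrC.
  by [].
- apply: (measurableT_comp mF); apply: measurable_funD => //; exact: measurable_funM.
Qed.

(** Averaging over the delays [x^2] raises the exponent of the profile from [1 / 2] to 1. The
    Riemann sums of this average are finite combinations of delayed roots, to which [solved_shifts]
    applies. *)
Lemma solved_ramp : solved (fun y => Num.max y 0).
Proof.
have k0 : kappa != 0 by rewrite gt_eqF// kappa_gt0.
pose r n : seq (R * R) := [seq (kappa^-1 * n.+1%:R^-1, ((j%:R + 0) / n.+1%:R) ^+ 2) | j <- iota 0 n.+1].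
have rE n y : \sum_(q <- r n) q.1 * (2 * Num.sqrt (y - q.2)) =
    kappa^-1 * rs n.+1 (fun x => 2 * Num.sqrt (y - x ^+ 2)) 0.
  rewrite /r big_map /rs mulrA mulr_sumr -[iota _ _]/(index_iota 0 n.+1) big_mkord.
  by apply: eq_bigr => j _.
apply: (@solved_limit (fun n y => \sum_(q <- r n) q.1 * (2 * Num.sqrt (y - q.2))) _ (`|kappa^-1| * 2)).
- move=> n; apply: measurable_sum => q; apply: measurable_funM => //; apply: measurable_funM => //.
  apply: continuous_measurable_fun => y.
  apply: (@continuous_comp _ _ _ (fun y => y - q.2) Num.sqrt); last exact: sqrt_continuous.
  by apply: cvgB; [exact: cvg_id|exact: cvg_cst].
- move=> n y y1; rewrite rE normrM ler_wpM2l//; apply: rs_bound => // x; exact: sqrt_sub_bound.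
- move=> y y1; under eq_fun do rewrite rE.
  rewrite (_ : Num.max y 0 = kappa^-1 * \int[lam]_x (2 * Num.sqrt (y - x ^+ 2))); last first.
    by rewrite sqrt_average// mulKf.
  apply: cvgMr; apply/cvgrPdist_le => /= e e0; near=> n; rewrite distrC.
  near: n; have := rs_cont (bm_integ (bm_sqrt_sub y1)) (continuous_sqrt_sub (y := y)) e0.
  by apply: filterS => n; apply; rewrite lexx ler01.
- move=> n; apply: solved_shifts solved_sqrt.
  by move=> q /mapP[j _ ->]; exact: sqr_ge0.
Unshelve. all: by end_near. Qed.

(** Difference quotients of the ramp stay between 0 and 1. Backward ones are used: they are delays,
    and they vanish for [y <= 0], which gives the strict indicator. *)
Lemma solved_indicator : solved (fun y => (0 < y)%R%:R).
Proof.
pose r n : seq (R * R) := [:: (n.+1%:R, 0); (- n.+1%:R, n.+1%:R^-1)].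
have rE n y : \sum_(q <- r n) q.1 * (Num.max (y - q.2) 0) =
    n.+1%:R * (Num.max y 0 - Num.max (y - n.+1%:R^-1) 0).
  by rewrite /r !big_cons big_nil /= subr0 addr0 mulNr mulrBr.
have n0 n : 0 < n.+1%:R^-1 :> R by rewrite invr_gt0.
apply: (@solved_limit (fun n y => \sum_(q <- r n) q.1 * (Num.max (y - q.2) 0)) _ 1).
- move=> n; apply: measurable_sum => q; apply: measurable_funM => //.
  by apply: measurable_maxr => //; apply: measurable_funB.
- move=> n y _; rewrite rE normrM ger0_norm// -ler_pdivlMl// mulr1.
  have := n0 n; set k := _^-1 => k0.
  by rewrite /Num.max; case: ltP => h1; case: ltP => h2; rewrite ler_norml; apply/andP; split; lra.
- move=> y _; under eq_fun do rewrite rE.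
  have /orP[y0|y0] : (0 < y) || (y <= 0) by rewrite leNgt orbN.
  2:{
    rewrite ltNge y0.
    have -> : (fun n => n.+1%:R * (Num.max y 0 - Num.max (y - n.+1%:R^-1) 0)) = fun=> 0.
      apply/funext => n; have k0 := n0 n; rewrite !max_r ?subrr ?mulr0//.
      by rewrite subr_le0 (le_trans y0)// ltW.
    exact: cvg_cst. }
  rewrite y0; apply: cvg_near_cst; near=> n.
  have h : n.+1%:R^-1 <= y.
    rewrite -[y]invrK lef_pV2 ?posrE ?invr_gt0// -natr1.
    have : y^-1 <= n%:R by near: n; exact: nbhs_infty_ger.
    by move=> h; rewrite (le_trans h)// lerDl.
  by rewrite !max_l ?(ltW y0) ?subr_ge0// opprB addrC subrK mulfV// pnatr_eq0.
- move=> n; apply: solved_shifts solved_ramp.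
  by move=> q; rewrite !inE => /orP[]/eqP -> //=; exact: ltW.
Unshelve. all: by end_near. Qed.

End stages.

(** * Path space and local means *)

Section path_space.
Variable R : realType.
Local Notation lam := (@lam R).
Implicit Types (x y : L2 R) (t u v r e : R).

Lemma measurable_repr x : measurable_fun setT (L2_repr x).
Proof.
have := @measurable_funPT _ _ (measurableTypeR R) (measurableTypeR R)
  (repr (LebesgueSpace.sort (x : LspaceType2 (@leb01 R))))%qT.
exact.
Qed.

Lemma Lnorm2_lt (f : R -> R) (c : R) : measurable_fun setT f ->
  ('N[@leb01 R]_2%:E[EFin \o f] < +oo)%E ->
  integ lam (fun t => f t ^+ 2) /\
  (0 < c -> ('N[@leb01 R]_2%:E[EFin \o f] < c%:E)%E -> \int[lam]_t (f t ^+ 2) <= c ^+ 2).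
Proof.
move=> mf fin; set N := 'N[_]_2%:E[_]%E in fin *.
have E : (\int[lam]_t (f t ^+ 2)%:E = N `^ 2)%E.
  rewrite /N poweR_Lnorm ?pnatr_eq0//; apply: eq_integral => t _ /=.
  by rewrite powR_mulrn// real_normK ?num_real.
have N0 : (0 <= N)%E := Lnorm_ge0 _ _ _.
have mf2 : measurable_fun setT (fun t => f t ^+ 2) by exact: measurable_funX.
have i2 : integ lam (fun t => f t ^+ 2).
  apply/integrableP; split; first exact/measurable_EFinP.
  under eq_integral => t _ do rewrite /= ger0_norm ?sqr_ge0//.
  by rewrite E poweR_lty.
split => // c0 Nc; rewrite -lee_fin Rint_EFin// E.
move: fin Nc N0; case: N {E} => [n| |]//= _; rewrite lte_fin lee_fin => nc n0.
by rewrite lee_fin powR_mulrn// lerXn2r ?nnegrE ?(ltW c0)// ltW.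
Qed.

Lemma integ_repr_sqr x : integ lam (fun t => L2_repr x t ^+ 2).
Proof.
have := @Lebesgue_finite _ _ _ _ _ _ (x : LspaceType2 (@leb01 R)) => h.
exact: (Lnorm2_lt 0 (measurable_repr x) h).1.
Qed.

Lemma integ_repr x : integ lam (L2_repr x).
Proof. apply: (@integ_sqr _ _ _ lam); [exact: measurable_repr|exact: integ_repr_sqr]. Qed.

Lemma L2_dist_lt x y e : 0 < e -> (L2_dist x y < e%:E)%E ->
  \int[lam]_t ((L2_repr x t - L2_repr y t) ^+ 2) <= e ^+ 2.
Proof.
move=> e0 h; have mf : measurable_fun setT (L2_repr x \- L2_repr y).
  by apply: measurable_funB; exact: measurable_repr.
by apply: (Lnorm2_lt e mf (lt_trans h (ltry _))).2.
Qed.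

(** The primitive of the path at [v]. It is a continuous functional on L^2, and measurability of the
    process for the Borel sigma-field is derived from it. *)
Definition prim v (x : Omega R) : R := \int[lam]_u (step v u * L2_repr x u).

Lemma integ_prim v x : integ lam (fun u => step v u * L2_repr x u).
Proof. by have [mv hv] := bm_step v; exact: integ_mulb (integ_repr x) mv hv. Qed.

(** Replaces Cauchy-Schwarz: integrated, with [dl] chosen at the end, it avoids square roots of
    integrals. *)
Lemma amgm (a b dl : R) : 0 < dl -> `|a * b| <= (dl * a ^+ 2 + b ^+ 2 / dl) / 2.
Proof.
move=> dl0; have := sqr_ge0 (dl * `|a| - `|b|).
rewrite sqrrB exprMn !real_normK ?num_real// normrM => h.
rewrite ler_pdivlMr// -(ler_pM2l dl0).
have -> : dl * (dl * a ^+ 2 + b ^+ 2 / dl) = dl ^+ 2 * a ^+ 2 + b ^+ 2 by field; rewrite gt_eqF.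
by rewrite -subr_ge0; apply: le_trans h _; rewrite mulr2n; lra.
Qed.

Lemma prim_dist x y v e : 0 < e -> (L2_dist x y < e%:E)%E -> `|prim v x - prim v y| <= e.
Proof.
move=> e0 h; have h2 := L2_dist_lt e0 h.
have i2 : integ lam (fun t => (L2_repr x t - L2_repr y t) ^+ 2).
  apply: (@integ_le _ _ _ lam _ (fun t => 2 * L2_repr x t ^+ 2 + 2 * L2_repr y t ^+ 2)).
  - by apply: measurable_funX; apply: measurable_funB; exact: measurable_repr.
  - by apply: integD; apply: integZ; exact: integ_repr_sqr.
  - move=> t; rewrite ger0_norm ?sqr_ge0//; have := sqr_ge0 (L2_repr x t + L2_repr y t).
    by rewrite sqrrD sqrrB => h'; rewrite !mulr2n in h' *; lra.
rewrite /prim -RintB; [|exact: integ_prim|exact: integ_prim].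
(* [amgm] with [dl = e^-1]: each of the two terms contributes at most [e / 2]. *)
apply: (@le_trans _ _ (\int[lam]_t ((e^-1 * (L2_repr x t - L2_repr y t) ^+ 2 + e) / 2))).
  apply: norm_Rint_le.
  - by apply: integB; exact: integ_prim.
  - under eq_fun do rewrite mulrC; apply: integZ; apply: integD; last exact: integ_cst.
    exact: integZ.
  - move=> t; rewrite -mulrBr mulrC.
    have e1 : 0 < e^-1 by rewrite invr_gt0.
    apply: le_trans (amgm _ _ e1) _; rewrite ler_pM2r// lerD2l invrK.
    rewrite ler_piMl ?(ltW e0)//; have := step_bound v t.
    by rewrite -real_normK ?num_real// => h'; rewrite expr_le1.
under eq_Rintegral do rewrite mulrC.
rewrite RintZ; last by apply: integD; [exact: integZ|exact: integ_cst].
rewrite RintD; [|exact: integZ|exact: integ_cst].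
rewrite RintZ// Rint_probability_cst.
have : e^-1 * \int[lam]_t (L2_repr x t - L2_repr y t) ^+ 2 <= e.
  by rewrite ler_pdivrMl// -expr2.
by move=> h'; rewrite ler_pdivrMl//; lra.
Qed.

(** By [prim_dist] the set where [prim v] exceeds [c] contains a ball around each of its points, so
    it belongs to [L2_open], which generates the sigma-field. *)
Lemma measurable_prim v : measurable_fun setT (prim v).
Proof.
apply: (measurability _ (RGenOInfty.measurableE R)) => _ [_ [c ->] <-].
rewrite setTI; apply: sub_sigma_algebra => x /=; rewrite in_itv/= andbT => hc.
exists ((prim v x - c) / 2) => [|y hy]; first by rewrite divr_gt0// subr_gt0.
rewrite in_itv/= andbT; have e0 : 0 < (prim v x - c) / 2 by rewrite divr_gt0// subr_gt0.
by have := prim_dist v e0 hy; rewrite ler_norml => /andP[h1 h2]; lra.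
Qed.

Lemma step_sub_sqr v w : v <= w -> \int[lam]_u ((step w u - step v u) ^+ 2) = clip w - clip v.
Proof.
move=> vw; rewrite -!Rint_step -RintB; [|exact: bm_integ (bm_step _)|exact: bm_integ (bm_step _)].
apply: eq_Rintegral => u _; rewrite /step.
case: (ltP u v) => uv; first by rewrite (lt_le_trans uv vw) subrr expr0n.
by case: (ltP u w) => uw; rewrite subr0 ?expr1n ?expr0n.
Qed.

(** The modulus of order [1 / 2] of the primitive of an L^2 function, with the parameter [dl] left
    free. *)
Lemma prim_modulus v w (x : Omega R) (dl : R) : 0 < dl -> v <= w ->
  `|prim w x - prim v x| <= (dl * \int[lam]_u (L2_repr x u ^+ 2) + (clip w - clip v) / dl) / 2.
Proof.
move=> dl0 vw; rewrite /prim -RintB; [|exact: integ_prim|exact: integ_prim].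
have is2 : integ lam (fun u => (step w u - step v u) ^+ 2).
  apply: (@integ_bounded _ _ _ lam _ 1).
    by apply: measurable_funX; apply: measurable_funB; exact: measurable_step.
  move=> u; rewrite /step; do 2 case: ltP => _; rewrite ?subrr ?subr0 ?sub0r ?expr0n/= ?normr0 ?normrX ?normrN1 ?normr1 ?expr1n ?ler01 ?lexx//.
apply: (@le_trans _ _ (\int[lam]_u (2^-1 * (dl * L2_repr x u ^+ 2 + dl^-1 * (step w u - step v u) ^+ 2)))).
  apply: norm_Rint_le.
  - by apply: integB; exact: integ_prim.
  - by apply: integZ; apply: integD; [apply: integZ; exact: integ_repr_sqr|exact: integZ].
  - move=> u; rewrite -mulrBl mulrC; apply: le_trans (amgm _ _ dl0) _.
    by rewrite mulrC [_^-1 * (_ - _) ^+ 2]mulrC.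
rewrite RintZ; last by apply: integD; [apply: integZ; exact: integ_repr_sqr|exact: integZ].
rewrite RintD; [|by apply: integZ; exact: integ_repr_sqr|exact: integZ].
rewrite RintZ; last exact: integ_repr_sqr.
by rewrite RintZ// step_sub_sqr// mulrC [dl^-1 * _]mulrC.
Qed.

Lemma clip_sub v w : v <= w -> 0 <= clip w - clip v <= w - v.
Proof.
move=> vw; rewrite /clip /Num.max /Num.min.
by case: (ltP w 1) => h1; case: (ltP v 1) => h2; rewrite ?ltr01; case: (ltP 0 w) => h3;
  case: (ltP 0 v) => h4; apply/andP; split; lra.
Qed.

Lemma continuous_prim (x : Omega R) : continuous (prim ^~ x).
Proof.
move=> v; apply/cvgrPdist_le => /= e e0.
set K := \int[lam]_u (L2_repr x u ^+ 2).
have K0 : 0 <= K by apply: Rintegral_ge0 => u _; exact: sqr_ge0.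
(* This keeps the energy term below [e]; increments of at most [e * dl] then bound the other term by
   [e]. *)
pose dl := e / (K + 1).
have dl0 : 0 < dl by rewrite divr_gt0// ltr_wpDl.
have dK : dl * K <= e by rewrite /dl mulrAC ler_pdivrMr ?ltr_wpDl// ler_wpM2l ?(ltW e0)//; lra.
have ed : 0 < e * dl by rewrite mulr_gt0.
have key a b : a <= b -> b - a <= e * dl -> `|prim b x - prim a x| <= e.
  move=> ab h; apply: le_trans (prim_modulus x dl0 ab) _; rewrite -/K.
  have : (clip b - clip a) / dl <= e.
    by rewrite ler_pdivrMr//; have /andP[_ h'] := clip_sub ab; apply: le_trans h' h.
  by move=> h'; rewrite ler_pdivrMr//; lra.
near=> w.
have : `|v - w| <= e * dl by near: w; exact: cvgr_dist_le.
case: (leP v w) => vw; rewrite ler_norml => /andP[h1 h2].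
  by rewrite distrC; apply: key => //; lra.
by apply: key; lra.
Unshelve. all: by end_near. Qed.

End path_space.

(** * Measurability of limits at 0 from the right *)

Section limits.
Variable R : realType.

Definition grid (n : nat) (r : R) : R := (Num.truncn (r * n.+1%:R))%:R / n.+1%:R.

Lemma grid_dist n r : 0 <= r -> `|r - grid n r| <= n.+1%:R^-1.
Proof.
move=> r0; have n0 : 0 < n.+1%:R :> R by [].
have /andP[h1 h2] := truncn_itv (mulr_ge0 r0 (ltW n0)).
have h3 : grid n r <= r by rewrite /grid ler_pdivrMr.
rewrite ger0_norm ?subr_ge0// lerBlDl /grid -[X in _ <= _ + X]mul1r -mulrDl.
by rewrite ler_pdivlMr// natr1 ltW.
Qed.

Lemma cvg_inv_nat : n.+1%:R^-1 @[n --> \oo] --> (0 : R).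
Proof.
apply/gtr0_cvgV0; first by near=> n.
apply/cvgryPge => A; near=> n; rewrite -natr1.
have h : A <= n%:R by near: n; exact: nbhs_infty_ger.
by rewrite (le_trans h)// lerDl.
Unshelve. all: by end_near. Qed.

Lemma cvg_grid r : 0 <= r -> grid n r @[n --> \oo] --> r.
Proof.
move=> r0; apply/cvgrPdist_le => e e0; near=> n.
apply: le_trans (grid_dist n r0) _.
near: n; have /cvgrPdist_le/(_ _ e0) := cvg_inv_nat.
by apply: filterS => n; rewrite sub0r normrN ger0_norm.
Unshelve. all: by end_near. Qed.

Lemma cvg_dist_le (u : nat -> R) (l c e : R) : u n @[n --> \oo] --> l ->
  (\forall n \near \oo, `|u n - c| <= e) -> `|l - c| <= e.
Proof.
move=> ul h; apply: (@cvgr_to_le _ \oo _ R (fun n => `|u n - c|)) => //.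
by apply: cvg_norm; apply: cvgB => //; exact: cvg_cst.
Qed.

(** Functions measurable in one variable and continuous in the other: replacing the time by the grid
    point below it gives a finite sum of products, and continuity gives the limit. *)
Lemma measurable_caratheodory d (S : measurableType d) (F : R -> S -> R) :
  (forall v, measurable_fun setT (F v)) -> (forall x, continuous (F ^~ x)) ->
  measurable_fun setT (fun z : R * S => F (clip z.1) z.2).
Proof.
move=> mF cF.
(* The index runs up to [n.+1] inclusive because time 1 falls on the last grid point. *)
pose chi (n j : nat) (v : R) : R := ((j%:R <= clip v * n.+1%:R)%R && (clip v * n.+1%:R < j.+1%:R)%R)%:R.
pose G n (z : R * S) := \sum_(j < n.+2) chi n j z.1 * F (j%:R / n.+1%:R) z.2.
have GE n z : G n z = F (grid n (clip z.1)) z.2.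
  have n0 : 0 < n.+1%:R :> R by [].
  have /andP[c0 c1] := clip_in z.1.
  have cn : 0 <= clip z.1 * n.+1%:R by rewrite mulr_ge0// ltW.
  have hj : (Num.truncn (clip z.1 * n.+1%:R)%R < n.+2)%N.
    rewrite ltnS -(ler_nat R); have /andP[h1 _] := truncn_itv cn; apply: le_trans h1 _.
    by rewrite -[leRHS]mul1r ler_wpM2r// ltW.
  rewrite /G (bigD1 (Ordinal hj))//= big1 ?addr0.
    by rewrite /chi truncn_itv// mul1r.
  move=> j /eqP nj; rewrite /chi -truncn_eq//.
  by case: eqP => [e|_]; rewrite ?mul0r//; case: nj; apply: val_inj.
have mchi n j : measurable_fun setT (chi n j).
  have m1 : measurable_fun setT (fun v : R => clip v * n.+1%:R).
    by apply: measurable_funM => //; exact: measurable_clip.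
  rewrite (_ : chi n j = (fun v => (1 - step j%:R (clip v * n.+1%:R)) * step j.+1%:R (clip v * n.+1%:R))).
    by apply: measurable_funM; [apply: measurable_funB => //|]; exact: measurable_step.
  apply/funext => v; rewrite /chi /step.
  by rewrite leNgt; case: (_ < j%:R); rewrite /= ?subrr ?mul0r ?subr0 ?mul1r.
apply: (measurable_fun_cvg (h := G)).
- move=> n; apply: measurable_sum => j; apply: measurable_funM.
    by apply: (measurableT_comp (mchi n j)); exact: measurable_fst.
  by apply: (measurableT_comp (mF _)); exact: measurable_snd.
- move=> z _; under eq_fun do rewrite GE.
  have /andP[c0 _] := clip_in z.1.
  exact: (cvg_comp _ _ (cvg_grid c0) (cF z.2 (clip z.1))).
Qed.

Section xget_limit.
Context d (S : measurableType d) (F : R -> S -> R).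
Hypothesis mF : forall r, 0 < r -> measurable_fun setT (F r).
Hypothesis cF : forall z r, 0 < r -> {for r, continuous (F ^~ z)}.

Let q (a b : nat) : R := a%:R / b.+1%:R.

(** Cauchy's criterion at 0 from the right, tested on the countably many positive rationals below
    [1 / m.+1] against the reference radius [1 / m.+2], which lies below that bound. *)
Let close (k m a b : nat) : set S := [set z | 0 < q a b < m.+1%:R^-1 ->
  `|F (q a b) z - F m.+2%:R^-1 z| <= k.+1%:R^-1].

Let conv : set S := \bigcap_k \bigcup_m \bigcap_a \bigcap_b close k m a b.

Let m0 (m : nat) : 0 < m.+1%:R^-1 :> R. Proof. by rewrite invr_gt0. Qed.

Let measurable_close k m a b : measurable (close k m a b).
Proof.
have [h|h] := pselect (0 < q a b < m.+1%:R^-1); last first.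
  by rewrite (_ : close _ _ _ _ = setT)//; apply/seteqP; split => // z _ /h.
rewrite (_ : close _ _ _ _ = setT `&`
    (fun z => `|F (q a b) z - F m.+2%:R^-1 z|) @^-1` `]-oo, k.+1%:R^-1]).
  have hm : measurable_fun setT (fun z => `|F (q a b) z - F m.+2%:R^-1 z|).
    apply: measurableT_comp => //; apply: measurable_funB; apply: mF => //.
    by case/andP: h.
  by apply: hm => //; exact: measurable_itv.
rewrite setTI; apply/seteqP; split => z /=; rewrite in_itv/=; first by apply.
by move=> ? _.
Qed.

Let measurable_conv : measurable conv.
Proof.
apply: bigcapT_measurable => k; apply: bigcup_measurable => m _.
by apply: bigcapT_measurable => a; apply: bigcapT_measurable => b; exact: measurable_close.
Qed.

Let convP z : conv z <-> exists l : R, F r z @[r --> 0^'+] --> l.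
Proof.
split; last first.
  move=> [l Fl] k _; have h2 : 0 < (2 * k.+1%:R)^-1 :> R by rewrite invr_gt0 mulr_gt0.
  have /cvgrPdist_le/(_ _ h2)[dl /= dl0 H] := Fl.
  have {}H r : 0 < r -> r < dl -> `|l - F r z| <= (2 * k.+1%:R)^-1.
    by move=> r0 rd; apply: H => //=; rewrite sub0r normrN gtr0_norm.
  exists (Num.truncn dl^-1) => // a _ b _ /andP[q0 qm]; set m := Num.truncn _ in qm *.
  have dlm : m.+1%:R^-1 < dl.
    rewrite invf_plt ?posrE//.
    by have /andP[_] := truncn_itv (ltW (etrans (invr_gt0 dl) dl0)).
  have h1 := H _ q0 (lt_trans qm dlm).
  have h3 : `|l - F m.+2%:R^-1 z| <= (2 * k.+1%:R)^-1.
    by apply: H => //; apply: lt_trans dlm; rewrite ltf_pV2 ?posrE// ltr_nat.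
  have -> : k.+1%:R^-1 = (2 * k.+1%:R)^-1 + (2 * k.+1%:R)^-1 :> R by field; rewrite ?nat1r ?natr1 ?pnatr_eq0.
  apply: le_trans (ler_distD l _ _) _; apply: lerD => //.
  by rewrite distrC.
move=> hz; apply/cvg_ex; apply: cauchy_cvg; apply: cauchy_exP => e e0.
have [m _ hm] := hz (Num.truncn e^-1) I.
have ke : (Num.truncn e^-1).+1%:R^-1 < e.
  rewrite invf_plt ?posrE//.
  by have /andP[_] := truncn_itv (ltW (etrans (invr_gt0 e) e0)).
exists (F m.+2%:R^-1 z).
suff h : \forall r \near (0:R)^'+, ball (F m.+2%:R^-1 z) e (F r z) by exact: h.
near=> r.
have r0 : 0 < r by near: r; exact: nbhs_right_gt.
have rm : r < m.+1%:R^-1 by near: r; apply: nbhs_right_lt.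
(* Continuity in the radius extends the estimate from the rational radii [grid n r] to [r]. *)
have cr := cvg_comp _ _ (cvg_grid (ltW r0)) (@cF z r r0).
rewrite -ball_normE/= distrC; apply: le_lt_trans ke; apply: (cvg_dist_le cr).
have h1 := cvgr_gt r (cvg_grid (ltW r0)) 0 r0.
have h2 := cvgr_lt r (cvg_grid (ltW r0)) _ rm.
near=> n; apply: (hm _ I n I); apply/andP; split; near: n; [exact: h1|exact: h2].
Unshelve. all: by end_near. Qed.

Lemma measurable_cvg_right : measurable [set z | exists l : R, F r z @[r --> 0^'+] --> l].
Proof.
rewrite (_ : [set z | _] = conv); first exact: measurable_conv.
by apply/seteqP; split => z /convP.
Qed.

(** The default 0 of [xget] makes it the limit, at every point, of a sequence of values multiplied
    by the indicator of the measurable set of convergence. *)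
Lemma measurable_xget_lim :
  measurable_fun setT (fun z => xget 0 [set l | F r z @[r --> 0^'+] --> l]).
Proof.
apply: (measurable_fun_cvg (h := fun n (z : S) => \1_conv z * F n.+1%:R^-1 z)).
  by move=> n; apply: measurable_funM; [apply: measurable_indic; exact: measurable_conv|exact: mF].
move=> z _; have [cz|cz] := pselect (conv z).
  have := xgetPex 0 ((convP z).1 cz); set l := xget _ _ => /= hl.
  under eq_fun do rewrite indicE mem_set// mul1r.
  have := (cvg_at_rightP (F ^~ z) 0 l).1 hl (fun n => n.+1%:R^-1).
  by apply; split => //; exact: cvg_inv_nat.
rewrite xgetPN; last by move=> l hl; apply: cz; apply/convP; exists l.
by under eq_fun do rewrite indicE memNset// mul0r; exact: cvg_cst.
Qed.

End xget_limit.
End limits.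

Lemma xget_lim (R : realType) (f : R -> R) (l : R) : f r @[r --> 0^'+] --> l ->
  xget 0 [set l : R | f r @[r --> 0^'+] --> l] = l.
Proof.
move=> H; have H' := @xgetI R 0 [set l : R | f r @[r --> 0^'+] --> l] l H.
exact: (cvg_unique (@norm_hausdorff _ _) H' H).
Qed.

(** * Local means as increments of the primitive *)

Section local_means.
Variable R : realType.
Local Notation lam := (@lam R).
Implicit Types (x : Omega R) (t u v r : R).

Lemma int_ball (f : R -> R) t r : measurable_fun setT f -> 0 < r ->
  \int[lebesgue_measure]_(s in `[0%R, 1%R] `&` ball t r) f s =
  \int[lam]_s ((step (t + r) s - step (t - r) s) * f s).
Proof.
move=> mf r0.
have mst u : measurable_fun setT (step u) by exact: measurable_step.
pose A := (`]t - r, t + r[%classic : set R).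
have bE : ball t r = A by rewrite /A ball_itv.
have mA : measurable A by exact: measurable_itv.
have m1 : measurable_fun setT (fun s => \1_A s * f s) by apply: measurable_funM.
transitivity (\int[lam]_s (\1_A s * f s)).
  rewrite -lam_Rintegral// Rintegral_mkcond [RHS]Rintegral_mkcond bE.
  apply: eq_Rintegral => s _; rewrite !patchE in_setI indicE.
  by case: (_ \in `[0, 1]%classic); case: (s \in A); rewrite /= ?mul1r ?mul0r.
have m2 : measurable_fun setT (fun s => (step (t + r) s - step (t - r) s) * f s).
  by apply: measurable_funM => //; apply: measurable_funB; exact: mst.
apply: (@ae_eq_Rint _ _ _ lam _ _ m1 m2).
(* The open ball and the half-open interval cut out by the steps differ at [t - r] only. *)
apply: lam_ae; exists [set t - r]; split => //; first exact: lebesgue_measure_set1.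
move=> s /= /not_implyP[_ ns]; apply: contrapT => st; apply: ns.
rewrite indicE /A mem_setE in_itv/= /step; congr (_ * _).
have [sr|sr] := ltP s (t - r).
  by rewrite ltNge (ltW sr)/= (lt_le_trans sr) ?subrr//; lra.
rewrite subr0; congr (_%:R); rewrite lt_neqAle sr andbT.
by case: eqP => // e; case: st.
Qed.

Lemma clip_lt t r : 0 <= t <= 1 -> 0 < r -> 0 < clip (t + r) - clip (t - r).
Proof.
move=> /andP[t0 t1] r0; rewrite /clip /Num.max /Num.min.
case: (ltP (t + r) 1) => h1; case: (ltP (t - r) 1) => h2; rewrite ?ltr01;
  case: (ltP 0 (t + r)) => h3; case: (ltP 0 (t - r)) => h4; lra.
Qed.

(** The local mean written with increments of [prim], a form that shows joint measurability in time
    and path and continuity in [r]. *)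
Definition mean t r x : R := (prim (t + r) x - prim (t - r) x) / (clip (t + r) - clip (t - r)).

Lemma local_mean_prim x t r : 0 < r -> local_mean x t r = mean t r x.
Proof.
move=> r0; rewrite /local_mean /mean; congr (_ / _).
  rewrite int_ball//; last exact: measurable_repr.
  rewrite /prim -RintB; [|exact: integ_prim|exact: integ_prim].
  by apply: eq_Rintegral => s _; rewrite mulrBl.
have mb : measurable (`[0%R, 1%R]%classic `&` ball t r : set R).
  by rewrite ball_itv; apply: measurableI; exact: measurable_itv.
have := @int_ball (fun=> 1) t r (measurable_cst _) r0.
rewrite Rintegral_cst// mul1r => ->.
rewrite -!Rint_step -RintB; [|exact: bm_integ (bm_step _)|exact: bm_integ (bm_step _)].
by apply: eq_Rintegral => s _; rewrite mulr1.
Qed.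

Lemma prim_clip v x : prim (clip v) x = prim v x.
Proof.
have cc : clip (clip v) = clip v by rewrite clip_id// clip_in.
set K := \int[lam]_u (L2_repr x u ^+ 2).
have K0 : 0 <= K by apply: Rintegral_ge0 => u _; exact: sqr_ge0.
(* With equal clipped times one term of [prim_modulus] vanishes, and the other is made small through
   [dl]. *)
have key a b : a <= b -> clip a = clip b -> prim b x = prim a x.
  move=> ab e; apply/eqP; rewrite -subr_eq0 -normr_le0; apply/ler_addgt0Pr => d d0; rewrite add0r.
  have dl0 : 0 < d / (K + 1) by rewrite divr_gt0// ltr_wpDl.
  apply: le_trans (prim_modulus x dl0 ab) _; rewrite e subrr mul0r addr0 -/K.
  have h : d / (K + 1) * K <= d by rewrite mulrAC ler_pdivrMr ?ltr_wpDl// ler_wpM2l ?(ltW d0)//; lra.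
  have h0 : 0 <= d / (K + 1) * K by rewrite mulr_ge0// ltW.
  by rewrite ler_pdivrMr//; lra.
by case: (leP v (clip v)) => [h|/ltW h]; [exact: key|symmetry; exact: key].
Qed.

Lemma measurable_prim2 : measurable_fun setT (fun z : R * Omega R => prim z.1 z.2).
Proof.
have := measurable_caratheodory (@measurable_prim R) (@continuous_prim R).
by congr (measurable_fun _ _); apply/funext => z; exact: prim_clip.
Qed.

Lemma continuous_clip : continuous (@clip R).
Proof.
move=> v; apply/cvgrPdist_le => /= e e0; near=> w.
have : `|v - w| <= e by near: w; exact: cvgr_dist_le.
case: (leP v w) => [vw|/ltW vw]; have /andP[h1 h2] := clip_sub vw;
  rewrite !ler_norml => /andP[h3 h4]; apply/andP; split; lra.
Unshelve. all: by end_near. Qed.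

Lemma continuous_mean t x r : 0 <= t <= 1 -> 0 < r -> {for r, continuous (fun r => mean t r x)}.
Proof.
move=> t01 r0; have c1 : {for r, continuous (fun r : R => t + r)}.
  by apply: cvgD; [exact: cvg_cst|exact: cvg_id].
have c2 : {for r, continuous (fun r : R => t - r)}.
  by apply: cvgB; [exact: cvg_cst|exact: cvg_id].
apply: cvgM.
  by apply: cvgB; [exact: (continuous_comp c1 (@continuous_prim R x _))
                  |exact: (continuous_comp c2 (@continuous_prim R x _))].
apply: cvgV; first by rewrite gt_eqF// clip_lt.
by apply: cvgB; [exact: (continuous_comp c1 (@continuous_clip _))
                |exact: (continuous_comp c2 (@continuous_clip _))].
Qed.

(** The co-ordinate process continued constantly outside [0,1], so that it is defined and measurable
    on the whole product. *)
Definition pathv t x : R := coordinate (clip t) x.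

Lemma pathv_mean t x :
  pathv t x = xget 0 [set l : R | mean (clip t) r x @[r --> 0^'+] --> l].
Proof.
rewrite /pathv /coordinate; congr (xget _ _); apply/funext => l; apply/propext.
by split; apply: cvg_trans; apply: near_eq_cvg; near=> r;
  rewrite local_mean_prim//; near: r; exact: nbhs_right_gt.
Unshelve. all: by end_near. Qed.

Lemma measurable_mean2 r : 0 < r ->
  measurable_fun setT (fun z : R * Omega R => mean (clip z.1) r z.2).
Proof.
move=> r0.
have mc : measurable_fun setT (fun z : R * Omega R => clip z.1).
  by apply: (measurableT_comp (@measurable_clip R)); exact: measurable_fst.
have mp (c : R) : measurable_fun setT (fun z : R * Omega R => prim (clip z.1 + c) z.2).
  have h : measurable_fun setT (fun z : R * Omega R => (clip z.1 + c, z.2)).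
    by apply: measurable_fun_pair; [exact: measurable_funD|exact: measurable_snd].
  exact: (measurableT_comp measurable_prim2 h).
have mq (c : R) : measurable_fun setT (fun z : R * Omega R => clip (clip z.1 + c)).
  by apply: (measurableT_comp (@measurable_clip R)); exact: measurable_funD.
apply: measurable_funM; first by apply: measurable_funB; exact: mp.
(* The reciprocal of a positive quantity, written as a power to inherit the measurability of
   [powR]. *)
rewrite (_ : (fun z => _) = (fun z : R * Omega R =>
    (clip (clip z.1 + r) - clip (clip z.1 - r)) `^ (-1))).
  apply: (measurableT_comp (@measurable_powR R (-1))).
  by apply: measurable_funB; exact: mq.
by apply/funext => z; rewrite powR_inv1// ltW// clip_lt// clip_in.
Qed.

Lemma measurable_process : measurable_fun setT (fun z : R * Omega R => pathv z.1 z.2).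
Proof.
rewrite (_ : (fun z => pathv z.1 z.2) =
  (fun z : R * Omega R => xget 0 [set l : R | mean (clip z.1) r z.2 @[r --> 0^'+] --> l])); last first.
  by apply/funext => z; exact: pathv_mean.
apply: (@measurable_xget_lim _ _ _ (fun r z => mean (clip z.1) r z.2)) => r.
  exact: measurable_mean2.
by move=> r' r0; apply: continuous_mean => //; exact: clip_in.
Qed.

Lemma measurable_mean_cvg : measurable [set z : R * Omega R |
  exists l : R, mean (clip z.1) r z.2 @[r --> 0^'+] --> l].
Proof.
apply: (@measurable_cvg_right _ _ _ (fun r z => mean (clip z.1) r z.2)) => r.
  exact: measurable_mean2.
by move=> r' r0; apply: continuous_mean => //; exact: clip_in.
Qed.

(** Lebesgue differentiation of the path extended by 0. The two end points are discarded, so that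
    small balls lie inside [0,1] and the extension does not interfere. *)
Lemma ae_mean_cvg x : {ae lam, forall t, 0 <= t <= 1 /\ mean t r x @[r --> 0^'+] --> L2_repr x t}.
Proof.
pose f := L2_repr x \_ (`[0, 1]%classic : set R).
have ix : lebesgue_measure.-integrable (`[0, 1]%classic : set R) (EFin \o L2_repr x).
  exact: lam_integrable (integ_repr x).
have lf : locally_integrable setT f by apply: integrable_locally_restrict => //; exact: measurable_itv.
apply: lam_ae.
have n01 (c : R) : {ae lebesgue_measure, forall t : R, t != c}.
  exists [set c]; split; [exact: measurable_set1|exact: lebesgue_measure_set1|].
  by move=> t /= /negP; rewrite negbK => /eqP.
have := lebesgue_differentiation lf; move: (n01 0) (n01 1).
apply: (@filterS3 _ _ (ae_filter_ringOfSetsType _)) => t t0 t1 ld /andP[t0' t1'].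
have {t0 t0'}t0 : 0 < t by rewrite lt_neqAle eq_sym t0.
have {t1 t1'}t1 : t < 1 by rewrite lt_neqAle t1.
have ft : f t = L2_repr x t by rewrite /f patchE mem_setE in_itv/= !ltW.
split; first by rewrite !ltW.
suff H : local_mean x t r @[r --> 0^'+] --> L2_repr x t.
  apply: cvg_trans H; apply: near_eq_cvg; near=> r.
  by rewrite local_mean_prim//; near: r; exact: nbhs_right_gt.
apply/cvgrPdist_le => /= e e0.
have : \forall r \near (0:R)^'+, (davg f t r <= e%:E)%E.
  have [hfin hf] := (@fine_cvgP _ _ _ _ _ _).1 ld.
  move/cvgrPdist_le: hf => /(_ _ e0) /= hf.
  near=> r; have hr : davg f t r \is a fin_num by near: r.
  have : `|0 - fine (davg f t r)| <= e by near: r.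
  by rewrite sub0r normrN -{2}(fineK hr) lee_fin; apply: le_trans; exact: ler_norm.
move=> hd; near=> r.
have r0 : 0 < r by near: r; exact: nbhs_right_gt.
have rt : r < t by near: r; exact: nbhs_right_lt.
have rt1 : r < 1 - t by near: r; apply: nbhs_right_lt; lra.
have hr : (davg f t r <= e%:E)%E by near: r.
have bb : `[0%R, 1%R]%classic `&` ball t r = ball t r.
  apply/setIidPr => s; rewrite ball_itv /= !in_itv/= => /andP[h1 h2]; apply/andP; split; lra.
have r2 : 0 < r *+ 2 by rewrite mulrn_wgt0.
have mb : measurable (ball t r) by rewrite ball_itv; exact: measurable_itv.
have bS : ball t r `<=` (`[0, 1]%classic : set R) by rewrite -bb; exact: subIsetl.
have ib : lebesgue_measure.-integrable (ball t r) (EFin \o L2_repr x).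
  by apply: (@integrableS _ _ _ (@lebesgue_measure R) (`[0, 1]%classic : set R)) => //; exact: ix.
have ic : lebesgue_measure.-integrable (ball t r) (EFin \o cst (L2_repr x t)).
  apply: (@integrableS _ _ _ (@lebesgue_measure R) (`[0, 1]%classic : set R)) => //.
  apply: continuous_compact_integrable; first exact: segment_compact.
  by apply: continuous_subspaceT => s; exact: cvg_cst.
have lb : fine (lebesgue_measure (ball t r)) = r *+ 2 by rewrite lebesgue_measure_ball ?(ltW r0).
have lc : \int[lebesgue_measure]_(s in ball t r) L2_repr x t = L2_repr x t * (r *+ 2).
  by rewrite Rintegral_cst//; congr (_ * _); exact: lb.
have id : lebesgue_measure.-integrable (ball t r) (EFin \o (fun s => L2_repr x s - L2_repr x t)).
  have h := @integrableB _ _ _ (@lebesgue_measure R) _ mb _ _ ib ic; exact: h.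
rewrite /local_mean bb lebesgue_measure_ball ?(ltW r0)//= distrC.
have -> : \int[lebesgue_measure]_(s in ball t r) L2_repr x s / (r *+ 2) - L2_repr x t =
    (\int[lebesgue_measure]_(s in ball t r) (L2_repr x s - L2_repr x t)) / (r *+ 2).
  by rewrite RintegralB// lc mulrBl mulfK// gt_eqF.
rewrite normrM normfV (gtr0_norm r2) ler_pdivrMr//.
apply: le_trans (le_normr_Rintegral _ _) _ => //.
move: hr; rewrite /davg /iavg lebesgue_measure_ball ?(ltW r0)// inver gt_eqF//.
have -> : (\int[lebesgue_measure]_(y in ball t r) `|((center (f t) \o f) y)%:E| =
    (\int[lebesgue_measure]_(s in ball t r) `|L2_repr x s - L2_repr x t|)%:E)%E.
  rewrite /Rintegral fineK.
    apply: eq_integral => s /set_mem /bS s01; rewrite /= ft /f patchE mem_set//.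
  by apply: integrable_fin_num => //; exact: integrable_norm.
by rewrite -EFinM lee_fin ler_pdivrMl// mulrC.
Unshelve. all: by end_near. Qed.

Lemma ae_path_repr x : {ae lam, forall t, pathv t x = L2_repr x t}.
Proof.
have := ae_mean_cvg x; apply: (@filterS _ _ (ae_filter_ringOfSetsType _)) => t [t01 h].
by rewrite pathv_mean clip_id//; exact: xget_lim h.
Qed.

End local_means.

(** * Convergence of local means at a fixed time *)

Section process_on_paths.
Context (R : realType) (P : probability (Omega R) R).
Local Notation lam := (@lam R).
Implicit Types (x : Omega R) (t u v r : R).

Lemma integ_path_process x : integ lam ((@pathv R) ^~ x).
Proof.
apply: ae_eq_integ (ae_path_repr x) (integ_repr x).
exact: (measurableT_comp (@measurable_process R) (measurable_pair2 x)).
Qed.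

Lemma integ_path_rho (rho : R -> R) C x : bm rho C ->
  smear (@pathv R) rho x = \int[lam]_t (rho t * L2_repr x t).
Proof.
move=> [mr hr]; apply: ae_eq_Rint.
- apply: measurable_funM => //; exact: integ_meas (integ_path_process x).
- apply: measurable_funM => //; exact: measurable_repr.
- have := ae_path_repr x; apply: (@filterS _ _ (ae_filter_ringOfSetsType _)) => t.
  by move=> /= ->.
Qed.

Hypothesis hB : (\int[@lebesgue_measure R]_(t in `[0%R, 1%R])
   'E_P[fun w => (coordinate t w ^+ 2)%R] < +oo)%E.

Lemma integ_process_sqr : integ (lam \x P)%E (fun z : R * Omega R => pathv z.1 z.2 ^+ 2).
Proof.
have m2 : measurable_fun setT (fun z : R * Omega R => pathv z.1 z.2 ^+ 2).
  by apply: measurable_funX; exact: measurable_process.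
have m2E : measurable_fun setT (fun z : R * Omega R => (pathv z.1 z.2 ^+ 2)%:E).
  exact/measurable_EFinP.
have p2 (z : R * Omega R) : (0 <= (pathv z.1 z.2 ^+ 2)%:E)%E by rewrite lee_fin sqr_ge0.
apply/integrableP; split => //.
under eq_integral => z _ do rewrite /= ger0_norm ?sqr_ge0//.
have -> : (\int[lam \x P]_z (pathv z.1 z.2 ^+ 2)%:E =
    \int[lam]_t \int[P]_x (pathv t x ^+ 2)%:E)%E.
  exact: (@fubini_tonelli1 _ _ _ _ _ lam P _ m2E p2).
rewrite -lam_integral; last first.
  exact: (@measurable_fun_fubini_tonelli_F _ _ _ _ _ P _ m2E p2).
apply: le_lt_trans hB; rewrite le_eqVlt; apply/orP; left; apply/eqP.
apply: eq_integral => t; rewrite mem_setE in_itv/= => t01.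
by rewrite expectation.unlock; apply: eq_integral => x _; rewrite /pathv clip_id.
Qed.

End process_on_paths.

(** * Densities of the local means and their covariances *)

Section densities.
Variable R : realType.
Local Notation lam := (@lam R).
Implicit Types (s t u v r : R) (w : seq (R * (R * R))).

Definition window t r : R := clip (t + r) - clip (t - r).
(* [mean t r] is the integral of the path against [dens t r]. *)
Definition dens t r s : R :=
  (step (clip (t + r)) (clip s) - step (clip (t - r)) (clip s)) / window t r.

Lemma measurable_dens t r : measurable_fun setT (dens t r).
Proof.
apply: measurable_funM => //; apply: measurable_funB; apply: measurable_step => //;
  exact: measurable_clip.
Qed.

Lemma clip_mono u v : u <= v -> clip u <= clip v.
Proof. by move=> uv; have /andP[+ _] := clip_sub uv; rewrite subr_ge0. Qed.

Lemma dens_ge0 t r s : 0 <= t <= 1 -> 0 < r -> 0 <= dens t r s.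
Proof.
move=> t01 r0; apply: divr_ge0; last by rewrite ltW// clip_lt.
have h : clip (t - r) <= clip (t + r) by apply: clip_mono; lra.
rewrite /step; case: (ltP (clip s) (clip (t - r))) => h1.
  by rewrite (lt_le_trans h1 h) subrr.
by rewrite subr0 ler0n.
Qed.

Lemma bm_dens t r : 0 <= t <= 1 -> 0 < r -> bm (dens t r) (2 / window t r).
Proof.
move=> t01 r0; split; first exact: measurable_dens.
move=> s; rewrite normrM normfV (gtr0_norm (clip_lt t01 r0)) ler_pM2r ?invr_gt0 ?clip_lt//.
by apply: le_trans (ler_normB _ _) _; apply: lerD; exact: step_bound.
Qed.

Lemma Rint_step_clip u : \int[lam]_s step (clip u) (clip s) = clip u.
Proof.
rewrite (@lam_clip R (step (clip u))); last exact: measurable_step.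
by rewrite Rint_step clip_id// clip_in.
Qed.

Lemma bm_step_clip u : bm (fun s => step (clip u) (clip s)) 1.
Proof.
by split; [apply: measurable_step => //; exact: measurable_clip|move=> s; exact: step_bound].
Qed.

Lemma Rint_dens t r : 0 <= t <= 1 -> 0 < r -> \int[lam]_s dens t r s = 1.
Proof.
move=> t01 r0; rewrite /dens; under eq_Rintegral do rewrite mulrC.
have i u := bm_integ (bm_step_clip u).
rewrite RintZ; last exact: integB.
by rewrite RintB// !Rint_step_clip mulVf// gt_eqF// clip_lt.
Qed.

Lemma dens_support t r s : 0 <= t <= 1 -> 0 < r -> dens t r s != 0 -> `|clip s - t| <= r.
Proof.
move=> t01 r0; rewrite /dens /step; have /andP[t0 t1] := t01.
have h : clip (t - r) <= clip (t + r) by apply: clip_mono; lra.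
have /andP[_ h1] : 0 <= clip (t + r) - clip t <= t + r - t by apply: clip_sub; lra.
have /andP[_ h2] : 0 <= clip t - clip (t - r) <= t - (t - r) by apply: clip_sub; lra.
rewrite (clip_id t01) in h1 h2.
case: (ltP (clip s) (clip (t - r))) => h3; first by rewrite (lt_le_trans h3 h) subrr mul0r eqxx.
case: (ltP (clip s) (clip (t + r))) => h4; last by rewrite subrr mul0r eqxx.
by move=> _; rewrite ler_norml; apply/andP; split; lra.
Qed.

(** In each variable both the minimum and the product are 1-Lipschitz on [0,1], whence the factor
    2. *)
Lemma kern_lip s s' t t' : `|kern s s' - kern t t'| <=
  2 * `|clip s - clip t| + 2 * `|clip s' - clip t'|.
Proof.
have one a b c : `|kern a c - kern b c| <= 2 * `|clip a - clip b|.
  rewrite /kern; have /andP[c0 c1] := clip_in c.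
  set x := clip a; set y := clip b; set z := clip c in c0 c1 *.
  have h1 : `|Num.min x z - Num.min y z| <= `|x - y|.
    wlog xy : x y / x <= y => [H|].
      by case: (leP x y) => [|/ltW] h; [exact: H|rewrite distrC [leRHS]distrC; exact: H].
    rewrite (ler0_norm (_ : x - y <= 0)); last lra.
    by rewrite /Num.min; case: ltP => h1; case: ltP => h2; rewrite ler_norml; apply/andP; split; lra.
  have h2 : `|x * z - y * z| <= `|x - y| by rewrite -mulrBl normrM (ger0_norm c0) ler_piMr.
  have -> : Num.min x z - x * z - (Num.min y z - y * z) =
    (Num.min x z - Num.min y z) - (x * z - y * z) by ring.
  by apply: le_trans (ler_normB _ _) _; lra.
apply: le_trans (ler_distD (kern t s') _ _) _; apply: lerD; first exact: one.
by rewrite ![kern t _]kernC; exact: one.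
Qed.

(** The product of the two densities has mass 1 and is carried by points within [r] of [t] and [r']
    of [t'], where [kern_lip] compares the kernel with its value at the centre. *)
Lemma dens_energy t r t' r' : 0 <= t <= 1 -> 0 < r -> 0 <= t' <= 1 -> 0 < r' ->
  `|\int[(lam \x lam)%E]_z (dens t r z.1 * dens t' r' z.2 * kern z.1 z.2) - kern t t'|
    <= 2 * r + 2 * r'.
Proof.
move=> t01 r0 t01' r0'; have b := bm_dens t01 r0; have b' := bm_dens t01' r0'.
have m12 : measurable_fun setT (fun z : R * R => dens t r z.1 * dens t' r' z.2).
  apply: measurable_funM.
    by apply: (measurableT_comp b.1); exact: measurable_fst.
  by apply: (measurableT_comp b'.1); exact: measurable_snd.
have i12 : integ (lam \x lam)%E (fun z : R * R => dens t r z.1 * dens t' r' z.2).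
  apply: (@integ_prod_bounded _ _ _ _ _ lam lam _ (2 / window t r * (2 / window t' r'))) => //.
  by move=> x y; rewrite normrM ler_pM//; [exact: b.2|exact: b'.2].
have one : \int[(lam \x lam)%E]_z (dens t r z.1 * dens t' r' z.2) = 1.
  rewrite -(Rint_section1 i12) /= -[RHS](Rint_dens t01 r0); apply: eq_Rintegral => s _.
  by rewrite RintZ ?Rint_dens ?mulr1//; exact: bm_integ b'.
have -> : kern t t' = \int[(lam \x lam)%E]_z (kern t t' * (dens t r z.1 * dens t' r' z.2)).
  by rewrite RintZ// one mulr1.
rewrite -RintB; [|exact: integ_kern2 b b'|exact: integZ].
have -> : 2 * r + 2 * r' = \int[(lam \x lam)%E]_z ((2 * r + 2 * r') * (dens t r z.1 * dens t' r' z.2)).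
  by rewrite RintZ// one mulr1.
apply: norm_Rint_le; [apply: integB; [exact: integ_kern2 b b'|exact: integZ]|exact: integZ|].
move=> [s s'] /=; rewrite mulrC -mulrBl normrM.
have d0 : 0 <= dens t r s * dens t' r' s' by rewrite mulr_ge0// dens_ge0.
rewrite (ger0_norm d0); have [e|e] := eqVneq (dens t r s * dens t' r' s') 0.
  by rewrite e !mulr0.
rewrite ler_wpM2r//; apply: le_trans (kern_lip _ _ _ _) _.
move: e; rewrite mulf_eq0 negb_or => /andP[h1 h2]; rewrite (clip_id t01) (clip_id t01').
by apply: lerD; rewrite ler_pM2l//; [exact: dens_support h1|exact: dens_support h2].
Qed.

Lemma bilinear_sum (I : Type) (l : seq I) (a : I -> R) (f : I -> R -> R) (C : I -> R) :
  (forall i, bm (f i) (C i)) ->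
  energy (fun s => \sum_(i <- l) a i * f i s) =
  \sum_(i <- l) \sum_(j <- l) a i * a j *
    \int[(lam \x lam)%E]_z (f i z.1 * f j z.2 * kern z.1 z.2).
Proof.
move=> bf; rewrite /energy.
have ii i j : integ (lam \x lam)%E (fun z : R * R => a i * a j * (f i z.1 * f j z.2 * kern z.1 z.2)).
  by apply: integZ; exact: integ_kern2 (bf i) (bf j).
have -> : \int[(lam \x lam)%E]_z ((\sum_(i <- l) a i * f i z.1) * (\sum_(i <- l) a i * f i z.2) * kern z.1 z.2) =
    \int[(lam \x lam)%E]_z (\sum_(i <- l) \sum_(j <- l) a i * a j * (f i z.1 * f j z.2 * kern z.1 z.2)).
  apply: eq_Rintegral => z _; rewrite mulr_suml mulr_suml; apply: eq_bigr => i _.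
  by rewrite mulr_sumr mulr_suml; apply: eq_bigr => j _; ring.
rewrite Rint_sum; last by move=> i; exact: integ_sum.
apply: eq_bigr => i _; rewrite Rint_sum//; apply: eq_bigr => j _.
by rewrite RintZ//; exact: integ_kern2 (bf i) (bf j).
Qed.

End densities.

(** The series of nonnegative functions has finite integral by monotone convergence, hence is finite
    almost everywhere. *)
Lemma summable_ae d (T : measurableType d) (R : realType) (P : {measure set T -> \bar R})
    (f : nat -> T -> R) (c : nat -> R) (K : R) : (forall n, integ P (f n)) ->
  (forall n x, 0 <= f n x) -> (forall n, \int[P]_x f n x <= c n) ->
  (forall N, \sum_(n < N) c n <= K) ->
  {ae P, forall x, exists L : R, forall N, \sum_(n < N) f n x <= L}.
Proof.
move=> fi f0 fc cK.
have mf n : measurable_fun setT (fun x => (f n x)%:E) by apply/measurable_EFinP; exact: integ_meas (fi n).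
have p0 n x : setT x -> (0 <= (f n x)%:E)%E by rewrite lee_fin.
have E : (\int[P]_x (\sum_(n <oo) (f n x)%:E) <= K%:E)%E.
  rewrite integral_nneseries//; apply: lime_le.
    by apply: is_cvg_nneseries => n _ _; apply: integral_ge0 => x _; rewrite lee_fin.
  apply: nearW => N; rewrite big_mkord.
  under eq_bigr => n _ do rewrite -Rint_EFin//.
  rewrite sumEFin lee_fin; apply: le_trans (cK N); exact: ler_sum.
have i : P.-integrable setT (fun x => \sum_(n <oo) (f n x)%:E)%E.
  apply/integrableP; split.
    by apply: ge0_emeasurable_sum => // n x _ _; exact: p0.
  under eq_integral => x _.
    rewrite gee0_abs; last by apply: nneseries_ge0 => n _ _; rewrite lee_fin.
    over.
  exact: le_lt_trans E (ltry _).
have := integrable_ae measurableT i; apply: (@filterS _ _ (ae_filter_ringOfSetsType _)) => x /= /(_ I) h.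
exists (fine (\sum_(n <oo) (f n x)%:E)%E) => N.
rewrite -lee_fin fineK// -sumEFin -(big_mkord xpredT (fun n => (f n x)%:E)).
by apply: nneseries_lim_ge => n _ _; rewrite lee_fin.
Qed.

Section oscillation.
Variable R : realType.

(** Consecutive scales differ by summable amounts, and within one scale [M] stays close to its value
    at the upper end: a Cauchy criterion at 0. *)
Lemma cvg_right_of_summable (M : R -> R) (D : nat -> R) (K : R) :
  (forall n, 0 <= D n) -> (forall N, \sum_(n < N) D n <= K) ->
  (forall n r, 4^-1 ^+ n.+1 <= r <= 4^-1 ^+ n -> `|M r - M (4^-1 ^+ n)| <= D n) ->
  exists l : R, M r @[r --> 0^'+] --> l.
Proof.
move=> D0 DK hM; pose A N := \sum_(n < N) D n.
have AS N : A N.+1 = A N + D N by rewrite /A big_ord_recr.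
have And : nondecreasing_seq A by apply/nondecreasing_seqP => n; rewrite AS lerDl.
have cA : cvgn A.
  apply: nondecreasing_is_cvgn => //; exists K => _ [n _ <-]; exact: DK.
have q0 n : 0 < 4^-1 ^+ n :> R by rewrite exprn_gt0// invr_gt0.
have step1 n : `|M (4^-1 ^+ n.+1) - M (4^-1 ^+ n)| <= D n.
  apply: hM; rewrite lexx exprS ler_piMl ?ltW//; lra.
have chain N m : (N <= m)%N -> `|M (4^-1 ^+ m) - M (4^-1 ^+ N)| <= A m - A N.
  elim: m => [|m ih]; first by rewrite leqn0 => /eqP ->; rewrite !subrr normr0.
  rewrite leq_eqVlt => /predU1P[->|]; first by rewrite !subrr normr0.
  rewrite ltnS => /ih h; apply: le_trans (ler_distD (M (4^-1 ^+ m)) _ _) _.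
  by rewrite AS; have := step1 m; lra.
have cq : 4^-1 ^+ n @[n --> \oo] --> (0 : R) by apply: cvg_expr; rewrite ger0_norm; lra.
apply/cvg_ex; apply: cauchy_cvg; apply: cauchy_exP => e e0.
have [N hN] : exists N, lim (A n @[n --> \oo]) - A N < e / 2.
  have e2 : 0 < e / 2 by rewrite divr_gt0.
  have /cvgrPdist_lt/(_ _ e2)[N _ h] := cA.
  by exists N; have := h N (leqnn N); apply: le_lt_trans; exact: ler_norm.
exists (M (4^-1 ^+ N)).
suff h : \forall r \near (0:R)^'+, ball (M (4^-1 ^+ N)) e (M r) by exact: h.
near=> r.
have r0 : 0 < r by near: r; exact: nbhs_right_gt.
have rN : r < 4^-1 ^+ N by near: r; exact: nbhs_right_lt.
(* The least such [n] brackets [r] between two consecutive scales, and [r < 4^-1 ^+ N] forces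
   [n >= N]. *)
have ex : exists n, 4^-1 ^+ n.+1 <= r.
  have /cvgrPdist_lt/(_ _ r0)[m _ h] := cq.
  exists m; have := h m.+1 (leqnSn m); rewrite sub0r normrN ger0_norm; [exact: ltW|exact: ltW].
case: (ex_minnP ex) => n rn nmin.
have nN : (N <= n)%N.
  rewrite leqNgt; apply/negP => nN.
  have : 4^-1 ^+ N <= 4^-1 ^+ n.+1 :> R by rewrite ler_wiXn2l//; lra.
  by move=> h; have := lt_le_trans rN h; rewrite ltNge rn.
have rn' : r <= 4^-1 ^+ n.
  case: n rn nmin nN => [|n] rn nmin nN.
    by move: nN rN; rewrite leqn0 => /eqP -> /ltW.
  by rewrite leNgt; apply/negP => /ltW /nmin; rewrite ltnn.
have h1 : `|M r - M (4^-1 ^+ n)| <= D n by apply: hM; rewrite rn rn'.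
have h2 := chain _ _ nN.
have h3 : A n.+1 <= lim (A n @[n --> \oo]) by exact: nondecreasing_cvgn_le.
rewrite -ball_normE/= distrC; apply: le_lt_trans (ler_distD (M (4^-1 ^+ n)) _ _) _.
by move: h3; rewrite AS; lra.
Unshelve. all: by end_near. Qed.

End oscillation.

(** * Gaussian laws of finitely many local means *)

Section gaussian_means.
Context (R : realType) (P : probability (Omega R) R).
Local Notation lam := (@lam R).
Implicit Types (x : Omega R) (s t u v r l : R).

Lemma smear_dens t r x : 0 <= t <= 1 -> 0 < r -> smear (@pathv R) (dens t r) x = mean t r x.
Proof.
move=> t01 r0; rewrite (integ_path_rho x (bm_dens t01 r0)) /mean -(prim_clip (t + r) x) -(prim_clip (t - r) x) /dens -/(window t r).
have e v : \int[lam]_u (step (clip v) (clip u) * L2_repr x u) = prim (clip v) x.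
  apply: eq_lam_Rint.
  - by apply: measurable_funM; [exact: (bm_step_clip v).1|exact: measurable_repr].
  - exact: integ_meas (integ_prim (clip v) x).
  - by move=> u u01; rewrite (clip_id u01).
have i v : integ lam (fun u => step (clip v) (clip u) * L2_repr x u).
  by have [m h] := bm_step_clip v; exact: integ_mulb (integ_repr x) m h.
rewrite -!e -RintB// mulrC -RintZ; last exact: integB.
by apply: eq_Rintegral => u _; ring.
Qed.

Definition comb n (a t r : 'I_n -> R) s : R := \sum_i a i * dens (t i) (r i) s.

Lemma smear_comb n (a t r : 'I_n -> R) x : (forall i, 0 <= t i <= 1) -> (forall i, 0 < r i) ->
  smear (@pathv R) (comb a t r) x = \sum_i a i * mean (t i) (r i) x.
Proof.
move=> t01 r0; rewrite /smear /comb.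
under eq_Rintegral => s _ do rewrite mulr_suml.
under eq_Rintegral => s _ do under eq_bigr => i _ do rewrite -mulrA.
have ii i := integ_smear_path (@integ_path_process R) x (bm_dens (t01 i) (r0 i)).
rewrite Rint_sum; last by move=> i; exact: integZ.
by apply: eq_bigr => i _; rewrite RintZ// -(smear_dens x (t01 i) (r0 i)).
Qed.

Lemma energy_comb n (a t r : 'I_n -> R) : (forall i, 0 <= t i <= 1) -> (forall i, 0 < r i) ->
  `|energy (comb a t r) - \sum_i \sum_j a i * a j * kern (t i) (t j)| <=
  \sum_i \sum_j `|a i * a j| * (2 * r i + 2 * r j).
Proof.
move=> t01 r0; rewrite /comb (bilinear_sum _ _ (fun i => bm_dens (t01 i) (r0 i))).
rewrite -sumrB; apply: le_trans (ler_norm_sum _ _ _) _; apply: ler_sum => i _.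
rewrite -sumrB; apply: le_trans (ler_norm_sum _ _ _) _; apply: ler_sum => j _.
by rewrite -mulrBr normrM ler_wpM2l// dens_energy.
Qed.

Hypothesis hB : (\int[@lebesgue_measure R]_(t in `[0%R, 1%R])
   'E_P[fun w => (coordinate t w ^+ 2)%R] < +oo)%E.
Hypothesis stein_density : forall rho C a, bm rho C ->
  \int[P]_x (sin (smear (@pathv R) rho x + a) * smear (@pathv R) (volt rho) x) =
  stein_coef rho * \int[P]_x cos (smear (@pathv R) rho x + a).

(** Each density of a local mean is a difference of two translated indicators with end points
    [clip (t + r)] and [clip (t - r)], both at most 1, so [solved_indicator] applies. The frequency
    [l] is absorbed into the weights. *)
Lemma gauss_char_comb n (a t r : 'I_n -> R) : (forall i, 0 <= t i <= 1) -> (forall i, 0 < r i) ->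
  gauss_char P (fun x => \sum_i a i * mean (t i) (r i) x) (energy (comb a t r)).
Proof.
move=> t01 r0 l c.
pose S := flatten [seq [:: (l * a i / window (t i) (r i), clip (t i + r i));
  (- (l * a i / window (t i) (r i)), clip (t i - r i))] | i <- index_enum 'I_n].
have S1 : below1 S.
  move=> p /flattenP[_ /mapP[i _ ->]]; rewrite !inE => /orP[]/eqP -> /=.
    by have /andP[] := clip_in (t i + r i).
  by have /andP[] := clip_in (t i - r i).
have SE : lsum S (fun y => (0 < y)%R%:R) = comb (fun i => l * a i) t r.
  apply/funext => s; rewrite /lsum /comb /S big_flatten big_map; apply: eq_bigr => i _.
  by rewrite !big_cons big_nil /= addr0 !subr_gt0 /dens /step -/(window _ _); ring.
have := solved_indicator (@measurable_process R) (@integ_path_process R) (integ_process_sqr hB)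
  stein_density S1 c.
rewrite SE /phase => h.
transitivity (\int[P]_x cos (smear (@pathv R) (comb (fun i => l * a i) t r) x + c)).
  apply: eq_Rintegral => x _; rewrite smear_comb// mulr_sumr.
  by congr (cos (_ + _)); apply: eq_bigr => i _; rewrite mulrA.
rewrite h; congr (_ * expR (- (_ / 2))).
have bf i := bm_dens (t01 i) (r0 i).
rewrite /comb !(bilinear_sum _ _ bf) mulr_sumr; apply: eq_bigr => i _.
by rewrite mulr_sumr; apply: eq_bigr => j _; ring.
Qed.

Lemma measurable_mean t r : measurable_fun setT (mean t r).
Proof. by apply: measurable_funM => //; apply: measurable_funB; exact: measurable_prim. Qed.

Lemma kern_ge0_sub s t : kern s s - kern s t - kern t s + kern t t <= 4 * `|clip s - clip t|.
Proof.
have := kern_lip s s s t; have := kern_lip t t t s; rewrite !subrr normr0 !mulr0 !add0r.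
rewrite [`|clip t - _|]distrC !ler_norml => /andP[_ h1] /andP[_ h2]; lra.
Qed.

(** The difference is centred Gaussian. Its variance is at most [q]: [4 |t - t'|] bounds the kernel
    part by [kern_ge0_sub], and the four error terms of [energy_comb] add up to [8 r + 8 r']. The
    mean absolute value follows from [amgm]. *)
Lemma mean_diff t r t' r' (dl q : R) : 0 <= t <= 1 -> 0 < r -> 0 <= t' <= 1 -> 0 < r' -> 0 < dl ->
  4 * `|t - t'| + 8 * r + 8 * r' <= q ->
  integ P (fun x => mean t r x - mean t' r' x) /\
  \int[P]_x `|mean t r x - mean t' r' x| <= (dl + q / dl) / 2.
Proof.
move=> t01 r0 t01' r0' dl0 hq.
pose sel (y z : R) (i : 'I_2) := if val i == 0%N then y else z.
have T01 i : 0 <= sel t t' i <= 1 by rewrite /sel; case: ifP.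
have R0 i : 0 < sel r r' i by rewrite /sel; case: ifP.
have gc := gauss_char_comb (sel 1 (-1)) T01 R0.
have := energy_comb (sel 1 (-1)) T01 R0.
rewrite !big_ord_recl !big_ord0 /sel/= !addr0 !mulr1 !mul1r !mulrN1 !mulN1r !opprK !normrN !normr1 !mul1r.
rewrite (_ : (fun x => \sum_i _) = (fun x => mean t r x - mean t' r' x)) in gc; last first.
  by apply/funext => x; rewrite !big_ord_recl !big_ord0 /sel/= addr0 mul1r mulN1r.
set V := energy _ in gc * => hV.
have mX : measurable_fun setT (fun x => mean t r x - mean t' r' x).
  by apply: measurable_funB; exact: measurable_mean.
have [i2 e2 _] := gauss_char_moments mX gc.
have i1 := integ_sqr mX i2.
split => //.
have Vq : V <= q.
  have := kern_ge0_sub t t'; rewrite (clip_id t01) (clip_id t01').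
  move: hV; rewrite ler_norml => /andP[_ hV] h; lra.
apply: (@le_trans _ _ (\int[P]_x (2^-1 * (dl + dl^-1 * (mean t r x - mean t' r' x) ^+ 2)))).
  apply: le_Rint; [exact: integ_norm|apply: integZ; apply: integD; [exact: integ_cst|exact: integZ]|].
  move=> x; set X := _ - _; have dl1 : 0 < dl^-1 by rewrite invr_gt0.
  have := amgm X 1 dl1; rewrite mulr1 expr1n invrK => h; apply: le_trans h _; lra.
rewrite RintZ; last by apply: integD; [exact: integ_cst|exact: integZ].
rewrite RintD; [|exact: integ_cst|exact: integZ].
rewrite RintZ// e2 Rint_probability_cst [leRHS]mulrC ler_pM2l ?invr_gt0// lerD2l mulrC.
by rewrite ler_pM2r ?invr_gt0.
Qed.

End gaussian_means.

Section window.
Variable R : realType.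
Implicit Types (s t r q : R).

Lemma window_bounds t r : 0 <= t <= 1 -> 0 < r -> r <= 1 -> r <= window t r <= 2 * r.
Proof.
move=> t01 r0 r1; have /andP[t0 t1] := t01; apply/andP; split; last first.
  have /andP[_ h] : 0 <= window t r <= t + r - (t - r) by apply: clip_sub; lra.
  by apply: le_trans h _; lra.
rewrite /window /clip /Num.max /Num.min.
case: (ltP (t + r) 1) => h1; case: (ltP (t - r) 1) => h2; rewrite ?ltr01;
  case: (ltP 0 (t + r)) => h3; case: (ltP 0 (t - r)) => h4; lra.
Qed.

Lemma step_mono u v s : u <= v -> step u s <= step v s.
Proof. by move=> uv; rewrite /step; case: (ltP s u) => h //=; rewrite (lt_le_trans h uv). Qed.

(** The smaller interval lies in the larger one, and [window t q <= 2 q <= 8 r <= 8 window t r]. *)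
Lemma dens_compare t r q s : 0 <= t <= 1 -> 0 < q -> q <= 1 -> q / 4 <= r -> r <= q ->
  dens t r s <= 8 * dens t q s.
Proof.
move=> t01 q0 q1 qr rq; have r0 : 0 < r by lra.
have /andP[wr _] := window_bounds t01 r0 (le_trans rq q1).
have /andP[_ wq] := window_bounds t01 q0 q1.
have wr0 := clip_lt t01 r0; have wq0 := clip_lt t01 q0.
have h1 : step (clip (t + r)) (clip s) <= step (clip (t + q)) (clip s).
  by apply: step_mono; apply: clip_mono; lra.
have h2 : step (clip (t - q)) (clip s) <= step (clip (t - r)) (clip s).
  by apply: step_mono; apply: clip_mono; lra.
have h3 := dens_ge0 s t01 q0.
rewrite /dens ler_pdivrMr//; move: h3; rewrite /dens; set N := _ - _ => h3.
have N0 : 0 <= N by move: h3; rewrite pmulr_lge0// invr_gt0.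
apply: (@le_trans _ _ N); first by rewrite /N; lra.
set y := N / _ in h3 *; have -> : N = y * window t q by rewrite divfK// gt_eqF.
rewrite -subr_ge0; have -> : 8 * y * window t r - y * window t q = y * (8 * window t r - window t q) by ring.
by rewrite mulr_ge0//; lra.
Qed.

End window.

(** * Regularity of the process at a fixed time *)

Section regularity.
Context (R : realType) (P : probability (Omega R) R).
Local Notation lam := (@lam R).
Local Notation pathv := (@pathv R).
Implicit Types (x : Omega R) (s t u v r q l : R).
Hypothesis hB : (\int[@lebesgue_measure R]_(t in `[0%R, 1%R])
   'E_P[fun w => (coordinate t w ^+ 2)%R] < +oo)%E.
Hypothesis stein_density : forall rho C a, bm rho C ->
  \int[P]_x (sin (smear pathv rho x + a) * smear pathv (volt rho) x) =
  stein_coef rho * \int[P]_x cos (smear pathv rho x + a).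

(* At one scale all means [mean t r x], [q / 4 <= r <= q], are controlled by this
   single random variable. *)
Definition oscil t q x : R := \int[lam]_s (dens t q s * `|pathv s x - mean t q x|).

Lemma integ_oscil t q x : 0 <= t <= 1 -> 0 < q ->
  integ lam (fun s => dens t q s * `|pathv s x - mean t q x|).
Proof.
move=> t01 q0; have [m h] := bm_dens t01 q0.
have i : integ lam (fun s => `|pathv s x - mean t q x|).
  by apply: integ_norm; apply: integB; [exact: integ_path_process|exact: integ_cst].
exact: (integ_mulb i m h).
Qed.

(** As [dens t r] has mass 1, the difference of means is the integral of the path minus [mean t q]
    against [dens t r], which [dens_compare] bounds by [8 dens t q]. *)
Lemma mean_osc t r q x : 0 <= t <= 1 -> 0 < q -> q <= 1 -> q / 4 <= r -> r <= q ->
  `|mean t r x - mean t q x| <= 8 * oscil t q x.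
Proof.
move=> t01 q0 q1 qr rq; have r0 : 0 < r by lra.
have bd := bm_dens t01 r0; have [m h] := bd.
have ip := integ_smear_path (@integ_path_process R) x bd.
have -> : mean t r x - mean t q x = \int[lam]_s (dens t r s * pathv s x - mean t q x * dens t r s).
  rewrite RintB//; last by apply: integZ; exact: bm_integ bd.
  by rewrite RintZ ?Rint_dens ?mulr1 -?(smear_dens x t01 r0)//; exact: bm_integ bd.
rewrite -RintZ; last exact: integ_oscil.
apply: norm_Rint_le.
- by apply: integB => //; apply: integZ; exact: bm_integ bd.
- by apply: integZ; exact: integ_oscil.
- move=> s; rewrite [mean t q x * _]mulrC -mulrBr normrM mulrA ler_wpM2r//.
  by rewrite ger0_norm ?dens_ge0//; exact: dens_compare.
Qed.

Lemma mean_bound t r x : 0 <= t <= 1 -> 0 < r -> r <= 1 ->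
  `|mean t r x| <= 2 / r * pathnorm pathv x.
Proof.
move=> t01 r0 r1; rewrite -(smear_dens x t01 r0).
apply: le_trans (smear_bound (@integ_path_process R) x (bm_dens t01 r0)) _.
rewrite ler_wpM2r ?pathnorm_ge0// ler_pM2l// lef_pV2 ?posrE ?clip_lt//.
by have /andP[] := window_bounds t01 r0 r1.
Qed.

Let conv : set (R * Omega R) :=
  [set z | exists l : R, mean (clip z.1) r z.2 @[r --> 0^'+] --> l].

Let mconv : measurable conv. Proof. exact: measurable_mean_cvg. Qed.

(** The law of a value of the path at a single time is not yet known, so [pathv s] is approached by
    its local means of radius [rk k]. Their distance to [mean t q] is bounded in mean by
    [mean_diff], uniformly in [k], and Fatou's lemma passes to the limit. *)
Lemma Rint_oscil t n : 0 <= t <= 1 ->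
  integ P (oscil t (4^-1 ^+ n)) /\ \int[P]_x oscil t (4^-1 ^+ n) x <= 11 * 2^-1 ^+ n.
Proof.
move=> t01; set q := 4^-1 ^+ n; set dl := 2^-1 ^+ n.
have q0 : 0 < q by rewrite exprn_gt0// invr_gt0.
have dl0 : 0 < dl by rewrite exprn_gt0// invr_gt0.
have q1 : q <= 1 by rewrite exprn_ile1//; lra.
have qdl : q = dl ^+ 2.
  by rewrite /q /dl -exprM mulnC exprM; congr (_ ^+ _); rewrite expr2; field.
pose rk k : R := q / k.+1%:R.
have rk0 k : 0 < rk k by rewrite divr_gt0.
have rkq k : rk k <= q by rewrite ler_pdivrMr// ler_peMr// ?(ltW q0)// ler1n.
pose M := mean t q.
have mM : measurable_fun setT (fun z : R * Omega R => M z.2).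
  by apply: (measurableT_comp (measurable_mean t q)); exact: measurable_snd.
have md : measurable_fun setT (fun z : R * Omega R => dens t q z.1).
  by apply: (measurableT_comp (measurable_dens t q)); exact: measurable_fst.
have mc : measurable_fun setT (\1_conv : R * Omega R -> R) by exact: measurable_indic.
pose g k (z : R * Omega R) := dens t q z.1 * `|mean (clip z.1) (rk k) z.2 - M z.2|.
(* Where the means diverge [pathv] is 0; with the indicator of [conv] the functions [f k] converge
   everywhere to the integrand of [oscil]. *)
pose f k (z : R * Omega R) := dens t q z.1 * `|\1_conv z * mean (clip z.1) (rk k) z.2 - M z.2|.
have mg k : measurable_fun setT (g k).
  apply: measurable_funM => //; apply: measurableT_comp => //; apply: measurable_funB => //.
  exact: measurable_mean2.
have mf k : measurable_fun setT (f k).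
  apply: measurable_funM => //; apply: measurableT_comp => //; apply: measurable_funB => //.
  by apply: measurable_funM => //; exact: measurable_mean2.
have dom k (c : R) s x : 0 <= c <= 1 -> `|dens t q s * `|c * mean (clip s) (rk k) x - M x| | <=
    2 / window t q * ((2 / rk k + 2 / q) * pathnorm pathv x).
  move=> /andP[c0 c1]; rewrite normrM normr_id ler_pM//; first exact: (bm_dens t01 q0).2.
  apply: le_trans (ler_normB _ _) _; rewrite mulrDl; apply: lerD; last exact: mean_bound.
  rewrite normrM (ger0_norm c0); apply: le_trans (_ : `|mean (clip s) (rk k) x| <= _).
    by rewrite ler_piMl.
  apply: mean_bound => //; [exact: clip_in|exact: le_trans q1].
have iP : integ P (fun x => pathnorm pathv x).
  exact: integ_pathnorm (@measurable_process R) (integ_process_sqr hB).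
have ig k : integ (lam \x P)%E (g k).
  apply: (@integ_prodM _ _ _ _ _ lam P _ (fun=> 2 / window t q)
    (fun x => (2 / rk k + 2 / q) * pathnorm pathv x)).
  - exact: mg.
  - exact: integ_cst.
  - exact: integZ.
  - by move=> s x; have := dom k 1 s x; rewrite mul1r; apply; rewrite ler01 lexx.
have if_ k : integ (lam \x P)%E (f k).
  apply: (@integ_prodM _ _ _ _ _ lam P _ (fun=> 2 / window t q)
    (fun x => (2 / rk k + 2 / q) * pathnorm pathv x)).
  - exact: mf.
  - exact: integ_cst.
  - exact: integZ.
  - by move=> s x; apply: dom; rewrite indicE; case: (_ \in _); rewrite ?ler01 ?lexx.
have gle k : \int[(lam \x P)%E]_z g k z <= 11 * dl.
  rewrite -(Rint_section1 (ig k)).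
  apply: (@le_trans _ _ (\int[lam]_s (11 * dl * dens t q s))); last first.
    by rewrite RintZ ?Rint_dens ?mulr1//; exact: bm_integ (bm_dens t01 q0).
  apply: le_Rint; [exact: integ_section1|by apply: integZ; exact: bm_integ (bm_dens t01 q0)|].
  move=> s; rewrite /g /=.
  have [e|e] := eqVneq (dens t q s) 0.
    rewrite e mulr0; under eq_Rintegral do rewrite mul0r.
    by rewrite Rintegral_zero.
  have sq := dens_support t01 q0 e.
  (* On the support of the density [|clip s - t| <= q], and [rk k <= q]: the total is
     [4 q + 8 q + 8 q]. *)
  have hq : 4 * `|clip s - t| + 8 * rk k + 8 * q <= 20 * q by have := rkq k; lra.
  have [ii hh] := mean_diff hB stein_density (clip_in s) (rk0 k) t01 q0 dl0 hq.
  rewrite RintZ; last exact: integ_norm.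
  rewrite mulrC ler_wpM2r ?dens_ge0//; apply: le_trans hh _.
  (* With [q = dl^2] the bound is [(dl + 20 dl) / 2], which is below [11 dl]. *)
  have -> : 20 * q / dl = 20 * dl by rewrite qdl; field; rewrite gt_eqF.
  lra.
(* For each path the means converge at almost every time, so that the indicator is 1 there. *)
have fg k : \int[(lam \x P)%E]_z f k z = \int[(lam \x P)%E]_z g k z.
  rewrite -(Rint_section1 (if_ k)) -(Rint_section1 (ig k)) (Rint_fubini (if_ k)) (Rint_fubini (ig k)).
  apply: eq_Rintegral => x _; apply: ae_eq_Rint.
  - exact: (measurableT_comp (mf k) (measurable_pair2 x)).
  - exact: (measurableT_comp (mg k) (measurable_pair2 x)).
  have := ae_mean_cvg x; apply: (@filterS _ _ (ae_filter_ringOfSetsType _)) => s [s01 h].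
  rewrite /f /g /= indicE mem_set ?mul1r//.
  by exists (L2_repr x s); rewrite /= clip_id.
have [||||iF leF] := @Rint_fatou _ _ _ (lam \x P)%E f
  (fun z => dens t q z.1 * `|pathv z.1 z.2 - M z.2|) (11 * dl).
- exact: if_.
- by move=> k z; rewrite mulr_ge0// dens_ge0.
- move=> z; apply: cvgMr; apply: cvg_norm; apply: cvgB; last exact: cvg_cst.
  rewrite pathv_mean; have [cz|cz] := pselect (conv z).
    have := xgetPex 0 cz; set l := xget _ _ => /= hl.
    under eq_fun do rewrite indicE mem_set// mul1r.
    have := (cvg_at_rightP (fun r => mean (clip z.1) r z.2) 0 l).1 hl rk.
    apply; split => //; rewrite -[X in _ --> X](mulr0 q); apply: cvgMr; exact: cvg_inv_nat.
  rewrite xgetPN; last by move=> l hl; apply: cz; exists l.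
  by under eq_fun do rewrite indicE memNset// mul0r; exact: cvg_cst.
- by move=> k; rewrite fg.
split; first exact: integ_section2 iF.
by rewrite /oscil -(Rint_fubini iF) (Rint_section1 iF).
Qed.

Lemma ae_mean_path t : 0 <= t <= 1 ->
  {ae P, forall x, mean t r x @[r --> 0^'+] --> pathv t x}.
Proof.
move=> t01.
have : {ae P, forall x, exists L : R, forall N, \sum_(n < N) oscil t (4^-1 ^+ n) x <= L}.
  (* The bound 22 is 11 times the sum 2 of the geometric series. *)
  apply: (@summable_ae _ _ _ P (fun n => oscil t (4^-1 ^+ n)) (fun n => 11 * 2^-1 ^+ n) 22).
  - by move=> n; exact: (Rint_oscil n t01).1.
  - move=> n x; apply: Rintegral_ge0 => s _; rewrite mulr_ge0// dens_ge0//.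
  - by move=> n; exact: (Rint_oscil n t01).2.
  - move=> N; rewrite -mulr_sumr.
    have -> : \sum_(n < N) 2^-1 ^+ n = 2 - 2 * 2^-1 ^+ N :> R.
      elim: N => [|N ih]; first by rewrite big_ord0 expr0; ring.
      by rewrite big_ord_recr /= ih exprS; field.
    have : 0 <= 2^-1 ^+ N :> R by rewrite exprn_ge0// invr_ge0.
    lra.
apply: (@filterS _ _ (ae_filter_ringOfSetsType _)) => x [L hL].
suff [l hl] : exists l : R, mean t r x @[r --> 0^'+] --> l.
  by rewrite pathv_mean (clip_id t01) (xget_lim hl).
apply: (@cvg_right_of_summable _ _ (fun n => 8 * oscil t (4^-1 ^+ n) x) (8 * L)).
- move=> n; rewrite mulr_ge0//; apply: Rintegral_ge0 => s _; rewrite mulr_ge0// dens_ge0//.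
- by move=> N; rewrite -mulr_sumr ler_pM2l.
- move=> n r /andP[h1 h2]; apply: mean_osc => //.
  + by rewrite exprn_ile1//; lra.
  + by apply: le_trans h1; rewrite exprS mulrC.
Qed.

(** At the finitely many times involved the local means converge almost surely, so their
    characteristic functions converge; [energy_comb] gives the limit of the variances. *)
Lemma gauss_char_path n (a t : 'I_n -> R) : (forall i, 0 <= t i <= 1) ->
  gauss_char P (fun x => \sum_i a i * pathv (t i) x)
    (\sum_i \sum_j a i * a j * kern (t i) (t j)).
Proof.
move=> t01 l c; set V := \sum_i _.
pose r k (i : 'I_n) : R := k.+1%:R^-1.
have r0 k i : 0 < r k i by rewrite invr_gt0.
have mm u : measurable_fun setT (pathv u).
  exact: (measurableT_comp (@measurable_process R) (measurable_pair1 u)).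
pose Y x := \sum_i a i * pathv (t i) x.
pose Z k x := \sum_i a i * mean (t i) (r k i) x.
have mY : measurable_fun setT Y by apply: measurable_sum => i; exact: measurable_funM.
have mZ k : measurable_fun setT (Z k).
  by apply: measurable_sum => i; apply: measurable_funM => //; exact: measurable_mean.
have ZY : {ae P, forall x, Z k x @[k --> \oo] --> Y x}.
  have : {ae P, forall x, forall i, mean (t i) r x @[r --> 0^'+] --> pathv (t i) x}.
    apply: (filter_forall (ae_filter_ringOfSetsType P)) => i; exact: ae_mean_path.
  apply: (@filterS _ _ (ae_filter_ringOfSetsType _)) => x h.
  apply: (@cvg_sumr _ _ _ _ _ _ (fun i k => a i * mean (t i) (r k i) x) (fun i => a i * pathv (t i) x)) => i; apply: cvgMr.
  apply: (cvg_at_rightP (fun r => mean (t i) r x) 0 (pathv (t i) x)).1 (h i) (fun k => k.+1%:R^-1) _.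
  by split; [move=> k; rewrite invr_gt0|exact: cvg_inv_nat].
have c1 : \int[P]_x cos (l * Z k x + c) @[k --> \oo] --> \int[P]_x cos (l * Y x + c).
  have [| | | | |h1 _ h2] := @dominated_convergence _ _ _ P setT measurableT
      (fun k x => (cos (l * Z k x + c))%:E) (fun x => (cos (l * Y x + c))%:E) (cst 1%:E).
  - by move=> k; apply/measurable_EFinP; exact: measurable_cosl.
  - by apply/measurable_EFinP; exact: measurable_cosl.
  - apply: (@filterS _ _ (ae_filter_ringOfSetsType _)) ZY => x h _ /=.
    apply: cvg_EFin; first exact: nearW.
    apply: (cvg_comp_continuous (@continuous_cos R)); apply: cvgD; last exact: cvg_cst.
    exact: cvgMr.
  - exact: (integ_cst P 1).
  - by apply: nearW => x k _; rewrite lee_fin cos_max.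
  apply: fine_cvg; rewrite fineK; first exact: h2.
  by rewrite integrable_fin_num.
have c2 : cos c * expR (- (l ^+ 2 * energy (comb a t (r k)) / 2)) @[k --> \oo] -->
    cos c * expR (- (l ^+ 2 * V / 2)).
  apply: cvgMr; apply: (cvg_comp_continuous (@continuous_expR R)); apply: cvgN; apply: cvgMl.
  apply: cvgMr; apply/subr_cvg0.
  pose W := \sum_i \sum_j `|a i * a j|.
  apply: (@cvg_to0 _ _ (fun k => W * 4 * k.+1%:R^-1)).
    move=> k; apply: le_trans (energy_comb a t01 (r0 k)) _.
    rewrite /W !mulr_suml; apply: ler_sum => i _; rewrite !mulr_suml; apply: ler_sum => j _.
    by rewrite -mulrA ler_wpM2l// /r -mulrDl ler_wpM2r ?invr_ge0// -natrD.
  by rewrite -[X in _ --> X](mulr0 (W * 4)); apply: cvgMr; exact: cvg_inv_nat.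
have e : (fun k => \int[P]_x cos (l * Z k x + c)) =
    (fun k => cos c * expR (- (l ^+ 2 * energy (comb a t (r k)) / 2))).
  by apply/funext => k; exact: (gauss_char_comb hB stein_density a t01 (r0 k) l c).
by rewrite e in c1; exact: (cvg_unique (@norm_hausdorff _ _) c1 c2).
Qed.

End regularity.

(** * Moments of the bridge *)

Section gaussian_laws.
Context d (T : measurableType d) (R : realType) (P : probability T R).
Implicit Types X Y : T -> R.

(** Point masses and normal laws are brought to one form, a centring constant [m] and a variance
    [q]; [gauss_char_moments] then identifies both with the moments of [X]. *)
Lemma gaussian_moments X : gaussian P X ->
  [/\ measurable_fun setT X, forall k, integ P (fun w => `|X w| ^+ k) &
      gauss_char P (fun w => X w - \int[P]_w X w) (\int[P]_w (X w - \int[P]_w X w) ^+ 2)].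
Proof.
move=> [mX H].
have [m [q [hq hk]]] : exists m q : R, gauss_char P (fun w => X w - m) q /\
    forall k, integ P (fun w => `|X w - m| ^+ k).
  case: H => [[m hm]|[m [s [s0 hs]]]]; last first.
    by have [h1 h2] := normal_law s0 mX hs; exists m, (s ^+ 2).
  have ae0 : {ae P, forall w, X w = m}.
    exists (X @^-1` [set~ m]); split.
    - rewrite -[X in measurable X]setTI; apply: mX => //; apply: measurableC; exact: measurable_set1.
    - have := hm [set~ m] (measurableC (measurable_set1 m)); rewrite /pushforward => ->.
      by rewrite diracE memNset// => h; exact: h.
    - by move=> w /= h; exact: h.
  have me (f : R -> R) : measurable_fun setT f ->
      integ P (fun w => f (X w - m)) /\ \int[P]_w f (X w - m) = f 0.
    move=> mf; have m1 : measurable_fun setT (fun w => f (X w - m)).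
      by apply: (measurableT_comp mf); apply: measurable_funB.
    have ae1 : {ae P, forall w, f (X w - m) = f 0}.
      by apply: (@filterS _ _ (ae_filter_ringOfSetsType P)) ae0 => w ->; rewrite subrr.
    split; first exact: ae_eq_integ m1 ae1 (integ_cst P (f 0)).
    by rewrite -[RHS](Rint_probability_cst P); exact: ae_eq_Rint.
  exists m, 0; split.
    move=> l a; have mc : measurable_fun setT (fun x : R => cos (l * x + a)).
      by apply: continuous_measurable_fun => x; exact: is_derive_cont (is_derive_cosl _ _ _).
    by rewrite (me _ mc).2 mulr0 add0r mulr0 mul0r oppr0 expR0 mulr1.
  move=> k; apply: (me (fun x => `|x| ^+ k) _).1.
  apply: continuous_measurable_fun => x.
  apply: (@continuous_comp _ _ _ (@Num.norm _ R) (fun y => y ^+ k)); first exact: norm_continuous.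
  exact: exprn_continuous.
have mXm : measurable_fun setT (fun w => X w - m) by apply: measurable_funB.
have [i2 e2 e1] := gauss_char_moments mXm hq.
have i1 := integ_sqr mXm i2.
have iX : integ P X.
  have := integD i1 (integ_cst P m); congr (_.-integrable _ (EFin \o _)).
  by apply/funext => w; rewrite subrK.
have em : \int[P]_w X w = m.
  move: e1; rewrite RintB//; last exact: integ_cst.
  by rewrite Rint_probability_cst => /eqP; rewrite subr_eq0 => /eqP.
split => //; last by rewrite em e2.
move=> k; apply: (@integ_le _ _ _ P _ (fun w => 2 ^+ k * (`|X w - m| ^+ k + `|m| ^+ k))).
- by apply: measurable_funX; exact: measurableT_comp.
- by apply: integZ; apply: integD => //; exact: integ_cst.
- move=> w; rewrite normrX normr_id.
  have h : `|X w| <= 2 * Num.max `|X w - m| `|m|.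
    have : `|X w| <= `|X w - m| + `|m| by rewrite -[X in `|X|](subrK m); exact: ler_normD.
    by move=> h; apply: le_trans h _; rewrite mulr2n mulrDl !mul1r lerD// le_max lexx ?orbT.
  apply: (@le_trans _ _ ((2 * Num.max `|X w - m| `|m|) ^+ k)).
    by rewrite lerXn2r ?nnegrE ?mulr_ge0// le_max normr_ge0.
  rewrite exprMn ler_wpM2l ?exprn_ge0//.
  by case: (leP `|X w - m| `|m|) => _; [rewrite lerDr|rewrite lerDl]; rewrite exprn_ge0.
Qed.

Lemma integ_M2 X Y : measurable_fun setT X -> measurable_fun setT Y ->
  integ P (fun w => `|X w| ^+ 2) -> integ P (fun w => `|Y w| ^+ 2) -> integ P (fun w => X w * Y w).
Proof.
move=> mX mY iX iY; apply: integ_mul2 => //.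
  by move: iX; under eq_fun do rewrite real_normK ?num_real//.
by move: iY; under eq_fun do rewrite real_normK ?num_real//.
Qed.

Lemma expectation_Rint X : integ P X -> 'E_P[X]%E = (\int[P]_w X w)%:E.
Proof. by move=> iX; rewrite expectation.unlock Rint_EFin. Qed.

Lemma kern_in s t : 0 <= s <= 1 -> 0 <= t <= 1 -> kern s t = Num.min s t - s * t :> R.
Proof. by move=> s01 t01; rewrite /kern !clip_id. Qed.

Lemma bridge_gauss_char (X : R -> T -> R) : brownian_bridge P X ->
  forall n (a t : 'I_n -> R), (forall i, 0 <= t i <= 1) ->
  [/\ measurable_fun setT (fun w => \sum_i a i * X (t i) w),
      forall k, integ P (fun w => `|\sum_i a i * X (t i) w| ^+ k) &
      gauss_char P (fun w => \sum_i a i * X (t i) w) (\sum_i \sum_j a i * a j * kern (t i) (t j))].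
Proof.
move=> [gX eX cX].
have g1 t : 0 <= t <= 1 -> [/\ measurable_fun setT (X t), integ P (X t),
    integ P (fun w => `|X t w| ^+ 2) & \int[P]_w X t w = 0].
  move=> t01; have [] := gaussian_moments (gX 1%N (fun=> t) (fun=> 1) (fun=> t01)).
  have E1 w : \sum_(i < 1) 1 * X t w = X t w by rewrite big_ord_recl big_ord0 addr0 mul1r.
  under eq_fun do rewrite E1.
  move=> m h' _.
  have h k : integ P (fun w => `|X t w| ^+ k) by have := h' k; under eq_fun do rewrite E1.
  have i1 : integ P (X t).
    by apply: (@integ_le _ _ _ P _ (fun w => `|X t w| ^+ 1) m (h 1%N)) => w; rewrite expr1.
  split; [exact: m|exact: i1|exact: h|].
  by apply/EFin_inj; rewrite -expectation_Rint// eX.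
have g2 s t : 0 <= s <= 1 -> 0 <= t <= 1 -> integ P (fun w => X s w * X t w) /\
    \int[P]_w (X s w * X t w) = kern s t.
  move=> s01 t01; have [ms is1 is2 es] := g1 _ s01; have [mt it1 it2 et] := g1 _ t01.
  have i := integ_M2 ms mt is2 it2; split => //.
  have := cX _ _ s01 t01; rewrite covariance.unlock !eX//= => h.
  apply/EFin_inj; rewrite -expectation_Rint// kern_in// -h.
  congr ('E_P[ _ ])%E; apply/funext => w /=.
  by rewrite -[RHS]/((X s w - 0) * (X t w - 0)) !subr0.
move=> n a t t01; have [mL kL cL] := gaussian_moments (gX n t a t01).
split => //.
have e0 : \int[P]_w (\sum_i a i * X (t i) w) = 0.
  have ii i : integ P (fun w => a i * X (t i) w) by apply: integZ; have [] := g1 _ (t01 i).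
  rewrite Rint_sum//.
  by apply: big1 => i _; have [_ ? _ e] := g1 _ (t01 i); rewrite RintZ// e mulr0.
move: cL; rewrite e0; under eq_fun do rewrite subr0.
congr (gauss_char P _ _).
transitivity (\int[P]_w (\sum_i \sum_j a i * a j * (X (t i) w * X (t j) w))).
  apply: eq_Rintegral => w _; rewrite subr0 expr2 mulr_suml; apply: eq_bigr => i _.
  by rewrite mulr_sumr; apply: eq_bigr => j _; ring.
have ij i j : integ P (fun w => a i * a j * (X (t i) w * X (t j) w)).
  by apply: integZ; have [] := g2 _ _ (t01 i) (t01 j).
rewrite Rint_sum; last by move=> i; exact: integ_sum.
apply: eq_bigr => i _; rewrite Rint_sum//; apply: eq_bigr => j _.
by have [h e] := g2 _ _ (t01 i) (t01 j); rewrite RintZ// e.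
Qed.

Lemma gauss_char_bridge (X : R -> T -> R) : (forall t, measurable_fun setT (X t)) ->
  (forall n (a t : 'I_n -> R), (forall i, 0 <= t i <= 1) ->
    gauss_char P (fun w => \sum_i a i * X (t i) w) (\sum_i \sum_j a i * a j * kern (t i) (t j))) ->
  brownian_bridge P X.
Proof.
move=> mX H.
have mL n (a t : 'I_n -> R) : measurable_fun setT (fun w => \sum_i a i * X (t i) w).
  by apply: measurable_sum => i; exact: measurable_funM.
have g1 t : 0 <= t <= 1 -> [/\ integ P (X t), integ P (fun w => X t w ^+ 2),
    \int[P]_w X t w = 0 & \int[P]_w X t w ^+ 2 = kern t t].
  move=> t01; have := gauss_char_moments (mL 1%N (fun=> 1) (fun=> t)) (H 1%N (fun=> 1) (fun=> t) (fun=> t01)).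
  have E1 w : \sum_(i < 1) 1 * X t w = X t w by rewrite big_ord_recl big_ord0 addr0 mul1r.
  have -> : \sum_(i < 1) \sum_(j < 1) 1 * 1 * kern t t = kern t t.
    by rewrite !big_ord_recl !big_ord0 !addr0 !mul1r.
  move=> [i2' e2 e1].
  have i2 : integ P (fun w => X t w ^+ 2) by move: i2'; under eq_fun do rewrite E1.
  move: e2 e1; under eq_Rintegral do rewrite E1; move=> e2.
  under eq_Rintegral do rewrite E1; move=> e1; split => //.
  exact: integ_sqr.
have e0 t : 0 <= t <= 1 -> ('E_P[X t] = 0)%E.
  by move=> t01; have [i _ e _] := g1 _ t01; rewrite expectation_Rint// e.
split => //.
  by move=> n t a t01; exact: gauss_char_law (mL n a t) (H n a t t01).
move=> s t s01 t01; rewrite covariance.unlock !e0//=.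
have [is1 is2 es1 es2] := g1 _ s01; have [it1 it2 et1 et2] := g1 _ t01.
have ist : integ P (fun w => X s w * X t w) by exact: integ_mul2.
have -> : ((X s \- cst 0) * (X t \- cst 0))%R = (fun w => X s w * X t w).
  by apply/funext => w; rewrite -[LHS]/((X s w - 0) * (X t w - 0)) !subr0.
rewrite expectation_Rint//; congr EFin; rewrite -kern_in//.
(* Polarisation: the covariance is extracted from the variances of [X s], [X t] and [X s + X t]. *)
pose sel (y z : R) (i : 'I_2) := if val i == 0%N then y else z.
have T01 i : 0 <= sel s t i <= 1 by rewrite /sel; case: ifP.
have := gauss_char_moments (mL 2%N (sel 1 1) (sel s t)) (H 2%N (sel 1 1) (sel s t) T01).
have E2 w : \sum_i sel 1 1 i * X (sel s t i) w = X s w + X t w.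
  by rewrite !big_ord_recl big_ord0 /sel/= addr0 !mul1r.
have -> : \sum_i \sum_j sel 1 1 i * sel 1 1 j * kern (sel s t i) (sel s t j) =
    kern s s + kern s t + (kern t s + kern t t).
  by rewrite !big_ord_recl !big_ord0 /sel/= !addr0 !mulr1 !mul1r.
move=> [_ + _]; under eq_Rintegral do rewrite E2.
have -> : \int[P]_w (X s w + X t w) ^+ 2 =
    \int[P]_w (X s w ^+ 2 + X t w ^+ 2 + 2 * (X s w * X t w)).
  by apply: eq_Rintegral => w _; ring.
rewrite RintD; [|exact: integD|exact: integZ].
rewrite RintD// RintZ// es2 et2 [kern t s]kernC; lra.
Qed.

End gaussian_laws.

(** * Symmetry of second derivatives *)

Section partials.
Context (R : realType) (n : nat).
Implicit Types (h : 'rV[R]_n -> R) (z e c : 'rV[R]_n) (t u : R).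

Lemma is_derive_line h z e u : derivable h (z + u *: e) e ->
  is_derive u (1:R) (fun u => h (z + u *: e)) ('D_e h (z + u *: e)).
Proof.
move=> dh.
have E : (fun k : R => k^-1 *: (((fun u => h (z + u *: e)) \o shift u) (k *: (1:R)) - h (z + u *: e))) =
    (fun k => k^-1 *: ((h \o shift (z + u *: e)) (k *: e) - h (z + u *: e))).
  apply/funext => k; congr (_ *: (h _ - _)) => /=.
  by rewrite [k *: _]mulr1 scalerDl addrCA.
by split; rewrite /derivable /derive E.
Qed.

Lemma MVT_line h z e t : (forall x, derivable h x e) ->
  exists2 u, `|u| <= `|t| & h (z + t *: e) - h z = t * 'D_e h (z + u *: e).
Proof.
move=> dh; have [u hu e1] := MVT_dist (fun u => is_derive_line (dh (z + u *: e))) 0 t.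
exists u; first by rewrite !subr0 in hu.
by move: e1; rewrite scale0r addr0 subr0 mulrC.
Qed.

Lemma norm_delta (k : 'I_n) u : `|u *: delta_mx 0 k : 'rV[R]_n| <= `|u|.
Proof.
apply: rV_norm_le => // j; rewrite !mxE eqxx /=.
by case: eqP => _; rewrite ?mulr1 ?mulr0 ?normr0.
Qed.

(** Coordinates are changed one at a time with a mean value theorem for each, so that partial
    derivatives suffice and no total differential is involved. *)
Lemma increments h z c t : (forall (k : 'I_n) x, derivable h x (delta_mx 0 k)) ->
  exists xi : 'I_n -> 'rV[R]_n, (forall j, `|xi j - z| <= `|t| * `|c|) /\
    h (z + t *: c) - h z = \sum_j t * (c 0 j * partial j h (xi j)).
Proof.
(* [p m] has its first [m] coordinates moved. *)
move=> dh; pose p m : 'rV[R]_n := z + t *: \row_l (if (l < m)%N then c 0 l else 0).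
have p0 : p 0%N = z by rewrite /p (_ : \row__ _ = 0) ?scaler0 ?addr0//; apply/rowP => l; rewrite !mxE.
have pn : p n = z + t *: c.
  by rewrite /p; congr (_ + _ *: _); apply/rowP => l; rewrite !mxE ltn_ord.
have pS (j : 'I_n) : p j.+1 = p j + (t * c 0 j) *: delta_mx 0 j.
  rewrite /p -addrA; congr (_ + _); apply/rowP => l; rewrite !mxE eqxx /= ltnS leq_eqVlt.
  have [->|lj] := eqVneq l j; first by rewrite eqxx ltnn mulr0 add0r mulr1.
  by rewrite -val_eqE in lj; rewrite (negbTE lj) mulr0 addr0.
have ex (j : 'I_n) : exists x, `|x - z| <= `|t| * `|c| /\
    h (p j.+1) - h (p j) = t * (c 0 j * partial j h x).
  have [u hu e1] := MVT_line (p j) (t * c 0 j) (dh j).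
  exists (p j + u *: delta_mx 0 j); split; last by rewrite pS e1 /partial mulrA.
  have cl l : `|c 0 l| <= `|c| by exact: rV_coord_le.
  apply: rV_norm_le => [|l]; first by rewrite mulr_ge0.
  rewrite /p !mxE eqxx /=.
  have -> (a b d : R) : a + b + d - a = b + d by ring.
  have [->|lj] := eqVneq l j.
    rewrite ltnn mulr0 add0r mulr1; apply: le_trans hu _.
    by rewrite normrM ler_wpM2l.
  rewrite mulr0 addr0; case: ifP => _; last by rewrite mulr0 normr0 mulr_ge0.
  by rewrite normrM ler_wpM2l.
have [xi hxi] := choice ex.
exists xi; split; first by move=> j; have [] := hxi j.
rewrite -pn -[X in _ - h X]p0 -(telescope_sumr (fun m => h (p m)) (leq0n n)) big_mkord.
by apply: eq_bigr => j _; have [_] := hxi j.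
Qed.

Lemma second_difference h z (k l : 'I_n) t :
  (forall k x, derivable h x (delta_mx 0 k)) ->
  (forall k l x, derivable (partial k h) x (delta_mx 0 l)) ->
  exists2 xi, `|z - xi| <= 2 * `|t| &
   h (z + t *: delta_mx 0 l + t *: delta_mx 0 k) - h (z + t *: delta_mx 0 k)
    - (h (z + t *: delta_mx 0 l) - h z) = t * (t * partial l (partial k h) xi).
Proof.
move=> d1 d2; set e := delta_mx 0 k; set f := delta_mx 0 l.
pose phi u := h (z + t *: f + u *: e) - h (z + u *: e).
have dphi u : is_derive u (1:R) phi (partial k h (z + t *: f + u *: e) - partial k h (z + u *: e)).
  exact: is_deriveB (is_derive_line (d1 k (z + t *: f + u *: e))) (is_derive_line (d1 k (z + u *: e))).
have [u] := MVT_dist dphi 0 t; rewrite !subr0 => hu e1.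
have [v hv e2] := MVT_line (z + u *: e) t (d2 k l).
exists (z + u *: e + v *: f).
  rewrite -[z + _ + _]addrA opprD addrA subrr sub0r normrN.
  apply: le_trans (ler_normD _ _) _; rewrite mulr2n mulrDl !mul1r.
  by apply: lerD; apply: le_trans (norm_delta _ _) _.
rewrite -e2 -[z + u *: e + t *: f]addrA [u *: e + _]addrC addrA.
by move: e1; rewrite /phi !scale0r !addr0 => ->; rewrite mulrC.
Qed.

(** The mixed second difference is symmetric in the two directions. By [second_difference] it is
    [t^2] times either mixed partial at some point near [z]; letting [t] tend to 0, continuity
    concludes. *)
Lemma clairaut h z (k l : 'I_n) :
  (forall k x, derivable h x (delta_mx 0 k)) ->
  (forall k l x, derivable (partial k h) x (delta_mx 0 l)) ->
  (forall k l, continuous (partial k (partial l h))) ->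
  partial k (partial l h) z = partial l (partial k h) z.
Proof.
move=> d1 d2 c2.
have ex (m : nat) : exists xx : 'rV[R]_n * 'rV[R]_n,
    [/\ `|z - xx.1| <= 2 * m.+1%:R^-1, `|z - xx.2| <= 2 * m.+1%:R^-1 &
     partial k (partial l h) xx.1 = partial l (partial k h) xx.2].
  have [x hx ex] := second_difference z l k m.+1%:R^-1 d1 d2.
  have [y hy ey] := second_difference z k l m.+1%:R^-1 d1 d2.
  have m0 : m.+1%:R^-1 != 0 :> R by rewrite invr_neq0// pnatr_eq0.
  exists (x, y); rewrite /= in hx hy *; split.
  - by rewrite ger0_norm// in hx.
  - by rewrite ger0_norm// in hy.
  - have sw (a b c d : R) : a - b - (c - d) = a - c - (b - d) by ring.
    have E : m.+1%:R^-1 * (m.+1%:R^-1 * partial k (partial l h) x) =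
        m.+1%:R^-1 * (m.+1%:R^-1 * partial l (partial k h) y).
      apply: (etrans (esym ex)); apply: (etrans _ ey); rewrite [z + _ + _]addrAC; exact: sw.
    exact: (mulfI m0 (mulfI m0 E)).
have [xx hxx] := choice ex.
have cv (u : nat -> 'rV[R]_n) : (forall m, `|z - u m| <= 2 * m.+1%:R^-1) -> u m @[m --> \oo] --> z.
  move=> hu; apply/cvgrPdist_le => e e0.
  have e2 : 0 < e / 2 by rewrite divr_gt0.
  near=> m; apply: le_trans (hu m) _; rewrite -ler_pdivlMl// mulrC.
  near: m; have /cvgrPdist_le/(_ _ e2) := @cvg_inv_nat R.
  by apply: filterS => m; rewrite sub0r normrN ger0_norm.
have c1 := cvg_comp _ _ (cv (fun m => (xx m).1) (fun m => let: And3 a _ _ := hxx m in a)) (c2 k l z).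
have c2' := cvg_comp _ _ (cv (fun m => (xx m).2) (fun m => let: And3 _ a _ := hxx m in a)) (c2 l k z).
have e : (partial k (partial l h) \o (fun m => (xx m).1)) = (partial l (partial k h) \o (fun m => (xx m).2)).
  by apply/funext => m /=; have [] := hxx m.
by rewrite e in c1; exact: (cvg_unique (@norm_hausdorff _ _) c1 c2').
Unshelve. all: by end_near. Qed.

End partials.

(** * Gaussian integration by parts *)

Lemma lam_FTC (R : realType) (F f : R -> R) : (forall x, is_derive x (1:R) F (f x)) ->
  continuous f -> \int[@lam R]_x f x = F 1 - F 0.
Proof.
move=> dF cf; have cF : continuous F by move=> x; exact: is_derive_cont (dF x).
rewrite -lam_Rintegral; last exact: continuous_measurable_fun.
rewrite /Rintegral (@continuous_FTC2 _ _ F)//=.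
- exact: continuous_subspaceT.
- split; first by move=> x _; have [] := dF x.
  + by apply: cvg_at_right_filter; exact: cF.
  + by apply: cvg_at_left_filter; exact: cF.
- by move=> x _; rewrite derive1E; have [] := dF x.
Qed.

Lemma integ_prod_snd d1 d2 (T1 : measurableType d1) (T2 : measurableType d2) (R : realType)
    (m1 : probability T1 R) (m2 : probability T2 R) (f : T2 -> R) : integ m2 f ->
  integ (m1 \x m2)%E (fun z : T1 * T2 => f z.2) /\
  \int[(m1 \x m2)%E]_z f z.2 = \int[m2]_y f y.
Proof.
move=> i; have i' : integ (m1 \x m2)%E (fun z : T1 * T2 => f z.2).
  apply: (@integ_prodM _ _ _ _ _ m1 m2 _ (fun=> 1) (fun y => `|f y|)).
  - by apply: (measurableT_comp (integ_meas i)); exact: measurable_snd.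
  - exact: integ_cst.
  - exact: integ_norm.
  - by move=> x y; rewrite mul1r.
split => //; rewrite -(Rint_section1 i') -[RHS](Rint_probability_cst m1).
by apply: eq_Rintegral => x _.
Qed.

(** The grid approximations of [F] are measurable along [Z], a part of their being multipliers. The
    zero measure is supplied because only measurability is extracted. *)
Lemma measurable_comp_row (R : realType) d (T : measurableType d) n (Z : T -> 'rV[R]_n)
    (F : 'rV[R]_n -> R) : (forall k, measurable_fun setT (fun x => Z x 0 k)) ->
  continuous F -> measurable_fun setT (fun x => F (Z x)).
Proof.
move=> mZ cF.
pose mu (_ : 'I_1) : {measure set T -> \bar R} := @mzero d T R.
have iU (i : 'I_1) : integ (mu i) (fun=> 0) by exact: integrable0.
apply: (measurable_fun_cvg (h := fun m x => gridfun F m.+1 (Z x))).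
- move=> m; have [[h _] _] := @gridfun_multiplier R n d T 'I_1 mu (fun _ _ => 0) (fun _ => Z)
    iU (fun _ => mZ) F m.+1.
  exact: h ord0.
- by move=> x _; exact: gridfun_cvg.
Qed.

Section integration_by_parts.
Context (R : realType) d (T : measurableType d) (P : probability T R) (n : nat).
Variables (Y : T -> R) (Z : 'I_n -> T -> R) (q : R) (c : 'rV[R]_n) (V : ('I_n -> R) -> R).
Local Notation lam := (@lam R).
Hypotheses (mY : measurable_fun setT Y) (mZ : forall l, measurable_fun setT (Z l)).
Hypothesis iY : forall k, integ P (fun w => `|Y w| ^+ k).
Hypothesis iZ : forall l k, integ P (fun w => `|Z l w| ^+ k).
(** Joint Gaussianity: [q] is the variance of [Y], [c] lists its covariances with the [Z l], and
    [V la] is the variance of the combination of the [Z l]. *)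
Hypothesis joint : forall (mu : R) (la : 'I_n -> R),
  gauss_char P (fun w => mu * Y w + \sum_l la l * Z l w)
    (mu ^+ 2 * q + 2 * mu * (\sum_l la l * c 0 l) + V la).
Implicit Types (la : 'I_n -> R) (F : 'rV[R]_n -> R).

Definition vec (w : T) : 'rV[R]_n := \row_l Z l w.

(** Both sides are, up to sign, the derivative at [mu = 0] of the joint characteristic function:
    once under the integral, once in its explicit form. *)
Lemma stein_phase la (a : R) :
  \int[P]_w (Y w * sin (\sum_l la l * Z l w + a)) =
  (\sum_l la l * c 0 l) * (cos a * expR (- (V la / 2))).
Proof.
set S := \sum_l la l * c 0 l; pose A w := \sum_l la l * Z l w.
have mA : measurable_fun setT A by apply: measurable_sum => l; exact: measurable_funM.
have iY1 : integ P (fun w => `|Y w|) by have := iY 1; under eq_fun do rewrite expr1.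
have mL m : measurable_fun setT (fun w => m * Y w + A w).
  by apply: measurable_funD => //; exact: measurable_funM.
have E m : \int[P]_w cos (m * Y w + (A w + a)) = cos a * expR (- ((m ^+ 2 * q + 2 * m * S + V la) / 2)).
  have := joint m la 1 a; rewrite expr1n mul1r => <-.
  by apply: eq_Rintegral => w _; rewrite mul1r addrA.
have D1 : is_derive (0:R) (1:R) (fun m => \int[P]_w cos (m * Y w + (A w + a)))
    (\int[P]_w (- (Y w * sin (0 * Y w + (A w + a))))).
  apply: (@is_derive_Rint _ _ _ P (fun m w => cos (m * Y w + (A w + a)))
    (fun m w => - (Y w * sin (m * Y w + (A w + a)))) (fun w => `|Y w|) 0 1) => //.
  - move=> m; apply: (@integ_bounded _ _ _ P _ 1) => [|w]; last exact: cos_max.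
    have := measurable_cosl 1 a (mL m); congr (measurable_fun _ _).
    by apply/funext => w; rewrite mul1r addrA.
  - move=> m w _; have := is_derive_cosl (Y w) (A w + a) m.
    by under eq_fun do rewrite [Y w * _]mulrC; rewrite [Y w * m]mulrC.
  - by move=> m w _; rewrite normrN normrM ler_piMr// sin_max.
have D2 : is_derive (0:R) (1:R) (fun m => cos a * expR (- ((m ^+ 2 * q + 2 * m * S + V la) / 2)))
    (- (S * (cos a * expR (- (V la / 2))))).
  have h := is_deriveMr (is_derive_lin (- (q / 2)) (- S) 0) (is_derive_lin 1 0 0).
  have h' := is_derive_expf (is_deriveD h (is_derive_cst (- (V la / 2)) (0:R) 1)).
  have h3 := is_deriveMr (is_derive_cst (cos a) (0:R) 1) h'.
  rewrite (_ : (fun m => cos a * expR (- ((m ^+ 2 * q + 2 * m * S + V la) / 2))) =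
    (fun m => cst (cos a) m * expR ((- (q / 2) * m + - S) * (1 * m + 0) + cst (- (V la / 2)) m))).
    apply: is_derive_eq h3 _ => /=; rewrite mul0r add0r.
    rewrite (_ : (_ + _) 0 = - (V la / 2)); first by ring.
    by rewrite -[LHS]/((- (q / 2) * 0 - S) * (1 * 0 + 0) + - (V la / 2)); ring.
  by apply/funext => m; congr (_ * expR _) => /=; field.
have EF : (fun m => \int[P]_w cos (m * Y w + (A w + a))) =
    (fun m => cos a * expR (- ((m ^+ 2 * q + 2 * m * S + V la) / 2))).
  by apply/funext => m; exact: E.
have [_ e1] := D1; have [_ e2] := D2; move: e1; rewrite EF e2 RintN.
  by move/oppr_inj => ->; apply: eq_Rintegral => w _; rewrite mul0r add0r.
apply: (@integ_le _ _ _ P _ (fun w => `|Y w|)) => //.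
  apply: measurable_funM => //; have := measurable_sinl 1 a mA; congr (measurable_fun _ _).
  by apply/funext => w; rewrite mul1r mul0r add0r.
by move=> w; rewrite normrM ler_piMr// sin_max.
Qed.

Lemma vec_norm_pow p w : (2 + `|vec w|) ^+ p <= 2 ^+ p + \sum_l (2 + `|Z l w|) ^+ p.
Proof.
have s0 : 0 <= \sum_l (2 + `|Z l w|) ^+ p by apply: sumr_ge0 => l _; rewrite exprn_ge0// addr_ge0.
(* The norm is attained at a coordinate unless it is 0, as happens for [n = 0]. *)
have [e|ne] := eqVneq `|vec w| 0; first by rewrite e addr0 lerDl.
have [[i l] /= e] : exists i, `|vec w| = `|vec w i.1 i.2| by exact: mx_norm_neq0 ne.
rewrite e (ord1 i) mxE (bigD1 l)//= addrCA lerDl addr_ge0 ?exprn_ge0//.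
by apply: sumr_ge0 => j _; rewrite exprn_ge0// addr_ge0.
Qed.

Lemma integ_pow2 (X : T -> R) p : measurable_fun setT X -> (forall k, integ P (fun w => `|X w| ^+ k)) ->
  integ P (fun w => (2 + `|X w|) ^+ p).
Proof.
move=> mX iX; apply: (@integ_le _ _ _ P _ (fun w => 2 ^+ p * (2 ^+ p + `|X w| ^+ p))).
- by apply: measurable_funX; apply: measurable_funD => //; exact: measurableT_comp.
- by apply: integZ; apply: integD => //; exact: integ_cst.
- move=> w; rewrite ger0_norm ?exprn_ge0 ?addr_ge0//.
  have h : 2 + `|X w| <= 2 * Num.max 2 `|X w|.
    have h1 : 2 <= Num.max 2 `|X w| by rewrite le_max lexx.
    have h2 : `|X w| <= Num.max 2 `|X w| by rewrite le_max lexx orbT.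
    lra.
  apply: (@le_trans _ _ ((2 * Num.max 2 `|X w|) ^+ p)).
    by rewrite lerXn2r ?nnegrE ?mulr_ge0 ?addr_ge0// le_max ler0n.
  rewrite exprMn ler_wpM2l ?exprn_ge0//.
  by case: (leP 2 `|X w|) => _; [rewrite lerDr|rewrite lerDl]; rewrite exprn_ge0.
Qed.

Lemma measurable_vec F : continuous F -> measurable_fun setT (fun w => F (vec w)).
Proof.
apply: measurable_comp_row => k; rewrite (_ : (fun w => _) = Z k)//.
by apply/funext => w; rewrite mxE.
Qed.

Lemma measurable_vec_norm : measurable_fun setT (fun w => `|vec w|).
Proof. by apply: measurable_vec; exact: norm_continuous. Qed.

Lemma integ_vec_pow p : integ P (fun w => (2 + `|vec w|) ^+ p).
Proof.
apply: (@integ_le _ _ _ P _ (fun w => 2 ^+ p + \sum_l (2 + `|Z l w|) ^+ p)).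
- by apply: measurable_funX; apply: measurable_funD => //; exact: measurable_vec_norm.
- by apply: integD; [exact: integ_cst|apply: integ_sum => l; exact: integ_pow2].
- by move=> w; rewrite ger0_norm ?exprn_ge0 ?addr_ge0//; exact: vec_norm_pow.
Qed.

Lemma integ_Yvec_pow p : integ P (fun w => `|Y w| * (2 + `|vec w|) ^+ p).
Proof.
apply: (@integ_le _ _ _ P _ (fun w => `|Y w| ^+ 2 + (2 + `|vec w|) ^+ (p + p))).
- apply: measurable_funM; first exact: measurableT_comp.
  by apply: measurable_funX; apply: measurable_funD => //; exact: measurable_vec_norm.
- by apply: integD => //; exact: integ_vec_pow.
- move=> w; rewrite exprD; set X := _ ^+ p; rewrite ger0_norm; last first.
    by rewrite mulr_ge0// exprn_ge0// addr_ge0.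
  have := sqr_ge0 (`|Y w| - X); have := sqr_ge0 (`|Y w|); have := sqr_ge0 X.
  by rewrite sqrrB -!expr2; set u := `|Y w| => h1 h2 h3; rewrite mulr2n in h3; lra.
Qed.

Lemma stein_phase_cos la (a : R) :
  \int[P]_w (Y w * cos (\sum_l la l * Z l w + a)) =
  - (\sum_l la l * c 0 l) * (sin a * expR (- (V la / 2))).
Proof.
have := stein_phase la (a + pi / 2); rewrite cosDpihalf mulNr mulrN mulNr => <-.
by apply: eq_Rintegral => w _; rewrite addrA sinDpihalf.
Qed.

Lemma phase_vec la (a : R) :
  \int[P]_w cos (\sum_l la l * Z l w + a) = cos a * expR (- (V la / 2)).
Proof.
have := joint 0 la 1 a; rewrite expr1n mul1r expr0n /= mul0r mulr0 mul0r !add0r => <-.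
by apply: eq_Rintegral => w _; rewrite mul0r add0r mul1r.
Qed.

Lemma shift_pow (z : 'rV[R]_n) (s K : R) p : `|s| <= K ->
  (2 + `|z + s *: c|) ^+ p <= (1 + K * `|c|) ^+ p * (2 + `|z|) ^+ p.
Proof.
move=> sK; have K0 : 0 <= K := le_trans (normr_ge0 _) sK.
have h : `|z + s *: c| <= `|z| + K * `|c|.
  apply: le_trans (ler_normD _ _) _; rewrite lerD2l.
  apply: rV_norm_le => [|k]; first by rewrite mulr_ge0.
  by rewrite mxE normrM ler_pM// rV_coord_le.
rewrite -exprMn lerXn2r ?nnegrE ?mulr_ge0 ?addr_ge0 ?mulr_ge0//.
have : 0 <= K * `|c| * (1 + `|z|) by rewrite !mulr_ge0// addr_ge0.
move: h; set u := `|z + _|; set v := `|z|; set k := K * _ => h h2.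
by apply: (@le_trans _ _ (2 + (v + k))); [lra|have := mulrDr k 1 v; lra].
Qed.

(* Both sides are integrals of [F] against signed measures, so that it is enough to
   check trigonometric [F], where it is an integrated form of [stein_phase_cos]. *)
Lemma shift_identity F (C : R) p (h : R) : continuous F -> 0 <= C ->
  (forall z, `|F z| <= C * (1 + `|z|) ^+ p) -> h != 0 ->
  \int[(lam \x P)%E]_z (Y z.2 * F (vec z.2 + (h * clip z.1) *: c)) =
  h^-1 * (\int[P]_w F (vec w + h *: c) - \int[P]_w F (vec w)).
Proof.
move=> cF C0 hF h0.
(* Index 0 carries the left side, indices 1 and 2 the two terms of the right side moved over; all
   live on the product, although the last two ignore the averaging variable. *)
pose U (i : 'I_3) (z : R * T) := match val i with 0%N => Y z.2 | 1%N => - h^-1 | _ => h^-1 end.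
pose s (i : 'I_3) (z : R * T) := match val i with 0%N => h * clip z.1 | 1%N => h | _ => 0 end.
pose ZZ i z := vec z.2 + s i z *: c.
have mY2 : measurable_fun setT (fun z : R * T => Y z.2).
  by apply: (measurableT_comp mY); exact: measurable_snd.
have iY1 : integ P Y.
  by apply: (@integ_le _ _ _ P _ (fun w => `|Y w| ^+ 1)) => // w; rewrite expr1.
have mU i : measurable_fun setT (U i).
  by case: i => -[|[|[|//]]] lt3; rewrite /U /=; [exact: mY2|exact: measurable_cst|exact: measurable_cst].
have ms i : measurable_fun setT (s i).
  case: i => -[|[|[|//]]] lt3; rewrite /s /=; [|exact: measurable_cst|exact: measurable_cst].
  apply: measurable_funM => //; apply: (measurableT_comp (@measurable_clip R)); exact: measurable_fst.
have mZZ i k : measurable_fun setT (fun z => ZZ i z 0 k).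
  rewrite (_ : (fun z => ZZ i z 0 k) = (fun z => Z k z.2 + s i z * c 0 k)).
    apply: measurable_funD; first by apply: (measurableT_comp (mZ k)); exact: measurable_snd.
    by apply: measurable_funM.
  by apply/funext => z; rewrite /ZZ !mxE.
have iU i : integ (lam \x P)%E (U i).
  case: i => -[|[|[|//]]] lt3; rewrite /U /=; [exact: (integ_prod_snd lam iY1).1| |].
    exact: (integ_prod_snd lam (integ_cst P (- h^-1))).1.
  exact: (integ_prod_snd lam (integ_cst P (h^-1))).1.
have sh i z : `|s i z| <= `|h|.
  case: i => -[|[|[|//]]] lt3; rewrite /s /= ?normr0//.
  have /andP[c0 c1] := clip_in z.1.
  by rewrite normrM ler_piMr// ger0_norm.
have bnd i : integ (lam \x P)%E (fun z => (2 + `|ZZ i z|) ^+ p * `|U i z|).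
  apply: (@integ_le _ _ _ (lam \x P)%E _ (fun z => (1 + `|h| * `|c|) ^+ p *
    (`|Y z.2| * (2 + `|vec z.2|) ^+ p + `|h^-1| * (2 + `|vec z.2|) ^+ p))).
  - have mn : measurable_fun setT (@Num.norm _ R).
      by apply: continuous_measurable_fun; exact: norm_continuous.
    apply: measurable_funM; last exact: (measurableT_comp mn (mU i)).
    apply: measurable_funX; apply: measurable_funD => //.
    by apply: (measurable_comp_row (mZZ i)); exact: norm_continuous.
  - apply: integZ; apply: integD.
      exact: (integ_prod_snd lam (integ_Yvec_pow p)).1.
    exact: (integ_prod_snd lam (integZ _ (integ_vec_pow p))).1.
  - move=> z; have P0 : 0 <= (2 + `|vec z.2|) ^+ p by rewrite exprn_ge0// addr_ge0.
    rewrite normrM normr_id ger0_norm ?exprn_ge0 ?addr_ge0//.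
    rewrite -mulrDl [X in _ <= _ * X]mulrC mulrA ler_pM ?exprn_ge0 ?addr_ge0//; first exact: shift_pow.
    case: i => -[|[|[|//]]] lt3; rewrite /U /= ?normrN ?lerDl ?lerDr//.
have pt l a : pairing (fun=> (lam \x P)%E : {measure set _ -> \bar R}) U ZZ (trig l a) = 0.
  set S := \sum_k l k * c 0 k; set E := expR (- (V l / 2)).
  have tE i z : trig l a (ZZ i z) = cos (\sum_k l k * Z k z.2 + (s i z * S + a)).
    rewrite /trig /ZZ addrA; congr (cos (_ + _)); rewrite /S mulr_sumr -big_split/=.
    by apply: eq_bigr => k _; rewrite !mxE; ring.
  have icos b : integ P (fun w => cos (\sum_k l k * Z k w + b)).
    have mA : measurable_fun setT (fun w => \sum_k l k * Z k w).
      by apply: measurable_sum => k; exact: measurable_funM.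
    have := integ_cosl P 1 b mA; congr (_.-integrable _ (EFin \o _)).
    by apply/funext => w; rewrite mul1r.
  rewrite /pairing !big_ord_recl big_ord0 addr0.
  under eq_Rintegral => z _ do rewrite tE.
  under [X in _ + (X + _)]eq_Rintegral => z _ do rewrite tE.
  under [X in _ + (_ + X)]eq_Rintegral => z _ do rewrite tE.
  rewrite /U /s /=.
  have -> : \int[(lam \x P)%E]_z (- h^-1 * cos (\sum_k l k * Z k z.2 + (h * S + a))) =
      - h^-1 * (cos (h * S + a) * E).
    rewrite (integ_prod_snd lam (integZ (- h^-1) (icos (h * S + a)))).2 RintZ// phase_vec.
    by [].
  have -> : \int[(lam \x P)%E]_z (h^-1 * cos (\sum_k l k * Z k z.2 + (0 * S + a))) =
      h^-1 * (cos a * E).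
    rewrite mul0r add0r (integ_prod_snd lam (integZ (h^-1) (icos a))).2 RintZ// phase_vec.
    by [].
  have i0 : integ (lam \x P)%E (fun z => Y z.2 * cos (\sum_k l k * Z k z.2 + (h * clip z.1 * S + a))).
    apply: (@integ_le _ _ _ (lam \x P)%E _ (fun z => `|Y z.2|)).
    - apply: measurable_funM => //; apply: (measurableT_comp (f := @cos R)).
        by apply: continuous_measurable_fun; exact: continuous_cos.
      apply: measurable_funD.
        apply: measurable_sum => k; apply: measurable_funM => //.
        by apply: (measurableT_comp (mZ k)); exact: measurable_snd.
      apply: measurable_funD => //; apply: measurable_funM => //; apply: measurable_funM => //.
      by apply: (measurableT_comp (@measurable_clip R)); exact: measurable_fst.
    - exact: (integ_prod_snd lam (integ_norm iY1)).1.
    - by move=> z; rewrite normrM ler_piMr// cos_max.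
  rewrite -(Rint_section1 i0) /=.
  under eq_Rintegral => e _ do rewrite stein_phase_cos -/S -/E.
  rewrite (@lam_clip R (fun e => - S * (sin (h * e * S + a) * E))); last first.
    apply: measurable_funM => //; apply: measurable_funM => //; apply: (measurableT_comp (f := @sin R)).
      by apply: continuous_measurable_fun; exact: continuous_sin.
    by apply: measurable_funD => //; apply: measurable_funM => //; apply: measurable_funM.
  (* Averaging over the shift turns the sine coming from [stein_phase_cos] into a difference of
     cosines; this is the reason for the integrated form. *)
  have FTC : \int[lam]_e (- (h * S * sin (h * S * e + a))) = cos (h * S * 1 + a) - cos (h * S * 0 + a).
    apply: (lam_FTC (F := fun e => cos (h * S * e + a))) => e; first exact: is_derive_cosl.
    by apply: cvgN; apply: cvgMr; exact: is_derive_cont (is_derive_sinl _ _ _).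
  have -> : \int[lam]_e (- S * (sin (h * e * S + a) * E)) =
      h^-1 * E * \int[lam]_e (- (h * S * sin (h * S * e + a))).
    rewrite -RintZ.
      by apply: eq_Rintegral => e _; rewrite [h * e * S]mulrAC; field.
    apply: (@integ_bounded _ _ _ lam _ `|h * S|) => [|e]; last first.
      by rewrite normrN normrM ler_piMr// sin_max.
    apply: continuous_measurable_fun => e.
    by apply: cvgN; apply: cvgMr; exact: is_derive_cont (is_derive_sinl _ _ _).
  by rewrite FTC mulr1 mulr0 add0r; ring.
have := trig_uniqueness iU mZZ pt cF C0 hF bnd.
rewrite /pairing !big_ord_recl big_ord0 addr0 /U /ZZ /s /=.
have iF (b : R) : integ P (fun w => F (vec w + b *: c)).
  apply: (@integ_le _ _ _ P _ (fun w => C * ((1 + `|b| * `|c|) ^+ p * (2 + `|vec w|) ^+ p))).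
  - apply: (measurable_comp_row _ cF) => k.
    rewrite (_ : (fun w => _) = (fun w => Z k w + b * c 0 k)); first exact: measurable_funD.
    by apply/funext => w; rewrite !mxE.
  - by apply: integZ; apply: integZ; exact: integ_vec_pow.
  - move=> w; apply: le_trans (hF _) _; rewrite ler_wpM2l//.
    apply: le_trans (shift_pow (vec w) p (lexx `|b|)).
    by rewrite lerXn2r ?nnegrE ?addr_ge0// lerD2r ler1n.
rewrite (integ_prod_snd lam (integZ (- h^-1) (iF h))).2 (integ_prod_snd lam (integZ (h^-1) (iF 0))).2.
rewrite !RintZ// mulNr mulrBr => e; under [X in _ = _ - _ * X]eq_Rintegral => w _ do rewrite -[vec w]addr0 -(scale0r c).
lra.
Qed.

End integration_by_parts.

Lemma cvg_comp_row (R : realType) n (F : 'rV[R]_n -> R) (u : nat -> 'rV[R]_n) (z : 'rV[R]_n)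
    (b : nat -> R) : continuous F -> (forall m, `|z - u m| <= b m) ->
  b m @[m --> \oo] --> 0 -> F (u m) @[m --> \oo] --> F z.
Proof.
move=> cF hu hb; have hz : u @ \oo --> z.
  apply/cvgrPdist_le => e e0.
  move/cvgrPdist_le: hb => /(_ _ e0); apply: filterS => m; apply: le_trans.
  by apply: le_trans (hu m) _; rewrite sub0r normrN ler_norm.
exact: (cvg_comp _ _ hz (cF z)).
Qed.

Section integration_by_parts_limit.
Context (R : realType) d (T : measurableType d) (P : probability T R) (n : nat).
Variables (Y : T -> R) (Z : 'I_n -> T -> R) (q : R) (c : 'rV[R]_n) (V : ('I_n -> R) -> R).
Local Notation lam := (@lam R).
Local Notation vec := (vec Z).
Hypotheses (mY : measurable_fun setT Y) (mZ : forall l, measurable_fun setT (Z l)).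
Hypothesis iY : forall k, integ P (fun w => `|Y w| ^+ k).
Hypothesis iZ : forall l k, integ P (fun w => `|Z l w| ^+ k).
Hypothesis joint : forall (mu : R) (la : 'I_n -> R),
  gauss_char P (fun w => mu * Y w + \sum_l la l * Z l w)
    (mu ^+ 2 * q + 2 * mu * (\sum_l la l * c 0 l) + V la).
Variables (F : 'rV[R]_n -> R) (C : R) (p : nat).
Hypotheses (cF : continuous F) (dF : forall (k : 'I_n) z, derivable F z (delta_mx 0 k)).
Hypothesis cdF : forall k : 'I_n, continuous (partial k F).
Hypotheses (C0 : 0 <= C) (hF : forall z, `|F z| <= C * (1 + `|z|) ^+ p).
Hypothesis hdF : forall (k : 'I_n) z, `|partial k F z| <= C * (1 + `|z|) ^+ p.

Lemma integ_comp_growth (G : 'rV[R]_n -> R) : continuous G ->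
  (forall z, `|G z| <= C * (1 + `|z|) ^+ p) -> integ P (fun w => G (vec w)).
Proof.
move=> cG hG; apply: (@integ_le _ _ _ P _ (fun w => C * (2 + `|vec w|) ^+ p)).
- exact: measurable_vec.
- by apply: integZ; exact: integ_vec_pow.
- move=> w; apply: le_trans (hG _) _; rewrite ler_wpM2l// lerXn2r ?nnegrE ?addr_ge0//.
  by rewrite lerD2r ler1n.
Qed.

Lemma integ_Y_growth (G : 'rV[R]_n -> R) : continuous G ->
  (forall z, `|G z| <= C * (1 + `|z|) ^+ p) -> integ P (fun w => Y w * G (vec w)).
Proof.
move=> cG hG; apply: (@integ_le _ _ _ P _ (fun w => C * (`|Y w| * (2 + `|vec w|) ^+ p))).
- by apply: measurable_funM => //; exact: measurable_vec.
- by apply: integZ; exact: integ_Yvec_pow.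
- move=> w; rewrite normrM mulrCA ler_wpM2l//.
  apply: le_trans (hG _) _; rewrite ler_wpM2l// lerXn2r ?nnegrE ?addr_ge0//.
  by rewrite lerD2r ler1n.
Qed.

Lemma growth_shift (G : 'rV[R]_n -> R) z x : (forall z, `|G z| <= C * (1 + `|z|) ^+ p) ->
  `|x - z| <= `|c| -> `|G x| <= C * ((1 + `|c|) ^+ p * (2 + `|z|) ^+ p).
Proof.
move=> hG h; apply: le_trans (hG _) _; rewrite ler_wpM2l// -exprMn.
rewrite lerXn2r ?nnegrE ?mulr_ge0 ?addr_ge0//.
have h1 : `|x| <= `|z| + `|c|.
  by rewrite -[X in `|X|](subrK z) addrC; apply: le_trans (ler_normD _ _) _; rewrite lerD2l.
have : 0 <= `|c| * (1 + `|z|) by rewrite mulr_ge0// addr_ge0.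
move: h1; set u := `|x|; set v := `|z|; set k := `|c| => h1 h2.
have := mulrDr k 1 v; lra.
Qed.

(** [shift_identity] along [h = 1 / m.+1]. As [h <= 1], every point involved is within [|c|] of
    [vec w], and the growth bound there, with the factor [K], dominates both sides. *)
Theorem stein_ibp : \int[P]_w (Y w * F (vec w)) =
  \sum_l c 0 l * \int[P]_w partial l F (vec w).
Proof.
pose h m : R := m.+1%:R^-1.
have h0 m : h m != 0 by rewrite invr_neq0// pnatr_eq0.
have hp m : 0 < h m by rewrite invr_gt0.
have h1 m : h m <= 1 by rewrite invf_le1// ler1n.
have ch : h m @[m --> \oo] --> (0 : R) := @cvg_inv_nat R.
have si m := shift_identity mY mZ iY iZ joint cF C0 hF (h0 m).
pose K := (1 + `|c|) ^+ p.
have iG : integ P (fun w => C * (K * (`|Y w| * (2 + `|vec w|) ^+ p))).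
  by apply: integZ; apply: integZ; exact: integ_Yvec_pow.
have ch0 : h m * `|c| @[m --> \oo] --> 0 by rewrite -[X in _ --> X](mul0r `|c|); exact: cvgMl.
have L : \int[(lam \x P)%E]_z (Y z.2 * F (vec z.2 + (h m * clip z.1) *: c)) @[m --> \oo] -->
    \int[(lam \x P)%E]_z (Y z.2 * F (vec z.2)).
  have dist m z : `|vec z.2 - (vec z.2 + (h m * clip z.1) *: c)| <= h m * `|c|.
    rewrite opprD addrA subrr sub0r normrN; apply: rV_norm_le => [|k]; first by rewrite mulr_ge0// ltW.
    have /andP[c0 c1] := clip_in z.1.
    rewrite mxE !normrM (gtr0_norm (hp m)) (ger0_norm c0) ler_pM ?mulr_ge0 ?(ltW (hp m))//.
      by rewrite ler_piMr// ltW.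
    exact: rV_coord_le.
  have [||||_] // := @Rint_dct _ _ _ (lam \x P)%E
    (fun m z => Y z.2 * F (vec z.2 + (h m * clip z.1) *: c)) (fun z => Y z.2 * F (vec z.2))
    (fun z => C * (K * (`|Y z.2| * (2 + `|vec z.2|) ^+ p))).
  - move=> m; apply: measurable_funM; first by apply: (measurableT_comp mY); exact: measurable_snd.
    apply: (measurable_comp_row _ cF) => k.
    rewrite (_ : (fun x => _) = (fun x => Z k x.2 + (h m * clip x.1) * c 0 k)).
      apply: measurable_funD; first by apply: (measurableT_comp (mZ k)); exact: measurable_snd.
      apply: measurable_funM => //; apply: measurable_funM => //.
      by apply: (measurableT_comp (@measurable_clip R)); exact: measurable_fst.
    by apply/funext => x; rewrite !mxE.
  - exact: (integ_prod_snd lam iG).1.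
  - move=> z; apply: cvgMr.
    exact: (cvg_comp_row cF (fun m => dist m z) ch0).
  - move=> m z; rewrite normrM.
    have gs := growth_shift hF (z := vec z.2) (x := vec z.2 + (h m * clip z.1) *: c).
    have -> : C * (K * (`|Y z.2| * (2 + `|vec z.2|) ^+ p)) =
      `|Y z.2| * (C * (K * (2 + `|vec z.2|) ^+ p)) by ring.
    rewrite ler_wpM2l//; apply: gs; rewrite distrC; apply: le_trans (dist m z) _.
    by rewrite ler_piMl.
have Rm : (h m)^-1 * (\int[P]_w F (vec w + h m *: c) - \int[P]_w F (vec w)) @[m --> \oo] -->
    \int[P]_w (\sum_l c 0 l * partial l F (vec w)).
  have iFs m : integ P (fun w => F (vec w + h m *: c)).
    apply: (@integ_le _ _ _ P _ (fun w => C * (K * (2 + `|vec w|) ^+ p))).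
    - apply: (measurable_comp_row _ cF) => k.
      rewrite (_ : (fun w => _) = (fun w => Z k w + h m * c 0 k)); first exact: measurable_funD.
      by apply/funext => w; rewrite !mxE.
    - by apply: integZ; apply: integZ; exact: integ_vec_pow.
    - move=> w; apply: (growth_shift hF).
      rewrite addrAC subrr add0r; apply: rV_norm_le => // k.
      rewrite mxE normrM (gtr0_norm (hp m)); apply: le_trans (rV_coord_le c k).
      by rewrite ler_piMl.
  have iF0 : integ P (fun w => F (vec w)) by exact: integ_comp_growth.
  have eqm m : (h m)^-1 * (\int[P]_w F (vec w + h m *: c) - \int[P]_w F (vec w)) =
      \int[P]_w ((h m)^-1 * (F (vec w + h m *: c) - F (vec w))).
    by rewrite -RintB// RintZ//; exact: integB.
  under eq_fun do rewrite eqm.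
  have inc m z : exists xi : 'I_n -> 'rV[R]_n, (forall j, `|xi j - z| <= h m * `|c|) /\
      (h m)^-1 * (F (z + h m *: c) - F z) = \sum_j c 0 j * partial j F (xi j).
    have [xi [hx ex]] := increments z c (h m) dF; exists xi; split.
      by move=> j; have := hx j; rewrite (gtr0_norm (hp m)).
    by rewrite ex -mulr_sumr mulKf.
  have [||||_] // := @Rint_dct _ _ _ P
    (fun m w => (h m)^-1 * (F (vec w + h m *: c) - F (vec w)))
    (fun w => \sum_l c 0 l * partial l F (vec w))
    (fun w => (\sum_l `|c 0 l|) * (C * (K * (2 + `|vec w|) ^+ p))).
  - move=> m; apply: integ_meas; apply: integZ; exact: integB.
  - by apply: integZ; apply: integZ; apply: integZ; exact: integ_vec_pow.
  - move=> w; have [xi hxi] := choice (fun m => inc m (vec w)).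
    under eq_fun do rewrite (hxi _).2.
    apply: (@cvg_sumr _ _ _ _ _ _ (fun j m => c 0 j * partial j F (xi m j))
      (fun j => c 0 j * partial j F (vec w))) => j; apply: cvgMr.
    apply: (cvg_comp_row (@cdF j) _ ch0) => m.
    by rewrite distrC; exact: (hxi m).1.
  - move=> m w; have [xi [hx ->]] := inc m (vec w).
    apply: le_trans (ler_norm_sum _ _ _) _; rewrite mulr_suml; apply: ler_sum => j _.
    rewrite normrM ler_wpM2l//; apply: (growth_shift (hdF j)).
    by apply: le_trans (hx j) _; rewrite ler_piMl.
have e : (fun m => \int[(lam \x P)%E]_z (Y z.2 * F (vec z.2 + (h m * clip z.1) *: c))) =
    (fun m => (h m)^-1 * (\int[P]_w F (vec w + h m *: c) - \int[P]_w F (vec w))).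
  by apply/funext => m; exact: si.
rewrite e in L.
have := cvg_unique (@norm_hausdorff _ _) L Rm.
rewrite (integ_prod_snd lam (integ_Y_growth cF hF)).2 => ->.
rewrite Rint_sum; last by move=> l; apply: integZ; exact: integ_comp_growth.
by apply: eq_bigr => l _; rewrite RintZ//; exact: integ_comp_growth.
Qed.

End integration_by_parts_limit.

(** * Integration by parts for the bridge *)

Section bridge_stein.
Context (R : realType) (P : probability (Omega R) R).
Local Notation lam := (@lam R).
Local Notation pathv := (@pathv R).
Hypothesis bridge : brownian_bridge P coordinate.
Implicit Types (s : seq (R * R)) (t : R).

Definition qform s : R := \sum_(p <- s) \sum_(r <- s) p.1 * r.1 * kern p.2 r.2.

Lemma measurable_pathv t : measurable_fun setT (pathv t).
Proof. exact: (measurableT_comp (@measurable_process R) (measurable_pair1 t)). Qed.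

Lemma kern_clip (u v : R) : kern (clip u) (clip v) = kern u v.
Proof. by rewrite /kern !(clip_id (clip_in _)). Qed.

Lemma point_sum_gauss s :
  [/\ measurable_fun setT (point_sum pathv s),
      forall k, integ P (fun x => `|point_sum pathv s x| ^+ k) &
      gauss_char P (point_sum pathv s) (qform s)].
Proof.
have := bridge_gauss_char bridge (fun i => (tnth (in_tuple s) i).1)
  (fun i => clip_in (tnth (in_tuple s) i).2).
have E x : \sum_i (tnth (in_tuple s) i).1 * coordinate (clip (tnth (in_tuple s) i).2) x =
    point_sum pathv s x.
  by rewrite /point_sum [RHS]big_tnth; apply: eq_bigr => i _.
under eq_fun do rewrite E.
have -> : \sum_i \sum_j (tnth (in_tuple s) i).1 * (tnth (in_tuple s) j).1 *
    kern (clip (tnth (in_tuple s) i).2) (clip (tnth (in_tuple s) j).2) = qform s.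
  rewrite /qform [RHS]big_tnth; apply: eq_bigr => i _; rewrite [RHS]big_tnth; apply: eq_bigr => j _.
  by rewrite kern_clip.
move=> [m h g]; split => //.
by move=> k; have := h k; under eq_fun do rewrite E.
Qed.

Lemma pathv_gauss t : [/\ forall k, integ P (fun x => `|pathv t x| ^+ k) &
  \int[P]_x (pathv t x ^+ 2) = kern t t].
Proof.
have [m h g] := point_sum_gauss [:: (1, t)].
have E x : point_sum pathv [:: (1, t)] x = pathv t x.
  by rewrite /point_sum big_cons big_nil addr0 mul1r.
split; first by move=> k; have := h k; under eq_fun do rewrite E.
have [_ e _] := gauss_char_moments m g.
transitivity (\int[P]_x (point_sum pathv [:: (1, t)] x ^+ 2)).
  by apply: eq_Rintegral => x _; rewrite E.
by rewrite e /qform !big_cons !big_nil /= !addr0 !mul1r.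
Qed.

Lemma qform_cons (m t : R) s :
  qform ((m, t) :: s) = m ^+ 2 * kern t t + 2 * m * kern_sum s t + qform s.
Proof.
rewrite /qform !big_cons /= expr2 -!addrA; congr (_ + _).
under [X in _ + X = _]eq_bigr => p _ do rewrite big_cons.
rewrite big_split /= addrA; congr (_ + _).
rewrite /kern_sum mulr_sumr -big_split/=; apply: eq_bigr => p _.
by rewrite [kern p.2 t]kernC; ring.
Qed.

Variables (n : nat) (e : 'I_n -> seq (R * R)).

Let Z (k : 'I_n) : Omega R -> R := point_sum pathv (e k).
Let all_points (la : 'I_n -> R) : seq (R * R) :=
  flatten [seq [seq (la k * p.1, p.2) | p <- e k] | k <- index_enum 'I_n].

Let all_sum (la : 'I_n -> R) (f : R -> R) :
  \sum_(p <- all_points la) p.1 * f p.2 = \sum_k la k * \sum_(p <- e k) p.1 * f p.2.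
Proof.
rewrite /all_points big_flatten big_map; apply: eq_bigr => k _.
by rewrite big_map mulr_sumr; apply: eq_bigr => p _; rewrite mulrA.
Qed.

Let joint t (m : R) (la : 'I_n -> R) :
  gauss_char P (fun x => m * pathv t x + \sum_k la k * Z k x)
    (m ^+ 2 * kern t t + 2 * m * (\sum_k la k * (\row_k kern_sum (e k) t) 0 k) + qform (all_points la)).
Proof.
have [_ _] := point_sum_gauss ((m, t) :: all_points la).
have -> : point_sum pathv ((m, t) :: all_points la) = (fun x => m * pathv t x + \sum_k la k * Z k x).
  by apply/funext => x; rewrite /point_sum big_cons (all_sum la (fun u => pathv u x)).
rewrite qform_cons /kern_sum (all_sum la (kern t)).
by under [X in _ -> gauss_char _ _ (_ + 2 * m * X + _)]eq_bigr => k _ do rewrite mxE.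
Qed.

Variables (F : 'rV[R]_n -> R) (C : R) (p : nat).
Hypotheses (cF : continuous F) (dF : forall (k : 'I_n) z, derivable F z (delta_mx 0 k)).
Hypothesis cdF : forall k : 'I_n, continuous (partial k F).
Hypotheses (C0 : 0 <= C) (hF : forall z, `|F z| <= C * (1 + `|z|) ^+ p).
Hypothesis hdF : forall (k : 'I_n) z, `|partial k F z| <= C * (1 + `|z|) ^+ p.

Let mZ k : measurable_fun setT (Z k). Proof. by have [] := point_sum_gauss (e k). Qed.
Let iZ k j : integ P (fun x => `|Z k x| ^+ j). Proof. by have [_ h _] := point_sum_gauss (e k). Qed.
Let iY t j : integ P (fun x => `|pathv t x| ^+ j). Proof. by have [] := pathv_gauss t. Qed.

Lemma stein_point t : \int[P]_x (pathv t x * F (vec Z x)) =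
  \sum_l kern_sum (e l) t * \int[P]_x partial l F (vec Z x).
Proof.
rewrite (stein_ibp (measurable_pathv t) mZ (iY t) iZ (joint t) cF dF cdF C0 hF hdF).
by apply: eq_bigr => l _; rewrite mxE.
Qed.

Lemma integ_partial l : integ P (fun x => partial l F (vec Z x)).
Proof. exact: (integ_comp_growth mZ iZ C0 (@cdF l) (hdF l)). Qed.

(** The pointwise formula integrated in [t]: Fubini exchanges the time integral with the
    expectation, and the sum over [l] is finite. *)
Lemma stein_smear rho (K : R) : bm rho K ->
  integ P (fun x => smear pathv rho x * F (vec Z x)) /\
  \int[P]_x (smear pathv rho x * F (vec Z x)) =
  \sum_l (\int[lam]_t (rho t * kern_sum (e l) t)) * \int[P]_x partial l F (vec Z x).
Proof.
move=> brho; have [mrho hrho] := brho; have K0 := bm_ge0 brho.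
have mF : measurable_fun setT (fun x => F (vec Z x)) := measurable_vec mZ cF.
have iF2 : integ P (fun x => F (vec Z x) ^+ 2).
  apply: (@integ_le _ _ _ P _ (fun x => C ^+ 2 * (2 + `|vec Z x|) ^+ (p * 2))).
  - exact: measurable_funX.
  - by apply: integZ; exact: integ_vec_pow.
  - move=> x; rewrite normrX exprM -exprMn lerXn2r ?nnegrE ?mulr_ge0 ?exprn_ge0 ?addr_ge0//.
    apply: le_trans (hF _) _; rewrite ler_wpM2l// lerXn2r ?nnegrE ?addr_ge0//.
    by rewrite lerD2r ler1n.
have iY2 t : integ P (fun x => pathv t x ^+ 2).
  by have := iY t 2; under eq_fun do rewrite real_normK ?num_real//.
have iYF t : integ P (fun x => pathv t x * F (vec Z x)).
  exact: (integ_mul2 (measurable_pathv t) mF (iY2 t) iF2).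
have ij : integ (lam \x P)%E (fun z : R * Omega R => rho z.1 * (pathv z.1 z.2 * F (vec Z z.2))).
  (* For each [t] the mean of [|B_t F|] is at most [E[B_t^2] + E[F^2]], and the first term is
     [kern t t <= 1]. *)
  apply: (@integ_prod12 _ _ _ _ _ lam P _ (fun=> K * (1 + \int[P]_x (F (vec Z x) ^+ 2)))).
  - apply: measurable_funM; first by apply: (measurableT_comp mrho); exact: measurable_fst.
    apply: measurable_funM; first exact: measurable_process.
    by apply: (measurableT_comp mF); exact: measurable_snd.
  - exact: integ_cst.
  - by move=> t; exact: (integZ (rho t) (iYF t)).
  - move=> t; have [_ e2] := pathv_gauss t.
    apply: (@le_trans _ _ (\int[P]_x (K * (pathv t x ^+ 2 + F (vec Z x) ^+ 2)))).
      apply: le_Rint; first exact: (integ_norm (integZ (rho t) (iYF t))).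
        by apply: integZ; exact: integD.
      move=> x; rewrite /= normrM ler_pM// normrM.
      have := sqr_ge0 (`|pathv t x| - `|F (vec Z x)|).
      rewrite sqrrB !real_normK ?num_real// => h.
      have := sqr_ge0 (pathv t x); have := sqr_ge0 (F (vec Z x)).
      by rewrite mulr2n in h; lra.
    rewrite RintZ; last exact: integD.
    rewrite RintD// e2 ler_wpM2l// lerD2r.
    by have := kern_bound t t; apply: le_trans; exact: ler_norm.
have sec x : \int[lam]_t (rho t * (pathv t x * F (vec Z x))) = smear pathv rho x * F (vec Z x).
  rewrite /smear mulrC -RintZ; last exact: (integ_smear_path (@integ_path_process R) x brho).
  by apply: eq_Rintegral => t _; ring.
split.
  by have := integ_section2 ij; under eq_fun do rewrite sec.
under eq_Rintegral => x _ do rewrite -sec.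
rewrite -(Rint_fubini ij).
transitivity (\int[lam]_t (\sum_l \int[P]_x partial l F (vec Z x) * (rho t * kern_sum (e l) t))).
  apply: eq_Rintegral => t _; rewrite /= RintZ//; rewrite stein_point mulr_sumr.
  by apply: eq_bigr => l _; ring.
have ik l : integ lam (fun t => rho t * kern_sum (e l) t).
  rewrite /kern_sum; under eq_fun do rewrite mulr_sumr.
  apply: integ_sum => r; under eq_fun do rewrite mulrCA.
  apply: integZ; have := bm_integ (bmM brho (bm_kern r.2)).
  by under eq_fun do rewrite kernC.
rewrite Rint_sum; last by move=> l; exact: integZ.
by apply: eq_bigr => l _; rewrite RintZ// mulrC.
Qed.

End bridge_stein.

(** As [1 + |z| >= 1], summing the constants and the exponents over the finite family gives one
    bound for all members. *)
Lemma poly_bounded_common (R : realType) n (I : finType) (f : I -> 'rV[R]_n -> R) :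
  (forall i, poly_bounded (f i)) ->
  exists C : R, exists p, 0 <= C /\ forall i z, `|f i z| <= C * (1 + `|z|) ^+ p.
Proof.
move=> h; have [C /choice[p hp]] := choice h.
exists (\sum_i `|C i|), (\sum_i p i)%N; split; first by rewrite sumr_ge0.
move=> i z; apply: le_trans (hp i z) _.
have z1 : 1 <= 1 + `|z| by rewrite lerDl.
apply: (@le_trans _ _ (`|C i| * (1 + `|z|) ^+ p i)).
  by rewrite ler_wpM2r ?ler_norm// exprn_ge0// (le_trans ler01).
have zi q : 0 <= (1 + `|z|) ^+ q by rewrite exprn_ge0// (le_trans ler01).
apply: ler_pM => //; first by rewrite (bigD1 i)//= lerDl sumr_ge0.
by rewrite ler_weXn2l// (bigD1 i)//= leq_addr.
Qed.

Lemma bm_step_sum (R : realType) (s : seq (R * R)) : bm (step_sum s) (\sum_(p <- s) `|p.1|).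
Proof.
split.
  by apply: measurable_sum => p; apply: measurable_funM => //; exact: measurable_step.
move=> t; apply: le_trans (ler_norm_sum _ _ _) _; apply: ler_sum => p _.
by rewrite normrM -[leRHS]mulr1 ler_wpM2l// step_bound.
Qed.

Section bridge_identity.
Context (R : realType) (P : probability (Omega R) R).
Local Notation lam := (@lam R).
Local Notation pathv := (@pathv R).
Hypothesis bridge : brownian_bridge P coordinate.
Variables (n : nat) (e : 'I_n -> seq (R * R)) (h : 'rV[R]_n -> R).
Hypothesis smooth_h : Cinf_p h.

Let Z (k : 'I_n) : Omega R -> R := point_sum pathv (e k).

Let cov (k l : 'I_n) : R := \int[lam]_t (step_sum (e k) t * kern_sum (e l) t).

(** [stein_smear] for [F] the [k]-th partial derivative and [rho] the [k]-th step function, summed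
    over [k]. The mixed partials come out in the opposite order, which [clairaut] corrects. *)
Lemma stein_smooth :
  [/\ integ P (fun x => \sum_k partial k h (vec Z x) * smear pathv (step_sum (e k)) x),
      integ P (fun x => \sum_k \sum_l partial k (partial l h) (vec Z x) * cov k l) &
      \int[P]_x (\sum_k partial k h (vec Z x) * smear pathv (step_sum (e k)) x) =
      \int[P]_x (\sum_k \sum_l partial k (partial l h) (vec Z x) * cov k l)].
Proof.
have b1 k : poly_bounded (partial k h) by have [_ _] := smooth_h [:: k].
have b2 (k : 'I_n * 'I_n) : poly_bounded (partial k.1 (partial k.2 h)).
  by have [_ _] := smooth_h [:: k.1; k.2].
have z0 (z : 'rV[R]_n) q : 0 <= (1 + `|z|) ^+ q by rewrite exprn_ge0// addr_ge0.
have [C1 [p1 [C10 h1]]] := poly_bounded_common b1.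
have [C2 [p2 [C20 h2]]] := poly_bounded_common b2.
have z1 (z : 'rV[R]_n) : 1 <= 1 + `|z| by rewrite lerDl.
have d1 k z : derivable h z (delta_mx 0 k) by have [_ d _] := smooth_h [::]; exact: d.
have d2 k l z : derivable (partial k h) z (delta_mx 0 l).
  by have [_ d _] := smooth_h [:: k]; exact: d.
have c1 k : continuous (partial k h) by have [c _ _] := smooth_h [:: k]; exact: c.
have c2 k l : continuous (partial k (partial l h)).
  by have [c _ _] := smooth_h [:: k; l]; exact: c.
have g1 k z : `|partial k h z| <= (C1 + C2) * (1 + `|z|) ^+ (p1 + p2).
  apply: le_trans (h1 k z) _; apply: ler_pM => //; first by rewrite lerDl.
  by rewrite ler_weXn2l// leq_addr.
have g2 k l z : `|partial l (partial k h) z| <= (C1 + C2) * (1 + `|z|) ^+ (p1 + p2).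
  apply: le_trans (h2 (l, k) z) _; apply: ler_pM => //; first by rewrite lerDr.
  by rewrite ler_weXn2l// leq_addl.
have C0 : 0 <= C1 + C2 by rewrite addr_ge0.
have S k := stein_smear bridge e (c1 k) (d2 k) (c2 ^~ k) C0 (g1 k) (g2 k) (bm_step_sum (e k)).
have i2 k l : integ P (fun x => partial k (partial l h) (vec Z x)).
  exact: (integ_partial bridge e (c2 ^~ l) C0 (g2 l)).
have I1 k : integ P (fun x => partial k h (vec Z x) * smear pathv (step_sum (e k)) x).
  by have [j _] := S k; under eq_fun do rewrite mulrC.
have I2 k l : integ P (fun x => partial k (partial l h) (vec Z x) * cov k l).
  by under eq_fun do rewrite mulrC; exact: integZ.
have I3 k : integ P (fun x => \sum_l partial k (partial l h) (vec Z x) * cov k l).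
  by apply: integ_sum => l.
split; [by apply: integ_sum => k|by apply: integ_sum => k|].
rewrite !Rint_sum//; apply: eq_bigr => k _; rewrite Rint_sum//.
have [_ E] := S k; under eq_Rintegral do rewrite mulrC.
rewrite E; apply: eq_bigr => l _.
under [RHS]eq_Rintegral do rewrite mulrC.
have Ekl : (fun x => partial l (partial k h) (vec Z x)) = (fun x => partial k (partial l h) (vec Z x)).
  by apply/funext => x; exact: (clairaut (vec Z x) l k d1 d2 c2).
rewrite -/Z Ekl; exact: (esym (RintZ (cov k l) (i2 k l))).
Qed.

End bridge_identity.

(** * The Malliavin identity in coordinates *)

Section part.
Variable R : realType.

(* Real and imaginary parts are treated at once. *)
Definition part (b : bool) (w : R[i]) : R := if b then complex.Re w else complex.Im w.

Lemma part_inj w w' : part true w = part true w' -> part false w = part false w' -> w = w'.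
Proof. by case: w w' => [a b] [c d] /= -> ->. Qed.

Lemma part_sum b (I : Type) (s : seq I) (F : I -> R[i]) :
  part b (\sum_(i <- s) F i) = \sum_(i <- s) part b (F i).
Proof.
by elim/big_rec2: _ => [|i y w _ <-]; case: b => //; case: (F i) w => [? ?] [].
Qed.

Lemma partB b w w' : part b (w - w') = part b w - part b w'.
Proof. by case: b w w' => [] [? ?] []. Qed.

Lemma partZ b (r : R) w : part b (r%:C * w) = r * part b w.
Proof. by case: b w => [] [? ?] /=; ring. Qed.

Lemma partZr b (r : R) w : part b (w * r%:C) = part b w * r.
Proof. by rewrite mulrC partZ mulrC. Qed.

Lemma part_cintegral b d (T : measurableType d) (mu : {measure set T -> \bar R}) D (F : T -> R[i]) :
  part b (cintegral mu D F) = \int[mu]_(x in D) part b (F x).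
Proof. by case: b. Qed.

Lemma part_cpartial b n (k : 'I_n) (g : 'rV[R]_n -> R[i]) z :
  part b (cpartial k g z) = partial k (part b \o g) z.
Proof. by case: b. Qed.

Lemma part_cpartial2 b n (k l : 'I_n) (g : 'rV[R]_n -> R[i]) z :
  part b (cpartial k (cpartial l g) z) = partial k (partial l (part b \o g)) z.
Proof. by rewrite part_cpartial; congr partial; apply/funext => y; case: b. Qed.

End part.

(** * The kernel produced by the right-hand side *)

Section step_kernel.
Variable R : realType.
Local Notation lam := (@lam R).
Implicit Types (e : step_fun R) (s t u : R).

Lemma ind_step u t : 0 <= t -> ind u t = step u t.
Proof. by move=> t0; rewrite /ind /step indicE mem_setE in_itv/= t0. Qed.

Lemma step_val_sum e t : 0 <= t -> step_val e t = step_sum e t.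
Proof. by move=> t0; apply: eq_bigr => p _; rewrite ind_step. Qed.

(** The bridge kernel is the covariance of the indicators that a uniform variable lies below [t] and
    below [u]. *)
Lemma Rint_step_step (t u : R) :
  \int[lam]_s ((step t s - clip t) * (step u s - clip u)) = kern t u.
Proof.
have i1 v : integ lam (step v) := bm_integ (bm_step v).
have E s : (step t s - clip t) * (step u s - clip u) =
    step (Num.min t u) s - (clip t * step u s + clip u * (step t s - clip t)).
  have -> : step (Num.min t u) s = step t s * step u s.
    by rewrite /step lt_min; case: (s < t); case: (s < u); rewrite ?mulr1 ?mulr0.
  by ring.
under eq_Rintegral do rewrite E.
have i2 : integ lam (fun s => step t s - clip t) by apply: integB => //; exact: integ_cst.
rewrite RintB//; last by apply: integD; exact: integZ.
rewrite RintD; [|exact: integZ..].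
rewrite !RintZ// RintB//; last exact: integ_cst.
rewrite Rint_probability_cst !Rint_step subrr mulr0 addr0 /kern; congr (_ - _).
by case: (leP t u) => tu; [rewrite min_l|rewrite min_r]; rewrite ?clip_mono// ltW.
Qed.

Definition step_mean (e : seq (R * R)) : R := \sum_(p <- e) p.1 * clip p.2.

Lemma Rint_step_sum (e : seq (R * R)) : \int[lam]_t step_sum e t = step_mean e.
Proof.
rewrite Rint_sum; last by move=> p; apply: integZ; exact: bm_integ (bm_step p.2).
by apply: eq_bigr => p _; rewrite RintZ ?Rint_step//; exact: bm_integ (bm_step p.2).
Qed.

Lemma integ_step_sub t : integ lam (fun s => step t s - clip t).
Proof. by apply: integB; [exact: bm_integ (bm_step t)|exact: integ_cst]. Qed.

Lemma integ_step_sub_mul t (g : R -> R) : integ lam g ->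
  integ lam (fun s => (step t s - clip t) * g s).
Proof.
move=> ig; apply: (@integ_mulb _ _ _ lam g _ 2) => //; first exact: integ_meas (integ_step_sub t).
move=> s; apply: le_trans (ler_normB _ _) _; apply: lerD; first exact: step_bound.
by have /andP[c0 c1] := clip_in t; rewrite ger0_norm.
Qed.

(** The measure [delta_s(du) - du] replaces a step function by its value at [s] minus its mean; this
    is the remaining integral over [s]. *)
Lemma Rint_step_kern (e : seq (R * R)) t :
  \int[lam]_s ((step t s - clip t) * (step_sum e s - step_mean e)) = kern_sum e t.
Proof.
have E s : (step t s - clip t) * (step_sum e s - step_mean e) =
    \sum_(p <- e) p.1 * ((step t s - clip t) * (step p.2 s - clip p.2)).
  by rewrite -sumrB mulr_sumr; apply: eq_bigr => p _; ring.
under eq_Rintegral do rewrite E.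
have i2 u : integ lam (fun s => (step t s - clip t) * (step u s - clip u)).
  exact: integ_step_sub_mul (integ_step_sub u).
rewrite Rint_sum; last by move=> p; exact: integZ.
by apply: eq_bigr => p _; rewrite RintZ// Rint_step_step.
Qed.

Lemma Rint_dirac (s : R) (F : R -> R) : 0 <= s <= 1 -> measurable_fun setT F ->
  \int[@dirac _ (measurableTypeR R) s R]_(u in `[0%R, 1%R]) F u = F s.
Proof.
move=> s01 mF; rewrite /Rintegral integral_dirac//.
- by rewrite diracE mem_setE in_itv/= s01 /= mul1r.
- exact/measurable_EFinP/measurable_funTS.
Qed.

End step_kernel.

Section reduction.
Variable R : realType.
Local Notation lam := (@lam R).
Local Notation pathv := (@pathv R).
Implicit Types (f : smooth_functional R) (x : Omega R).

Definition sf_points f (k : 'I_(sf_dim f)) : Omega R -> R := point_sum pathv (sf_step k).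

Lemma pathv_coordinate (t : R) x : 0 <= t <= 1 -> pathv t x = coordinate t x.
Proof. by move=> t01; rewrite /pathv clip_id. Qed.

Lemma sf_arg_vec f x : sf_arg f x = vec (@sf_points f) x.
Proof.
apply/rowP => k; rewrite [LHS]mxE.
rewrite [RHS]mxE.
rewrite /sf_points.
rewrite /point_sum /step_int.
apply: eq_big_seq => p pk.
by rewrite pathv_coordinate//; have /andP[/ltW -> ->] := step_seqP pk.
Qed.

Lemma part_stein_lhs b f x : part b (stein_lhs f x) =
  \sum_k partial k (part b \o @sf_fun R f) (vec (@sf_points f) x) *
    smear pathv (step_sum (sf_step k)) x.
Proof.
rewrite part_cintegral.
pose H k := partial k (part b \o @sf_fun R f) (vec (@sf_points f) x).
transitivity (\int[lebesgue_measure]_(t in `[0%R, 1%R])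
    \sum_k H k * (step_sum (sf_step k) t * pathv t x)).
  apply: eq_Rintegral => t; rewrite inE/= in_itv/= => t01.
  rewrite partZ part_sum mulr_sumr; apply: eq_bigr => k _.
  rewrite partZr part_cpartial sf_arg_vec step_val_sum; last by case/andP: t01.
  by rewrite pathv_coordinate//; rewrite /H; ring.
have i1 (k : 'I_(sf_dim f)) : integ lam (fun t => step_sum (sf_step k) t * pathv t x).
  exact: (integ_smear_path (@integ_path_process R) x (bm_step_sum _)).
rewrite lam_Rintegral; last by apply: measurable_sum => k; exact: integ_meas (integZ (H k) (i1 k)).
rewrite Rint_sum; last by move=> k; exact: integZ.
by apply: eq_bigr => k _; rewrite RintZ.
Qed.

(** The factor [ind t s - t] is constant in [u], so the innermost integral only centres the second
    step function; [Rint_step_kern] then carries out the integral over [s]. *)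
Lemma part_stein_rhs b f x : part b (stein_rhs f x) =
  \sum_k \sum_l partial k (partial l (part b \o @sf_fun R f)) (vec (@sf_points f) x) *
    \int[lam]_t (step_sum (sf_step k) t * kern_sum (sf_step l) t).
Proof.
pose H k l := partial k (partial l (part b \o @sf_fun R f)) (vec (@sf_points f) x).
have mS (k : 'I_(sf_dim f)) : measurable_fun setT (step_sum (sf_step k)).
  by have [] := bm_step_sum (sf_step k).
have D2E t u : 0 <= t -> 0 <= u -> part b (D2 f t u x) =
    \sum_k \sum_l H k l * step_sum (sf_step k) t * step_sum (sf_step l) u.
  move=> t0 u0; rewrite part_sum; apply: eq_bigr => k _; rewrite part_sum; apply: eq_bigr => l _.
  by rewrite !partZr part_cpartial2 sf_arg_vec !step_val_sum.
have inner t s : 0 <= t <= 1 -> 0 <= s <= 1 ->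
    part b (int_dirac_sub_leb s (fun u => (ind t s - t)%:C * D2 f t u x)) =
    \sum_k \sum_l H k l * step_sum (sf_step k) t *
      ((step t s - clip t) * (step_sum (sf_step l) s - step_mean (sf_step l))).
  move=> t01 s01; have /andP[t0 _] := t01; have /andP[s0 _] := s01.
  rewrite partB !part_cintegral.
  pose F (u : R) : R := (step t s - t) *
    \sum_k \sum_l H k l * step_sum (sf_step k) t * step_sum (sf_step l) u.
  have mF : measurable_fun setT F.
    apply: measurable_funM => //; apply: measurable_sum => k; apply: measurable_sum => l.
    exact: measurable_funM.
  have FE u : 0 <= u <= 1 -> part b ((ind t s - t)%:C * D2 f t u x) = F u.
    by move=> /andP[u0 _]; rewrite partZ ind_step// D2E.
  rewrite (_ : \int[_]_(_ in _) _ = F s); last first.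
    transitivity (\int[@dirac _ (measurableTypeR R) s R]_(u in `[0%R, 1%R]) F u).
      apply: eq_Rintegral => u; rewrite inE/= in_itv/=; exact: FE.
    exact: Rint_dirac.
  rewrite (_ : \int[lebesgue_measure]_(_ in _) _ = \int[lam]_u F u); last first.
    rewrite -lam_Rintegral//; apply: eq_Rintegral => u.
    by rewrite inE/= in_itv/= => /FE.
  have i1 k l : integ lam (fun u => H k l * step_sum (sf_step k) t * step_sum (sf_step l) u).
    by apply: integZ; exact: bm_integ (bm_step_sum _).
  have i2 k : integ lam (fun u => \sum_l H k l * step_sum (sf_step k) t * step_sum (sf_step l) u).
    by apply: integ_sum.
  rewrite /F RintZ; last by apply: integ_sum.
  rewrite -mulrBr Rint_sum// -sumrB mulr_sumr; apply: eq_bigr => k _.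
  rewrite Rint_sum// -sumrB mulr_sumr; apply: eq_bigr => l _.
  rewrite RintZ; last exact: bm_integ (bm_step_sum _).
  by rewrite Rint_step_sum clip_id//; ring.
rewrite part_cintegral.
transitivity (\int[lebesgue_measure]_(t in `[0%R, 1%R])
    \sum_k \sum_l H k l * (step_sum (sf_step k) t * kern_sum (sf_step l) t)).
  apply: eq_Rintegral => t; rewrite inE/= in_itv/= => t01.
  rewrite part_cintegral.
  pose G (s : R) : R := \sum_k \sum_l H k l * step_sum (sf_step k) t *
      ((step t s - clip t) * (step_sum (sf_step l) s - step_mean (sf_step l))).
  have i0 (l : 'I_(sf_dim f)) : integ lam (fun s => (step t s - clip t) * (step_sum (sf_step l) s - step_mean (sf_step l))).
    apply: integ_step_sub_mul; apply: integB; last exact: integ_cst.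
    exact: bm_integ (bm_step_sum _).
  have i1 k l := integZ (H k l * step_sum (sf_step k) t) (i0 l).
  have i2 k := integ_sum (index_enum _) (i1 k).
  transitivity (\int[lam]_s G s).
    rewrite -lam_Rintegral; last by have := integ_sum (index_enum _) i2; move=> /integ_meas.
    by apply: eq_Rintegral => s; rewrite inE/= in_itv/= => s01; rewrite inner.
  rewrite /G Rint_sum//; apply: eq_bigr => k _; rewrite Rint_sum//; apply: eq_bigr => l _.
  by rewrite RintZ// Rint_step_kern; ring.
have i1 (k l : 'I_(sf_dim f)) : integ lam (fun t => step_sum (sf_step k) t * kern_sum (sf_step l) t).
  rewrite /kern_sum; under eq_fun do rewrite mulr_sumr.
  apply: integ_sum => r; under eq_fun do rewrite mulrCA.
  apply: integZ; have := bm_integ (bmM (bm_step_sum (sf_step k)) (bm_kern r.2)).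
  by under eq_fun do rewrite kernC.
have i2 k l := integZ (H k l) (i1 k l).
have i3 k := integ_sum (index_enum _) (i2 k).
rewrite lam_Rintegral; last by have := integ_sum (index_enum _) i3; move=> /integ_meas.
rewrite Rint_sum//; apply: eq_bigr => k _; rewrite Rint_sum//; apply: eq_bigr => l _.
by rewrite RintZ.
Qed.

End reduction.

(** * The two implications *)

Section cosine.
Variable R : realType.
Implicit Types (a : R) (z : 'rV[R]_1).

(* The test functionals: their derivatives are again of this form. *)
Definition wave1 a z : R := cos (z 0 0 + a).

Let quotient a z (k : 'I_1) :
  (fun h : R => h^-1 *: ((wave1 a \o shift z) (h *: delta_mx 0 k) - wave1 a z)) =
  (fun h : R => h^-1 *: (((fun y : R => cos (y + a)) \o shift (z 0 0)) (h *: (1 : R)) - cos (z 0 0 + a))).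
Proof. by apply/funext => h; rewrite /wave1 /= !mxE ord1 eqxx. Qed.

Let is_derive_cos a (y : R) : is_derive (y : R) (1 : R) (fun y : R => cos (y + a)) (cos (y + (a + pi / 2))).
Proof.
have h : is_derive (y : R) (1 : R) (fun y : R => y + a) 1.
  by apply: is_derive_eq; rewrite addr0.
have := @is_derive1_comp _ cos (fun y : R => y + a) y _ _ _ h.
move=> /(_ _ (is_derive_cos (y + a))); rewrite mulr1 addrA cosDpihalf; exact.
Qed.

Lemma derivable_wave1 a z (k : 'I_1) : derivable (wave1 a) z (delta_mx 0 k).
Proof. by rewrite /derivable quotient; have [] := is_derive_cos a (z 0 0). Qed.

Lemma partial_wave1 a (k : 'I_1) : partial k (wave1 a) = wave1 (a + pi / 2).
Proof. by apply/funext => z; rewrite /partial /derive quotient; have [_] := is_derive_cos a (z 0 0). Qed.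

Lemma continuous_wave1 a : continuous (wave1 a).
Proof.
move=> z; apply: (@continuous_comp _ _ _ (fun z : 'rV[R]_1 => z 0 0) (fun y : R => cos (y + a))).
  exact: coord_continuous.
apply: (@continuous_comp _ _ _ (fun y : R => y + a) cos); last exact: continuous_cos.
by apply: cvgD; [exact: cvg_id|exact: cvg_cst].
Qed.

Lemma Cinf_p_wave1 a : Cinf_p (wave1 a).
Proof.
move=> s; have [b ->] : exists b, partials s (wave1 a) = wave1 b.
  elim: s => [|k s [b IH]] /=; first by exists a.
  by exists (b + pi / 2); rewrite IH partial_wave1.
split; [exact: continuous_wave1|by move=> k z; exact: derivable_wave1|].
exists 1, 0%N => z; rewrite expr0 mulr1 /wave1; exact: cos_max.
Qed.

Lemma Cinf_p_cst n (c : R) : Cinf_p (fun _ : 'rV[R]_n => c).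
Proof.
move=> s; have [b ->] : exists b : R, partials s (fun _ : 'rV[R]_n => c) = fun=> b.
  elim: s => [|k s [b IH]] /=; first by exists c.
  by exists 0; rewrite IH; apply/funext => z; rewrite /partial derive_cst.
split; [exact: cst_continuous|by move=> k z; exact: derivable_cst|].
by exists `|b|, 0%N => z; rewrite expr0 mulr1.
Qed.

Lemma cCinf_p_wave1 a : cCinf_p (fun z => (wave1 a z)%:C).
Proof. by split; [exact: Cinf_p_wave1|exact: Cinf_p_cst]. Qed.

End cosine.

Section equivalence.
Context (R : realType) (P : probability (Omega R) R).
Local Notation lam := (@lam R).
Local Notation pathv := (@pathv R).

Lemma bridge_stein (f : smooth_functional R) : brownian_bridge P coordinate ->
  [/\ cintegrable P setT (stein_lhs f), cintegrable P setT (stein_rhs f) &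
      cintegral P setT (stein_lhs f) = cintegral P setT (stein_rhs f)].
Proof.
move=> bridge.
have S b : [/\ integ P (fun x => part b (stein_lhs f x)), integ P (fun x => part b (stein_rhs f x)) &
    \int[P]_x part b (stein_lhs f x) = \int[P]_x part b (stein_rhs f x)].
  have smooth : Cinf_p (part b \o @sf_fun R f) by case: (sf_smooth f); case: b.
  have [i1 i2 e] := stein_smooth bridge (fun k => sf_step k) smooth.
  have El : (fun x => part b (stein_lhs f x)) =
      (fun x => \sum_k partial k (part b \o @sf_fun R f) (vec (@sf_points _ f) x) *
         smear pathv (step_sum (sf_step k)) x).
    by apply/funext => x; exact: part_stein_lhs.
  have Er : (fun x => part b (stein_rhs f x)) =
      (fun x => \sum_k \sum_l partial k (partial l (part b \o @sf_fun R f)) (vec (@sf_points _ f) x) *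
         \int[lam]_t (step_sum (sf_step k) t * kern_sum (sf_step l) t)).
    by apply/funext => x; exact: part_stein_rhs.
  by rewrite El Er; split.
have E b : part b (cintegral P setT (stein_lhs f)) = part b (cintegral P setT (stein_rhs f)).
  have [_ _ e] := S b.
  exact: (etrans (part_cintegral b P setT (stein_lhs f)) (etrans e (esym (part_cintegral b P setT (stein_rhs f))))).
have [l1 r1 _] := S true; have [l2 r2 _] := S false.
split; [exact: (conj l1 l2)|exact: (conj r1 r2)|].
exact: (part_inj (E true) (E false)).
Qed.

Hypothesis hB : (\int[@lebesgue_measure R]_(t in `[0%R, 1%R])
  'E_P[fun w => (coordinate t w ^+ 2)%R] < +oo)%E.

Hypothesis stein : forall f : smooth_functional R,
  cintegral P setT (stein_lhs f) = cintegral P setT (stein_rhs f).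

(** Each derivative adds [pi / 2] to the phase. Starting from [a - pi], the first derivative is
    [sin (z + a)] and the second [cos (z + a)], with the signs required. *)
Lemma stein_cosine (s : seq (R * R)) (a : R) : (forall p, p \in s -> 0 < p.2 <= 1) ->
  \int[P]_x (sin (point_sum pathv s x + a) * smear pathv (step_sum s) x) =
  \int[P]_x ((\int[lam]_t (step_sum s t * kern_sum s t)) * cos (point_sum pathv s x + a)).
Proof.
move=> hs; pose e := @StepFun R s hs.
pose f := @SmoothFunctional R 1 (fun z => (wave1 (a - pi) z)%:C) (fun=> e) (cCinf_p_wave1 (a - pi)).
have Z x : vec (@sf_points _ f) x 0 0 = point_sum pathv s x by rewrite mxE.
have := congr1 (part true) (stein f); rewrite !part_cintegral.
have cE : part true \o @sf_fun R f = wave1 (a - pi) by [].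
have -> : (fun x => part true (stein_lhs f x)) =
    (fun x => sin (point_sum pathv s x + a) * smear pathv (step_sum s) x).
  apply/funext => x; rewrite part_stein_lhs cE big_ord_recl big_ord0 addr0 partial_wave1.
  rewrite /wave1 Z; congr (_ * _); rewrite -sinDpihalf; congr sin.
  by field.
have -> : (fun x => part true (stein_rhs f x)) = (fun x => (\int[lam]_t (step_sum s t * kern_sum s t)) *
    cos (point_sum pathv s x + a)).
  apply/funext => x; rewrite part_stein_rhs cE; under eq_bigr => k _.
    under eq_bigr => l _ do rewrite (partial_wave1 (a - pi) l) (partial_wave1 _ k).
    over.
  rewrite big_ord_recl big_ord0 addr0 big_ord_recl big_ord0 addr0 mulrC /wave1 Z.
  by congr (_ * cos _); field.
by [].
Qed.

Lemma stein_bridge : brownian_bridge P coordinate.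
Proof.
have := gauss_char_path hB (stein_density (@measurable_process R) (@integ_path_process R)
  (integ_process_sqr hB) stein_cosine).
move=> g; have [G m c] : brownian_bridge P pathv.
  apply: gauss_char_bridge => [t|n a t t01]; last exact: g.
  exact: measurable_pathv.
(* All conditions in [brownian_bridge] concern times in [0,1], where clipping changes nothing. *)
have E (t : R) : 0 <= t <= 1 -> pathv t = coordinate t.
  by move=> t01; apply/funext => x; exact: pathv_coordinate.
split.
- move=> n t a t01; have -> : (fun w => \sum_(i < n) a i * coordinate (t i) w) = (fun w => \sum_(i < n) a i * pathv (t i) w).
    by apply/funext => w; apply: eq_bigr => i _; rewrite E.
  exact: G.
- by move=> t t01; rewrite -E// m.
- by move=> s t s01 t01; rewrite -!E// c.
Qed.

End equivalence.

Theorem corollary4p3 (R : realType) (P : probability (Omega R) R)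
  (hB : (\int[@lebesgue_measure R]_(t in `[0%R, 1%R])
           'E_P[fun w => (coordinate t w ^+ 2)%R] < +oo)%E) :
  brownian_bridge P coordinate <->
  (forall f : smooth_functional R,
     [/\ cintegrable P setT (stein_lhs f),
         cintegrable P setT (stein_rhs f) &
         cintegral P setT (stein_lhs f) = cintegral P setT (stein_rhs f)]).
Proof.
split=> [bridge f|stein]; first exact: bridge_stein.
by apply: (stein_bridge hB) => f; have [] := stein f.
Qed.
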